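(* Let $X_n$ be the $n\times n$ random matrix whose entries are iid complex random variables with mean $0$ and variance $1$, and let $M_n$ be a deterministic $n\times n$ complex matrix with rank $o(n)$ as $n\to\infty$ and satisfying $$\sup_n\frac{1}{n^2}\|M_n\|_2^2<\infty.$$ Let $A_n:=M_n+X_n$. Then the ESD $\mu_{\frac{1}{\sqrt n}A_n}$ of $\frac{1}{\sqrt n}A_n$ converges, both in probability and almost surely, to the uniform distribution on the unit disk $\{z\in\mathbb{C}:|z|\le 1\}$.
   Context: For an $n\times n$ complex matrix $A$ with eigenvalues $\lambda_1,\dots,\lambda_n$ (with algebraic multiplicity), the empirical spectral distribution (ESD) is the probability measure $\mu_A=\frac1n\sum_{i=1}^n\delta_{\lambda_i}$ on $\mathbb{C}$. $\|A\|_2:=\mathrm{trace}(AA^* )^{1/2}$ is the Hilbert-Schmidt norm. Mean $0$ and variance $1$ means $\mathbf{E}x=0$, $\mathbf{E}|x|^2=1$; the common distribution of the entries does not depend on $n$. Random probability measures $\mu_n$ on $\mathbb{C}$ converge in probability to $\mu$ if for every continuous compactly supported $f:\mathbb{C}\to\mathbb{R}$, $\int f\,d\mu_n\to\int f\,d\mu$ in probability; they converge almost surely to $\mu$ if with probability $1$, $\int f\,d\mu_n\to\int f\,d\mu$ for all such $f$. The matrices $X_n$ are the upper-left $n\times n$ blocks of a single infinite array $(x_{ij})_{i,j\ge1}$ of iid random variables. *)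

(* Defs.v *)
From HB Require Import structures.
From mathcomp Require Import all_boot all_order all_algebra.
From mathcomp Require Import all_classical all_reals all_analysis.
From mathcomp Require Import measurable_realfun complex.

Set Implicit Arguments.
Unset Strict Implicit.
Unset Printing Implicit Defensive.

Import Order.TTheory GRing.Theory Num.Theory.
Import numFieldNormedType.Exports.

Local Open Scope classical_set_scope.
Local Open Scope ring_scope.
Local Open Scope complex_scope.

Notation Re := complex.Re.
Notation Im := complex.Im.
Notation normc := ComplexField.Normc.normc.

(* MathComp-Analysis puts the metric topology of the norm on [R[i]^o] only, and
   no sigma-algebra: we transfer the topology to [R[i]] and add Borel sets. *)
HB.instance Definition _ (R : realType) :=
  PseudoPointedMetric.copy R[i] (R[i])^o.
HB.instance Definition _ (R : realType) :=
  Measurable.copy R[i] (g_sigma_algebraType (@open R[i])).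

Section plane_measure.
Variable R : realType.
Local Notation plane := (measurableTypeR R * measurableTypeR R)%type.

Definition complex_of_plane (p : plane) : R[i] := p.1 +i* p.2.

Lemma normc_le_ReIm (z : R[i]) : normc z <= `|Re z| + `|Im z|.
Proof.
case: z => a b /=; rewrite -[leRHS]ger0_norm ?addr_ge0// -sqrtr_sqr.
apply: ler_wsqrtr; rewrite sqrrD !real_normK ?num_real//.
by rewrite [leRHS]addrAC lerDl mulrn_wge0 ?mulr_ge0.
Qed.

Lemma measurable_complex_of_plane : measurable_fun [set: plane] complex_of_plane.
Proof.
apply: (@measurability _ _ plane R[i] setT complex_of_plane (@open R[i])) => //.
move=> _ [U oU <-]; rewrite setTI.
pose box (q : rat * rat * rat) : set plane :=
  ball (ratr q.1.1 : R) (ratr q.2) `*` ball (ratr q.1.2 : R) (ratr q.2).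
have -> : complex_of_plane @^-1` U =
    \bigcup_(q in [set q | box q `<=` complex_of_plane @^-1` U]) box q.
  apply/seteqP; split=> [[x y] Uxy|p [q /= qU /qU //]].
  have /nbhs_ballP[e /= e0 eU] : nbhs (x +i* y : R[i]) U by exact: open_nbhs_nbhs.
  have eE : e = (Re e)%:C.
    by case: e e0 {eU} => a b; rewrite ltcE /= => /andP[/eqP ->].
  have Re0 : 0 < Re e by move: e0; rewrite ltcE => /andP[].
  have [r] : exists r : rat, ratr r \in `]0, (Re e / 4)[%R.
    by apply: rat_in_itvoo; rewrite divr_gt0.
  rewrite in_itv/= => /andP[r0 re].
  have close (t : R) : exists q : rat, `|ratr q - t| < ratr r.
    have [q] : exists q : rat, ratr q \in `](t - ratr r), (t + ratr r)[%R.
      by apply: rat_in_itvoo; rewrite ltrD2l gtrN.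
    by rewrite in_itv/= => qt; exists q; rewrite ltr_distl.
  have [q1 hq1] := close x; have [q2 hq2] := close y.
  exists (q1, q2, r) => //=.
  move=> [u v] []; rewrite -!ball_normE /= => hu hv.
  apply: eU; rewrite /ball/= eE.
  rewrite [X in X < _](_ : _ = (normc ((x +i* y) - (u +i* v)))%:C)// ltcR.
  apply: le_lt_trans (normc_le_ReIm _) _ => /=.
  have ux : `|x - u| < ratr r + ratr r.
    apply: (le_lt_trans (ler_distD (ratr q1) x u)).
    by apply: ltrD hu; rewrite distrC.
  have vy : `|y - v| < ratr r + ratr r.
    apply: (le_lt_trans (ler_distD (ratr q2) y v)).
    by apply: ltrD hv; rewrite distrC.
  apply: lt_trans (ltrD ux vy) _.
  by move: re; rewrite ltr_pdivlMr// mulr_natr !mulrSr mulr0n add0r !addrA.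
rewrite bigcup_mkcond; apply: countable_bigcupT_measurable => // q.
by case: ifP => // _; apply: measurableX; exact: measurable_ball.
Qed.

Definition lebesgue_complex : set R[i] -> \bar R :=
  pushforward (lebesgue_measure \x lebesgue_measure)%E complex_of_plane.

HB.instance Definition _ := Measure.copy lebesgue_complex
  (measure_function_pushforward__canonical__measure_function_Measure
     (lebesgue_measure \x lebesgue_measure)%E measurable_complex_of_plane).

Definition unit_disk : set R[i] := [set z | `|z| <= 1].

Lemma measurable_unit_disk : measurable unit_disk.
Proof.
rewrite -[unit_disk]setCK; apply: measurableC; apply: sub_sigma_algebra.
have dE : ~` unit_disk = [set z : R[i] | 1 < `|z|].
  apply/seteqP; split=> z /=; rewrite real_ltNge ?real1 ?normr_real//.
    by move/negP.
  by move/negP.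
rewrite dE openE => z /= z1; apply/nbhs_ballP; exists (`|z| - 1) => /=.
  by rewrite subr_gt0.
move=> w; rewrite /ball/= => zw.
have : `|z| - `|w| < `|z| - 1 by exact: le_lt_trans (lerB_dist _ _) zw.
by rewrite ltrD2l ltrN2.
Qed.

Lemma invpi_ge0 : 0 <= (@pi R)^-1.
Proof. by rewrite invr_ge0 pi_ge0. Qed.

(* The unit disk has Lebesgue measure pi. *)
Definition uniform_disk : {measure set R[i] -> \bar R} :=
  mscale (NngNum invpi_ge0) (mrestr lebesgue_complex measurable_unit_disk).

End plane_measure.

Section empirical_spectral_distribution.
Variable R : realType.

(* With algebraic multiplicities: the roots of the characteristic polynomial. *)
Definition eigenvalues n (A : 'M[R[i]]_n) : seq R[i] :=
  sval (closed_field_poly_normal (char_poly A)).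

Lemma char_poly_eigenvalues n (A : 'M[R[i]]_n) :
  char_poly A = \prod_(z <- eigenvalues A) ('X - z%:P).
Proof.
rewrite /eigenvalues; case: closed_field_poly_normal => s /= {1}->.
by rewrite (monicP (char_poly_monic A)) scale1r.
Qed.

Lemma size_eigenvalues n (A : 'M[R[i]]_n) : size (eigenvalues A) = n.
Proof.
by have := size_char_poly A; rewrite char_poly_eigenvalues size_prod_XsubC => -[].
Qed.

Definition esd n (A : 'M[R[i]]_n) : {measure set R[i] -> \bar R} :=
  mscale (n%:R^-1)%:nng (msum (fun k => \d_((eigenvalues A)`_k)) n).

Lemma esd_setT n (A : 'M[R[i]]_n) : (0 < n)%N -> esd A setT = 1%E.
Proof.
move=> n0.
rewrite [LHS](_ : _ = ((n%:R^-1)%:E *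
  \sum_(k < n) \d_((eigenvalues A)`_k) [set: R[i]])%E)//.
under eq_bigr do rewrite diracT.
by rewrite sumEFin sumr_const card_ord -EFinM mulVf// pnatr_eq0 -lt0n.
Qed.

Definition hsnorm n (A : 'M[R[i]]_n) : R :=
  Num.sqrt (Re (\tr (A *m map_mx Num.conj A^T))).

End empirical_spectral_distribution.

Section random_variables.
Context d (T : measurableType d) (R : realType) (P : probability T R).

(* Only meaningful for integrable [X]. *)
Definition Cexpectation (X : T -> R[i]) : R[i] :=
  (\int[P]_t Re (X t)) +i* (\int[P]_t Im (X t)).

Definition mutually_independent d' (T' : measurableType d') (I : eqType)
    (X : I -> {RV P >-> T'}) :=
  forall (s : seq I) (B : I -> set T'), uniq s ->
    (forall i, measurable (B i)) ->
  P (\big[setI/setT]_(i <- s) (X i @^-1` B i)) =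
    (\prod_(i <- s) P (X i @^-1` B i))%E.

Definition identically_distributed d' (T' : measurableType d') (I : Type)
    (X : I -> {RV P >-> T'}) :=
  forall (i j : I) (B : set T'), measurable B ->
    distribution P (X i) B = distribution P (X j) B.

Definition compactly_supported (f : R[i] -> R) :=
  compact (closure [set z | f z != 0]).

Definition measures_cvg_in_probability
    (mu : nat -> T -> {measure set R[i] -> \bar R})
    (nu : {measure set R[i] -> \bar R}) :=
  forall f : R[i] -> R, continuous f -> compactly_supported f ->
  forall e : R, 0 < e ->
    P [set w | `|\int[mu n w]_z f z - \int[nu]_z f z| > e] @[n --> \oo] --> 0%E.

Definition measures_cvg_almost_surely
    (mu : nat -> T -> {measure set R[i] -> \bar R})
    (nu : {measure set R[i] -> \bar R}) :=
  {ae P, forall w, forall f : R[i] -> R,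
    continuous f -> compactly_supported f ->
    \int[mu n w]_z f z @[n --> \oo] --> \int[nu]_z f z}.

End random_variables.

(* Main.v *)
(* Let [A = M + X], let [l] range over the eigenvalues of [A / sqrt n], and let
   [p z = prod (z - l)], so that [|det (A - sqrt n z)|^2 = n^n |p z|^2].

   Upper bound. Revealing the rows of [X] one at a time, [E |det (A - sqrt n z)|^2] is a sum of
   mixed Gram determinants; since [M] has rank [o(n)] it is [n! exp (n |z|^2 + o(n))].
   Averaging [|p|^2] over a circle of radius [r] about [z], after reflecting the roots inside it
   and damping the factor [exp (2 n Re (conj z s))] by a power of an affine function, gives
   [sum log (max r |z - l|) <= n (|z|^2 + r^2 - 1 + o(1)) / 2] almost surely.

   Lower bound, for [|z| < 1]. The conditional expectation of [|det|^2] loses a factor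
   [exp (- o(n))] only, as long as many rows remain: a typical row realizes its expected
   quadratic form by Chebyshev, and the exceptional rows cost a polynomial factor by a small ball
   bound. For the last rows one follows many points close to [z] at once: a row at which [h] of
   them fail together yields [h] separated approximate eigenvalues of a matrix of bounded norm,
   hence [h] robustly independent vectors almost orthogonal to the next random row, which is too
   unlikely. So almost surely [log |p z'| >= n (|z|^2 - 1 - o(1)) / 2] for some [z'] near [z].

   Subtracting, [sum log^+ (r / |z - l|) <= n (r^2 / 2 + o(1))] for [|z| < 1], and since discs
   have area [pi r^2], the limiting density is at most [1 / pi] in the open unit disc. The upper
   bound at [z = 0] with [r] slightly below [1] shows that no mass escapes from the disc, so the
   limit is the uniform law. *)
Require Import Defs.
From HB Require Import structures.
From mathcomp Require Import all_boot all_order all_algebra.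
From mathcomp Require Import all_classical all_reals all_analysis.
From mathcomp Require Import complex.
From mathcomp Require Import measurable_realfun ring lra zify.

Set Implicit Arguments.
Unset Strict Implicit.
Unset Printing Implicit Defensive.

Import Order.TTheory GRing.Theory Num.Theory.
Import numFieldNormedType.Exports.

Local Open Scope classical_set_scope.
Local Open Scope ring_scope.
Local Open Scope complex_scope.

Local Notation Re := complex.Re.
Local Notation Im := complex.Im.

From mathcomp Require cyclic separable cyclotomic.

(** * Hermitian forms and Gram determinants *)

Section hermitian_forms.
Variable R : realType.
Local Notation C := R[i].

(** The entries have a second moment and nothing more, so the computable quantity is the expectation
    of the squared modulus of a determinant of independent rows; hence squared moduli and Gram
    determinants throughout. Given the first rows, the expected squared volume is a quadratic form
    in the next row, whose relative fluctuation is governed by the number of dimensions still free.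
    Near the end few are left, and second moments say nothing about a fixed point [z]. Therefore
    only one good point is asked for among [2 * h ^ q] candidates: each of the last [q] rows may
    divide the number of surviving candidates by [h]. A nearby point is good enough, because the
    logarithmic singularity is truncated at radius [r] in the comparison with the upper bound. Every
    scale is a power of [p], the integer part of the 16th root of [n]: [q = p ^ 2] and [h = p ^ 6].
    Then all losses are [exp (O (n / p))], and each failure probability is [O (exp (- p))], hence
    [O (n ^ -2)], which is summable. *)

Definition sqn (z : C) : R := Re z ^+ 2 + Im z ^+ 2.

Lemma sqn_ge0 z : 0 <= sqn z.
Proof. by rewrite addr_ge0 ?sqr_ge0. Qed.

Lemma sqnM z w : sqn (z * w) = sqn z * sqn w.
Proof. by case: z w => a b [c e]; rewrite /sqn /=; ring. Qed.

Lemma conjE (z : C) : (z^*)%R = (Re z) -i* (Im z).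
Proof. by case: z. Qed.

Lemma ReconjE (z : C) : Re (z^*)%R = Re z. Proof. by case: z. Qed.
Lemma ImconjE (z : C) : Im (z^*)%R = - Im z. Proof. by case: z. Qed.

Lemma sqn_conj z : sqn (z^*)%R = sqn z.
Proof. by rewrite /sqn ReconjE ImconjE sqrrN. Qed.

Lemma sqnN z : sqn (- z) = sqn z.
Proof. by case: z => a b; rewrite /sqn /= !sqrrN. Qed.

Lemma sqn0 : sqn 0 = 0. Proof. by rewrite /sqn /= expr0n /= addr0. Qed.
Lemma sqn1 : sqn 1 = 1. Proof. by rewrite /sqn /= expr1n expr0n /= addr0. Qed.

Lemma sqn_real (a : R) : sqn a%:C = a ^+ 2.
Proof. by rewrite /sqn /= expr0n /= addr0. Qed.

Lemma sqn_eq0 z : (sqn z == 0) = (z == 0).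
Proof.
case: z => a b; rewrite /sqn /= paddr_eq0 ?sqr_ge0// !sqrf_eq0.
by rewrite eq_complex.
Qed.

Lemma mulconj (z : C) : z * (z^*)%R = (sqn z)%:C.
Proof. by case: z => a b; apply/eqP; rewrite eq_complex /= /sqn /=; apply/andP; split; apply/eqP; ring. Qed.

Lemma sqnD z w : sqn (z + w) = sqn z + 2 * Re (z * (w^*)%R) + sqn w.
Proof. by case: z w => a b [c e]; rewrite /sqn /=; ring. Qed.

Lemma sqnV z : sqn z^-1 = (sqn z)^-1.
Proof.
have [->|z0] := eqVneq z 0; first by rewrite invr0 sqn0 invr0.
have s0 : sqn z != 0 by rewrite sqn_eq0.
by apply: (mulfI s0); rewrite -sqnM divff// sqn1 divff.
Qed.

Lemma sqnX z k : sqn (z ^+ k) = sqn z ^+ k.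
Proof. by elim: k => [|k IH]; rewrite ?expr0 ?sqn1// !exprS sqnM IH. Qed.

Lemma sqn_prod (I : Type) (s : seq I) (Q : pred I) (F : I -> C) :
  sqn (\prod_(i <- s | Q i) F i) = \prod_(i <- s | Q i) sqn (F i).
Proof.
elim: s => [|a s IH]; first by rewrite !big_nil sqn1.
by rewrite !big_cons; case: ifP => // _; rewrite sqnM IH.
Qed.

Lemma normcE2 (z : C) : normc z ^+ 2 = sqn z.
Proof. by case: z => a b /=; rewrite sqr_sqrtr // addr_ge0 ?sqr_ge0. Qed.

Lemma normc_sqrt (z : C) : normc z = Num.sqrt (sqn z).
Proof. by case: z. Qed.

Lemma normc_ge0' (z : C) : 0 <= normc z.
Proof. by rewrite normc_sqrt sqrtr_ge0. Qed.

Lemma Re_le_normc (z : C) : `|Re z| <= normc z.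
Proof.
rewrite normc_sqrt -sqrtr_sqr ler_sqrt ?sqn_ge0//.
by rewrite /sqn lerDl sqr_ge0.
Qed.

Lemma sqr_Re_le z : Re z ^+ 2 <= sqn z.
Proof. by rewrite /sqn lerDl sqr_ge0. Qed.

Lemma ReD (z w : C) : Re (z + w) = Re z + Re w. Proof. by case: z; case: w. Qed.
Lemma ReN (z : C) : Re (- z) = - Re z. Proof. by case: z. Qed.
Lemma ImD (z w : C) : Im (z + w) = Im z + Im w. Proof. by case: z; case: w. Qed.
Lemma ImN (z : C) : Im (- z) = - Im z. Proof. by case: z. Qed.

Lemma ReZ (a : R) (z : C) : Re (a%:C * z) = a * Re z.
Proof. by case: z => x y /=; rewrite mul0r subr0. Qed.

Lemma Re_sum (I : Type) (s : seq I) (Q : pred I) (F : I -> C) :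
  Re (\sum_(i <- s | Q i) F i) = \sum_(i <- s | Q i) Re (F i).
Proof.
elim: s => [|a s IH]; first by rewrite !big_nil.
by rewrite !big_cons; case: ifP => // _; rewrite ReD IH.
Qed.

Lemma Im_sum (I : Type) (s : seq I) (Q : pred I) (F : I -> C) :
  Im (\sum_(i <- s | Q i) F i) = \sum_(i <- s | Q i) Im (F i).
Proof.
elim: s => [|a s IH]; first by rewrite !big_nil.
by rewrite !big_cons; case: ifP => // _; rewrite ImD IH.
Qed.

Lemma sqnD_le (t : R) z w : 0 < t ->
  sqn (z + w) <= (1 + t^-1) * sqn z + (1 + t) * sqn w.
Proof.
move=> t0; rewrite sqnD.
have : 0 <= sqn (z - t%:C * w) by exact: sqn_ge0.
rewrite sqnD sqnN sqnM sqn_real => H.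
have H2 : Re (z * ((- (t%:C * w))^*)%R) = - (t * Re (z * (w^*)%R)).
  by case: z {H} => a b; case: w => c e /=; ring.
rewrite H2 in H.
have ti : t^-1 * t = 1 by rewrite mulVf ?gt_eqF.
have t1 : 0 < t^-1 by rewrite invr_gt0.
have := mulr_ge0 (ltW t1) H.
have -> : t^-1 * (sqn z + 2 * - (t * Re (z * (w^*)%R)) + t ^+ 2 * sqn w) =
  t^-1 * sqn z - 2 * (t^-1 * t) * Re (z * (w^*)%R) + (t^-1 * t) * t * sqn w by ring.
rewrite ti; lra.
Qed.

Lemma sqnD2 z w : sqn (z + w) <= 2 * sqn z + 2 * sqn w.
Proof. by have := @sqnD_le 1 z w ltr01; rewrite invr1. Qed.

Definition adj m n (A : 'M[C]_(m, n)) : 'M[C]_(n, m) := map_mx Num.conj A^T.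

Lemma adjE m n (A : 'M[C]_(m, n)) i j : adj A i j = (A j i)^*%R.
Proof. by rewrite !mxE. Qed.

Lemma adjK m n (A : 'M[C]_(m, n)) : adj (adj A) = A.
Proof. by apply/matrixP => i j; rewrite !mxE conjCK. Qed.

Lemma adjM m n p (A : 'M[C]_(m, n)) (B : 'M[C]_(n, p)) :
  adj (A *m B) = adj B *m adj A.
Proof. by rewrite /adj trmx_mul map_mxM. Qed.

Lemma adjD m n (A B : 'M[C]_(m, n)) : adj (A + B) = adj A + adj B.
Proof. by rewrite /adj linearD /= map_mxD. Qed.

Lemma adjN m n (A : 'M[C]_(m, n)) : adj (- A) = - adj A.
Proof. by rewrite /adj linearN /= map_mxN. Qed.

Lemma adjB m n (A B : 'M[C]_(m, n)) : adj (A - B) = adj A - adj B.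
Proof. by rewrite adjD adjN. Qed.

Lemma adjZ m n a (A : 'M[C]_(m, n)) : adj (a *: A) = (a^*)%R *: adj A.
Proof. by rewrite /adj linearZ /= map_mxZ. Qed.

Lemma adj0 m n : adj (0 : 'M[C]_(m, n)) = 0.
Proof. by rewrite /adj trmx0 map_mx0. Qed.

Lemma adj1 n : adj (1%:M : 'M[C]_n) = 1%:M.
Proof. by rewrite /adj trmx1 map_mx1. Qed.

Lemma adj_sum (I : Type) (s : seq I) (P : pred I) m n (F : I -> 'M[C]_(m, n)) :
  adj (\sum_(i <- s | P i) F i) = \sum_(i <- s | P i) adj (F i).
Proof.
elim: s => [|a s IH]; first by rewrite !big_nil adj0.
by rewrite !big_cons; case: ifP => // _; rewrite adjD IH.
Qed.

Lemma conj_realc (a : R) : ((a%:C)^*)%R = a%:C :> C.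
Proof. by rewrite conjE /= oppr0. Qed.

Variable n : nat.
Implicit Types (u v : 'rV[C]_n) (Q P : 'M[C]_n).

(** Vectors are rows and matrices act on the right, so [dot] is linear in its first argument and
    conjugate-linear in the second. *)
Definition dot u v : C := (u *m adj v) 0 0.
Definition nrm2 v : R := Re (dot v v).
Definition qf Q v : R := Re (dot (v *m Q) v).
Definition herm Q := adj Q = Q.
Definition trR Q : R := Re (\tr Q).
Definition ev (i : 'I_n) : 'rV[C]_n := delta_mx 0 i.

Lemma dotE u v : dot u v = \sum_j u 0 j * (v 0 j)^*%R.
Proof. by rewrite /dot mxE; apply: eq_bigr => j _; rewrite adjE. Qed.

Lemma dotDl u1 u2 v : dot (u1 + u2) v = dot u1 v + dot u2 v.
Proof. by rewrite /dot mulmxDl mxE. Qed.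
Lemma dotDr u v1 v2 : dot u (v1 + v2) = dot u v1 + dot u v2.
Proof. by rewrite /dot adjD mulmxDr mxE. Qed.
Lemma dotZl a u v : dot (a *: u) v = a * dot u v.
Proof. by rewrite /dot -scalemxAl mxE. Qed.
Lemma dotZr a u v : dot u (a *: v) = (a^*)%R * dot u v.
Proof. by rewrite /dot adjZ -scalemxAr mxE. Qed.
Lemma dotNl u v : dot (- u) v = - dot u v.
Proof. by rewrite /dot mulNmx mxE. Qed.
Lemma dotNr u v : dot u (- v) = - dot u v.
Proof. by rewrite /dot adjN mulmxN mxE. Qed.
Lemma dot0l v : dot 0 v = 0.
Proof. by rewrite /dot mul0mx mxE. Qed.
Lemma dot0r v : dot v 0 = 0.
Proof. by rewrite /dot adj0 mulmx0 mxE. Qed.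
Lemma dotC u v : dot v u = ((dot u v)^*)%R.
Proof.
rewrite !dotE rmorph_sum /=; apply: eq_bigr => j _.
by rewrite rmorphM /= conjCK mulrC.
Qed.
Lemma dot_adj u v Q : dot (u *m Q) v = dot u (v *m adj Q).
Proof. by rewrite /dot adjM adjK mulmxA. Qed.

Lemma nrm2E v : nrm2 v = \sum_j sqn (v 0 j).
Proof. by rewrite /nrm2 dotE Re_sum; apply: eq_bigr => j _; rewrite mulconj. Qed.

Lemma dot_nrm2 v : dot v v = (nrm2 v)%:C.
Proof.
rewrite /nrm2; apply/eqP; rewrite eq_complex /= eqxx /=; apply/eqP.
by rewrite dotE Im_sum big1// => j _; rewrite mulconj.
Qed.

Lemma nrm2_ge0 v : 0 <= nrm2 v.
Proof. by rewrite nrm2E sumr_ge0// => j _; exact: sqn_ge0. Qed.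

Lemma nrm2_eq0 v : nrm2 v = 0 -> v = 0.
Proof.
move=> /eqP; rewrite nrm2E psumr_eq0; last by move=> j _; exact: sqn_ge0.
move=> /allP H; apply/matrixP => i j; rewrite ord1 mxE.
by have := H j (mem_index_enum _); rewrite sqn_eq0 => /eqP.
Qed.

Lemma nrm2_0 : nrm2 0 = 0.
Proof. by rewrite /nrm2 dot0l. Qed.

Lemma nrm2Z a v : nrm2 (a *: v) = sqn a * nrm2 v.
Proof. by rewrite !nrm2E mulr_sumr; apply: eq_bigr => j _; rewrite mxE sqnM. Qed.

Lemma nrm2N v : nrm2 (- v) = nrm2 v.
Proof. by rewrite !nrm2E; apply: eq_bigr => j _; rewrite mxE sqnN. Qed.

Lemma qf1 v : qf 1%:M v = nrm2 v.
Proof. by rewrite /qf mulmx1. Qed.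
Lemma qfD Q1 Q2 v : qf (Q1 + Q2) v = qf Q1 v + qf Q2 v.
Proof. by rewrite /qf mulmxDr dotDl ReD. Qed.
Lemma qfN Q v : qf (- Q) v = - qf Q v.
Proof. by rewrite /qf mulmxN dotNl ReN. Qed.
Lemma qfZ (a : R) Q v : qf (a%:C *: Q) v = a * qf Q v.
Proof. by rewrite /qf -scalemxAr dotZl ReZ. Qed.
Lemma qf0 v : qf 0 v = 0.
Proof. by rewrite /qf mulmx0 dot0l. Qed.
Lemma qf_sum (I : Type) (s : seq I) (D : pred I) (F : I -> 'M[C]_n) v :
  qf (\sum_(i <- s | D i) F i) v = \sum_(i <- s | D i) qf (F i) v.
Proof.
elim: s => [|a s IH]; first by rewrite !big_nil qf0.
by rewrite !big_cons; case: ifP => // _; rewrite qfD IH.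
Qed.
Lemma qf0r Q : qf Q 0 = 0.
Proof. by rewrite /qf dot0r. Qed.

Lemma qfDr Q u v : herm Q ->
  qf Q (u + v) = qf Q u + 2 * Re (dot (u *m Q) v) + qf Q v.
Proof.
move=> hQ; rewrite /qf mulmxDl !dotDl !dotDr !ReD.
have -> : dot (v *m Q) u = ((dot (u *m Q) v)^*)%R by rewrite dot_adj hQ dotC.
by rewrite ReconjE; ring.
Qed.

Lemma qfZr Q a v : qf Q (a *: v) = sqn a * qf Q v.
Proof.
rewrite /qf -scalemxAl dotZl dotZr mulrA mulconj.
by rewrite ReZ.
Qed.

Lemma qfNr Q v : qf Q (- v) = qf Q v.
Proof. by rewrite /qf mulNmx dotNl dotNr opprK. Qed.

Lemma dot_qf Q v : herm Q -> dot (v *m Q) v = (qf Q v)%:C.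
Proof.
move=> hQ; rewrite /qf; apply/eqP; rewrite eq_complex /= eqxx /=; apply/eqP.
have : dot (v *m Q) v = ((dot (v *m Q) v)^*)%R by rewrite {1}dot_adj hQ dotC.
by move=> /(congr1 (@Im R)); rewrite ImconjE; lra.
Qed.

Definition psd Q := herm Q /\ forall v, 0 <= qf Q v.

Lemma quad_disc (a b c : R) : 0 <= a -> 0 <= c ->
  (forall x, 0 <= a * x ^+ 2 - 2 * b * x + c) -> b ^+ 2 <= a * c.
Proof.
move=> a0 c0 H; have [a00|an0] := eqVneq a 0.
  subst a; rewrite mul0r; have [->|b0] := eqVneq b 0; first by rewrite expr0n.
  (* For [a = 0] the function is affine and takes the value -1 at this point. *)
  have := H ((c + 1) / (2 * b)); rewrite mul0r.
  have -> : 2 * b * ((c + 1) / (2 * b)) = c + 1.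
    by rewrite mulrC divfK// mulf_neq0// pnatr_eq0.
  lra.
have ap : 0 < a by rewrite lt0r an0.
have := H (b / a).
have -> : a * (b / a) ^+ 2 - 2 * b * (b / a) + c = (a * c - b ^+ 2) / a by field.
by rewrite pmulr_lge0 ?invr_gt0// subr_ge0.
Qed.

(** For real [x] the form at [- x * conj d * u + v] is a real quadratic polynomial in [x], since the
    factor [conj d] makes the cross term real; [quad_disc] then bounds its discriminant. *)
Lemma cauchy_schwarz Q u v : psd Q ->
  sqn (dot (u *m Q) v) <= qf Q u * qf Q v.
Proof.
move=> [hQ pQ]; set d := dot (u *m Q) v.
have := @quad_disc (qf Q u * sqn d) (sqn d) (qf Q v).
have -> : qf Q u * sqn d * qf Q v = sqn d * (qf Q u * qf Q v) by ring.
move=> H; have [->|d0] := eqVneq (sqn d) 0; first by rewrite mulr_ge0.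
have dp : 0 < sqn d by rewrite lt0r d0 sqn_ge0.
rewrite -(ler_pM2l dp) -expr2; apply: H => //.
  by rewrite mulr_ge0 ?sqn_ge0.
move=> x; have := pQ ((- x%:C * (d^*)%R) *: u + v).
rewrite qfDr// qfZr -scalemxAl dotZl -/d sqnM sqnN sqn_real sqn_conj.
have -> : Re (- x%:C * (d^*)%R * d) = - (x * sqn d).
  by rewrite -mulrA [(d^*)%R * d]mulrC mulconj mulNr ReN ReZ.
by move=> K; rewrite (le_trans K)// le_eqVlt; apply/orP; left; apply/eqP; ring.
Qed.

Lemma psd1 : psd 1%:M.
Proof. by split; [exact: adj1 | move=> v; rewrite qf1 nrm2_ge0]. Qed.

Lemma dot_cs u v : sqn (dot u v) <= nrm2 u * nrm2 v.
Proof. by have := cauchy_schwarz u v psd1; rewrite mulmx1 !qf1. Qed.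

Lemma trRE Q : trR Q = \sum_i qf Q (ev i).
Proof.
rewrite /trR /mxtrace Re_sum; apply: eq_bigr => i _.
rewrite /qf dotE (bigD1 i)//= big1 ?addr0; last first.
  by move=> j ji; rewrite [ev i 0 j]mxE (negbTE ji) andbF conjC0 mulr0.
by rewrite [ev i 0 i]mxE !eqxx /= conjC1 mulr1 -rowE mxE.
Qed.

Lemma trRD Q1 Q2 : trR (Q1 + Q2) = trR Q1 + trR Q2.
Proof. by rewrite /trR mxtraceD ReD. Qed.
Lemma trRN Q : trR (- Q) = - trR Q.
Proof. by rewrite !trRE -sumrN; apply: eq_bigr => i _; rewrite qfN. Qed.
Lemma trRZ (a : R) Q : trR (a%:C *: Q) = a * trR Q.
Proof. by rewrite /trR mxtraceZ ReZ. Qed.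
Lemma trR_sum (I : Type) (s : seq I) (D : pred I) (F : I -> 'M[C]_n) :
  trR (\sum_(i <- s | D i) F i) = \sum_(i <- s | D i) trR (F i).
Proof.
elim: s => [|a s IH]; first by rewrite !big_nil /trR mxtrace0.
by rewrite !big_cons; case: ifP => // _; rewrite trRD IH.
Qed.
Lemma trR1 : trR 1%:M = n%:R.
Proof. by rewrite /trR mxtrace1; elim: n => //= m IH; rewrite -addn1 !natrD ReD IH. Qed.
Lemma trR_ge0 Q : psd Q -> 0 <= trR Q.
Proof. by move=> [_ h]; rewrite trRE sumr_ge0. Qed.

Lemma qf_ev Q i : qf Q (ev i) = Re (Q i i).
Proof.
rewrite /qf dotE (bigD1 i)//= big1 ?addr0; last first.
  by move=> j ji; rewrite [ev i 0 j]mxE (negbTE ji) andbF conjC0 mulr0.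
by rewrite [ev i 0 i]mxE !eqxx /= conjC1 mulr1 -rowE mxE.
Qed.

Lemma nrm2_ev i : nrm2 (ev i) = 1.
Proof. by rewrite -qf1 qf_ev mxE eqxx. Qed.

Lemma rank1_herm v : herm (adj v *m v).
Proof. by rewrite /herm adjM adjK. Qed.

Lemma qf_rank1 v u : qf (adj v *m v) u = sqn (dot u v).
Proof.
rewrite /qf /dot mulmxA.
have -> : u *m adj v = (dot u v)%:M.
  by apply/matrixP => i j; rewrite !ord1 [RHS]mxE eqxx.
rewrite mul_scalar_mx -scalemxAl mxE.
have -> : (v *m adj u) 0 0 = ((dot u v)^*)%R by rewrite -dotC.
by rewrite mulconj mxE eqxx.
Qed.

Lemma trR_rank1 v : trR (adj v *m v) = nrm2 v.
Proof.
rewrite trRE nrm2E; apply: eq_bigr => i _; rewrite qf_rank1 dotE (bigD1 i)//= big1 ?addr0.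
  by rewrite [ev i 0 i]mxE !eqxx mul1r sqn_conj.
by move=> j ji; rewrite [ev i 0 j]mxE (negbTE ji) andbF mul0r.
Qed.

End hermitian_forms.

(** * Gram-Schmidt downdates and squared volumes *)

Section gram_schmidt.
Variable R : realType.
Local Notation C := R[i].
Variable n : nat.
Implicit Types (u v x : 'rV[C]_n) (s t : seq 'rV[C]_n) (Q P : 'M[C]_n).

(* Orthogonal projection away from the span of the list, by successive rank-one
   downdates; a vector already in the span divides by 0 and changes nothing. *)
Fixpoint PJ s : 'M[C]_n :=
  if s is v :: s' then
    let P := PJ s' in P - ((qf P v)^-1)%:C *: (adj (v *m P) *m (v *m P))
  else 1%:M.

(** Product of the squared distances from each vector to the span of its successors; [det_smat]
    identifies it with the Gram determinant. *)
Fixpoint gram s : R := if s is v :: s' then qf (PJ s') v * gram s' else 1.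

Lemma gram_cons v s : gram (v :: s) = qf (PJ s) v * gram s.
Proof. by []. Qed.

Definition isproj P := herm P /\ P *m P = P.

Lemma qf_proj P v : isproj P -> qf P v = nrm2 (v *m P).
Proof.
move=> [hP PP]; rewrite /nrm2 /qf -{1}PP mulmxA.
by rewrite dot_adj hP.
Qed.

Lemma proj_psd P : isproj P -> psd P.
Proof. by move=> hP; split; [case: hP | move=> v; rewrite qf_proj// nrm2_ge0]. Qed.

Lemma isproj1 : isproj 1%:M.
Proof. by split; [exact: adj1 | rewrite mulmx1]. Qed.

Lemma isprojC P : isproj P -> isproj (1%:M - P).
Proof.
move=> [hP PP]; split; first by rewrite /herm adjB adj1 hP.
by rewrite mulmxBl mul1mx mulmxBr mulmx1 PP subrr subr0.
Qed.

Lemma qf_proj_le P v : isproj P -> qf P v <= nrm2 v.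
Proof.
move=> hP; have := nrm2_ge0 (v *m (1%:M - P)).
rewrite -(qf_proj _ (isprojC hP)) qfD qfN qf1; lra.
Qed.

Lemma hermZ (a : R) Q : herm Q -> herm (a%:C *: Q).
Proof. by move=> h; rewrite /herm adjZ conj_realc h. Qed.
Lemma hermD Q1 Q2 : herm Q1 -> herm Q2 -> herm (Q1 + Q2).
Proof. by move=> h1 h2; rewrite /herm adjD h1 h2. Qed.
Lemma hermB Q1 Q2 : herm Q1 -> herm Q2 -> herm (Q1 - Q2).
Proof. by move=> h1 h2; rewrite /herm adjB h1 h2. Qed.

Lemma dot_mx u v : u *m adj v = (dot u v)%:M.
Proof. by apply/matrixP => i j; rewrite !ord1 [RHS]mxE eqxx. Qed.

(** The vector [w = v *m P] has squared norm [qf P v], so the downdate removes the orthogonal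
    projection on the line of [w]. If [qf P v = 0], the inverse is 0 and [P] stays as it is. *)
Lemma PJ_proj s : isproj (PJ s).
Proof.
elim: s => [|v s [hP PP]] /=; first exact: isproj1.
set P := PJ s in hP PP *; set w := v *m P.
have wP : w *m P = w by rewrite /w -mulmxA PP.
have Pw : P *m adj w = adj w by rewrite -{1}hP -adjM wP.
split; first by apply: hermB => //; apply: hermZ; exact: rank1_herm.
have ww : w *m adj w = (qf P v)%:C%:M.
  by rewrite dot_mx dot_nrm2 -qf_proj.
rewrite mulmxBl !mulmxBr PP -!scalemxAr -!scalemxAl.
rewrite [P *m (_ *m w)]mulmxA Pw -[adj w *m w *m P]mulmxA wP.
have -> : adj w *m w *m (adj w *m w) = (qf P v)%:C *: (adj w *m w).
  by rewrite mulmxA -[adj w *m w *m adj w]mulmxA ww mul_mx_scalar -scalemxAl.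
set a := qf P v; rewrite !scalerA.
have [a0|a0] := eqVneq a 0.
  by rewrite a0 invr0 !mul0r !scale0r !subr0.
have -> : (a^-1)%:C * (a^-1)%:C * a%:C = (a^-1)%:C :> C.
  by rewrite -mulrA -rmorphM /= mulVf// mulr1.
by rewrite subrr subr0.
Qed.

Lemma PJ_herm s : adj (PJ s) = PJ s. Proof. by case: (PJ_proj s). Qed.

Lemma PJ_psd s : psd (PJ s). Proof. exact/proj_psd/PJ_proj. Qed.
Lemma dotPJ u v s : dot u (v *m PJ s) = dot (u *m PJ s) v.
Proof. by rewrite dot_adj PJ_herm. Qed.
Lemma qfPJ_ge0 s v : 0 <= qf (PJ s) v. Proof. by case: (PJ_psd s). Qed.
Lemma qfPJ_le s v : qf (PJ s) v <= nrm2 v. Proof. exact/qf_proj_le/PJ_proj. Qed.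

Lemma gram_ge0 s : 0 <= gram s.
Proof. by elim: s => //= v s IH; rewrite mulr_ge0 ?qfPJ_ge0. Qed.

Lemma qf_PJ_cons v s u : qf (PJ (v :: s)) u =
  qf (PJ s) u - (qf (PJ s) v)^-1 * sqn (dot (u *m PJ s) v).
Proof.
rewrite /= qfD qfN qfZ qf_rank1; congr (_ - _ * sqn _).
by rewrite dotPJ.
Qed.

Lemma trR_PJ_cons v s :
  trR (PJ (v :: s)) = trR (PJ s) - (qf (PJ s) v != 0)%:R.
Proof.
rewrite /= trRD trRN trRZ trR_rank1 -qf_proj; last exact: PJ_proj.
by have [->|a0] := eqVneq (qf (PJ s) v) 0; rewrite ?invr0 ?mul0r// mulVf.
Qed.

(** The trace of a projection is its rank, and a downdate lowers it by at most one. *)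
Lemma trR_PJ_ge s : n%:R - (size s)%:R <= trR (PJ s).
Proof.
elim: s => [|v s IH]; first by rewrite /= trR1 subr0.
rewrite trR_PJ_cons /= -[(size s).+1]addn1 natrD.
by case: (_ != 0) => /=; lra.
Qed.

Lemma trR_PJ_eq s : gram s != 0 -> trR (PJ s) = n%:R - (size s)%:R.
Proof.
elim: s => [|v s IH]; first by rewrite /= trR1 subr0.
rewrite trR_PJ_cons /= mulf_eq0 negb_or => /andP[-> /IH ->].
by rewrite -[(size s).+1]addn1 natrD /=; ring.
Qed.

Lemma mul_PJ_cons u v s : u *m PJ (v :: s) =
  u *m PJ s - ((qf (PJ s) v)^-1%:C * dot u (v *m PJ s)) *: (v *m PJ s).
Proof.
rewrite [PJ (v :: s)]/= mulmxBr -scalemxAr; congr (_ - _).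
by rewrite (mulmxA u) dot_mx mul_scalar_mx scalerA.
Qed.

Lemma PJ_kill s v : v \in s -> v *m PJ s = 0.
Proof.
elim: s => //= u s IH; rewrite inE => /orP[/eqP ->|/IH vP]; last first.
  by rewrite mul_PJ_cons dotPJ vP dot0l mulr0 scale0r subr0.
set P := PJ s; have hP := PJ_proj s.
rewrite mul_PJ_cons; have -> : dot u (u *m P) = (qf P u)%:C.
  by rewrite /P dotPJ dot_qf//; exact: PJ_herm.
have [a0|a0] := eqVneq (qf P u) 0.
  rewrite a0 invr0 mul0r scale0r subr0; apply: nrm2_eq0.
  by rewrite -qf_proj.
by rewrite -rmorphM /= mulVf// scale1r subrr.
Qed.

Lemma PJ_fix s u : (forall v, v \in s -> dot v u = 0) -> u *m PJ s = u.
Proof.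
elim: s => [|v s IH] H; first by rewrite mulmx1.
have uP : u *m PJ s = u by apply: IH => w ws; apply: H; rewrite inE ws orbT.
rewrite mul_PJ_cons dotPJ uP dotC.
by rewrite H ?mem_head// conjC0 mulr0 scale0r subr0.
Qed.

Lemma PJ_perp s u v : v \in s -> dot v (u *m PJ s) = 0.
Proof. by move=> vs; rewrite -{1}(PJ_herm s) -dot_adj PJ_kill// dot0l. Qed.

(** The rows of [PJ t] are orthogonal to [t], hence to [s], and [PJ s] fixes whatever is orthogonal
    to [s]. It follows that [PJ] depends on the set of vectors only, which makes [gram]
    symmetric. *)
Lemma PJ_sub s t : {subset s <= t} -> PJ t *m PJ s = PJ t.
Proof.
move=> st; apply/row_matrixP => i; rewrite row_mul.
have -> : row i (PJ t) = ev R i *m PJ t by rewrite -rowE.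
by apply: PJ_fix => v /st vt; exact: PJ_perp.
Qed.

Lemma PJ_subr s t : {subset s <= t} -> PJ s *m PJ t = PJ t.
Proof. by move=> st; rewrite -[in LHS](PJ_herm s) -[in LHS](PJ_herm t) -adjM PJ_sub// PJ_herm. Qed.

Lemma PJ_mem s t : s =i t -> PJ s = PJ t.
Proof.
move=> st; rewrite -(@PJ_subr t s); last by move=> v; rewrite st.
by rewrite PJ_sub// => v; rewrite st.
Qed.

Lemma qfPJ_mem s v : v \in s -> qf (PJ s) v = 0.
Proof. by move=> vs; rewrite qf_proj ?PJ_kill ?nrm2_0//; exact: PJ_proj. Qed.

Lemma qf0_dot P u v : psd P -> qf P v = 0 -> dot (u *m P) v = 0.
Proof.
move=> pP v0; apply/eqP; rewrite -sqn_eq0 eq_le sqn_ge0 andbT.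
by have := cauchy_schwarz u v pP; rewrite v0 mulr0.
Qed.

(** Both sides contain the two-by-two Gram determinant of the components of [u] and [v] orthogonal
    to [s]. Where a diagonal entry vanishes, Cauchy-Schwarz kills the off-diagonal one, so the
    convention that 0 is its own inverse does no harm. *)
Lemma gram_swap u v s : gram (u :: v :: s) = gram (v :: u :: s).
Proof.
have H a b : gram (a :: b :: s) =
  (qf (PJ s) a * qf (PJ s) b - sqn (dot (a *m PJ s) b)) * gram s.
  rewrite [LHS]/gram -/gram qf_PJ_cons.
  have [b0|b0] := eqVneq (qf (PJ s) b) 0; last by rewrite mulrA; congr (_ * _); field.
  by rewrite b0 !(mul0r, mulr0) (qf0_dot _ (PJ_psd s) b0) sqn0 subrr mul0r.
rewrite !H; congr (_ * _); rewrite [qf _ u * _]mulrC; congr (_ - _).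
by rewrite dot_adj PJ_herm dotC sqn_conj.
Qed.

Lemma gram_move s t v : gram (s ++ v :: t) = gram (v :: s ++ t).
Proof.
elim: s => // u s IH; rewrite cat_cons gram_swap /= IH /=; congr (_ * _).
congr qf; rewrite -/(cat s t) -[_ - _]/(PJ (v :: s ++ t)).
by apply: PJ_mem => x; rewrite !(mem_cat, inE) orbCA.
Qed.

Lemma gram_cat_perm s s' t : perm_eq s s' -> gram (s ++ t) = gram (s' ++ t).
Proof.
elim: s s' t => [|u s IH] s' t; first by rewrite perm_sym => /perm_nilP ->.
move=> H; have us' : u \in s' by rewrite -(perm_mem H) mem_head.
case/splitPr: us' H => a b H.
have {}H : perm_eq s (a ++ b).
  by move: H; rewrite -cat1s perm_sym -[u :: b]cat1s perm_catCA perm_cat2l perm_sym.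
have -> : (a ++ u :: b) ++ t = a ++ u :: (b ++ t) by rewrite -catA.
rewrite gram_move [LHS]gram_cons [RHS]gram_cons (IH _ t H) -catA; congr (_ * _).
by congr qf; apply: PJ_mem => x; rewrite !mem_cat (perm_mem H) !mem_cat orbA.
Qed.

Lemma gram_mem0 v s : v \in s -> gram (v :: s) = 0.
Proof. by move=> vs; rewrite /= qfPJ_mem// mul0r. Qed.

Lemma span_PJ s x : exists c : seq C,
  x - x *m PJ s = \sum_(i < size s) nth 0 c i *: nth 0 s i.
Proof.
elim: s x => [|v s IH] x; first by exists [::]; rewrite /= mulmx1 subrr big_ord0.
rewrite mul_PJ_cons; set a := (_ * _)%R; have [c1 h1] := IH x; have [c2 h2] := IH v.
exists (a :: mkseq (fun i => nth 0 c1 i - a * nth 0 c2 i) (size s)).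
rewrite big_ord_recl /= opprB addrCA h1.
have -> : v *m PJ s = v - (v - v *m PJ s) by rewrite opprB addrC subrK.
rewrite h2 scalerBr -addrA; congr (_ + _).
rewrite scaler_sumr addrC -sumrB; apply: eq_bigr => i _.
by rewrite /= add0n nth_mkseq// scalerBl scalerA.
Qed.

(** Subtracting a combination of [s] does not change the projection. With [qfPJ_attained] this
    exhibits [qf (PJ s) v] as the squared distance to the span, a description that survives linear
    maps. *)
Lemma qfPJ_min s v (c : seq C) :
  qf (PJ s) v <= nrm2 (v - \sum_(i < size s) nth 0 c i *: nth 0 s i).
Proof.
set w := \sum_(i < _) _; have wP : w *m PJ s = 0.
  rewrite /w mulmx_suml big1// => i _.
  by rewrite -scalemxAl PJ_kill ?scaler0// mem_nth.
have -> : qf (PJ s) v = qf (PJ s) (v - w).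
  by rewrite !qf_proj ?mulmxBl ?wP ?subr0//; exact: PJ_proj.
exact: qfPJ_le.
Qed.

Lemma qfPJ_attained s v : exists c : seq C,
  qf (PJ s) v = nrm2 (v - \sum_(i < size s) nth 0 c i *: nth 0 s i).
Proof.
have [c h] := span_PJ s v; exists c.
by rewrite -h opprB addrC subrK qf_proj//; exact: PJ_proj.
Qed.

(** A contraction shrinks distances to spans: the image of the best approximation of [v] competes
    for the image of [v]. *)
Lemma gram_contract s Q : (forall v, nrm2 (v *m Q) <= nrm2 v) ->
  gram [seq v *m Q | v <- s] <= gram s.
Proof.
move=> hQ; elim: s => //= v s IH; apply: ler_pM; rewrite ?qfPJ_ge0 ?gram_ge0//.
have [c ->] := qfPJ_attained s v; apply: le_trans (hQ _).
have := qfPJ_min (map (mulmx^~ Q) s) (v *m Q) c; rewrite size_map.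
move=> h; apply: (le_trans h); rewrite le_eqVlt; apply/orP; left; apply/eqP.
congr nrm2; rewrite mulmxBl; congr (_ - _).
rewrite mulmx_suml; apply: eq_bigr => i _.
by rewrite (nth_map 0)// scalemxAl.
Qed.

Lemma gram_cons_le v s : gram (v :: s) <= nrm2 v * gram s.
Proof. by rewrite /= ler_wpM2r ?gram_ge0// qfPJ_le. Qed.

Lemma sum_gram_ev s : gram s != 0 -> \sum_a gram (ev R a :: s) = (n%:R - (size s)%:R) * gram s.
Proof.
move=> g0; rewrite /= -mulr_suml; congr (_ * _).
by rewrite -trRE trR_PJ_eq.
Qed.

Lemma size_gram_neq0 s : gram s != 0 -> (size s <= n)%N.
Proof.
move=> /trR_PJ_eq h; rewrite -(ler_nat R) -subr_ge0 -h.
by apply: trR_ge0; exact: PJ_psd.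
Qed.

(** A vector orthogonal to [s] certifies a lower bound for the distance to the span of [s]. The unit
    normals that become approximate eigenvectors enter in this way. *)
Lemma qfPJ_functional s v u : (forall x, x \in s -> dot x u = 0) ->
  sqn (dot v u) <= qf (PJ s) v * nrm2 u.
Proof.
move=> /PJ_fix uP.
have -> : dot v u = dot (v *m PJ s) u.
  by rewrite dot_adj PJ_herm uP.
by rewrite qf_proj ?dot_cs//; exact: PJ_proj.
Qed.

End gram_schmidt.

Section gram_determinant.
Variable R : realType.
Local Notation C := R[i].
Variable n : nat.
Implicit Types (u v x : 'rV[C]_n) (s t : seq 'rV[C]_n) (Q P : 'M[C]_n).

Fixpoint smat s : 'M[C]_(size s, n) :=
  match s return 'M[C]_(size s, n) with
  | [::] => 0
  | v :: s' => (col_mx v (smat s') : 'M[C]_(1 + size s', n))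
  end.

Lemma row_smat s (i : 'I_(size s)) : row i (smat s) = nth 0 s i.
Proof.
elim: s i => [[]//|v s IH] i /=.
case: (@split_ordP 1 (size s) i) => j ->.
  by rewrite (@rowKu _ 1 (size s)) !ord1 /= row_id.
by rewrite (@rowKd _ 1 (size s)) IH.
Qed.

Lemma span_mx s x : exists c : 'rV[C]_(size s), x - x *m PJ s = c *m smat s.
Proof.
have [c ->] := span_PJ s x; exists (\row_i nth 0 c i).
rewrite mulmx_sum_row; apply: eq_bigr => i _; by rewrite mxE row_smat.
Qed.

Lemma smat_perp s x : x *m PJ s *m adj (smat s) = 0.
Proof.
apply/matrixP => i j; rewrite !ord1 mxE [RHS]mxE.
have := @PJ_perp _ _ s x (nth 0 s j) (mem_nth 0 (ltn_ord j)).
rewrite dotC dotE => /(congr1 Num.conj) h; rewrite conjCK conjC0 in h.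
rewrite -[RHS]h; apply: eq_bigr => k _; rewrite adjE.
by have /rowP/(_ k) := row_smat j; rewrite mxE => ->.
Qed.

(** Subtracting from [v] its component in the span of [s] is a row operation of determinant one,
    after which the Gram matrix is block triangular. *)
Lemma det_smat s : \det (smat s *m adj (smat s)) = (gram s)%:C.
Proof.
elim: s => [|v s IH]; first by rewrite det_mx00.
have [c hc] := span_mx s v.
set S := smat s in IH hc *; set k := size s in c S IH hc *; set vP := v *m PJ s in hc.
pose L : 'M[C]_(1 + k) := block_mx 1%:M c 0 1%:M.
have E : L *m (col_mx vP S : 'M[C]_(1 + k, n)) = col_mx v S.
  by rewrite /L mul_block_col !mul1mx mul0mx add0r -hc addrC subrK.
rewrite -[smat (v :: s)]/(col_mx v S : 'M[C]_(1 + k, n)) -E.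
rewrite adjM mulmxA -[L *m _ *m _]mulmxA !det_mulmx.
have dL : \det L = 1 by rewrite det_ublock !det1 mulr1.
have -> : \det (adj L) = 1 by rewrite /adj det_map_mx det_tr dL rmorph1.
rewrite dL mul1r mulr1.
have -> : adj (col_mx vP S : 'M[C]_(1 + k, n)) = row_mx (adj vP) (adj S).
  by rewrite /adj tr_col_mx map_row_mx.
have z : vP *m adj S = 0 := smat_perp s v.
rewrite mul_col_row z.
rewrite (@det_lblock _ 1 k (vP *m adj vP) (S *m adj vP) (S *m adj S)) IH gram_cons rmorphM /=; congr (_ * _).
rewrite det_mx11 -/(dot vP vP) dot_nrm2 qf_proj//; exact: PJ_proj.
Qed.

Lemma gram_perm s s' : perm_eq s s' -> gram s = gram s'.
Proof. by move=> h; rewrite -[s]cats0 -[s']cats0; exact: gram_cat_perm. Qed.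

Lemma sqn_det_mx (A : 'M[C]_n) : (sqn (\det A))%:C = \det (A *m adj A).
Proof. by rewrite det_mulmx /adj det_map_mx det_tr mulconj. Qed.

Lemma sqn_det_smat s (e : size s = n) :
  sqn (\det (castmx (e, erefl n) (smat s))) = gram s.
Proof.
apply: complexI; rewrite sqn_det_mx -det_smat.
suff H k (E : k = n) (S : 'M[C]_(k, n)) :
    \det (castmx (E, erefl n) S *m adj (castmx (E, erefl n) S)) = \det (S *m adj S).
  exact: H.
by subst k; rewrite castmx_id.
Qed.

Lemma sqn_det (A : 'M[C]_n) : sqn (\det A) = gram [seq row i A | i <- enum 'I_n].
Proof.
set s := [seq _ | i <- _]; have e : size s = n by rewrite size_map size_enum_ord.
rewrite -(sqn_det_smat e); congr (sqn (\det _)); apply/row_matrixP => i.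
apply/rowP => j; rewrite !mxE castmxE /= cast_ord_id.
have := row_smat (cast_ord (esym e) i) => /rowP /(_ j); rewrite mxE => ->.
by rewrite /= (nth_map i) ?size_enum_ord ?nth_ord_enum// mxE.
Qed.

(** The newest row comes first, so that revealing one more row is a single [cons] for [PJ], [gram]
    and [Qf]. *)
Fixpoint rlist (r : nat -> 'rV[C]_n) k : seq 'rV[C]_n :=
  if k is k'.+1 then r k' :: rlist r k' else [::].

Lemma size_rlist r k : size (rlist r k) = k.
Proof. by elim: k => //= k ->. Qed.

Lemma rlistE r k : rlist r k = rev [seq r i | i <- iota 0 k].
Proof.
by elim: k => // k IH; rewrite -[in iota _ _]addn1 iotaD map_cat rev_cat -IH.
Qed.

Lemma mem_rlist r k v : reflect (exists2 i, (i < k)%N & v = r i) (v \in rlist r k).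
Proof.
rewrite rlistE mem_rev; apply: (iffP mapP) => [ [j] | [j ik ->] ].
  by rewrite mem_iota add0n => ik ->; exists j.
by exists j => //; rewrite mem_iota.
Qed.

Lemma sqn_det_rlist (A : 'M[C]_n) (r : nat -> 'rV[C]_n) :
  (forall i : 'I_n, row i A = r i) -> sqn (\det A) = gram (rlist r n).
Proof.
move=> h; rewrite sqn_det rlistE; apply: gram_perm.
rewrite perm_sym perm_rev -val_enum_ord -map_comp.
by rewrite (eq_map (g := fun i => row i A))// => i /=; rewrite h.
Qed.

End gram_determinant.

(** * Mixed Gram determinants and the expected squared volume *)

Section mixed_gram.
Variable R : realType.
Local Notation C := R[i].
Variable n : nat.
Implicit Types (u v x N : 'rV[C]_n) (s t Ns L : seq 'rV[C]_n) (Q P : 'M[C]_n).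

(* The conditional expectation of the squared volume when the rows still to be
   revealed are [N + X] with [X] centred of identity covariance. *)
Fixpoint Yf Ns s : R :=
  if Ns is N :: Ns' then \sum_a Yf Ns' (ev R a :: s) + Yf Ns' (N :: s) else gram s.

(** As a function of one further revealed row, [Yf] is a quadratic form, and this is its matrix
    ([Yf_Qf]): the expectation of a Gram determinant times a projection. *)
Fixpoint Qf Ns s : 'M[C]_n :=
  if Ns is N :: Ns' then \sum_a Qf Ns' (ev R a :: s) + Qf Ns' (N :: s)
  else (gram s)%:C *: PJ s.

Lemma Yf_perm Ns s s' : perm_eq s s' -> Yf Ns s = Yf Ns s'.
Proof.
elim: Ns s s' => [|N Ns IH] s s' h /=; first exact: gram_perm.
congr (_ + _); last by apply: IH; rewrite perm_cons.
by apply: eq_bigr => a _; apply: IH; rewrite perm_cons.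
Qed.

Lemma Yf_ge0 Ns s : 0 <= Yf Ns s.
Proof.
elim: Ns s => [|N Ns IH] s /=; first exact: gram_ge0.
by rewrite addr_ge0 ?sumr_ge0.
Qed.

Lemma perm_swap2 u v s : perm_eq (u :: v :: s) (v :: u :: s).
Proof. by rewrite -[u :: v :: s]/([:: u] ++ [:: v] ++ s) perm_catCA. Qed.

Lemma Yf_Qf Ns s v : Yf Ns (v :: s) = qf (Qf Ns s) v.
Proof.
elim: Ns s v => [|N Ns IH] s v /=; first by rewrite qfZ mulrC.
rewrite qfD qf_sum; congr (_ + _); last by rewrite -IH; exact/Yf_perm/perm_swap2.
by apply: eq_bigr => a _; rewrite -IH; exact/Yf_perm/perm_swap2.
Qed.

Lemma Yf_step N Ns s : Yf (N :: Ns) s = trR (Qf Ns s) + qf (Qf Ns s) N.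
Proof.
rewrite /= -Yf_Qf trRE; congr (_ + _).
by apply: eq_bigr => a _; rewrite Yf_Qf.
Qed.

Lemma Qf_herm Ns s : herm (Qf Ns s).
Proof.
elim: Ns s => [|N Ns IH] s /=; first by apply: hermZ; exact: PJ_herm.
apply: hermD => //; rewrite /herm adj_sum; apply: eq_bigr => a _; exact: IH.
Qed.

Lemma Qf_psd Ns s : psd (Qf Ns s).
Proof. by split; [exact: Qf_herm | move=> v; rewrite -Yf_Qf Yf_ge0]. Qed.

(** [Qf] is a nonnegative combination of projections away from [size s + size Ns] vectors at most,
    so each of them has rank at least [m]. The largest eigenvalue is thus at most the trace divided
    by [m]; this flatness drives the estimates for a single row. *)
Lemma Qf_bound Ns s v (m : nat) : (m + size s + size Ns)%N = n ->
  m%:R * qf (Qf Ns s) v <= trR (Qf Ns s) * nrm2 v.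
Proof.
elim: Ns s => [|N Ns IH] s /= hm.
  rewrite qfZ trRZ mulrCA -mulrA ler_wpM2l ?gram_ge0//.
  have h := @trR_PJ_ge _ n s; have h2 : (m%:R : R) <= trR (PJ s).
    apply: le_trans h; have := congr1 (fun k => k%:R : R) hm.
    by rewrite addn0 natrD => <-; rewrite addrK.
  by apply: ler_pM; rewrite ?ler0n ?qfPJ_ge0 ?qfPJ_le.
have hm' : (m + (size s).+1 + size Ns)%N = n by rewrite -[RHS]hm addnS addSnnS.
rewrite qfD qf_sum trRD trR_sum mulrDr mulrDl mulr_sumr mulr_suml lerD//.
  by apply: ler_sum => a _; exact: IH.
exact: IH.
Qed.

(** Sum, over the choices of [j] places in [Ns], of the Gram determinant of the chosen vectors
    joined to [s]: an analogue of the elementary symmetric polynomials. *)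
Fixpoint ej Ns j s : R :=
  if Ns is N :: Ns' then ej Ns' j s + (if j is j'.+1 then ej Ns' j' (N :: s) else 0)
  else if j is 0 then gram s else 0.

Lemma ej0 Ns s : ej Ns 0 s = gram s.
Proof. by elim: Ns s => //= N Ns IH s; rewrite IH addr0. Qed.

Lemma ej_ge0 Ns j s : 0 <= ej Ns j s.
Proof.
elim: Ns j s => [|N Ns IH] [|j] s //=; rewrite ?gram_ge0 ?addr0//.
by rewrite addr_ge0.
Qed.

Lemma ej_perm Ns j s s' : perm_eq s s' -> ej Ns j s = ej Ns j s'.
Proof.
elim: Ns j s s' => [|N Ns IH] [|j] s s' h //=; try exact: gram_perm.
  by congr (_ + _); exact: IH.
by congr (_ + _); apply: IH => //; rewrite perm_cons.
Qed.

Lemma ej_big Ns j s : (size Ns < j)%N -> ej Ns j s = 0.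
Proof.
elim: Ns j s => [|N Ns IH] [|j] s //= h.
by rewrite !IH ?addr0//; exact: ltnW.
Qed.

Lemma sum_gram_ev' s : \sum_a gram (ev R a :: s) = (n - size s)%:R * gram s :> R.
Proof.
have [g0|g0] := eqVneq (gram s) 0.
  by rewrite g0 mulr0 big1// => a _; rewrite gram_cons g0 mulr0.
by rewrite sum_gram_ev// natrB// size_gram_neq0.
Qed.

Fixpoint sumev b (f : seq 'rV[C]_n -> R) s : R :=
  if b is b'.+1 then \sum_a sumev b' f (ev R a :: s) else f s.

Lemma sumev_perm b f s s' : (forall s s', perm_eq s s' -> f s = f s') ->
  perm_eq s s' -> sumev b f s = sumev b f s'.
Proof.
move=> hf; elim: b s s' => [|b IH] s s' h /=; first exact: hf.
by apply: eq_bigr => a _; apply: IH; rewrite perm_cons.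
Qed.

Lemma sumevD b f g s : sumev b (fun s => f s + g s) s = sumev b f s + sumev b g s.
Proof.
elim: b s => //= b IH s; rewrite -big_split /=.
by apply: eq_bigr => a _.
Qed.

Lemma sumevS b f s : sumev b (fun s => \sum_a f (ev R a :: s)) s = sumev b.+1 f s.
Proof. by elim: b s => //= b IH s; apply: eq_bigr => a _; rewrite IH. Qed.

Lemma sumev_cons b f N s : (forall s s', perm_eq s s' -> f s = f s') ->
  sumev b (fun s => f (N :: s)) s = sumev b f (N :: s).
Proof.
move=> hf; elim: b s => //= b IH s; apply: eq_bigr => a _; rewrite IH.
apply: sumev_perm => //; exact: perm_swap2.
Qed.

(** [Yf] with [b] sums over the basis still to be carried out. Postponing them lets all be done at
    once by the falling factorial of [sumev_gram]. *)
Fixpoint Wf Ns s b : R :=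
  if Ns is N :: Ns' then Wf Ns' s b.+1 + Wf Ns' (N :: s) b
  else gram s * ((n - size s) ^_ b)%:R.

Lemma sumev_gram b s : sumev b (@gram R n) s = gram s * ((n - size s) ^_ b)%:R.
Proof.
elim: b s => [|b IH] s /=; first by rewrite ffactn0 mulr1.
under eq_bigr do rewrite IH /= -[(size s).+1]addn1 subnDA subn1.
rewrite -mulr_suml sum_gram_ev' ffactnS natrM; ring.
Qed.

Lemma sumev_Yf b Ns s : sumev b (Yf Ns) s = Wf Ns s b.
Proof.
elim: Ns s b => [|N Ns IH] s b; first exact: sumev_gram.
rewrite [LHS]/= sumevD sumevS IH /= sumev_cons ?IH//.
exact: Yf_perm.
Qed.

Lemma Yf_Wf Ns s : Yf Ns s = Wf Ns s 0.
Proof. by rewrite -sumev_Yf. Qed.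

(** The terms are grouped by the number [j] of pending rows replaced by their mean; each of the
    other rows is summed over the basis and contributes one factor of the falling factorial. *)
Lemma WfE Ns s b : Wf Ns s b = \sum_(j < (size Ns).+1)
  ej Ns j s * ((n - size s - j) ^_ (b + size Ns - j))%:R.
Proof.
elim: Ns s b => [|N Ns IH] s b; first by rewrite big_ord1 /= addn0 !subn0.
rewrite [LHS]/= !IH /=.
rewrite [in RHS]big_ord_recl /= [X in X + _ = _]big_ord_recl /= !addr0 -!addrA.
congr (_ + _); first by rewrite addSnnS.
rewrite [RHS](eq_bigr (fun j : 'I_(size Ns).+1 =>
   ej Ns j.+1 s * ((n - size s - j.+1) ^_ (b.+1 + size Ns - j.+1))%:R +
   ej Ns j (N :: s) * ((n - (size s).+1 - j) ^_ (b + size Ns - j))%:R)); last first.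
  move=> j _; rewrite /bump /= add1n mulrDl addSnnS; congr (_ + _ * _).
  by congr ((_ ^_ _)%:R); lia.
rewrite big_split /=; congr (_ + _).
by rewrite big_ord_recr /= (@ej_big _ (size Ns).+1)// mul0r addr0.
Qed.

Lemma Yf_ge_ej Ns j : (j <= size Ns)%N ->
  ej Ns j [::] * ((n - j) ^_ (size Ns - j))%:R <= Yf Ns [::].
Proof.
move=> h; rewrite Yf_Wf WfE (bigD1 (inord j : 'I_(size Ns).+1))//= inordK//.
by rewrite !subn0 add0n lerDl sumr_ge0// => i _; rewrite mulr_ge0 ?ej_ge0.
Qed.

Lemma ej_cons_mem L j v s : v \in s -> ej L j (v :: s) = 0.
Proof.
elim: L j s => [|N L IH] [|j] s vs; [exact: gram_mem0| by []| by rewrite ej0 gram_mem0|].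
rewrite /= IH ?add0r//.
by rewrite (ej_perm _ _ (perm_swap2 _ _ _)) IH// inE vs orbT.
Qed.

(** Each choice of [j + 1] vectors arises once for each of its members, and a repeated vector gives
    a zero Gram determinant. *)
Lemma ej_mul L j s : \sum_(v <- L) ej L j (v :: s) = j.+1%:R * ej L j.+1 s.
Proof.
elim: L j s => [|N L IH] j s; first by rewrite big_nil /= mulr0.
rewrite big_cons /= big_split /= IH.
case: j => [|j]; first by rewrite big1// !addr0 mulrDr !mul1r ej0 addrC.
have -> : ej L j [:: N, N & s] = 0 by rewrite ej_cons_mem// mem_head.
have -> : \sum_(i <- L) ej L j [:: N, i & s] = j.+1%:R * ej L j.+1 (N :: s).
  by rewrite -IH; apply: eq_bigr => v _; exact/ej_perm/perm_swap2.
by rewrite [j.+2%:R]mulrSr; ring.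
Qed.

(** By [ej_mul] the vectors can be added one at a time. The hypothesis bounds below the sum of the
    squared distances to what has been chosen, so each choice contributes one factor of the falling
    factorial. *)
Lemma ej_low L (K : nat) j s :
  (forall t, (K - size t)%:R <= \sum_(v <- L) qf (PJ t) v) ->
  gram s * ((K - size s) ^_ j)%:R <= (j`!)%:R * ej L j s.
Proof.
move=> hK; elim: j s => [|j IH] s; first by rewrite ej0 fact0 mul1r ffactn0 mulr1.
rewrite factS mulnC natrM -mulrA -ej_mul mulr_sumr.
apply: (@le_trans _ _ (\sum_(v <- L) gram (v :: s) * ((K - (size s).+1) ^_ j)%:R)); last first.
  by apply: ler_sum => v _; exact: IH.
under eq_bigr do rewrite gram_cons -mulrA.
rewrite -mulr_suml ffactnS natrM -subn1 -subnDA addn1.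
rewrite mulrCA ler_wpM2r//.
by rewrite mulr_ge0 ?gram_ge0.
Qed.

Lemma ej_contract L j s Q : (forall v, nrm2 (v *m Q) <= nrm2 v) ->
  ej [seq v *m Q | v <- L] j [seq v *m Q | v <- s] <= ej L j s.
Proof.
move=> hQ; elim: L j s => [|N L IH] [|j] s //=; rewrite ?gram_contract// ?addr0//.
by apply: lerD => //; exact: (IH j (N :: s)).
Qed.

Lemma gram_scale a v s : gram (a *: v :: s) = sqn a * gram (v :: s).
Proof. by rewrite !gram_cons qfZr mulrA. Qed.

Lemma ej_scale1 L j a v s : ej L j (a *: v :: s) = sqn a * ej L j (v :: s).
Proof.
elim: L j s => [|N L IH] [|j] s; [exact: gram_scale | by rewrite /= mulr0 |
  by rewrite !ej0 gram_scale |].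
rewrite /= mulrDr IH; congr (_ + _).
by rewrite (ej_perm _ _ (perm_swap2 _ _ _)) IH (ej_perm _ _ (perm_swap2 _ _ _)).
Qed.

Lemma ej_scale L j a s : ej [seq a *: v | v <- L] j s = sqn a ^+ j * ej L j s.
Proof.
elim: L j s => [|N L IH] [|j] s //=; rewrite ?mul1r ?mulr0 ?addr0//.
  by rewrite IH mul1r.
by rewrite !IH ej_scale1 mulrDr exprS; ring.
Qed.

Lemma ej_cons_le L j v s : ej L j (v :: s) <= nrm2 v * ej L j s.
Proof.
elim: L j s => [|N L IH] [|j] s //=; rewrite ?gram_cons_le ?mulr0 ?addr0//.
rewrite mulrDr lerD// (ej_perm _ _ (perm_swap2 _ _ _)); exact: IH.
Qed.

(** Expand the form at [u - x * v] and divide by [x]. A small [x] keeps the factor of [v] close to 1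
    at the expense of [u]. *)
Lemma qfD_le (x : R) Q u v : 0 < x -> psd Q ->
  qf Q (u + v) <= (1 + x^-1) * qf Q u + (1 + x) * qf Q v.
Proof.
move=> x0 [hQ pQ]; have := pQ (u - x%:C *: v).
rewrite qfDr// qfNr qfZr sqn_real dotNr dotZr conj_realc ReN ReZ => H.
have xi : 0 < x^-1 by rewrite invr_gt0.
have := mulr_ge0 (ltW xi) H; rewrite qfDr//.
set a := qf Q u; set b := qf Q v; set c := Re _.
have -> : x^-1 * (a + 2 * - (x * c) + x ^+ 2 * b) =
  x^-1 * a - 2 * (x^-1 * x) * c + (x^-1 * x) * x * b by ring.
rewrite mulVf ?gt_eqF//; lra.
Qed.

Lemma ej_split L j (x : R) u v s : 0 < x ->
  ej L j (u + v :: s) <= (1 + x^-1) * ej L j (u :: s) + (1 + x) * ej L j (v :: s).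
Proof.
move=> x0; elim: L j s => [|N L IH] [|j] s //=; rewrite ?mulr0 ?addr0//.
  rewrite !mulrA -mulrDl ler_wpM2r ?gram_ge0//.
  by apply: qfD_le => //; exact: PJ_psd.
rewrite !(ej_perm _ _ (perm_swap2 N _ _)).
have := lerD (IH j.+1 s) (IH j (N :: s)); lra.
Qed.

End mixed_gram.

(** * Low rank perturbations of the identity *)

Section low_rank.
Variable R : realType.
Local Notation C := R[i].
Variable n : nat.
Implicit Types (u v x N : 'rV[C]_n) (s t Ns L : seq 'rV[C]_n) (Q P : 'M[C]_n).

(** Rows are indexed by natural numbers, with the value 0 out of range, so that lists of rows can be
    built on [iota]. *)
Definition rw (A : 'M[C]_n) (i : nat) : 'rV[C]_n :=
  if insub i is Some i' then row (i' : 'I_n) A else 0.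

Lemma rw_ord (A : 'M[C]_n) (i : 'I_n) : rw A i = row i A.
Proof. by rewrite /rw valK. Qed.

Definition rspan (M : 'M[C]_n) : seq 'rV[C]_n :=
  [seq row i (row_base M) | i <- enum 'I_(\rank M)].

Lemma size_rspan M : size (rspan M) = \rank M.
Proof. by rewrite size_map size_enum_ord. Qed.

Lemma rspan_kill M Q : (forall v, v \in rspan M -> v *m Q = 0) -> M *m Q = 0.
Proof.
move=> h; have /submxP[D ->] : (M <= row_base M)%MS by rewrite eq_row_base.
rewrite -mulmxA; suff -> : row_base M *m Q = 0 by rewrite mulmx0.
apply/row_matrixP => i; rewrite row_mul row0; apply: h.
by apply: map_f; rewrite mem_enum.
Qed.

Lemma rw_rspan M i : rw M i *m PJ (rspan M) = 0.
Proof.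
have h := rspan_kill (M := M) (Q := PJ (rspan M)) (fun v => @PJ_kill _ _ _ v).
rewrite /rw; case: insubP => [j _ _|_]; last by rewrite mul0mx.
by rewrite -row_mul h row0.
Qed.

Lemma trR_rspan M : n%:R - (\rank M)%:R <= trR (PJ (rspan M)).
Proof. by rewrite -(size_rspan M); exact: trR_PJ_ge. Qed.

Lemma frob_adj (A : 'M[C]_n) :
  \sum_a nrm2 (ev R a *m A) = \sum_a nrm2 (ev R a *m adj A).
Proof.
under eq_bigr do rewrite nrm2E.
under [RHS]eq_bigr do rewrite nrm2E.
rewrite exchange_big /=; apply: eq_bigr => i _; apply: eq_bigr => j _.
by rewrite /ev -!rowE !mxE sqn_conj.
Qed.

(** The trace of [Q P Q] is that of [Q] minus that of [Q (1 - P) Q], and the latter is at most the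
    trace of [1 - P]; [frob_adj] exchanges the two projections under the norm. *)
Lemma trR_sandwich Q P : isproj Q -> isproj P ->
  trR Q + trR P - n%:R <= \sum_a qf P (ev R a *m Q).
Proof.
move=> pQ pP; have pC := isprojC pP.
have E : \sum_a qf P (ev R a *m Q) + \sum_a qf (1%:M - P) (ev R a *m Q) = trR Q.
  rewrite -big_split /= trRE; apply: eq_bigr => a _.
  by rewrite qfD qfN qf1 addrC subrK qf_proj.
have F : \sum_a qf (1%:M - P) (ev R a *m Q) <= trR (1%:M - P).
  have -> : \sum_a qf (1%:M - P) (ev R a *m Q) = \sum_a nrm2 (ev R a *m (1%:M - P) *m Q).
    transitivity (\sum_a nrm2 (ev R a *m (Q *m (1%:M - P)))).
      by apply: eq_bigr => a _; rewrite qf_proj// mulmxA.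
    rewrite frob_adj; apply: eq_bigr => a _.
    by rewrite adjM; case: pQ => -> _; case: pC => -> _; rewrite mulmxA.
  rewrite trRE; apply: ler_sum => a _.
  by rewrite -qf_proj// (le_trans (qf_proj_le _ pQ))// -qf_proj.
move: E F; rewrite trRD trRN trR1; lra.
Qed.

Lemma sum_iota_ord (f : 'rV[C]_n -> R) :
  \sum_(i <- iota 0 n) f (rw 1%:M i) = \sum_a f (ev R a).
Proof.
rewrite -val_enum_ord big_map big_enum /=; apply: eq_bigr => a _.
by rewrite rw_ord rowE mulmx1.
Qed.

Lemma nrm2_rw1 i : nrm2 (rw 1%:M i) <= 1.
Proof.
rewrite /rw; case: insubP => [j _ _|_]; last by rewrite nrm2_0 ler01.
by rewrite rowE mulmx1 nrm2_ev.
Qed.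

Lemma rw_shift M (w : C) i : rw (M - w%:M) i = rw M i - w *: rw 1%:M i.
Proof.
rewrite /rw; case: insubP => [j _ _|_]; last by rewrite scaler0 subr0.
by rewrite !rowE mulmxBr mul_mx_scalar mulmx1.
Qed.

(** The projection [Q] away from the row space of [M] kills [M] and turns the rows of [M - w] into
    [- w] times those of [Q]. Being a contraction it can only lower [ej], and [ej_low] applies with
    [K = k0 - \rank M] by the trace estimate for two projections. *)
Lemma Y_lower M (w : C) k0 j : (k0 <= n)%N -> (j <= k0)%N ->
  sqn w ^+ j * ((k0 - \rank M) ^_ j)%:R * ((n - j) ^_ (k0 - j))%:R <=
  (j`!)%:R * Yf [seq rw (M - w%:M) i | i <- iota 0 k0] [::].
Proof.
move=> k0n jk; set Ns := [seq _ | i <- _]; set Q := PJ (rspan M).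
have pQ : isproj Q := PJ_proj _.
have szN : size Ns = k0 by rewrite size_map size_iota.
pose L := [seq rw 1%:M i *m Q | i <- iota 0 k0].
have low : ((k0 - \rank M) ^_ j)%:R <= (j`!)%:R * ej L j [::].
  have := @ej_low R n L (k0 - \rank M) j [::]; rewrite subn0 mul1r; apply => t.
  have g0 : 0 <= \sum_(v <- L) qf (PJ t) v by rewrite sumr_ge0// => v _; exact: qfPJ_ge0.
  have [h|h] := leqP (k0 - \rank M) (size t).
    by move: h => /eqP ->.
  have rk : (\rank M + size t <= k0)%N by lia.
  rewrite -subnDA natrB// natrD.
  have S := trR_sandwich pQ (PJ_proj t).
  rewrite -(sum_iota_ord (fun v => qf (PJ t) (v *m Q))) in S.
  have Ei : iota 0 n = iota 0 k0 ++ iota k0 (n - k0) by rewrite -[k0 in iota k0 _]add0n -iotaD subnKC.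
  rewrite Ei big_cat /= in S.
  (* Each of the [n - k0] missing rows contributes at most 1 to the trace. *)
  have tail : \sum_(i <- iota k0 (n - k0)) qf (PJ t) (rw 1%:M i *m Q) <= (n - k0)%:R.
    apply: (@le_trans _ _ (\sum_(i <- iota k0 (n - k0)) 1)).
      apply: ler_sum => i _; apply: le_trans (qfPJ_le _ _) _.
      by rewrite -qf_proj//; apply: le_trans (qf_proj_le _ pQ) (nrm2_rw1 _).
    by rewrite big_const_seq count_predT size_iota iter_addr_0.
  have T1 := trR_rspan M; have T2 := @trR_PJ_ge R n t.
  rewrite natrB// in tail; rewrite /L big_map.
  rewrite -/Q in T1; lra.
have con : sqn w ^+ j * ej L j [::] <= ej Ns j [::].
  have := @ej_contract R n Ns j [::] Q (fun v => _); rewrite /=.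
  have -> : [seq v *m Q | v <- Ns] = [seq (- w) *: v | v <- L].
    rewrite /Ns /L -!map_comp; apply: eq_map => i /=.
    by rewrite rw_shift mulmxBl rw_rspan sub0r -scalemxAl scaleNr.
  rewrite ej_scale sqnN; apply => v.
  by rewrite -qf_proj// qf_proj_le.
have := @Yf_ge_ej R n Ns j; rewrite szN => /(_ jk) Y.
have f0 : (0 : R) <= (j`!)%:R by rewrite ler0n.
apply: le_trans (ler_wpM2l f0 Y); rewrite mulrA ler_wpM2r ?ler0n//.
apply: le_trans (_ : sqn w ^+ j * ((j`!)%:R * ej L j [::]) <= _).
  by rewrite ler_wpM2l ?exprn_ge0 ?sqn_ge0.
by rewrite mulrCA ler_wpM2l.
Qed.

Implicit Type T : seq ('rV[C]_n * 'rV[C]_n).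

(** Expansion of the rows [M + D]: [ej_split] gives a row [M] the weight [1 + t^-1 = (1 + t) / t]
    and a row [D] the weight [1 + t], and [D] is then replaced by its norm. The binomial counts the
    places of the rows [D], and the induction is Pascal's rule. *)
Lemma ej_upper T j s (t o : R) : 0 < t -> (forall p, p \in T -> nrm2 p.2 <= o) ->
  ej [seq p.1 + p.2 | p <- T] j s <= (1 + t) ^+ j *
    \sum_(a < j.+1) (t^-1) ^+ a * o ^+ (j - a) * ('C(size T - a, j - a))%:R *
      ej [seq p.1 | p <- T] a s.
Proof.
move=> t0; elim: T j s => [|[M D] T IH] j s hT.
  case: j => [|j] /=; first by rewrite big_ord1 /= subn0 !expr0 !mul1r.
  by rewrite big1 ?mulr0// => a _; case: (a : nat) => [|?]; rewrite ?bin0n /= ?mulr0 ?mul0r.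
have hT' p : p \in T -> nrm2 p.2 <= o by move=> h; apply: hT; rewrite inE h orbT.
have hD : nrm2 D <= o by apply: (hT (M, D)); rewrite mem_head.
have t1 : 0 <= 1 + t by lra.
have o0 : 0 <= o by apply: le_trans hD; exact: nrm2_ge0.
case: j => [|j].
  by rewrite !ej0 expr0 mul1r big_ord1 /= subn0 !expr0 bin0 !mul1r ej0 addr0.
set Ms := [seq p.1 | p <- T]; set Ns := [seq p.1 + p.2 | p <- T].
have H1 := IH j.+1 s hT'.
have H2 := IH j s hT'.
have H3 := IH j (M :: s) hT'.
rewrite -/Ms -/Ns in H1 H2 H3.
set m := size T in H1 H2 H3.
have step : ej Ns j (M + D :: s) <= (1 + t) * (t^-1 * ej Ns j (M :: s) + o * ej Ns j s).
  apply: le_trans (ej_split _ _ _ _ _ t0) _.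
  rewrite mulrDr lerD//.
    have -> : (1 + t) * (t^-1 * ej Ns j (M :: s)) = (t^-1 + t / t) * ej Ns j (M :: s) by ring.
    by rewrite divff ?gt_eqF// addrC.
  rewrite ler_wpM2l//; apply: le_trans (ej_cons_le _ _ _ _) _.
  by rewrite ler_wpM2r ?ej_ge0.
rewrite [X in X <= _]/= -/Ns.
apply: le_trans (lerD H1 step) _.
apply: le_trans (_ : (1 + t) ^+ j.+1 * (\sum_(a < j.+2) (t^-1) ^+ a * o ^+ (j.+1 - a) *
    ('C(m - a, j.+1 - a))%:R * ej Ms a s + (
    t^-1 * (\sum_(a < j.+1) (t^-1) ^+ a * o ^+ (j - a) * ('C(m - a, j - a))%:R * ej Ms a (M :: s)) +
    o * (\sum_(a < j.+1) (t^-1) ^+ a * o ^+ (j - a) * ('C(m - a, j - a))%:R * ej Ms a s))) <= _).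
  rewrite [leRHS]mulrDr lerD// [in leRHS]exprS -mulrA ler_wpM2l// mulrDr lerD//.
    by rewrite mulrCA ler_wpM2l// ltW// invr_gt0.
  by rewrite mulrCA ler_wpM2l.
rewrite ler_wpM2l ?exprn_ge0//.
rewrite [leRHS](_ : _ = \sum_(a < j.+2) (t^-1) ^+ a * o ^+ (j.+1 - a) *
    ('C(m.+1 - a, j.+1 - a))%:R * ej Ms a s + \sum_(a < j.+1) (t^-1) ^+ a.+1 * o ^+ (j - a) *
    ('C(m - a, j - a))%:R * ej Ms a (M :: s)); last first.
  rewrite [LHS]big_ord_recl [X in X + _ = _]/= addr0 [in RHS]big_ord_recl -addrA; congr (_ + _).
  rewrite -big_split /=; apply: eq_bigr => a _.
  by rewrite /bump /= !add1n !subSS mulrDr.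
have -> : \sum_(a < j.+1) (t^-1) ^+ a.+1 * o ^+ (j - a) * ('C(m - a, j - a))%:R * ej Ms a (M :: s)
  = t^-1 * \sum_(a < j.+1) (t^-1) ^+ a * o ^+ (j - a) * ('C(m - a, j - a))%:R * ej Ms a (M :: s).
  by rewrite mulr_sumr; apply: eq_bigr => a _; rewrite exprS; ring.
rewrite addrCA addrC lerD2r.
rewrite [leLHS]addrC [X in _ + X]big_ord_recr /= [leRHS]big_ord_recr /= !subnn !bin0.
rewrite addrA lerD2r addrC mulr_sumr -big_split /=; apply: ler_sum => a _.
have aj : (a <= j)%N by rewrite -ltnS.
have [am|am] := leqP a m; last by rewrite (@ej_big _ _ Ms a) ?size_map// !mulr0 addr0.
rewrite (subSn aj) (subSn am) binS natrD exprS le_eqVlt; apply/orP; left; apply/eqP.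
ring.
Qed.

Lemma ej_le_sum L a s : (a`!)%:R * ej L a s <= (\sum_(v <- L) nrm2 v) ^+ a * gram s.
Proof.
elim: a s => [|a IH] s; first by rewrite fact0 ej0 expr0.
rewrite factS mulnC natrM -mulrA -ej_mul mulr_sumr.
apply: (@le_trans _ _ (\sum_(v <- L) (\sum_(v <- L) nrm2 v) ^+ a * (nrm2 v * gram s))).
  apply: ler_sum => v _; apply: le_trans (IH _) _; rewrite ler_wpM2l ?gram_cons_le//.
  by rewrite exprn_ge0// sumr_ge0// => u _; exact: nrm2_ge0.
by rewrite -mulr_sumr -mulr_suml exprSr mulrA.
Qed.

(** Otherwise [PJ s] would have rank [n - size s], less than the rank of [PJ (rspan M)], although
    [PJ s] fixes everything orthogonal to the row space of [M]. *)
Lemma gram_rank M s : (\rank M < size s)%N -> (forall v, v \in s -> exists i, v = rw M i) ->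
  gram s = 0.
Proof.
move=> hs hv; apply/eqP/negP => /negP g0; have := trR_PJ_eq g0.
have H : trR (PJ (rspan M)) <= trR (PJ s).
  have E : PJ (rspan M) *m PJ s = PJ (rspan M).
    apply/row_matrixP => i; rewrite row_mul; apply: PJ_fix => v /hv[k ->].
    rewrite rowE dotPJ rw_rspan; exact: dot0l.
  have E2 : PJ s *m PJ (rspan M) = PJ (rspan M).
    by rewrite -[in LHS](PJ_herm s) -[in LHS](PJ_herm (rspan M)) -adjM E PJ_herm.
  rewrite !trRE; apply: ler_sum => a _.
  rewrite (qf_proj _ (PJ_proj (rspan M))) -E2 mulmxA -(qf_proj _ (PJ_proj (rspan M))).
  by apply: le_trans (qfPJ_le _ _) _; rewrite -(qf_proj _ (PJ_proj s)).
move=> E; have := trR_rspan M; have : ((\rank M)%:R : R) < (size s)%:R by rewrite ltr_nat.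
by move: H; rewrite E; lra.
Qed.

Lemma ej_rank M L a s : (forall v, v \in L -> exists i, v = rw M i) ->
  (forall v, v \in s -> exists i, v = rw M i) -> (\rank M < a + size s)%N -> ej L a s = 0.
Proof.
elim: L a s => [|N L IH] [|a] s hL hs h //=; try exact: gram_rank hs.
  rewrite addr0 IH// => v vL; apply: hL; by rewrite inE vL orbT.
have hL' v : v \in L -> exists i, v = rw M i by move=> vL; apply: hL; rewrite inE vL orbT.
rewrite !IH ?addr0//; last by rewrite addnS.
by move=> v; rewrite inE => /orP[/eqP ->|/hs//]; apply: hL; rewrite mem_head.
Qed.

Lemma exp_partial (x : R) m : 0 <= x -> \sum_(i < m) x ^+ i / (i`!)%:R <= expR x.
Proof.
move=> x0; have -> : \sum_(i < m) x ^+ i / (i`!)%:R = series (exp_coeff x) m.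
  rewrite seriesEord; apply: eq_bigr => i _; by rewrite exp_coeffE mulrC.
rewrite /expR; apply: nondecreasing_cvgn_le; last exact: is_cvg_series_exp_coeff.
by apply: nondecreasing_series => i _ _; rewrite exp_coeffE mulr_ge0 ?exprn_ge0.
Qed.

(** Only choices of at most [\rank M] rows of [M] have a nonzero volume. For a fixed number [a] of
    them, the sum over the number [j - a] of shift rows is a partial exponential series, because
    [C(n-a, j-a) (n-j)! = (n-a)! / (j-a)!]. *)
Lemma Y_upper M (w : C) (t : R) : 0 < t ->
  Yf [seq rw (M - w%:M) i | i <- iota 0 n] [::] <=
  (1 + t) ^+ n * expR (sqn w) * \sum_(a < n.+1 | (a <= \rank M)%N)
    (t^-1 * \sum_(i < n) nrm2 (row i M)) ^+ a / (a`!)%:R * ((n - a)`!)%:R.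
Proof.
move=> t0; set o := sqn w; have o0 : 0 <= o := sqn_ge0 _.
pose T := [seq (rw M i, - (w *: rw 1%:M i)) | i <- iota 0 n].
have -> : [seq rw (M - w%:M) i | i <- iota 0 n] = [seq p.1 + p.2 | p <- T].
  by rewrite -map_comp; apply: eq_map => i /=; rewrite rw_shift.
have hT p : p \in T -> nrm2 p.2 <= o.
  by move=> /mapP[i _ ->] /=; rewrite nrm2N nrm2Z ler_piMr// nrm2_rw1.
have sT : size T = n by rewrite size_map size_iota.
set Ms := [seq p.1 | p <- T].
have hM v : v \in Ms -> exists i, v = rw M i.
  by rewrite /Ms -map_comp => /mapP[i _ ->]; exists i.
have SM : \sum_(v <- Ms) nrm2 v = \sum_(i < n) nrm2 (row i M).
  rewrite /Ms /T -map_comp big_map -val_enum_ord big_map big_enum /=.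
  by apply: eq_bigr => i _; rewrite rw_ord.
rewrite Yf_Wf WfE size_map sT /= subn0 add0n.
have t1 : 0 < t^-1 by rewrite invr_gt0.
apply: (@le_trans _ _ ((1 + t) ^+ n * \sum_(j < n.+1) \sum_(a < n.+1 | (a <= j)%N)
   (t^-1) ^+ a * o ^+ (j - a) * ('C(n - a, j - a))%:R * ej Ms a [::] * ((n - j)`!)%:R)).
  rewrite mulr_sumr; apply: ler_sum => j _; rewrite ffactnn.
  apply: (@le_trans _ _ ((1 + t) ^+ j * (\sum_(a < n.+1 | (a <= j)%N)
   (t^-1) ^+ a * o ^+ (j - a) * ('C(n - a, j - a))%:R * ej Ms a [::]) * ((n - j)`!)%:R)).
    rewrite ler_wpM2r// (le_trans (ej_upper _ _ t0 hT))// sT.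
    rewrite -(big_mkord (fun a => a <= j)%N (fun a => t^-1 ^+ a * o ^+ (j - a) * 'C(n - a, j - a)%:R * ej Ms a [::])).
    rewrite -(big_mkord xpredT (fun a => t^-1 ^+ a * o ^+ (j - a) * 'C(n - a, j - a)%:R * ej Ms a [::])).
    by rewrite (big_nat_widen _ _ n.+1).
  rewrite -mulrA mulr_suml ler_wpM2r//.
    by rewrite sumr_ge0// => a _; rewrite !mulr_ge0 ?exprn_ge0 ?ej_ge0// ltW.
  by rewrite ler_weXn2l//; [lra | rewrite -ltnS].
have p1 : 0 <= (1 + t) ^+ n by rewrite exprn_ge0// addr_ge0// ltW.
rewrite -mulrA; apply: ler_wpM2l => //.
rewrite (exchange_big_dep xpredT)//= mulr_sumr.
rewrite [leRHS]big_mkcond /=.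
apply: ler_sum => a _.
have an : (a <= n)%N by rewrite -ltnS.
have [ar|ar] := leqP a (\rank M); last first.
  rewrite big1// => j _; rewrite (@ej_rank M Ms a [::])//; last by rewrite addn0.
  by rewrite mulr0 mul0r.
have F : (0 : R) < (a`!)%:R by rewrite ltr0n fact_gt0.
have E : ej Ms a [::] <= (\sum_(i < n) nrm2 (row i M)) ^+ a / (a`!)%:R.
  by rewrite ler_pdivlMr// mulrC; have := ej_le_sum Ms a [::]; rewrite SM mulr1.
apply: (@le_trans _ _ ((t^-1) ^+ a * ej Ms a [::] * ((n - a)`!)%:R * expR o)); last first.
  rewrite exprMn mulrC ler_wpM2l ?expR_ge0// ler_wpM2r// -mulrA ler_wpM2l//.
  by rewrite exprn_ge0// ltW.
apply: (@le_trans _ _ ((t^-1) ^+ a * ej Ms a [::] * ((n - a)`!)%:R *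
   \sum_(i < (n - a).+1) o ^+ i / (i`!)%:R)); last first.
  rewrite ler_wpM2l ?exp_partial//; by rewrite !mulr_ge0 ?exprn_ge0 ?ej_ge0// ltW.
rewrite -(big_mkord xpredT (fun i => o ^+ i / (i`!)%:R)).
rewrite -(big_mkord (fun j => a <= j)%N (fun j => t^-1 ^+ a * o ^+ (j - a) * 'C(n - a, j - a)%:R * ej Ms a [::] * ((n - j)`!)%:R)).
rewrite -(big_nat_widenl a 0 n.+1 xpredT _ (leq0n a)).
rewrite -[X in index_iota X _]add0n big_addn subSn// mulr_sumr le_eqVlt; apply/orP; left; apply/eqP.
apply: eq_big_nat => i /andP[_ ii]; rewrite addnK.
have -> : ((n - (i + a))`!)%:R = ((n - a - i)`!)%:R :> R by rewrite addnC subnDA.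
have := @bin_fact (n - a) i; rewrite -ltnS ii => /(_ isT) <-.
have i0 : (i`!)%:R != 0 :> R by rewrite pnatr_eq0 -lt0n fact_gt0.
rewrite !natrM; field; by rewrite pnatr_eq0 -lt0n fact_gt0.
Qed.

End low_rank.

(** * Independence and decoupling *)

Section decoupling.
Context d (T : measurableType d) (R : realType) (P : probability T R).
Context d' (T' : measurableType d') (I : eqType) (X : I -> {RV P >-> T'}).
Hypothesis Xind : mutually_independent X.
Implicit Types (J K : set I).

Definition cylinders J : set (set T) :=
  [set A | exists s : seq I, exists B : I -> set T',
    [/\ (forall i, i \in s -> J i), uniq s, forall i, measurable (B i)
      & A = \big[setI/setT]_(i <- s) (X i @^-1` B i)]].

(** The sample space with the information of the coordinates in [J] only: measurability for this
    structure stands for being a function of these coordinates. *)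
Definition sigma_of J := g_sigma_algebraType (cylinders J).

Lemma big_setIP (J : Type) (U : Type) (s : seq J) (F : J -> set U) (t : U) :
  (\big[setI/setT]_(i <- s) F i) t <-> foldr (fun i Q => F i t /\ Q) True s.
Proof.
elim: s => [|a s IH]; first by rewrite big_nil.
by rewrite big_cons /= -IH.
Qed.

Lemma foldrP (s : seq I) (Q : I -> Prop) :
  foldr (fun i S => Q i /\ S) True s <-> (forall i, i \in s -> Q i).
Proof.
elim: s => [|a s IH] /=; first by split.
rewrite IH; split=> [[Qa H] i|H].
  by rewrite inE => /orP[/eqP ->|/H].
by split=> [|i si]; apply: H; rewrite inE ?eqxx ?si ?orbT.
Qed.

Lemma cylinders_setI J : setI_closed (cylinders J).
Proof.
move=> _ _ [s1 [B1 [h1 u1 m1 ->]]] [s2 [B2 [h2 u2 m2 ->]]].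
exists (undup (s1 ++ s2)).
exists (fun i => (if i \in s1 then B1 i else setT) `&` (if i \in s2 then B2 i else setT)).
split; [|exact: undup_uniq| |].
- by move=> i; rewrite mem_undup mem_cat => /orP[/h1|/h2].
- by move=> i; apply: measurableI; case: ifP.
apply/seteqP; split=> t.
  move=> [/big_setIP/foldrP H1 /big_setIP/foldrP H2]; apply/big_setIP/foldrP => i _.
  by split; case: ifPn => // si; [exact: H1|exact: H2].
move=> /big_setIP/foldrP H; split; apply/big_setIP/foldrP => i si.
  by move: (H i); rewrite mem_undup mem_cat si => /(_ isT)[].
by move: (H i); rewrite mem_undup mem_cat si orbT => /(_ isT)[].
Qed.

Lemma cylinders_measurable J A : cylinders J A -> measurable A.
Proof.
move=> [s [B [_ _ mB ->]]]; elim/big_ind: _ => // [U V mU mV|i _].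
  exact: measurableI.
by rewrite -[X in measurable X]setTI; exact: measurable_funPT.
Qed.

Lemma cylinders_setT J : cylinders J setT.
Proof. by exists [::], (fun=> setT); split => //; rewrite big_nil. Qed.

Lemma sigma_of_measurable J (A : set T) :
  measurable (A : set (sigma_of J)) -> measurable A.
Proof.
move: A; apply: smallest_sub; first exact: sigma_algebra_measurable.
exact: cylinders_measurable.
Qed.

Lemma cylinders_indep J K A B : J `&` K = set0 -> cylinders J A -> cylinders K B ->
  P (A `&` B) = (P A * P B)%E.
Proof.
move=> JK [s1 [B1 [h1 u1 m1 ->]]] [s2 [B2 [h2 u2 m2 ->]]].
pose D i := if i \in s1 then B1 i else B2 i.
have n21 i : i \in s2 -> (i \in s1) = false.
  move=> i2; apply/negP => i1; have : (J `&` K) i by split; [exact: h1|exact: h2].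
  by rewrite JK.
have E1 : \big[setI/setT]_(i <- s1) (X i @^-1` B1 i) =
          \big[setI/setT]_(i <- s1) (X i @^-1` D i).
  by apply: eq_big_seq => i is1; rewrite /D is1.
have E2 : \big[setI/setT]_(i <- s2) (X i @^-1` B2 i) =
          \big[setI/setT]_(i <- s2) (X i @^-1` D i).
  by apply: eq_big_seq => i is2; rewrite /D n21.
have mD i : measurable (D i) by rewrite /D; case: ifP.
have u12 : uniq (s1 ++ s2).
  rewrite cat_uniq u1 u2 andbT /=; apply/hasPn => i /n21 /= ->; by [].
rewrite E1 E2 -big_cat (Xind u12 mD) big_cat /=.
by rewrite (Xind u1 mD) (Xind u2 mD).
Qed.

(** Cylinders are stable under intersection, so the product rule passes to the generated
    sigma-algebra, first in one event and then in the other, by uniqueness of measures applied to a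
    restriction of [P] and a multiple of [P]. *)
Lemma sigma_indep J K (A B : set T) : J `&` K = set0 ->
  measurable (A : set (sigma_of J)) -> measurable (B : set (sigma_of K)) ->
  P (A `&` B) = (P A * P B)%E.
Proof.
move=> JK; have step (C : set T) (mC : measurable C) (L : set I) :
    (forall A0, cylinders L A0 -> P (A0 `&` C) = (P A0 * P C)%E) ->
    forall A0, measurable (A0 : set (sigma_of L)) -> P (A0 `&` C) = (P A0 * P C)%E.
  move=> h A0 mA0.
  have c0 : (0 <= fine (P C))%R by rewrite fine_ge0.
  have Em A2 : mscale (NngNum c0) P A2 = (P A2 * P C)%E.
    by rewrite /mscale /= muleC fineK// fin_num_measure.
  transitivity (mscale (NngNum c0) P A0); last exact: Em.
  apply: (@g_sigma_algebra_measure_unique _ R T (cylinders L) (@cylinders_measurable L)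
    (fun=> setT) (fun=> cylinders_setT L) _ (mrestr P mC) (mscale (NngNum c0) P)
    (@cylinders_setI L) _ _ A0 mA0).
  - by apply/seteqP; split => // t _; exists 0%N.
  - move=> A1 /h E; transitivity (P (A1 `&` C)) => //.
    by rewrite E; exact/esym/Em.
  - move=> _; apply: (@le_lt_trans _ _ 1%E); last exact: ltry.
    change (P (setT `&` C) <= 1)%E; rewrite setTI.
    exact: probability_le1.
move=> mA mB; have mB' := sigma_of_measurable mB.
apply: (step _ mB' J) => // A0 cA0; rewrite setIC muleC.
apply: (step _ (cylinders_measurable cA0) K) => // B0 cB0.
by rewrite setIC muleC; exact: cylinders_indep cA0 cB0.
Qed.

Definition to_sigma J : T -> sigma_of J := id.

Lemma measurable_to_sigma J : measurable_fun setT (to_sigma J).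
Proof. by move=> _ A mA; rewrite setTI; exact: sigma_of_measurable mA. Qed.
HB.instance Definition _ J := isMeasurableFun.Build _ _ _ _ (to_sigma J)
  (@measurable_to_sigma J).

Lemma measurable_coord J i : J i -> measurable_fun setT (X i : sigma_of J -> T').
Proof.
move=> Ji _ B mB; rewrite setTI; apply: sub_sigma_algebra.
exists [:: i], (fun=> B); split => //; last by rewrite big_seq1.
by move=> k; rewrite inE => /eqP ->.
Qed.

Definition diag_sigma J K : T -> sigma_of J * sigma_of K := fun w => (w, w).

Lemma measurable_diag_sigma J K : measurable_fun setT (@diag_sigma J K).
Proof.
by apply/measurable_fun_pairP; split; exact: measurable_to_sigma.
Qed.
HB.instance Definition _ J K := isMeasurableFun.Build _ _ _ _ (@diag_sigma J K)
  (@measurable_diag_sigma J K).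

(** By independence the pair [(w, w)], seen in [sigma_of J * sigma_of K], has the product law, and
    Tonelli gives the iterated integral. This does the work of conditional expectation: the inner
    variable is the part still to be revealed. *)
Lemma decouple J K (H : T * T -> \bar R) : J `&` K = set0 ->
  (forall z, 0 <= H z)%E ->
  measurable_fun setT (H : sigma_of J * sigma_of K -> \bar R) ->
  (\int[P]_w H (w, w) = \int[P]_w \int[P]_v H (w, v))%E.
Proof.
move=> JK H0 mH; pose Q1 := distribution P (to_sigma J).
pose Q2 := distribution P (to_sigma K); pose Q := distribution P (@diag_sigma J K).
have E : forall A, measurable A -> (Q1 \x Q2)%E A = Q A.
  move=> A mA; apply: (@product_measure_unique _ _ _ _ R Q1 Q2 Q) => // B C mB mC.
  exact: (sigma_indep JK mB mC).
have := @ge0_integral_distribution _ _ _ _ _ P (@diag_sigma J K) H mH H0.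
rewrite [RHS](_ : _ = \int[P]_w H (w, w))%E// => <-.
transitivity (\int[(Q1 \x Q2)%E]_z H z)%E.
  by apply: eq_measure_integral => A mA _; first [exact: E | exact/esym/E].
rewrite fubini_tonelli1//.
match goal with |- (integral _ _ ?F0 = _) => set F := F0 end.
have mF : measurable_fun setT F by apply: measurable_fun_fubini_tonelli_F.
have F0 z : (0 <= F z)%E by apply: integral_ge0.
rewrite (@ge0_integral_distribution _ _ _ _ _ P (to_sigma J) _ mF F0).
apply: eq_integral => w _; rewrite /= /F /fubini_F.
have mHw : measurable_fun setT (fun y : sigma_of K => H (w, y)).
  exact: (measurableT_comp mH (pair1_measurable _)).
by rewrite (@ge0_integral_distribution _ _ _ _ _ P (to_sigma K) _ mHw).
Qed.

Lemma decouple_le J K (A : set (T * T)) (q : \bar R) : J `&` K = set0 ->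
  measurable (A : set (sigma_of J * sigma_of K)) -> (0 <= q)%E ->
  (forall w, P [set v | A (w, v)] <= q)%E -> (P [set w | A (w, w)] <= q)%E.
Proof.
move=> JK mA q0 h.
have mI : measurable_fun setT
  ((fun z => (\1_A z)%:E) : sigma_of J * sigma_of K -> \bar R).
  by apply/measurable_EFinP; exact: measurable_indic.
have := @decouple J K (fun z => (\1_A z)%:E) JK (fun z => _) mI.
have mD : measurable [set w | A (w, w)].
  have := @measurable_diag_sigma J K measurableT A mA; rewrite setTI.
  by [].
have -> : (\int[P]_w (\1_A (w, w))%:E)%E = P [set w | A (w, w)].
  transitivity (\int[P]_w (\1_[set w | A (w, w)] w)%:E)%E.
    by apply: eq_integral => w _; rewrite !indicE; congr ((nat_of_bool _)%:R%:E);
      apply/idP/idP => /set_mem h'; exact/mem_set.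
  by rewrite integral_indic// setIT.
move=> ->; last by move=> z; rewrite lee_fin.
have mS w : measurable [set v | A (w, v)].
  apply: (@sigma_of_measurable K).
  have := @pair1_measurable _ _ (sigma_of J) (sigma_of K) w.
  by move=> /(_ measurableT A mA); rewrite setTI.
have F w : (\int[P]_v (\1_A (w, v))%:E)%E = P [set v | A (w, v)].
  transitivity (\int[P]_v (\1_[set v | A (w, v)] v)%:E)%E.
    by apply: eq_integral => v _; rewrite !indicE; congr ((nat_of_bool _)%:R%:E);
      apply/idP/idP => /set_mem h'; exact/mem_set.
  by rewrite integral_indic// setIT.
under eq_integral do rewrite F.
apply: (@le_trans _ _ (\int[P]_w (cst q w))%E); last first.
  by rewrite (integral_cst P measurableT q) -[X in (_ * X)%E]/(P setT) probability_setT mule1.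
apply: ge0_le_integral => //.
- have := measurable_fun_xsection (distribution P (to_sigma K)) mA.
  move=> /(_ _) h2.
  have : measurable_fun setT (fun w : sigma_of J => P [set v | A (w, v)]).
    apply: eq_measurable_fun h2 => w _ /=.
    by rewrite /distribution /pushforward /= /xsection; congr (P _); apply/seteqP; split=> v /=; rewrite inE.
  move=> h3 _ Y mY; rewrite setTI; apply: (@sigma_of_measurable J).
  by have := h3 measurableT Y mY; rewrite setTI.
Qed.

End decoupling.

(** * Measurability of complex vectors, matrices and Gram data *)

Section complex_measurability.
Context d (D : measurableType d) (R : realType).
Local Notation C := R[i].

(** Componentwise measurability reduces complex arithmetic to real functions; [cmeas_rv] provides it
    for Borel maps. *)
Definition cmeas (f : D -> C) :=
  measurable_fun setT (fun z => Re (f z)) /\ measurable_fun setT (fun z => Im (f z)).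

Lemma eq_meas d2 (E : measurableType d2) (f g : D -> E) : (forall z, g z = f z) ->
  measurable_fun setT f -> measurable_fun setT g.
Proof. by move=> h; have -> : g = f by apply/funext. Qed.

Lemma eq_cmeas (f g : D -> C) : (forall z, g z = f z) -> cmeas f -> cmeas g.
Proof. by move=> h; have -> : g = f by apply/funext. Qed.

Lemma cmeas_cst a : cmeas (fun=> a).
Proof. by split; exact: measurable_cst. Qed.

Lemma cmeasD f g : cmeas f -> cmeas g -> cmeas (fun z => f z + g z).
Proof.
move=> [f1 f2] [g1 g2]; split.
  by apply: (eq_meas (f := fun z => Re (f z) + Re (g z))) => [z|];
    [rewrite ReD | exact: measurable_funD].
by apply: (eq_meas (f := fun z => Im (f z) + Im (g z))) => [z|];
  [rewrite ImD | exact: measurable_funD].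
Qed.

Lemma cmeasN f : cmeas f -> cmeas (fun z => - f z).
Proof.
move=> [f1 f2]; split.
  by apply: (eq_meas (f := fun z => - Re (f z))) => [z|]; [rewrite ReN|exact: measurable_funN].
by apply: (eq_meas (f := fun z => - Im (f z))) => [z|]; [rewrite ImN|exact: measurable_funN].
Qed.

Lemma cmeasB f g : cmeas f -> cmeas g -> cmeas (fun z => f z - g z).
Proof. by move=> f1 /cmeasN; exact: cmeasD. Qed.

Lemma ReM (z w : C) : Re (z * w) = Re z * Re w - Im z * Im w.
Proof. by case: z; case: w. Qed.
Lemma ImM (z w : C) : Im (z * w) = Re z * Im w + Im z * Re w.
Proof. by case: z => a b; case: w => a' b' /=; ring. Qed.

Lemma cmeasM f g : cmeas f -> cmeas g -> cmeas (fun z => f z * g z).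
Proof.
move=> [f1 f2] [g1 g2]; split.
  apply: (eq_meas (f := fun z => Re (f z) * Re (g z) - Im (f z) * Im (g z))) => [z|].
    by rewrite ReM.
  by apply: measurable_funB; exact: measurable_funM.
apply: (eq_meas (f := fun z => Re (f z) * Im (g z) + Im (f z) * Re (g z))) => [z|].
  by rewrite ImM.
by apply: measurable_funD; exact: measurable_funM.
Qed.

Lemma cmeas_conj f : cmeas f -> cmeas (fun z => (f z)^*%R).
Proof.
move=> [f1 f2]; split.
  by apply: (eq_meas (f := fun z => Re (f z))) => [z|]; [rewrite ReconjE|].
by apply: (eq_meas (f := fun z => - Im (f z))) => [z|]; [rewrite ImconjE|exact: measurable_funN].
Qed.

Lemma cmeas_real (f : D -> R) : measurable_fun setT f -> cmeas (fun z => (f z)%:C).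
Proof. by move=> mf; split => //=; exact: measurable_cst. Qed.

Lemma cmeas_sum (I : Type) (s : seq I) (Q : pred I) (f : I -> D -> C) :
  (forall i, cmeas (f i)) -> cmeas (fun z => \sum_(i <- s | Q i) f i z).
Proof.
move=> mf; elim: s => [|a s IH].
  by apply: (eq_cmeas (f := fun=> 0)) => [z|]; [rewrite big_nil|exact: cmeas_cst].
case Qa: (Q a).
  apply: (eq_cmeas (f := fun z => f a z + \sum_(i <- s | Q i) f i z)) => [z|].
    by rewrite big_cons Qa.
  exact: cmeasD.
by apply: (eq_cmeas (f := fun z => \sum_(i <- s | Q i) f i z)) => [z|//]; rewrite big_cons Qa.
Qed.

Lemma cmeas_prod (I : Type) (s : seq I) (Q : pred I) (f : I -> D -> C) :
  (forall i, cmeas (f i)) -> cmeas (fun z => \prod_(i <- s | Q i) f i z).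
Proof.
move=> mf; elim: s => [|a s IH].
  by apply: (eq_cmeas (f := fun=> 1)) => [z|]; [rewrite big_nil|exact: cmeas_cst].
case Qa: (Q a).
  apply: (eq_cmeas (f := fun z => f a z * \prod_(i <- s | Q i) f i z)) => [z|].
    by rewrite big_cons Qa.
  exact: cmeasM.
by apply: (eq_cmeas (f := fun z => \prod_(i <- s | Q i) f i z)) => [z|//]; rewrite big_cons Qa.
Qed.

Lemma meas_sqn f : cmeas f -> measurable_fun setT (fun z => sqn (f z)).
Proof. by move=> [f1 f2]; apply: measurable_funD; exact: measurable_funX. Qed.

Definition mxmeas m n (A : D -> 'M[C]_(m, n)) := forall i j, cmeas (fun z => A z i j).

Lemma mxmeas_cst m n (A : 'M[C]_(m, n)) : mxmeas (fun=> A).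
Proof. by move=> i j; exact: cmeas_cst. Qed.
Lemma mxmeasD m n (A B : D -> 'M[C]_(m, n)) :
  mxmeas A -> mxmeas B -> mxmeas (fun z => A z + B z).
Proof.
move=> mA mB i j; apply: (eq_cmeas (f := fun z => A z i j + B z i j)) => [z|].
  by rewrite mxE.
exact: cmeasD.
Qed.
Lemma mxmeasN m n (A : D -> 'M[C]_(m, n)) : mxmeas A -> mxmeas (fun z => - A z).
Proof.
move=> mA i j; apply: (eq_cmeas (f := fun z => - A z i j)) => [z|].
  by rewrite mxE.
exact: cmeasN.
Qed.
Lemma mxmeasB m n (A B : D -> 'M[C]_(m, n)) :
  mxmeas A -> mxmeas B -> mxmeas (fun z => A z - B z).
Proof. by move=> mA /mxmeasN; exact: mxmeasD. Qed.
Lemma mxmeasZ m n (a : D -> C) (A : D -> 'M[C]_(m, n)) :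
  cmeas a -> mxmeas A -> mxmeas (fun z => a z *: A z).
Proof.
move=> ma mA i j; apply: (eq_cmeas (f := fun z => a z * A z i j)) => [z|].
  by rewrite mxE.
exact: cmeasM.
Qed.
Lemma mxmeasM m n p (A : D -> 'M[C]_(m, n)) (B : D -> 'M[C]_(n, p)) :
  mxmeas A -> mxmeas B -> mxmeas (fun z => A z *m B z).
Proof.
move=> mA mB i j; apply: (eq_cmeas (f := fun z => \sum_k A z i k * B z k j)) => [z|].
  by rewrite mxE.
by apply: cmeas_sum => k; exact: cmeasM.
Qed.
Lemma mxmeas_adj m n (A : D -> 'M[C]_(m, n)) : mxmeas A -> mxmeas (fun z => adj (A z)).
Proof.
move=> mA i j; apply: (eq_cmeas (f := fun z => (A z j i)^*%R)) => [z|].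
  by rewrite adjE.
exact: cmeas_conj.
Qed.
Lemma mxmeas_sum (I : Type) (s : seq I) m n (A : I -> D -> 'M[C]_(m, n)) :
  (forall i, mxmeas (A i)) -> mxmeas (fun z => \sum_(i <- s) A i z).
Proof.
move=> mA i j; apply: (eq_cmeas (f := fun z => \sum_(k <- s) A k z i j)) => [z|].
  by rewrite summxE.
by apply: cmeas_sum => k; exact: mA.
Qed.

Lemma cmeas_det n (A : D -> 'M[C]_n) : mxmeas A -> cmeas (fun z => \det (A z)).
Proof.
move=> mA; apply: cmeas_sum => s; apply: cmeasM; first exact: cmeas_cst.
by apply: cmeas_prod => i.
Qed.

Lemma meas_qf n (Q : D -> 'M[C]_n) (v : D -> 'rV[C]_n) : mxmeas Q -> mxmeas v ->
  measurable_fun setT (fun z => qf (Q z) (v z)).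
Proof.
move=> mQ mv; have [] : cmeas (fun z => (v z *m Q z *m adj (v z)) 0 0) => //.
by apply: mxmeasM; [exact: mxmeasM|exact: mxmeas_adj].
Qed.

Lemma meas_trR n (Q : D -> 'M[C]_n) : mxmeas Q -> measurable_fun setT (fun z => trR (Q z)).
Proof. by move=> mQ; have [] : cmeas (fun z => \sum_i Q z i i) by apply: cmeas_sum. Qed.

Lemma meas_invr (f : D -> R) : (forall z, 0 <= f z) -> measurable_fun setT f ->
  measurable_fun setT (fun z => (f z)^-1).
Proof.
(* On nonnegative reals the inverse is the power with exponent -1, also at 0. *)
move=> f0 mf; apply: (eq_meas (f := fun z => powR (f z) (- 1))) => [z|].
  by rewrite powR_inv1.
by apply: (measurableT_comp (f := fun x : R => powR x (- 1))) => //; exact: measurable_powR.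
Qed.

Lemma mxmeas_PJ n (s : seq (D -> 'rV[C]_n)) : (forall v, List.In v s -> mxmeas v) ->
  mxmeas (fun z => PJ [seq v z | v <- s]).
Proof.
elim: s => [|v s IH] ms; first exact: mxmeas_cst.
have mP : mxmeas (fun z => PJ [seq v z | v <- s]) by apply: IH => u us; apply: ms; right.
have mv : mxmeas v by apply: ms; left.
apply: mxmeasB => //; apply: mxmeasZ.
  apply: cmeas_real; apply: meas_invr; first by move=> z; exact: qfPJ_ge0.
  exact: meas_qf.
by apply: mxmeasM; [apply: mxmeas_adj|]; exact: mxmeasM.
Qed.

Lemma meas_gram n (s : seq (D -> 'rV[C]_n)) : (forall v, List.In v s -> mxmeas v) ->
  measurable_fun setT (fun z => gram [seq v z | v <- s]).
Proof.
elim: s => [|v s IH] ms; first exact: measurable_cst.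
apply: measurable_funM.
  apply: meas_qf; last by apply: ms; left.
  by apply: mxmeas_PJ => u us; apply: ms; right.
by apply: IH => u us; apply: ms; right.
Qed.

Lemma mxmeas_PJ_rlist n (r : nat -> D -> 'rV[C]_n) k : (forall i, (i < k)%N -> mxmeas (r i)) ->
  mxmeas (fun z => PJ (rlist (r ^~ z) k)).
Proof.
elim: k => [|k IH] mr; first exact: mxmeas_cst.
have mP := IH (fun i h => mr i (ltnW h)); have mv := mr k (leqnn _).
apply: mxmeasB => //; apply: mxmeasZ.
  apply: cmeas_real; apply: meas_invr; first by move=> z; exact: qfPJ_ge0.
  exact: meas_qf.
by apply: mxmeasM; [apply: mxmeas_adj|]; exact: mxmeasM.
Qed.

Lemma meas_gram_rlist n (r : nat -> D -> 'rV[C]_n) k : (forall i, (i < k)%N -> mxmeas (r i)) ->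
  measurable_fun setT (fun z => gram (rlist (r ^~ z) k)).
Proof.
elim: k => [|k IH] mr; first exact: measurable_cst.
apply: measurable_funM; last by apply: IH => i h; apply: mr; exact: ltnW.
by apply: meas_qf; [apply: mxmeas_PJ_rlist => i h; apply: mr; exact: ltnW | exact: mr].
Qed.

Lemma meas_sum (I : Type) (s : seq I) (f : I -> D -> R) :
  (forall i, measurable_fun setT (f i)) -> measurable_fun setT (fun z => \sum_(i <- s) f i z).
Proof.
move=> mf; elim: s => [|a s IH].
  by apply: (eq_meas (f := fun=> 0 : R)) => [z|]; [rewrite big_nil|exact: measurable_cst].
apply: (eq_meas (f := fun z => f a z + \sum_(i <- s) f i z)) => [z|].
  by rewrite big_cons.
exact: measurable_funD.
Qed.

(** Unfolding the recursion leaves a finite list of prefixes that does not depend on [s], so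
    measurability of [Qf] reduces to that of [gram] and [PJ]. *)
Lemma Qf_sum_choices n (Ns : seq 'rV[C]_n) : exists c : seq (seq 'rV[C]_n),
  forall s, Qf Ns s = \sum_(t <- c) (gram (t ++ s))%:C *: PJ (t ++ s).
Proof.
elim: Ns => [|N Ns [c hc]].
  by exists [:: [::]] => s; rewrite big_seq1.
exists ([seq rcons t N | t <- c] ++ [seq rcons t (ev R a) | a <- enum 'I_n, t <- c]) => s.
rewrite big_cat /= big_map addrC; congr (_ + _).
  rewrite big_allpairs_dep /= big_enum /=; apply: eq_bigr => a _.
  by rewrite hc; apply: eq_bigr => t _; rewrite cat_rcons.
by rewrite hc; apply: eq_bigr => t _; rewrite cat_rcons.
Qed.

Lemma mxmeas_Qf_rlist n (Ns : seq 'rV[C]_n) (r : nat -> D -> 'rV[C]_n) k :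
  (forall i, (i < k)%N -> mxmeas (r i)) -> mxmeas (fun z => Qf Ns (rlist (r ^~ z) k)).
Proof.
move=> mr; have [c hc] := Qf_sum_choices Ns.
have -> : (fun z => Qf Ns (rlist (r ^~ z) k)) = (fun z => \sum_(t <- c)
   (gram (t ++ rlist (r ^~ z) k))%:C *: PJ (t ++ rlist (r ^~ z) k)).
  by apply/funext => z; exact: hc.
apply: mxmeas_sum => t.
have E z : t ++ rlist (r ^~ z) k = [seq v z | v <- [seq (fun=> u) | u <- t] ++
    [seq r i | i <- rev (iota 0 k)]].
  rewrite map_cat -!map_comp /= map_id rlistE -map_rev.
  by [].
have M v : List.In v ([seq (fun=> u) | u <- t] ++ [seq r i | i <- rev (iota 0 k)]) -> mxmeas v.
  rewrite List.in_app_iff => -[].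
    by elim: t {E} => //= u t IH [<-|/IH//]; exact: mxmeas_cst.
  have : forall i, i \in rev (iota 0 k) -> (i < k)%N by move=> i; rewrite mem_rev mem_iota.
  elim: (rev _) => //= a l IH hl [<-|h]; first by apply: mr; apply: hl; rewrite mem_head.
  by apply: IH => // i il; apply: hl; rewrite inE il orbT.
apply: mxmeasZ.
  apply: cmeas_real.
  have -> : (fun z => gram (t ++ rlist (r ^~ z) k)) = (fun z => gram [seq v z | v <-
    [seq (fun=> u) | u <- t] ++ [seq r i | i <- rev (iota 0 k)]]).
    by apply/funext => z; rewrite E.
  exact: meas_gram.
have -> : (fun z => PJ (t ++ rlist (r ^~ z) k)) = (fun z => PJ [seq v z | v <-
    [seq (fun=> u) | u <- t] ++ [seq r i | i <- rev (iota 0 k)]]).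
  by apply/funext => z; rewrite E.
exact: mxmeas_PJ.
Qed.

End complex_measurability.

Section borel_complex.
Variable R : realType.
Local Notation C := R[i].

Lemma open_half (f : C -> R) (x : R) : (forall z w, `|f z - f w| <= normc (z - w)) ->
  open [set z | x < f z].
Proof.
move=> hf; rewrite openE => z /= xz; apply/nbhs_ballP; exists (f z - x)%:C => /=.
  by rewrite ltcR subr_gt0.
move=> w; rewrite /ball /= => zw.
have {}zw : normc (z - w) < f z - x.
  by move: zw; rewrite [X in X < _](_ : _ = (normc (z - w))%:C)// ltcR.
have := le_lt_trans (hf z w) zw; rewrite ltr_norml; lra.
Qed.

Lemma measurable_lip (f : C -> R) : (forall z w, `|f z - f w| <= normc (z - w)) ->
  measurable_fun [set: C] f.
Proof.
move=> hf; apply: (@measurability _ _ C R setT f (@RGenOInfty.G R)).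
  exact: RGenOInfty.measurableE.
move=> _ [_ [x ->] <-]; rewrite setTI; apply: sub_sigma_algebra.
have -> : f @^-1` `]x, +oo[%classic = [set z | x < f z].
  by apply/seteqP; split=> z /=; rewrite in_itv /= andbT.
exact: open_half.
Qed.

Lemma cmeas_id : cmeas (id : C -> C).
Proof.
split; apply: measurable_lip => z w.
  by rewrite -ReN -ReD; exact: Re_le_normc.
rewrite -ImN -ImD normc_sqrt -sqrtr_sqr ler_sqrt ?sqn_ge0//.
by rewrite /sqn lerDr sqr_ge0.
Qed.

Lemma cmeas_rv d (D : measurableType d) (f : D -> C) : measurable_fun setT f -> cmeas f.
Proof.
by move=> mf; have [h1 h2] := cmeas_id; split; [exact: (measurableT_comp h1 mf)|exact: (measurableT_comp h2 mf)].
Qed.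

End borel_complex.

Section decoupled_product.
Context d (T : measurableType d) (R : realType) (P : probability T R).
Context d' (T' : measurableType d') (I : eqType) (X : I -> {RV P >-> T'}).
Hypothesis Xind : mutually_independent X.
Implicit Types (J K : set I).

Lemma measurable_section J K (A : set (T * T)) w :
  measurable (A : set (sigma_of X J * sigma_of X K)) -> measurable [set v | A (w, v)].
Proof.
move=> mA; apply: (@sigma_of_measurable _ _ _ _ _ _ _ X K).
have := @pair1_measurable _ _ (sigma_of X J) (sigma_of X K) w.
by move=> /(_ measurableT A mA); rewrite setTI.
Qed.

Lemma measurable_diagonal J K (A : set (T * T)) :
  measurable (A : set (sigma_of X J * sigma_of X K)) -> measurable [set w | A (w, w)].
Proof.
by move=> mA; have := @measurable_diag_sigma _ _ _ _ _ _ _ X J K measurableT A mA; rewrite setTI.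
Qed.

(** The bound on sections is integrated over [B], an event of the past: this is the form in which
    conditioning is used below. *)
Lemma decouple_prod J K (B : set T) (A : set (T * T)) (q : R) : J `&` K = set0 ->
  measurable (B : set (sigma_of X J)) ->
  measurable (A : set (sigma_of X J * sigma_of X K)) -> 0 <= q ->
  (forall w, B w -> P [set v | A (w, v)] <= q%:E)%E ->
  (P [set w | B w /\ A (w, w)] <= q%:E * P B)%E.
Proof.
move=> JK mB mA q0 h.
have mB' := sigma_of_measurable mB.
have mI : measurable_fun setT
  ((fun z => (\1_B z.1 * \1_A z)%:E) : sigma_of X J * sigma_of X K -> \bar R).
  apply/measurable_EFinP; apply: measurable_funM; last exact: measurable_indic.
  exact: (measurableT_comp (f := \1_B : sigma_of X J -> R) (measurable_indic mB) measurable_fst).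
have := @decouple _ _ _ _ _ _ _ X Xind J K (fun z => (\1_B z.1 * \1_A z)%:E) JK (fun z => _) mI.
have mD := measurable_diagonal mA.
have -> : (\int[P]_w (\1_B (w, w).1 * \1_A (w, w))%:E)%E = P [set w | B w /\ A (w, w)].
  transitivity (\int[P]_w (\1_[set w | B w /\ A (w, w)] w)%:E)%E.
    apply: eq_integral => w _; rewrite /= !indicE -natrM mulnb; congr ((nat_of_bool _)%:R%:E).
    by apply/andP/idP => [[/set_mem b /set_mem a]|/set_mem[a b]]; [apply/mem_set | split; apply/mem_set].
  by rewrite integral_indic// ?setIT//; exact: measurableI.
move=> ->; last by move=> z; rewrite lee_fin mulr_ge0.
apply: (@le_trans _ _ (\int[P]_w (q * \1_B w)%:E)%E); last first.
  under eq_integral do rewrite EFinM.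
  rewrite ge0_integralZl//; first by rewrite integral_indic// setIT.
  by apply/measurable_EFinP; exact: measurable_indic.
have mS w := measurable_section w mA.
apply: ge0_le_integral => //.
- by move=> w _; apply: integral_ge0 => v _; rewrite lee_fin mulr_ge0.
- have mF : measurable_fun setT (fubini_F (distribution P (to_sigma X K))
     (fun z : sigma_of X J * sigma_of X K => (\1_B z.1 * \1_A z)%:E)).
    by apply: measurable_fun_fubini_tonelli_F => // z; rewrite lee_fin mulr_ge0.
  move=> _ Y mY; rewrite setTI; apply: (@sigma_of_measurable _ _ _ _ _ _ _ X J).
  have := mF measurableT Y mY; rewrite setTI.
  suff -> : fubini_F (distribution P (to_sigma X K))
     (fun z : sigma_of X J * sigma_of X K => (\1_B z.1 * \1_A z)%:E) =
     (fun w => \int[P]_v (\1_B w * \1_A (w, v))%:E)%E by [].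
  apply/funext => w; rewrite /fubini_F /=.
  have mw : measurable_fun setT (fun v : sigma_of X K => (\1_B w * \1_A (w, v) : R)%:E).
    exact: (measurableT_comp mI (pair1_measurable _)).
  by rewrite (@ge0_integral_distribution _ _ _ _ _ P (to_sigma X K) _ mw)// => v;
    rewrite lee_fin mulr_ge0.
- by apply/measurable_EFinP; apply: measurable_funM => //; exact: measurable_indic.
move=> w _ /=; have [Bw|nBw] := pselect (B w); last first.
  rewrite (_ : \1_B w = 0) ?mulr0; last by rewrite indicE memNset.
  by rewrite integral0_eq// => v _; rewrite mul0r.
rewrite (_ : \1_B w = 1) ?mulr1; last by rewrite indicE mem_set.
apply: (@le_trans _ _ (\int[P]_v (\1_[set v | A (w, v)] v)%:E)%E); last first.
  by rewrite integral_indic// setIT; exact: h.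
under eq_integral do rewrite mul1r.
rewrite le_eqVlt; apply/orP; left; apply/eqP; apply: eq_integral => v _.
rewrite !indicE; congr ((nat_of_bool _)%:R%:E); apply/idP/idP => /set_mem h'; exact/mem_set.
Qed.

End decoupled_product.

(** * One entry: truncation and anticoncentration *)

Section one_variable.
Context d (T : measurableType d) (R : realType) (P : probability T R).
Local Notation C := R[i].
Implicit Types f g u : T -> R.

Definition int1 f := P.-integrable setT (EFin \o f).
Definition Ex f : R := \int[P]_w f w.

Lemma int1_cst a : int1 (fun=> a).
Proof. exact: finite_measure_integrable_cst. Qed.
Lemma int1D f g : int1 f -> int1 g -> int1 (fun w => f w + g w).
Proof. by move=> h1 h2; exact: (integrableD measurableT h1 h2). Qed.
Lemma int1Z a f : int1 f -> int1 (fun w => a * f w).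
Proof. by move=> h; exact: (integrableZl measurableT a h). Qed.
Lemma int1_le f g : measurable_fun setT f -> (forall w, `|f w| <= g w) -> int1 g -> int1 f.
Proof.
move=> mf fg ig; apply: (le_integrable measurableT _ _ ig); first exact/measurable_EFinP.
by move=> w _ /=; rewrite lee_fin; exact: le_trans (fg w) (ler_norm _).
Qed.
Lemma int1_meas f : int1 f -> measurable_fun setT f.
Proof. by move=> /measurable_int/measurable_EFinP. Qed.
Lemma Ex_fin f : int1 f -> (\int[P]_w (f w)%:E)%E = (Ex f)%:E.
Proof. by move=> h; rewrite /Ex /Rintegral fineK//; exact: integrable_fin_num. Qed.
Lemma ExD f g : int1 f -> int1 g -> Ex (fun w => f w + g w) = Ex f + Ex g.
Proof. by move=> h1 h2; exact: RintegralD. Qed.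
Lemma ExZ a f : int1 f -> Ex (fun w => a * f w) = a * Ex f.
Proof. by move=> h; exact: RintegralZl. Qed.
Lemma Ex_cst a : Ex (fun=> a) = a.
Proof. by rewrite /Ex Rintegral_cst// -[X in fine X]/(P setT) probability_setT mulr1. Qed.
Lemma Ex_le f g : int1 f -> int1 g -> (forall w, f w <= g w) -> Ex f <= Ex g.
Proof. by move=> h1 h2 h; apply: le_Rintegral => // w _. Qed.

Lemma Ex_indic (A : set T) : measurable A -> Ex (\1_A) = fine (P A).
Proof. by move=> mA; rewrite /Ex /Rintegral integral_indic// setIT. Qed.
Lemma int1_indic (A : set T) : measurable A -> int1 (\1_A).
Proof.
move=> mA; apply: (int1_le (g := fun=> 1)); first exact: measurable_indic.
  by move=> w; rewrite ger0_norm// indicE; case: (_ \in _).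
exact: int1_cst.
Qed.

Variable xi : T -> C.
Hypothesis mxi : cmeas xi.
Hypothesis xi_Re : Ex (fun w => Re (xi w)) = 0.
Hypothesis xi_Im : Ex (fun w => Im (xi w)) = 0.
Hypothesis xi_sqn : (\int[P]_w (sqn (xi w))%:E)%E = 1%E.

Lemma int1_sqn : int1 (fun w => sqn (xi w)).
Proof.
apply/integrableP; split; first by apply/measurable_EFinP; exact: meas_sqn.
under eq_integral => w _ do rewrite /= ger0_norm ?sqn_ge0//.
by rewrite xi_sqn ltry.
Qed.

Lemma Ex_sqn : Ex (fun w => sqn (xi w)) = 1.
Proof. by rewrite /Ex /Rintegral xi_sqn. Qed.

Lemma abs_le1sqr (a b : R) : a ^+ 2 <= b -> `|a| <= 1 + b.
Proof.
move=> ab; have h : 0 <= (1 - `|a|) ^+ 2 by exact: sqr_ge0.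
have e : `|a| ^+ 2 = a ^+ 2 by rewrite real_normK ?num_real.
have p : 0 <= `|a| := normr_ge0 a.
move: h; rewrite sqrrB expr1n mul1r e; lra.
Qed.

Lemma int1_Re : int1 (fun w => Re (xi w)).
Proof.
apply: (int1_le (g := fun w => 1 + sqn (xi w))); first by case: mxi.
  by move=> w; apply: abs_le1sqr; exact: sqr_Re_le.
exact: int1D (int1_cst _) int1_sqn.
Qed.

Lemma int1_Im : int1 (fun w => Im (xi w)).
Proof.
apply: (int1_le (g := fun w => 1 + sqn (xi w))); first by case: mxi.
  by move=> w; apply: abs_le1sqr; rewrite /sqn lerDr sqr_ge0.
exact: int1D (int1_cst _) int1_sqn.
Qed.

Lemma Ex_lin (A b c g : R) u : int1 u ->
  int1 (fun w => A + b * Re (xi w) + c * Im (xi w) + g * sqn (xi w) + u w) /\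
  Ex (fun w => A + b * Re (xi w) + c * Im (xi w) + g * sqn (xi w) + u w) = A + g + Ex u.
Proof.
move=> iu; have iA := int1_cst A.
have ib := int1Z b int1_Re; have ic := int1Z c int1_Im; have ig := int1Z g int1_sqn.
have h1 := int1D iA ib; have h2 := int1D h1 ic; have h3 := int1D h2 ig.
split; first exact: int1D h3 iu.
rewrite (ExD h3 iu) (ExD h2 ig) (ExD h1 ic) (ExD iA ib) Ex_cst.
by rewrite (ExZ _ int1_Re) (ExZ _ int1_Im) (ExZ _ int1_sqn) xi_Re xi_Im Ex_sqn; ring.
Qed.

Lemma int_quadratic (A g : R) (B : C) :
  (\int[P]_w (A + 2 * Re (xi w * B) + g * sqn (xi w))%:E)%E = (A + g)%:E.
Proof.
have [h1 h2] := Ex_lin A (2 * Re B) (- (2 * Im B)) g (int1_cst 0).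
rewrite -[in RHS](addr0 (A + g)) -[in X in (_ + X)%:E](Ex_cst 0) -h2 -Ex_fin//.
by apply: eq_integral => w _; rewrite ReM; congr EFin; ring.
Qed.

Variable K : R.
Hypothesis K0 : 0 <= K.
(** The squared modulus of an entry may have infinite variance, hence this truncation before
    variances are computed. *)
Definition trunc w := Num.min (sqn (xi w)) K.

Lemma trunc_bound w : 0 <= trunc w <= K.
Proof. by rewrite /trunc le_min sqn_ge0 K0 ge_min lexx orbT. Qed.

Lemma int1_trunc : int1 trunc.
Proof.
apply: (int1_le (g := fun=> K)); last exact: int1_cst.
  by apply: measurable_minr; [exact: meas_sqn|exact: measurable_cst].
by move=> w; have /andP[a b] := trunc_bound w; rewrite ger0_norm.
Qed.

Lemma Ex_trunc_le1 : Ex trunc <= 1.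
Proof.
rewrite -Ex_sqn; apply: Ex_le; [exact: int1_trunc|exact: int1_sqn|].
by move=> w; rewrite /trunc ge_min lexx.
Qed.

Lemma Ex_trunc_ge0 : 0 <= Ex trunc.
Proof. by apply: Rintegral_ge0 => w _; case/andP: (trunc_bound w). Qed.

(** The linear part and the truncated part are centred, so they do not interact with [a]. They may
    be correlated with each other, whence twice the sum of their second moments, at most [4 * sqn B]
    and [K * q ^+ 2]. *)
Lemma int_fluctuation (a q : R) (B : C) :
  (\int[P]_w ((a + (2 * Re (xi w * B) + q * (trunc w - Ex trunc))) ^+ 2)%:E <=
    (a ^+ 2 + 8 * sqn B + 2 * K * q ^+ 2)%:E)%E.
Proof.
set kap := Ex trunc.
(* Since [trunc ^+ 2 <= K * trunc], the majorant is affine in the two components, the square and its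
   truncation, whose expectations are known. *)
have [h1 h2] := Ex_lin (a ^+ 2 - 2 * a * q * kap + 2 * q ^+ 2 * kap ^+ 2)
  (4 * a * Re B) (- (4 * a * Im B)) (8 * sqn B)
  (int1Z (2 * a * q + 2 * q ^+ 2 * K - 4 * q ^+ 2 * kap) int1_trunc).
rewrite (ExZ _ int1_trunc) -/kap in h2.
apply: (@le_trans _ _ (\int[P]_w ((a ^+ 2 - 2 * a * q * kap + 2 * q ^+ 2 * kap ^+ 2) +
  (4 * a * Re B) * Re (xi w) + (- (4 * a * Im B)) * Im (xi w) + (8 * sqn B) * sqn (xi w) +
  (2 * a * q + 2 * q ^+ 2 * K - 4 * q ^+ 2 * kap) * trunc w)%:E)%E).
  have mt : measurable_fun setT trunc := int1_meas int1_trunc.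
  apply: ge0_le_integral => //.
  - by move=> w _; rewrite lee_fin sqr_ge0.
  - apply/measurable_EFinP; apply: measurable_funX; apply: measurable_funD => //.
    apply: measurable_funD; last by apply: measurable_funM => //; exact: measurable_funB.
    apply: measurable_funM => //; have [] // := cmeasM mxi (cmeas_cst _ B).
  - exact/measurable_EFinP/int1_meas/h1.
  move=> w _; rewrite lee_fin.
  have /andP[t0 tK] := trunc_bound w.
  set y := trunc w in t0 tK *; set z := xi w.
  have e1 : (Re (z * B)) ^+ 2 <= sqn z * sqn B by rewrite -sqnM; exact: sqr_Re_le.
  have e2 : y ^+ 2 <= K * y by rewrite expr2 ler_wpM2r.
  have e3 : Re (z * B) = Re z * Re B - Im z * Im B := ReM z B.
  set s := Re (z * B) in e1 e3 *.
  have e4 : 0 <= (2 * s - q * (y - kap)) ^+ 2 := sqr_ge0 _.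
  have e5 : 0 <= q ^+ 2 := sqr_ge0 _.
  have e6 : q ^+ 2 * y ^+ 2 <= q ^+ 2 * (K * y) by rewrite ler_wpM2l.
  have -> : (4 * a * Re B) * Re z = 4 * a * (s + Im z * Im B) by rewrite e3; ring.
  nra.
rewrite Ex_fin// lee_fin h2.
have k1 : kap <= 1 := Ex_trunc_le1; have k0 : 0 <= kap := Ex_trunc_ge0.
have e5 : 0 <= q ^+ 2 := sqr_ge0 _.
have e7 : q ^+ 2 * K * kap <= q ^+ 2 * K * 1 by rewrite ler_wpM2l// mulr_ge0.
have e8 : 0 <= q ^+ 2 * kap ^+ 2 by rewrite mulr_ge0 ?sqr_ge0.
nra.
Qed.

(** Compare [E |xi - a|^2 = 1 + |a|^2] with a pointwise majorant: [1/4] on the event and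
    [2 |xi|^2 + 2 |a|^2] off it, where [|xi|^2] is its truncation, at most [K], plus a remainder of
    small mean. If the complement had probability below [1/(4K)], the majorant would have too small
    a mean. *)
Lemma anticoncentration (a : C) : 1 <= K -> 15 / 16 <= Ex trunc ->
  (P [set w | (sqn (xi w - a) <= 1 / 4)%R] <= (1 - (4 * K)^-1)%:E)%E.
Proof.
move=> K1 hk; set A := [set w | _].
have mxa : measurable_fun setT (fun w => sqn (xi w - a)).
  by apply: meas_sqn; apply: cmeasB => //; exact: cmeas_cst.
have mA : measurable A.
  have := mxa measurableT _ (@measurable_itv R `]-oo, (1/4)]); rewrite setTI.
  by congr measurable; apply/seteqP; split=> w /=; rewrite in_itv.
have mAc : measurable (~` A) by exact: measurableC.
set p := fine (P (~` A)).
have pE : P A = (1 - p)%:E.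
  rewrite /p -[P A]fineK ?fin_num_measure//; congr EFin.
  by rewrite probability_setC// fineB ?fin_num_measure//= opprB addrC subrK.
have p0 : 0 <= p by rewrite fine_ge0.
rewrite pE lee_fin lerD2l lerN2.
have [h1 h2] := Ex_lin (sqn a) (- (2 * Re a)) (- (2 * Im a)) 1 (int1_cst 0).
have [h3 h4] := Ex_lin (1/4) 0 0 2 (int1D (int1Z (-2) int1_trunc)
   (int1Z (2 * (K + sqn a)) (int1_indic mAc))).
rewrite (ExD (int1Z _ int1_trunc) (int1Z _ (int1_indic mAc))) (ExZ _ int1_trunc)
  (ExZ _ (int1_indic mAc)) Ex_indic// -/p in h4.
rewrite Ex_cst in h2.
have : sqn a + 1 + 0 <= 1/4 + 2 + (-2 * Ex trunc + 2 * (K + sqn a) * p).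
  rewrite -h2 -h4; apply: Ex_le => // w.
  have /andP[t0 tK] := trunc_bound w.
  have e1 : sqn a + - (2 * Re a) * Re (xi w) + - (2 * Im a) * Im (xi w) + 1 * sqn (xi w) + 0
     = sqn (xi w - a).
    by case: (xi w) => b c; case: (a) => b' c'; rewrite /sqn /=; ring.
  rewrite e1; have ts : trunc w <= sqn (xi w) by rewrite /trunc ge_min lexx.
  have e2 : sqn (xi w - a) <= 2 * sqn (xi w) + 2 * sqn a.
    by have := sqnD2 (xi w) (- a); rewrite sqnN.
  have [wA|wA] := pselect (A w).
    rewrite (_ : \1_(~` A) w = 0); first by move: wA; rewrite /A /=; lra.
    by rewrite indicE memNset//= => h; exact: h.
  rewrite (_ : \1_(~` A) w = 1); last by rewrite indicE mem_set.
  move: (sqn_ge0 a); lra.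
have s0 := sqn_ge0 a.
have K4 : 0 < 4 * K by lra.
move=> h; rewrite -div1r ler_pdivrMr//; rewrite leNgt; apply/negP => hp.
have p4 : 2 * p <= 1/2.
  have : p * 4 <= p * (4 * K) by rewrite ler_wpM2l//; lra.
  lra.
have : sqn a * (2 * p) <= sqn a * (1/2) by rewrite ler_wpM2l.
lra.
Qed.

End one_variable.

(** * Quadratic forms in a random row *)

Section random_row.
Context d (T : measurableType d) (R : realType) (P : probability T R).
Local Notation C := R[i].
Context (I : eqType) (X : I -> {RV P >-> R[i]}).
Hypothesis Xind : mutually_independent X.
Hypothesis XRe : forall i, Ex P (fun w => Re (X i w)) = 0.
Hypothesis XIm : forall i, Ex P (fun w => Im (X i w)) = 0.
Hypothesis Xsqn : forall i, (\int[P]_w (sqn (X i w))%:E)%E = 1%E.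

Lemma cmeas_X i : cmeas (fun w : T => X i w).
Proof. by apply: cmeas_rv; exact: measurable_funPT. Qed.

Lemma cmeas_coord J i : J i -> cmeas (X i : sigma_of X J -> C).
Proof. by move=> Ji; apply: cmeas_rv; exact: measurable_coord. Qed.

Lemma cmeas_coord2 (J K : set I) i : K i -> cmeas (fun z : sigma_of X J * sigma_of X K => X i z.2).
Proof.
move=> Ki; have [h1 h2] := cmeas_coord Ki.
by split; [exact: (measurableT_comp h1 measurable_snd)|exact: (measurableT_comp h2 measurable_snd)].
Qed.

Lemma meas_int_section (J K : set I) (H : T * T -> \bar R) :
  measurable_fun setT (H : sigma_of X J * sigma_of X K -> _) ->
  (forall z, 0 <= H z)%E ->
  measurable_fun setT (fun w : T => \int[P]_v H (w, v))%E.
Proof.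
move=> mH H0; have mF : measurable_fun setT (fubini_F (distribution P (to_sigma X K))
    (H : sigma_of X J * sigma_of X K -> _)).
  by apply: measurable_fun_fubini_tonelli_F.
move=> _ Y mY; rewrite setTI; apply: (@sigma_of_measurable _ _ _ _ _ _ _ X J).
have := mF measurableT Y mY; rewrite setTI.
suff -> : fubini_F (distribution P (to_sigma X K)) (H : sigma_of X J * sigma_of X K -> _) =
    (fun w => \int[P]_v H (w, v))%E by [].
apply/funext => w; rewrite /fubini_F /=.
have mw : measurable_fun setT (fun v : sigma_of X K => H (w, v)).
  exact: (measurableT_comp mH (pair1_measurable _)).
by rewrite (@ge0_integral_distribution _ _ _ _ _ P (to_sigma X K) _ mw).
Qed.

Variable n : nat.
Variable phi : 'I_n -> I.
Hypothesis phi_inj : injective phi.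
Implicit Types (N u v : 'rV[C]_n) (Q : 'M[C]_n).

Definition xrow w : 'rV[C]_n := \row_j X (phi j) w.
(** The row with its first [k] entries revealed, so that [decouple] can treat one entry at a
    time. *)
Definition xpart N k w : 'rV[C]_n := N + \row_j (if (j < k)%N then X (phi j) w else 0).

Lemma xpart0 N w : xpart N 0 w = N.
Proof. by apply/rowP => j; rewrite !mxE ltn0 addr0. Qed.

Lemma xpartS N k (hk : (k < n)%N) w :
  xpart N k.+1 w = xpart N k w + X (phi (Ordinal hk)) w *: ev R (Ordinal hk).
Proof.
apply/rowP => j; rewrite !mxE eqxx /= -addrA; congr (_ + _).
rewrite ltnS leq_eqVlt; have [e|ne] := eqVneq (j : nat) k.
  have -> : j = Ordinal hk by exact: val_inj.
  by rewrite eqxx /= ltnn mulr1 add0r.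
have -> : (j == Ordinal hk) = false by apply/negbTE; apply: contra ne => /eqP ->.
by rewrite mulr0 addr0.
Qed.

Lemma xpart_full N w : xpart N n w = xrow w + N.
Proof. by apply/rowP => j; rewrite !mxE ltn_ord addrC. Qed.

Definition below k : set I := [set p | exists2 j : 'I_n, (j < k)%N & p = phi j].

Lemma below_disj k (hk : (k < n)%N) : below k `&` [set phi (Ordinal hk)] = set0.
Proof.
apply/seteqP; split => // p [[j jk ->] /= /phi_inj e].
by move: jk; rewrite e /= ltnn.
Qed.

Lemma mxmeas_xpart_sigma N k : mxmeas (xpart N k : sigma_of X (below k) -> _).
Proof.
move=> i j; apply: (eq_cmeas (f := fun w : sigma_of X (below k) => N i j + (if (j < k)%N then X (phi j) w else 0))).
  by move=> w; rewrite !mxE.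
apply: cmeasD; first exact: cmeas_cst.
by case jk: (j < k)%N; [apply: cmeas_coord; exists j | exact: cmeas_cst].
Qed.

Lemma mxmeas_xpart1 N k K :
  mxmeas (fun z : sigma_of X (below k) * sigma_of X K => xpart N k z.1).
Proof.
move=> i j; have [h1 h2] := mxmeas_xpart_sigma N k i j.
by split; [exact: (measurableT_comp h1 measurable_fst) | exact: (measurableT_comp h2 measurable_fst)].
Qed.

Lemma mxmeas_xpart N k : mxmeas (xpart N k : T -> _).
Proof.
move=> i j; apply: (eq_cmeas (f := fun w => N i j + (if (j < k)%N then X (phi j) w else 0))).
  by move=> w; rewrite !mxE.
apply: cmeasD; first exact: cmeas_cst.
by case jk: (j < k)%N; [exact: cmeas_X | exact: cmeas_cst].
Qed.

Lemma qf_pivot Q u (c : C) (i : 'I_n) : herm Q ->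
  qf Q (u + c *: ev R i) = qf Q u + 2 * Re (c * ((dot (u *m Q) (ev R i))^*)%R) + qf Q (ev R i) * sqn c.
Proof.
move=> hQ; rewrite qfDr// qfZr [sqn c * _]mulrC; congr (_ + _ + _).
rewrite dotZr; set b := dot _ _; congr (2 * _).
by case: (c) => a b'; case: (b) => a2 b2 /=; ring.
Qed.

Lemma sum_below (f : 'I_n -> R) k (hk : (k < n)%N) :
  \sum_(j < n | (j < k.+1)%N) f j = \sum_(j < n | (j < k)%N) f j + f (Ordinal hk).
Proof.
rewrite (bigD1 (Ordinal hk))//= addrC; congr (_ + _); apply: eq_bigl => j.
by rewrite ltnS [in RHS]ltn_neqAle andbC; congr (_ && _); rewrite -val_eqE.
Qed.

Lemma int_qf_part Q N k : psd Q -> (k <= n)%N ->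
  (\int[P]_w (qf Q (xpart N k w))%:E)%E =
  (\sum_(j < n | (j < k)%N) qf Q (ev R j) + qf Q N)%:E.
Proof.
move=> [hQ pQ]; elim: k => [|k IH] hk.
  rewrite big_pred0// add0r; under eq_integral do rewrite xpart0.
  by rewrite integral_cst// -[X in (_ * X)%E]/(P setT) probability_setT mule1.
have hk' : (k < n)%N := hk; set i := Ordinal hk'.
set K := [set phi i].
pose H (z : T * T) := (qf Q (xpart N k z.1 + X (phi i) z.2 *: ev R i))%:E.
have mH : measurable_fun setT (H : sigma_of X (below k) * sigma_of X K -> _).
  apply/measurable_EFinP; apply: meas_qf; first exact: mxmeas_cst.
  apply: mxmeasD; first exact: mxmeas_xpart1.
  by apply: mxmeasZ; [exact: cmeas_coord2 | exact: mxmeas_cst].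
have := @decouple _ _ _ _ _ _ _ X Xind _ _ H (below_disj hk') _ mH.
rewrite [X in (_ -> X = _) -> _](_ : _ = \int[P]_w (qf Q (xpart N k.+1 w))%:E)%E; last first.
  by apply: eq_integral => w _; rewrite /H /= (xpartS N hk').
move=> ->; last by move=> z; rewrite lee_fin.
have E w : (\int[P]_v H (w, v))%E = (qf Q (xpart N k w))%:E + (qf Q (ev R i))%:E.
  under eq_integral do rewrite /H /= qf_pivot//.
  by rewrite (int_quadratic (cmeas_X (phi i)))// EFinD.
under eq_integral do rewrite E.
have m1 : measurable_fun setT (fun w => (qf Q (xpart N k w))%:E).
  by apply/measurable_EFinP; apply: meas_qf; [exact: mxmeas_cst|exact: mxmeas_xpart].
have p1 w : setT w -> (0 <= (qf Q (xpart N k w))%:E)%E by rewrite lee_fin.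
have p2 (w : T) : setT w -> (0 <= (qf Q (ev R i))%:E)%E by rewrite lee_fin.
rewrite (ge0_integralD P measurableT p1 m1 p2 (measurable_cst _)) IH ?(ltnW hk)// integral_cst// -[X in (_ + _ * X)%E]/(P setT) probability_setT mule1.
by rewrite -EFinD (sum_below _ hk'); congr EFin; ring.
Qed.

Lemma int_qf_row Q N : psd Q ->
  (\int[P]_w (qf Q (xrow w + N))%:E)%E = (trR Q + qf Q N)%:E.
Proof.
move=> pQ; under eq_integral do rewrite -xpart_full.
rewrite int_qf_part// trRE; congr ((_ + _)%:E).
by apply: eq_bigl => j; rewrite ltn_ord.
Qed.

Section chebyshev.
Variables (K : R) (Q : 'M[C]_n) (N : 'rV[C]_n) (lam : R).
Hypothesis K0 : 0 <= K.
Hypothesis pQ : psd Q.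
Hypothesis Qlam : forall v, qf Q v <= lam * nrm2 v.
Let kap j := Ex P (trunc (X (phi j)) K).

(** The form with each diagonal square replaced by its truncation: still a lower bound for the form,
    with mean [tmean], and with increments of finite variance. *)
Definition tform k w := qf Q (xpart N k w) -
  \sum_(j < n | (j < k)%N) qf Q (ev R j) * (sqn (X (phi j) w) - trunc (X (phi j)) K w).
Definition tmean k := qf Q N + \sum_(j < n | (j < k)%N) kap j * qf Q (ev R j).

Lemma meas_tform_sigma k : measurable_fun setT (tform k : sigma_of X (below k) -> R).
Proof.
apply: measurable_funB.
  by apply: meas_qf; [exact: mxmeas_cst|exact: mxmeas_xpart_sigma].
under eq_fun => w do rewrite big_mkcond.
apply: meas_sum => j; case jk: (j < k)%N; last exact: measurable_cst.
have mj : cmeas (X (phi j) : sigma_of X (below k) -> C) by apply: cmeas_coord; exists j.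
apply: measurable_funM => //; apply: measurable_funB; first exact: meas_sqn.
by apply: measurable_minr; [exact: meas_sqn|exact: measurable_cst].
Qed.

Lemma meas_tform k : measurable_fun setT (tform k).
Proof.
have h := @meas_tform_sigma k; move=> _ Y mY; rewrite setTI.
apply: (@sigma_of_measurable _ _ _ _ _ _ _ X (below k)).
by have := h measurableT Y mY; rewrite setTI.
Qed.

Lemma tformS k (hk : (k < n)%N) w (i := Ordinal hk) :
  tform k.+1 w - tmean k.+1 = (tform k w - tmean k) +
   (2 * Re (X (phi i) w * ((dot (xpart N k w *m Q) (ev R i))^*)%R) +
    qf Q (ev R i) * (trunc (X (phi i)) K w - kap i)).
Proof.
rewrite /tform /tmean !(sum_below _ hk) -/i (xpartS N hk) -/i qf_pivot//; last by case: pQ.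
ring.
Qed.

(** From Cauchy-Schwarz for [v] and [v *m Q]; in terms of matrices, [Q^2 <= lam Q]. *)
Lemma nrm2_mul_le v : nrm2 (v *m Q) <= lam * qf Q v.
Proof.
have := cauchy_schwarz v (v *m Q) pQ; rewrite dot_nrm2 sqn_real expr2 => h.
have [z|nz] := eqVneq (nrm2 (v *m Q)) 0.
  rewrite z; have := Qlam v; have [_ h2] := pQ; have h3 := h2 v; have := nrm2_ge0 v => h4 h5.
  have [v0|v0] := eqVneq (nrm2 v) 0.
    by have := nrm2_eq0 v0 => ->; rewrite qf0r mulr0.
  have vp : 0 < nrm2 v by rewrite lt0r v0.
  have l0 : 0 <= lam.
    rewrite leNgt; apply/negP => ln.
    have : lam * nrm2 v < 0 by rewrite pmulr_llt0.
    lra.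
  exact: mulr_ge0.
have p : 0 < nrm2 (v *m Q) by rewrite lt0r nz nrm2_ge0.
rewrite -(ler_pM2r p); apply: le_trans h _.
have [_ h2] := pQ; rewrite mulrAC mulrC -mulrA mulrC; apply: le_trans (ler_wpM2l (h2 v) (Qlam _)) _.
by rewrite le_eqVlt; apply/orP; left; apply/eqP; ring.
Qed.

(** Variance budget of entry [i]: the first two terms bound the second moment of its linear
    coefficient, which comes from the earlier entries and from the mean [N]; the last belongs to the
    truncated diagonal. *)
Definition vterm i := 8 * (nrm2 (ev R i *m Q) + sqn (dot (N *m Q) (ev R i))) +
  2 * K * qf Q (ev R i) ^+ 2.

Lemma int_tform k : (k <= n)%N ->
  (\int[P]_w ((tform k w - tmean k) ^+ 2)%:E <= (\sum_(j < n | (j < k)%N) vterm j)%:E)%E.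
Proof.
have [hQ pQ'] := pQ.
elim: k => [|k IH] hk.
  have E w : tform 0 w - tmean 0 = 0.
    by rewrite /tform /tmean !big_pred0// xpart0; ring.
  under eq_integral do rewrite E expr0n.
  by rewrite integral0_eq// big_pred0.
have hk' : (k < n)%N := hk; set i := Ordinal hk'; set J := below k; set L := [set phi i].
pose B w := ((dot (xpart N k w *m Q) (ev R i))^*)%R.
pose H (z : T * T) := ((((tform k z.1 - tmean k) + (2 * Re (X (phi i) z.2 * B z.1) +
    qf Q (ev R i) * (trunc (X (phi i)) K z.2 - kap i))) ^+ 2)%:E).
have mX2 : cmeas (fun z : sigma_of X J * sigma_of X L => X (phi i) z.2) by exact: cmeas_coord2.
have mB1 : cmeas (fun z : sigma_of X J * sigma_of X L => B z.1).
  apply: cmeas_conj; have := @mxmeasM _ _ _ _ _ _ _ _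
    (mxmeasM (@mxmeas_xpart1 N k L) (mxmeas_cst _ Q)) (mxmeas_cst _ (adj (ev R i))).
  by move=> /(_ 0 0).
have mH : measurable_fun setT (H : sigma_of X J * sigma_of X L -> _).
  apply/measurable_EFinP; apply: measurable_funX; apply: measurable_funD.
    apply: measurable_funB => //; exact: (measurableT_comp (@meas_tform_sigma k) measurable_fst).
  apply: measurable_funD.
    by apply: measurable_funM => //; have [] := cmeasM mX2 mB1.
  apply: measurable_funM => //; apply: measurable_funB => //.
  by apply: measurable_minr; [exact: meas_sqn|exact: measurable_cst].
have := @decouple _ _ _ _ _ _ _ X Xind _ _ H (below_disj hk') _ mH.
rewrite [X in (_ -> X = _) -> _](_ : _ = \int[P]_w ((tform k.+1 w - tmean k.+1) ^+ 2)%:E)%E; last first.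
  by apply: eq_integral => w _; rewrite /H /= tformS.
move=> ->; last by move=> z; rewrite lee_fin sqr_ge0.
pose g := ev R i *m Q.
have sB w : sqn (B w) = qf (adj g *m g) (xpart N k w).
  by rewrite qf_rank1 sqn_conj dot_adj hQ.
have pg : psd (adj g *m g).
  by split; [exact: rank1_herm|move=> v; rewrite qf_rank1 sqn_ge0].
pose F w := ((tform k w - tmean k) ^+ 2 + (8 * qf (adj g *m g) (xpart N k w) +
   2 * K * qf Q (ev R i) ^+ 2))%:E.
have mqf : measurable_fun setT (fun w => qf (adj g *m g) (xpart N k w)).
  by apply: meas_qf; [exact: mxmeas_cst|exact: mxmeas_xpart].
have mt2 : measurable_fun setT (fun w => (tform k w - tmean k) ^+ 2).
  by apply: measurable_funX; apply: measurable_funB => //; exact: meas_tform.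
apply: (@le_trans _ _ (\int[P]_w F w)%E).
  apply: ge0_le_integral => //.
  - by move=> w _; apply: integral_ge0 => v _; rewrite lee_fin sqr_ge0.
  - by apply: (meas_int_section mH) => z; rewrite lee_fin sqr_ge0.
  - apply/measurable_EFinP; apply: measurable_funD => //.
    by apply: measurable_funD => //; exact: measurable_funM.
  move=> w _; rewrite /H /=.
  have := int_fluctuation (cmeas_X (phi i)) (XRe _) (XIm _) (Xsqn _) K0
    (tform k w - tmean k) (qf Q (ev R i)) (B w).
  by rewrite sB /F addrA.
have t0 w : 0 <= (tform k w - tmean k) ^+ 2 := sqr_ge0 _.
have K2 : 0 <= 2 * K * qf Q (ev R i) ^+ 2 by rewrite !mulr_ge0 ?sqr_ge0.
have q0 w : 0 <= qf (adj g *m g) (xpart N k w) by case: pg.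
under eq_integral do rewrite /F EFinD.
rewrite ge0_integralD//; last 4 first.
- by move=> w _; rewrite lee_fin.
- exact/measurable_EFinP.
- by move=> w _; rewrite lee_fin addr_ge0// mulr_ge0.
- by apply/measurable_EFinP; apply: measurable_funD => //; exact: measurable_funM.
under [X in (_ + X)%E]eq_integral do rewrite EFinD.
rewrite (@ge0_integralD _ _ _ _ _ _ (fun w => (8 * qf (adj g *m g) (xpart N k w))%:E))//; last 2 first.
- by move=> w _; rewrite lee_fin mulr_ge0.
- by apply/measurable_EFinP; exact: measurable_funM.
under [X in (_ + (X + _))%E]eq_integral do rewrite EFinM.
rewrite ge0_integralZl//; last 2 first.
- exact/measurable_EFinP.
- by move=> w _; rewrite lee_fin.
rewrite int_qf_part ?(ltnW hk)// integral_cst// -[X in (_ + (_ + _ * X))%E]/(P setT) probability_setT mule1.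
rewrite (sum_below _ hk') -/i [leRHS]EFinD; apply: leeD; first by apply: IH; exact: ltnW.
rewrite -EFinM -EFinD lee_fin /vterm lerD2r ler_pM2l// lerD//; last by rewrite qf_rank1 dot_adj hQ.
rewrite nrm2E [leRHS](eq_bigr (fun j => qf (adj g *m g) (ev R j))); last first.
  move=> j _; rewrite qf_rank1 -/g dotE (bigD1 j)//= big1 ?addr0.
    by rewrite [ev R j 0 j]mxE !eqxx mul1r sqn_conj.
  by move=> l lj; rewrite [ev R j 0 l]mxE (negbTE lj) andbF mul0r.
(* Only entries already revealed occur in the coefficient; the whole row of [Q] serves as an upper
   bound. *)
rewrite big_mkcond /=; apply: ler_sum => j _; case: ifP => // _.
by case: pg.
Qed.

(** Truncation costs at most [eta / 2] of the mean, so the event forces [tform] to deviate by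
    [eta / 2] times [S = trR Q + qf Q N]. The variance is at most [lam * (8 + 2 * K) * S] because
    [Q^2 <= lam Q]. One factor [S] remains in the denominator and is replaced by the smaller
    [trR Q]. *)
Lemma chebyshev_row (eta : R) : 0 < eta -> eta <= 1 -> 0 < trR Q ->
  (forall j, 1 - eta / 2 <= kap j) ->
  (P [set w | (qf Q (xrow w + N) < (1 - eta) * (trR Q + qf Q N))%R] <=
    (4 * (8 + 2 * K) * lam / (eta ^+ 2 * trR Q))%:E)%E.
Proof.
move=> e0 e1 tQ hk; have [hQ pQ'] := pQ.
set S := trR Q + qf Q N; have S0 : 0 < S by rewrite ltr_pwDl.
have mT2 : measurable_fun setT (fun w => (tform n w - tmean n) ^+ 2).
  by apply: measurable_funX; apply: measurable_funB => //; exact: meas_tform.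
set a := (eta / 2 * S) ^+ 2; have a0 : 0 < a by rewrite exprn_gt0// mulr_gt0// divr_gt0.
set E1 := [set w | _]; set E2 := [set w | a <= (tform n w - tmean n) ^+ 2].
have mE2 : measurable E2.
  have := mT2 measurableT _ (@measurable_itv R `[a, +oo[); rewrite setTI.
  by congr measurable; apply/seteqP; split=> w /=; rewrite in_itv /= andbT.
have mE1 : measurable E1.
  have mq : measurable_fun setT (fun w => qf Q (xrow w + N)).
    apply: (eq_meas (f := fun w => qf Q (xpart N n w))) => [w|]; first by rewrite xpart_full.
    by apply: meas_qf; [exact: mxmeas_cst|exact: mxmeas_xpart].
  have := mq measurableT _ (@measurable_itv R `]-oo, ((1 - eta) * S)[); rewrite setTI.
  by congr measurable; apply/seteqP; split=> w /=; rewrite in_itv.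
have mean_ge : (1 - eta / 2) * S <= tmean n.
  rewrite /tmean /S mulrDr addrC lerD//.
    rewrite ler_piMl//; lra.
  rewrite trRE mulr_sumr [leRHS]big_mkcond /=; apply: ler_sum => j _.
  by rewrite ltn_ord ler_wpM2r.
have sub : E1 `<=` E2.
  move=> w; rewrite /E1 /E2 /= => hw.
  have tw : tform n w <= qf Q (xrow w + N).
    rewrite /tform xpart_full gerBl sumr_ge0// => j _.
    by rewrite mulr_ge0// subr_ge0 /trunc ge_min lexx.
  rewrite /a -[leRHS]sqrrN ler_pXn2r ?nnegrE//.
  - move: mean_ge; nra.
  - by rewrite mulr_ge0 ?divr_ge0 // ltW.
  - move: mean_ge; nra.
apply: (@le_trans _ _ (P E2)); first by apply: le_measure => //; rewrite inE.
have M : (a%:E * P E2 <= \int[P]_w ((tform n w - tmean n) ^+ 2)%:E)%E.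
  have -> : (a%:E * P E2 = \int[P]_w (a * \1_E2 w)%:E)%E.
    under eq_integral do rewrite EFinM.
    rewrite ge0_integralZl//; first by rewrite integral_indic// setIT.
    by apply/measurable_EFinP; exact: measurable_indic.
    by rewrite lee_fin ltW.
  apply: ge0_le_integral => //.
  - by move=> w _; rewrite lee_fin mulr_ge0// ltW.
  - by apply/measurable_EFinP; apply: measurable_funM => //; exact: measurable_indic.
  - exact/measurable_EFinP.
  move=> w _; rewrite lee_fin indicE; have [h|h] := pselect (E2 w).
    by rewrite mem_set// mulr1.
  by rewrite memNset// mulr0 sqr_ge0.
have V : \sum_(j < n | (j < n)%N) vterm j <= lam * (8 + 2 * K) * S.
  rewrite (eq_bigl xpredT); last by move=> j; rewrite ltn_ord.
  rewrite big_split /= -!mulr_sumr big_split /=.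
  have h1 : \sum_(j < n) nrm2 (ev R j *m Q) <= lam * trR Q.
    by rewrite trRE mulr_sumr; apply: ler_sum => j _; exact: nrm2_mul_le.
  have h2 : \sum_(j < n) sqn (dot (N *m Q) (ev R j)) <= lam * qf Q N.
    apply: le_trans (nrm2_mul_le N); rewrite nrm2E le_eqVlt; apply/orP; left; apply/eqP.
    apply: eq_bigr => j _; congr sqn; rewrite dotE (bigD1 j)//= big1 ?addr0.
      by rewrite [ev R j 0 j]mxE !eqxx conjC1 mulr1.
    by move=> l lj; rewrite [ev R j 0 l]mxE (negbTE lj) andbF conjC0 mulr0.
  have h3 : \sum_(j < n) qf Q (ev R j) ^+ 2 <= lam * trR Q.
    rewrite trRE mulr_sumr; apply: ler_sum => j _.
    by rewrite expr2 ler_wpM2r//; have := Qlam (ev R j); rewrite nrm2_ev mulr1.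
  have h4 : 2 * K * (\sum_(j < n) qf Q (ev R j) ^+ 2) <= 2 * K * (lam * trR Q).
    by rewrite ler_wpM2l// mulr_ge0.
  have l0 : 0 <= lam * qf Q N by apply: le_trans h2; apply: sumr_ge0 => j _; exact: sqn_ge0.
  have h5 : 0 <= 2 * K * (lam * qf Q N) by rewrite mulr_ge0// mulr_ge0.
  have -> : lam * (8 + 2 * K) * S = 8 * (lam * trR Q) + 8 * (lam * qf Q N) +
     2 * K * (lam * trR Q) + 2 * K * (lam * qf Q N) by rewrite /S; ring.
  lra.
have := le_trans M (int_tform (leqnn n)).
have -> : P E2 = (fine (P E2))%:E by rewrite fineK// fin_num_measure.
rewrite -EFinM !lee_fin => h.
have {}h := le_trans h V.
have p0 : 0 <= fine (P E2) by rewrite fine_ge0.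
have ae : a = eta ^+ 2 / 4 * S * S by rewrite /a; field.
rewrite ler_pdivlMr ?mulr_gt0 ?exprn_gt0//.
have h2 : fine (P E2) * (eta ^+ 2 * S) <= 4 * (8 + 2 * K) * lam.
  rewrite -(ler_pM2r S0).
  have -> : fine (P E2) * (eta ^+ 2 * S) * S = 4 * (a * fine (P E2)) by rewrite ae; field.
  have -> : 4 * (8 + 2 * K) * lam * S = 4 * (lam * (8 + 2 * K) * S) by ring.
  by rewrite ler_pM2l.
apply: le_trans h2; rewrite ler_wpM2l// ler_wpM2l ?sqr_ge0//.
by rewrite /S lerDl.
Qed.

End chebyshev.
End random_row.

(** * Small ball estimate for a quadratic form *)

Section trace_lemma.
Context d (T : measurableType d) (R : realType) (P : probability T R).
Local Notation C := R[i].
Context (I : eqType) (X : I -> {RV P >-> R[i]}).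
Hypothesis Xind : mutually_independent X.
Variable q : R.
Hypothesis q0 : 0 <= q.
Hypothesis Xac : forall i (a : C), (P [set w | (sqn (X i w - a) <= 1 / 4)%R] <= q%:E)%E.
Variable n : nat.
Variable phi : 'I_n -> I.
Hypothesis phi_inj : injective phi.
Implicit Types (N u v : 'rV[C]_n) (Q : 'M[C]_n).

Let rowbut i N w : 'rV[C]_n := N + \row_j (if j != i then X (phi j) w else 0).

Let rowbutE i N w : xrow X phi w + N = rowbut i N w + X (phi i) w *: ev R i.
Proof.
apply/rowP => j; rewrite !mxE eqxx /= [LHS]addrC -addrA; congr (_ + _).
by case: eqVneq => [->|] /=; [rewrite add0r mulr1|rewrite mulr0 addr0].
Qed.

Lemma mul_nrm2_le Q v : psd Q -> (forall v, qf Q v <= nrm2 v) -> nrm2 (v *m Q) <= qf Q v.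
Proof.
move=> pQ h; have := nrm2_mul_le pQ (lam := 1) _ v; rewrite mul1r; apply => u.
by rewrite mul1r.
Qed.

Lemma meas_set_le (f : T -> R) (c : R) : measurable_fun setT f -> measurable [set w | (f w <= c)%R].
Proof.
move=> mf; have := mf measurableT _ (@measurable_itv R `]-oo, c]); rewrite setTI.
by congr measurable; apply/seteqP; split=> w /=; rewrite in_itv.
Qed.

Lemma mxmeas_xrowD N : mxmeas (fun w : T => xrow X phi w + N).
Proof.
apply: mxmeasD; last exact: mxmeas_cst.
move=> i j; apply: (eq_cmeas (f := X (phi j))) => [w|]; first by rewrite mxE.
exact: cmeas_X.
Qed.

Lemma trace_lemma m Q N : psd Q -> (forall v, qf Q v <= nrm2 v) -> m%:R <= trR Q ->
  (P [set w | (qf Q (xrow X phi w + N) <= (4 * n%:R)^-1)%R] <= (q ^+ m)%:E)%E.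
Proof.
elim: m Q => [|m IH] Q pQ Q1 tQ.
  rewrite expr0 probability_le1//; apply: meas_set_le; apply: meas_qf; first exact: mxmeas_cst.
  exact: mxmeas_xrowD.
have [hQ Q0] := pQ.
have n0 : (0 < n)%N.
  rewrite lt0n; apply/eqP => n0; move: tQ; rewrite trRE big1; last first.
    by move=> i _; suff : false by []; rewrite -(ltn0 i) -[X in (_ < X)%N]n0 ltn_ord.
  by rewrite real_leNgt ?num_real// ltr0Sn.
have n0R : 0 < n%:R :> R by rewrite ltr0n.
(* The trace is at least 1, so some diagonal entry is at least its average [1 / n]. *)
have [i hi] : exists i, n%:R^-1 <= qf Q (ev R i).
  apply: contrapT => /forallNP h; move: tQ; apply/negP; rewrite -ltNge trRE.
  apply: (@lt_le_trans _ _ (\sum_(i < n) n%:R^-1)).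
    have e : (\sum_(i < n) qf Q (ev R i) < \sum_(i < n) n%:R^-1) =
       (\sum_(i in 'I_n) qf Q (ev R i) < \sum_(i in 'I_n) n%:R^-1) by [].
    apply: ltr_sum; first by apply/hasP; exists (Ordinal n0) => //; rewrite mem_index_enum.
    by move=> i _; rewrite ltNge; apply/negP/h.
  by rewrite sumr_const card_ord -[leLHS]mulr_natr mulVf ?gt_eqF// ler1n.
set g := ev R i *m Q; set gam := qf Q (ev R i).
have gam0 : 0 < gam by apply: lt_le_trans hi; rewrite invr_gt0.
pose Q' := Q - (gam^-1)%:C *: (adj g *m g).
have qfQ' v : qf Q' v = qf Q v - gam^-1 * sqn (dot v g).
  by rewrite /Q' qfD qfN qfZ qf_rank1.
have dotg v : dot v g = dot (v *m Q) (ev R i) by rewrite /g dot_adj hQ.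
have pQ' : psd Q'.
  split; first by apply: hermB => //; apply: hermZ; exact: rank1_herm.
  move=> v; rewrite qfQ' subr_ge0 mulrC ler_pdivrMr//.
  by rewrite dotg; exact: cauchy_schwarz.
have Q'le v : qf Q' v <= qf Q v by rewrite qfQ' gerBl mulr_ge0 ?sqn_ge0// invr_ge0 ltW.
have tQ' : m%:R <= trR Q'.
  rewrite /Q' trRD trRN trRZ trR_rank1.
  have : gam^-1 * nrm2 g <= 1 by rewrite mulrC ler_pdivrMr// mul1r; exact: mul_nrm2_le.
  by move: tQ; rewrite -addn1 natrD; lra.
have Q'i : qf Q' (ev R i) = 0.
  rewrite qfQ' dotg dot_qf// sqn_real -/gam expr2 mulrA mulVf ?gt_eqF// mul1r.
  exact: subrr.
have Q'but w : qf Q' (xrow X phi w + N) = qf Q' (rowbut i N w).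
  rewrite (rowbutE i) qfDr; last by case: pQ'.
  by rewrite qfZr Q'i mulr0 addr0 dotZr (qf0_dot _ pQ' Q'i) mulr0 /= mulr0 addr0.
pose J := [set p | exists2 j : 'I_n, j != i & p = phi j].
pose L := [set phi i].
have JL : J `&` L = set0.
  by apply/seteqP; split => // p [[j ji ->] /= /phi_inj e]; move: ji; rewrite e eqxx.
have mbut : mxmeas (rowbut i N : sigma_of X J -> _).
  move=> l j; apply: (eq_cmeas (f := fun w : sigma_of X J => N l j + (if j != i then X (phi j) w else 0))).
    by move=> w; rewrite !mxE.
  apply: cmeasD; first exact: cmeas_cst.
  by case ji: (j != i); [apply: cmeas_coord; exists j | exact: cmeas_cst].
pose B := [set w | (qf Q' (rowbut i N w) <= (4 * n%:R)^-1)%R].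
have mB : measurable (B : set (sigma_of X J)).
  have mf : measurable_fun setT (fun w : sigma_of X J => qf Q' (rowbut i N w)).
    by apply: meas_qf => //; exact: mxmeas_cst.
  have := mf measurableT _ (@measurable_itv R `]-oo, (4 * n%:R)^-1]); rewrite setTI.
  by congr measurable; apply/seteqP; split=> w /=; rewrite in_itv.
(* The value of entry [i] at which the completed square vanishes. *)
pose c (w : T) : C := - ((gam^-1)%:C * dot (rowbut i N w) g).
pose A := [set z : T * T | (sqn (X (phi i) z.2 - c z.1) <= 1 / 4)%R].
have mA : measurable (A : set (sigma_of X J * sigma_of X L)).
  have mf : measurable_fun setT (fun z : sigma_of X J * sigma_of X L => sqn (X (phi i) z.2 - c z.1)).
    apply: meas_sqn; apply: cmeasB; first exact: cmeas_coord2.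
    have : cmeas (fun w : sigma_of X J => c w).
      apply: cmeasN; apply: cmeasM; first exact: cmeas_cst.
      have := mxmeasM mbut (mxmeas_cst (sigma_of X J) (adj g)).
      by move=> /(_ 0 0).
    by move=> [h1 h2]; split; [exact: (measurableT_comp h1 measurable_fst) | exact: (measurableT_comp h2 measurable_fst)].
  have := mf measurableT _ (@measurable_itv R `]-oo, (1/4)]); rewrite setTI.
  by congr measurable; apply/seteqP; split=> w /=; rewrite in_itv.
apply: (@le_trans _ _ (P [set w | B w /\ A (w, w)])).
  apply: le_measure; rewrite ?inE.
  - by apply: meas_set_le; apply: meas_qf; [exact: mxmeas_cst|exact: mxmeas_xrowD].
  - by apply: measurableI; [exact: (sigma_of_measurable mB)|exact: (measurable_diagonal mA)].
  move=> w /= hw; split; first by rewrite /B /= -Q'but; exact: le_trans hw.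
  rewrite /A /= /c opprK.
  have : gam^-1 * sqn (dot (xrow X phi w + N) g) <= (4 * n%:R)^-1.
    apply: le_trans hw; have [_ p] := pQ'; have := p (xrow X phi w + N).
    by rewrite qfQ' subr_ge0.
  have -> : dot (xrow X phi w + N) g = gam%:C * (X (phi i) w + (gam^-1)%:C * dot (rowbut i N w) g).
    rewrite (rowbutE i) dotDl dotZl [dot (ev R i) g]dotg dot_qf// -/gam mulrDr addrC mulrC.
    by rewrite mulrA -rmorphM /= divff ?gt_eqF// mul1r.
  rewrite sqnM sqn_real; set s := sqn _ => h.
  have s0 : 0 <= s := sqn_ge0 _.
  have h2 : gam * s <= (4 * n%:R)^-1.
    by apply: le_trans h; rewrite le_eqVlt; apply/orP; left; apply/eqP; field; rewrite gt_eqF.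
  have h3 : n%:R^-1 * s <= (4 * n%:R)^-1 by apply: le_trans h2; exact: ler_wpM2r.
  move: h3; rewrite invfM [4^-1 * _]mulrC ler_pM2l ?invr_gt0//; lra.
apply: (@le_trans _ _ (q%:E * P B)%E).
  have hA (w : T) : B w -> (P [set v | A (w, v)] <= q%:E)%E.
    by move=> _; exact: (Xac (phi i) (c w)).
  exact: (decouple_prod Xind JL mB mA q0 hA).
have PB : (P B <= (q ^+ m)%:E)%E.
  have := IH Q' pQ' (fun v => le_trans (Q'le v) (Q1 v)) tQ'.
  by under eq_set do rewrite Q'but.
by rewrite exprS EFinM; apply: lee_pmul.
Qed.

End trace_lemma.

(** * A multiplicative process with rare bad steps *)

Section engine.
Context d (T : measurableType d) (R : realType) (P : probability T R).
Context d' (T' : measurableType d') (I : eqType) (X : I -> {RV P >-> T'}).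
Hypothesis Xind : mutually_independent X.
Variables (J L : nat -> set I).
Hypothesis JL : forall k, J k `&` L k = set0.
Variables (Y : nat -> T -> R) (H : nat -> T * T -> R).
Hypothesis mY : forall i k, (i <= k)%N -> measurable_fun setT (Y i : sigma_of X (J k) -> R).
Hypothesis mH : forall k, measurable_fun setT (H k : sigma_of X (J k) * sigma_of X (L k) -> R).
Hypothesis YH : forall k w, Y k.+1 w = H k (w, w).
Hypothesis Y_ge0 : forall k w, 0 <= Y k w.

Lemma meas_set_lt d0 (D : measurableType d0) (f g : D -> R) : measurable_fun setT f ->
  measurable_fun setT g -> measurable [set w | (f w < g w)%R].
Proof.
move=> mf mg; have := measurable_funB mf mg.
move=> /(_ measurableT _ (@measurable_itv R `]-oo, 0[)); rewrite setTI.
by congr measurable; apply/seteqP; split=> w /=; rewrite in_itv /= subr_lt0.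
Qed.

Variables (b tau p1 p2 : R) (k0 : nat).
Hypothesis tau0 : 0 < tau.
Hypothesis tau1 : tau <= 1.
Hypothesis b0 : 0 <= b.
Hypothesis b1 : b <= 1.
Hypothesis p10 : 0 <= p1.
Hypothesis p20 : 0 <= p2.
Hypothesis strong : forall k w, (k < k0)%N -> (P [set v | (H k (w, v) < b * Y k w)%R] <= p1%:E)%E.
Hypothesis weak : forall k w, (k < k0)%N -> (P [set v | (H k (w, v) < tau * Y k w)%R] <= p2%:E)%E.

Let mY1 k d0 (D : measurableType d0) (c : R) (f : D -> sigma_of X (J k)) :
  measurable_fun setT f -> measurable_fun setT (fun z => c * Y k (f z)).
Proof.
move=> mf; apply: measurable_funM => //.
exact: (measurableT_comp (mY (leqnn k)) mf).
Qed.

Let mstep k c : measurable ([set z | (H k z < c * Y k z.1)%R] : set (sigma_of X (J k) * sigma_of X (L k))).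
Proof. by apply: meas_set_lt => //; apply: mY1; exact: measurable_fst. Qed.

Let nofail k : set T := [set w | forall i, (i < k)%N -> tau * Y i w <= Y i.+1 w].
Let low k a : set T := [set w | (Y k w < b ^+ k * tau ^+ a * Y 0 w)%R] `&` nofail k.

Let mnofail k : measurable (nofail k : set (sigma_of X (J k))).
Proof.
rewrite (_ : nofail k = \bigcap_(i in [set i | (i < k)%N]) ~` [set w | (Y i.+1 w < tau * Y i w)%R]).
  apply: bigcap_measurableType => i ik; apply: measurableC; apply: meas_set_lt; first exact: mY.
  by apply: measurable_funM => //; apply: mY; exact: ltnW.
apply/seteqP; split => w /= h i ik; first by apply/negP; rewrite -leNgt; exact: h.
by have /negP := h i ik; rewrite -leNgt.
Qed.

Let mlow k a : measurable (low k a : set (sigma_of X (J k))).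
Proof.
apply: measurableI; last exact: mnofail.
by apply: meas_set_lt; [exact: mY|apply: measurable_funM => //; exact: mY].
Qed.

Let fail k : set T := [set w | (Y k.+1 w < tau * Y k w)%R].

Let mfail k : measurable (fail k).
Proof.
have := measurable_diagonal (@mstep k tau).
by suff -> : fail k = [set w | (H k (w, w) < tau * Y k w)%R] by []; apply/seteqP; split => w; rewrite /fail /= YH.
Qed.

(** If level [a + 1] is reached at time [k + 1], then either it was reached at time [k] already, or
    level [a] was and this step lost more than the factor [b], which has conditional probability at
    most [p1]. The bound [(1 + 2 p1)^k 2^-a] satisfies the resulting recursion. *)
Let low_bound k a : (k <= k0)%N -> (P (low k a) <= ((1 + 2 * p1) ^+ k * 2 ^- a)%:E)%E.
Proof.
have mlowT k' a' : measurable (low k' a') by exact: (@sigma_of_measurable _ _ _ _ _ _ _ X (J k') _ (@mlow k' a')).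
elim: k a => [|k IH] a hk.
  suff -> : low 0 a = set0 by rewrite measure0 lee_fin expr0 mul1r invr_ge0 exprn_ge0.
  apply/seteqP; split => // w [/= + _]; rewrite expr0 mul1r ltNge.
  by rewrite ler_piMl// exprn_ile1// ltW.
case: a => [|a].
  rewrite expr0 invr1 mulr1; apply: (@le_trans _ _ 1%E); first exact: probability_le1.
  by rewrite lee_fin exprn_ege1// lerDl mulr_ge0.
pose S := [set w | low k a w /\ (H k (w, w) < b * Y k w)%R].
have sub : low k.+1 a.+1 `<=` low k a.+1 `|` S.
  move=> w [/= h nf].
  have nf' : nofail k w by move=> i ik; apply: nf; exact: ltnW.
  (* A step that keeps the factor [b] cannot create a new level; a worse one still keeps the factor
     [tau], so it uses up one level only. *)
  have [st|st] := ltP (Y k.+1 w) (b * Y k w).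
    right; split; last by rewrite /= -YH.
    split => //=; have wk := nf k (ltnSn k).
    have h2 : tau * Y k w < b ^+ k.+1 * tau ^+ a.+1 * Y 0 w by exact: le_lt_trans h.
    rewrite -(ltr_pM2l tau0); apply: (lt_le_trans h2).
    rewrite exprS [tau ^+ a.+1]exprS.
    have -> : tau * (b ^+ k * tau ^+ a * Y 0 w) = 1 * (b ^+ k * (tau * tau ^+ a) * Y 0 w) by ring.
    rewrite -!mulrA ler_wpM2r//.
    by rewrite !mulr_ge0 ?exprn_ge0// ltW.
  left; split => //=; have bp : 0 < b.
    rewrite lt0r b0 andbT; apply/eqP => bz; move: h; rewrite bz expr0n /= !mul0r.
    by rewrite ltNge Y_ge0.
  rewrite -(ltr_pM2l bp); apply: (le_lt_trans st); apply: (lt_le_trans h).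
  by rewrite exprS !mulrA.
have mS : measurable S.
  by apply: measurableI; [exact: (@mlowT k a)|exact: (measurable_diagonal (@mstep k b))].
apply: (@le_trans _ _ (P (low k a.+1) + P S)%E).
  apply: le_trans (measureU2 _ (@mlowT k a.+1) mS).
  by apply: le_measure; rewrite ?inE//; exact: measurableU.
have PS : (P S <= p1%:E * P (low k a))%E.
  apply: (decouple_prod Xind (JL k) (@mlow k a) (@mstep k b) p10) => w _.
  exact: strong.
apply: (@le_trans _ _ (((1 + 2 * p1) ^+ k * 2 ^- a.+1)%:E + p1%:E * ((1 + 2 * p1) ^+ k * 2 ^- a)%:E)%E).
  apply: leeD; first by apply: IH; exact: ltnW.
  by apply: (le_trans PS); apply: lee_pmul => //; rewrite ?lee_fin//; apply: IH; exact: ltnW.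
rewrite -EFinM -EFinD lee_fin le_eqVlt; apply/orP; left; apply/eqP.
by rewrite !exprS; field; rewrite expf_neq0.
Qed.

(** Steps that lose more than [tau] are excluded by a union bound at the price [k0 * p2]; among the
    others those that lose more than [b] are counted by [low_bound]. *)
Lemma engine a : (P [set w | (Y k0 w < b ^+ k0 * tau ^+ a * Y 0 w)%R] <=
  (k0%:R * p2 + (1 + 2 * p1) ^+ k0 * 2 ^- a)%:E)%E.
Proof.
set E := [set w | _].
have sub : E `<=` \big[setU/set0]_(k < k0) fail k `|` low k0 a.
  move=> w Ew; have [nf|nf] := pselect (nofail k0 w); first by right; split.
  left; move: nf => /existsNP [i /not_implyP [ik /negP]]; rewrite -ltNge => f.
  by rewrite -bigcup_mkord; exists i.
have mlowT := @sigma_of_measurable _ _ _ _ _ _ _ X (J k0) _ (@mlow k0 a).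
have mU : measurable (\big[setU/set0]_(k < k0) fail k).
  by apply: bigsetU_measurable => k _; exact: (@mfail k).
have mE : measurable E.
  apply: (@sigma_of_measurable _ _ _ _ _ _ _ X (J k0)).
  by apply: meas_set_lt; [exact: mY|apply: measurable_funM => //; exact: mY].
apply: (@le_trans _ _ (P (\big[setU/set0]_(k < k0) fail k) + P (low k0 a))%E).
  apply: le_trans (measureU2 _ mU mlowT).
  by apply: le_measure; rewrite ?inE//; exact: measurableU.
rewrite EFinD; apply: leeD; last exact: low_bound.
apply: (le_trans (Boole_inequality P (fun k _ => @mfail k))).
apply: (@le_trans _ _ (\sum_(k < k0) p2%:E)%E).
  apply: lee_sum => k _; rewrite /fail.
  have := decouple_le Xind (JL k) (@mstep k tau) (q := p2%:E).
  rewrite lee_fin => /(_ p20 (fun w => weak w (ltn_ord k))); apply: le_trans.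
  by under eq_set do rewrite YH.
by rewrite sumEFin sumr_const card_ord mulr_natl.
Qed.

End engine.

(** * Revealing the rows one at a time *)

Section gaussian_elimination.
Context d (T : measurableType d) (R : realType) (P : probability T R).
Local Notation C := R[i].
Context (X : nat * nat -> {RV P >-> R[i]}).
Hypothesis Xind : mutually_independent X.
Hypothesis XRe : forall i, Ex P (fun w => Re (X i w)) = 0.
Hypothesis XIm : forall i, Ex P (fun w => Im (X i w)) = 0.
Hypothesis Xsqn : forall i, (\int[P]_w (sqn (X i w))%:E)%E = 1%E.

Definition rowix n (i : nat) (j : 'I_n) : nat * nat := (i, j : nat).
Lemma rowix_inj n i : injective (@rowix n i).
Proof. by move=> j k [] /val_inj. Qed.

Definition upto k : set (nat * nat) := [set p | (p.1 < k)%N].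
Definition atrow k : set (nat * nat) := [set p | p.1 = k].
Lemma upto_atrow k : upto k `&` atrow k = set0.
Proof. by apply/seteqP; split => // p [/= + e]; rewrite /upto /= e ltnn. Qed.

Variables (n : nat) (N : nat -> 'rV[C]_n).
Definition Rw i w : 'rV[C]_n := xrow X (@rowix n i) w + N i.

Lemma mxmeas_Rw (J : set (nat * nat)) i : (forall j, J (i, j)) ->
  mxmeas (Rw i : sigma_of X J -> _).
Proof.
move=> Ji; apply: mxmeasD; last exact: mxmeas_cst.
move=> a j; apply: (eq_cmeas (f := fun w : sigma_of X J => X (rowix i j) w)) => [w|].
  by rewrite mxE.
by apply: cmeas_coord; exact: Ji.
Qed.

Lemma mxmeas_Rw1 J L i : (forall j, J (i, j)) ->
  mxmeas (fun z : sigma_of X J * sigma_of X L => Rw i z.1).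
Proof.
move=> Ji a b; have [h1 h2] := mxmeas_Rw Ji a b.
by split; [exact: (measurableT_comp h1 measurable_fst) | exact: (measurableT_comp h2 measurable_fst)].
Qed.

Lemma mxmeas_Rw2 J L i : (forall j, L (i, j)) ->
  mxmeas (fun z : sigma_of X J * sigma_of X L => Rw i z.2).
Proof.
move=> Li a b; have [h1 h2] := mxmeas_Rw Li a b.
by split; [exact: (measurableT_comp h1 measurable_snd) | exact: (measurableT_comp h2 measurable_snd)].
Qed.

Lemma meas_Yf_rlist d0 (D : measurableType d0) (Ns : seq 'rV[C]_n) (r : nat -> D -> 'rV[C]_n) k :
  (forall i, (i < k)%N -> mxmeas (r i)) -> measurable_fun setT (fun z => Yf Ns (rlist (r ^~ z) k)).
Proof.
case: Ns => [|v Ns] mr; first exact: meas_gram_rlist.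
apply: (eq_meas (f := fun z => trR (Qf Ns (rlist (r ^~ z) k)) + qf (Qf Ns (rlist (r ^~ z) k)) v)).
  by move=> z; rewrite Yf_step.
have mQ := mxmeas_Qf_rlist Ns mr.
by apply: measurable_funD; [exact: meas_trR|apply: meas_qf => //; exact: mxmeas_cst].
Qed.

Variable k0 : nat.
Hypothesis k0n : (k0 <= n)%N.

Definition tailN k := [seq N i | i <- iota k (k0 - k)].
(** The conditional expectation of the squared volume of the first [k0] rows, once [k] of them are
    known. *)
Definition Ye k w : R := Yf (tailN k) (rlist (Rw ^~ w) k).
Definition Qe k w := Qf (tailN k.+1) (rlist (Rw ^~ w) k).

Lemma tailN_cons k : (k < k0)%N -> tailN k = N k :: tailN k.+1.
Proof. by move=> h; rewrite /tailN -[(k0 - k)%N]prednK ?subn_gt0//= -subnS. Qed.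

Lemma YeE k w : (k < k0)%N -> Ye k w = trR (Qe k w) + qf (Qe k w) (N k).
Proof. by move=> h; rewrite /Ye tailN_cons// Yf_step. Qed.

Lemma YeS k w : Ye k.+1 w = qf (Qe k w) (Rw k w).
Proof. by rewrite /Ye /= Yf_Qf. Qed.

(** The number of dimensions still free when the last of the [k0] rows arrives, hence a flatness
    constant valid for every [Qe]. *)
Let m := (n - k0).+1.

Lemma Qe_bound k w v : (k < k0)%N -> m%:R * qf (Qe k w) v <= trR (Qe k w) * nrm2 v.
Proof.
move=> h; apply: Qf_bound; rewrite size_rlist size_map size_iota /m.
by move: k0n h; clear; lia.
Qed.

(** Let [lam = trR (Qe k w) / m], a bound for the eigenvalues. Chebyshev controls the loss of a
    factor [1 - eta]. After division by [lam] the trace is [m], so the form falls below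
    [lam / (4 * n)] with probability at most [q ^+ m]; as its mean is at most [lam * (m + B)], this
    is the loss of the factor [1 / (4 * n * (m + B))]. *)
Lemma engine_rows (eta K q B : R) a : (0 < k0)%N -> 0 < eta -> eta <= 1 -> 0 <= K -> 0 <= q ->
  (forall p, 1 - eta / 2 <= Ex P (trunc (X p) K)) ->
  (forall p (a : C), (P [set w | (sqn (X p w - a) <= 1 / 4)%R] <= q%:E)%E) ->
  0 <= B -> (forall k, (k < k0)%N -> nrm2 (N k) <= B) ->
  (P [set w | (gram (rlist (Rw ^~ w) k0) <
     (1 - eta) ^+ k0 * (4 * n%:R * (m%:R + B)) ^- a * Yf [seq N i | i <- iota 0 k0] [::])%R] <=
   (k0%:R * q ^+ m + (1 + 2 * (4 * (8 + 2 * K) / (eta ^+ 2 * m%:R))) ^+ k0 * 2 ^- a)%:E)%E.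
Proof.
move=> k0p e0 e1 K0 q0 hK hq B0 hB.
have n0 : (0 < n)%N := leq_trans k0p k0n.
have n1 : 1 <= n%:R :> R by rewrite ler1n.
have m1 : 1 <= m%:R :> R by rewrite ler1n.
have m0 : 0 < m%:R :> R by rewrite ltr0n.
set tau := (4 * n%:R * (m%:R + B))^-1.
have tI : 1 <= 4 * n%:R * (m%:R + B) by nra.
have tau0 : 0 < tau by rewrite invr_gt0; apply: lt_le_trans tI.
have tau1 : tau <= 1 by rewrite invf_le1//; apply: lt_le_trans tI.
have p10 : 0 <= 4 * (8 + 2 * K) / (eta ^+ 2 * m%:R).
  by rewrite divr_ge0 ?mulr_ge0 ?addr_ge0 ?mulr_ge0 ?exprn_ge0// ltW.
have b0 : 0 <= 1 - eta by rewrite subr_ge0.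
have b1 : 1 - eta <= 1 by rewrite gerBl ltW.
have trQ0 k w : 0 <= trR (Qe k w) by apply: trR_ge0; exact: Qf_psd.
have Qz k w v : (k < k0)%N -> trR (Qe k w) = 0 -> qf (Qe k w) v = 0.
  move=> kk z; have := Qe_bound w v kk; rewrite z mul0r => h.
  have [_ /(_ v) h2] := Qf_psd (tailN k.+1) (rlist (Rw ^~ w) k).
  have : m%:R * qf (Qe k w) v = 0 by apply/eqP; rewrite eq_le h mulr_ge0.
  by move=> /eqP; rewrite mulf_eq0 gt_eqF//= => /eqP.
have Yz k w : (k < k0)%N -> trR (Qe k w) = 0 -> Ye k w = 0.
  by move=> kk z; rewrite YeE// z Qz// addr0.
have tauE : (4 * n%:R * (m%:R + B)) ^- a = tau ^+ a by rewrite -exprVn.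
rewrite tauE.
pose H k (z : T * T) := qf (Qe k z.1) (Rw k z.2).
have QB k w v : (k < k0)%N -> qf (Qe k w) v <= trR (Qe k w) / m%:R * nrm2 v.
  by move=> kk; rewrite mulrAC ler_pdivlMr// mulrC Qe_bound.
rewrite (_ : [set w | _] = [set w | (Ye k0 w < (1 - eta) ^+ k0 * tau ^+ a * Ye 0 w)%R]); last first.
  by apply/seteqP; split => w; rewrite /Ye /tailN subnn subn0.
apply: (@engine _ _ _ _ _ _ _ X Xind upto atrow upto_atrow Ye H _ _ _ _
  (1 - eta) tau _ (q ^+ m) k0 tau0 tau1 b0 b1 p10 (exprn_ge0 _ q0) _ _ a).
- move=> i k ik; apply: (@meas_Yf_rlist _ _ _ (fun i (w : sigma_of X (upto k)) => Rw i w)) => l li.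
  by apply: mxmeas_Rw => j; rewrite /upto /=; exact: leq_trans ik.
- move=> k; apply: meas_qf; last by apply: mxmeas_Rw2.
  apply: (@mxmeas_Qf_rlist _ _ _ _ _ (fun i (z : sigma_of X (upto k) * sigma_of X (atrow k)) => Rw i z.1)).
  by move=> i ik; apply: mxmeas_Rw1.
- by move=> k w; rewrite YeS.
- by move=> k w; exact: Yf_ge0.
- move=> k w kk; rewrite /H /= YeE//.
  (* With zero trace the whole form vanishes, and the strict inequality describes the empty
     event. *)
  have [z|nz] := eqVneq (trR (Qe k w)) 0.
    rewrite z Qz// addr0 mulr0 (_ : [set v | _] = set0) ?measure0 ?lee_fin//.
    by apply/seteqP; split => // v /=; rewrite Qz// ltxx.
  have tp : 0 < trR (Qe k w) by rewrite lt0r nz trQ0.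
  have := @chebyshev_row _ _ _ _ _ X Xind XRe XIm Xsqn n (@rowix n k) (@rowix_inj n k)
    K (Qe k w) (N k) (trR (Qe k w) / m%:R) K0 (Qf_psd _ _) (fun v => QB k w v kk) eta e0 e1 tp (fun j => hK _).
  move=> h; apply: (le_trans h); rewrite lee_fin le_eqVlt; apply/orP; left; apply/eqP.
  by field; rewrite !gt_eqF.
- move=> k w kk; rewrite /H /= YeE//.
  have [z|nz] := eqVneq (trR (Qe k w)) 0.
    rewrite z Qz// addr0 mulr0 (_ : [set v | _] = set0) ?measure0 ?lee_fin ?exprn_ge0//.
    by apply/seteqP; split => // v /=; rewrite Qz// ltxx.
  have tp : 0 < trR (Qe k w) by rewrite lt0r nz trQ0.
  set lam := trR (Qe k w) / m%:R; have lam0 : 0 < lam by rewrite divr_gt0.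
  pose Q := (lam^-1)%:C *: Qe k w.
  have pQ : psd Q.
    have [h1 h2] := Qf_psd (tailN k.+1) (rlist (Rw ^~ w) k).
    split; first exact: hermZ.
    by move=> v; rewrite qfZ; apply: mulr_ge0; [rewrite invr_ge0 ltW|exact: h2].
  have Q1 v : qf Q v <= nrm2 v by rewrite qfZ mulrC ler_pdivrMr// mulrC QB.
  have tQ : m%:R <= trR Q.
    rewrite trRZ /lam invf_div -mulrA mulVf ?mulr1//.
  have := trace_lemma Xind q0 hq (@rowix_inj n k) (N k) pQ Q1 tQ.
  apply: le_trans; apply: le_measure; rewrite ?inE.
  - apply: meas_set_lt; last exact: measurable_cst.
    by apply: meas_qf; [exact: mxmeas_cst|exact: mxmeas_xrowD].
  - by apply: meas_set_le; apply: meas_qf; [exact: mxmeas_cst|exact: mxmeas_xrowD].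
  move=> v /= h; rewrite qfZ mulrC ler_pdivrMr//; apply: ltW; apply: (lt_le_trans h).
  have hN : trR (Qe k w) + qf (Qe k w) (N k) <= lam * (m%:R + B).
    rewrite mulrDr /lam divfK ?gt_eqF// lerD2l -/lam; apply: (le_trans (QB k w (N k) kk)).
    by rewrite ler_pM2l// hB.
  apply: (@le_trans _ _ (tau * (lam * (m%:R + B)))); first by rewrite ler_pM2l.
  rewrite /tau le_eqVlt; apply/orP; left; apply/eqP; field.
  by rewrite !gt_eqF//; [lra|apply: lt_le_trans n1].
Qed.

End gaussian_elimination.

(** * Approximate eigenvectors and the last rows *)

Section approximate_eigenvectors.
Variable R : realType.
Local Notation C := R[i].

Lemma nrm2D_le n (u v : 'rV[C]_n) : nrm2 (u + v) <= 2 * nrm2 u + 2 * nrm2 v.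
Proof.
rewrite !nrm2E !mulr_sumr -big_split; apply: ler_sum => j _; rewrite mxE.
exact: sqnD2.
Qed.

Lemma nrm2_sum_le n (I : Type) (r : seq I) (F : I -> 'rV[C]_n) :
  nrm2 (\sum_(i <- r) F i) <= 2 ^+ size r * \sum_(i <- r) nrm2 (F i).
Proof.
elim: r => [|a r IH]; first by rewrite !big_nil nrm2_0 mulr0.
rewrite !big_cons /=; apply: (le_trans (nrm2D_le _ _)).
have h : 1 <= 2 ^+ size r :> R by rewrite exprn_ege1// ler1n.
have h1 : nrm2 (F a) <= 2 ^+ size r * nrm2 (F a) by rewrite ler_peMl ?nrm2_ge0.
by rewrite exprS -mulrA mulrDr; move: IH h1; lra.
Qed.

Lemma sqn_sum_le (I : Type) (r : seq I) (F : I -> C) :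
  sqn (\sum_(i <- r) F i) <= 2 ^+ size r * \sum_(i <- r) sqn (F i).
Proof.
elim: r => [|a r IH]; first by rewrite !big_nil sqn0 mulr0.
rewrite !big_cons /=; apply: (@le_trans _ _ (2 * (sqn (F a) + sqn (\sum_(j <- r) F j)))).
  by rewrite mulrDr; exact: sqnD2.
have h : 1 <= 2 ^+ size r :> R by rewrite exprn_ege1// ler1n.
have h1 : sqn (F a) <= 2 ^+ size r * sqn (F a) by rewrite ler_peMl ?sqn_ge0.
by rewrite exprS -mulrA mulrDr; move: IH h1; lra.
Qed.

Let fin1 (l w x y : R) : x <= 4 * l * w -> y <= w -> 2 * w <= 8 * l * w ->
  2 * x + 2 * y <= 16 * (l * w).
Proof. lra. Qed.

Let fin2 (x0 x1 x2 x3 u v : R) : x0 <= 2 * x1 + 2 * (2 * x2 + 2 * x3) ->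
  x1 <= v -> x3 <= u -> x2 <= u -> 16 * u <= x0 -> x0 <= 4 * v.
Proof. lra. Qed.

Section shifts.
Variables (m : nat) (D : 'M[C]_m) (L : R).
Hypothesis L1 : 1 <= L.
Hypothesis DL : forall v : 'rV[C]_m, nrm2 (v *m D) <= L * nrm2 v.

Let L0 : 0 <= L := le_trans ler01 L1.
Let L4 : 0 <= 4 * L := mulr_ge0 (ler0n _ 4) L0.
Let L16 : 0 <= 16 * L := mulr_ge0 (ler0n _ 16) L0.
Let L41 : 1 <= 4 * L. Proof. by move: L1; lra. Qed.
Let L161 : 1 <= 16 * L. Proof. by move: L1; lra. Qed.
Let L416 : 4 * L <= 16 * L. Proof. by move: L1; lra. Qed.
Let L8 : 2 <= 8 * L. Proof. by move: L1; lra. Qed.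
Let L4p : 0 < 4 * L := lt_le_trans ltr01 L41.

Definition ap (z : C) (v : 'rV[C]_m) := v *m D - z *: v.
Definition aps (js : seq C) v := foldr ap v js.

Lemma apD z u v : ap z (u + v) = ap z u + ap z v.
Proof. by rewrite /ap mulmxDl scalerDr opprD addrACA. Qed.
Lemma apZ z a v : ap z (a *: v) = a *: ap z v.
Proof. by rewrite /ap -scalemxAl scalerBr !scalerA [z * a]mulrC. Qed.
Lemma ap0 z : ap z 0 = 0.
Proof. by rewrite /ap mul0mx scaler0 subr0. Qed.
Lemma apC a b v : ap a (ap b v) = ap b (ap a v).
Proof.
rewrite /ap !mulmxBl !scalerBr !scalerA -!scalemxAl [b * a]mulrC -!addrA; congr (_ + _).
by rewrite !opprB !addrA addrC !addrA addrAC.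
Qed.
Lemma apsD js u v : aps js (u + v) = aps js u + aps js v.
Proof. by elim: js => //= j js ->; rewrite apD. Qed.
Lemma apsZ js a v : aps js (a *: v) = a *: aps js v.
Proof. by elim: js => //= j js ->; rewrite apZ. Qed.
Lemma aps0 js : aps js 0 = 0.
Proof. by elim: js => //= j js ->; rewrite ap0. Qed.
Lemma aps_sum js (I : Type) (r : seq I) (Q : pred I) (F : I -> 'rV[C]_m) :
  aps js (\sum_(i <- r | Q i) F i) = \sum_(i <- r | Q i) aps js (F i).
Proof.
elim: r => [|a r IH]; first by rewrite !big_nil aps0.
by rewrite !big_cons; case: ifP => // _; rewrite apsD IH.
Qed.
Lemma aps_ap js z v : aps js (ap z v) = ap z (aps js v).
Proof. by elim: js => //= j js ->; rewrite apC. Qed.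

Lemma nrm2_ap z v : sqn z <= L -> nrm2 (ap z v) <= 4 * L * nrm2 v.
Proof.
move=> zL; rewrite /ap -scaleNr; apply: (le_trans (nrm2D_le _ _)).
rewrite nrm2Z sqnN; have := DL v; have := ler_wpM2r (nrm2_ge0 v) zL; lra.
Qed.

Lemma nrm2_aps js v : all (fun z => sqn z <= L) js -> nrm2 (aps js v) <= (4 * L) ^+ size js * nrm2 v.
Proof.
elim: js => [|j js IH] /=; first by rewrite expr0 mul1r.
move=> /andP[jL aL]; apply: (le_trans (nrm2_ap _ jL)).
by rewrite exprS -[leRHS]mulrA ler_pM2l ?IH.
Qed.

(** The factors commute, so [D - z] may act first and shrinks the vector; the others enlarge it by a
    bounded factor. *)
Lemma nrm2_aps_kill js z v e : all (fun z => sqn z <= L) js -> z \in js ->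
  nrm2 (ap z v) <= e -> nrm2 (aps js v) <= (4 * L) ^+ size js * e.
Proof.
elim: js => // j js IH /andP[jL aL]; rewrite inE => /orP[/eqP <-|zjs] h /=.
  rewrite -aps_ap; apply: (le_trans (nrm2_aps _ aL)).
  apply: ler_pM => //; [by rewrite exprn_ge0|exact: nrm2_ge0|].
  exact: ler_weXn2l.
apply: (le_trans (nrm2_ap _ jL)).
by rewrite exprS -[leRHS]mulrA ler_pM2l ?IH.
Qed.

Lemma sqnB_le (a b : C) : sqn a <= L -> sqn b <= L -> sqn (a - b) <= 4 * L.
Proof. by have := sqnD2 a (- b); rewrite sqnN; lra. Qed.

(** On an approximate eigenvector a polynomial in [D] acts almost as its value at [z]; the induction
    adds the error of one factor. *)
Lemma nrm2_aps_eigen js z v e : all (fun z => sqn z <= L) js -> sqn z <= L -> 0 <= e ->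
  nrm2 (ap z v) <= e ->
  nrm2 (aps js v - (\prod_(j <- js) (z - j)) *: v) <= (16 * L) ^+ size js * e.
Proof.
move=> + zL e0 he; elim: js => [|j js IH] /=.
  by move=> _; rewrite big_nil scale1r subrr nrm2_0 expr0 mul1r.
move=> /andP[jL aL]; rewrite big_cons.
set c := \prod_(j <- js) _; set E := aps js v - c *: v.
have -> : ap j (aps js v) - ((z - j) * c) *: v = ap j E + c *: ap z v.
  rewrite -[aps js v](subrK (c *: v)) -/E apD apZ -addrA; congr (_ + _).
  by rewrite [_ * c]mulrC -scalerA -scalerBr /ap scalerBl opprB addrA subrK.
apply: (le_trans (nrm2D_le _ _)); rewrite nrm2Z.
have hE := IH aL; have h1 := nrm2_ap E jL.
have hc : sqn c <= (4 * L) ^+ size js.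
  rewrite /c; elim: (js) aL => [|j' js' IH'] /=; first by rewrite big_nil sqn1.
  move=> /andP[jL' aL']; rewrite big_cons sqnM exprS.
  by apply: ler_pM; rewrite ?sqn_ge0//; [exact: sqnB_le|exact: IH'].
have hp : (4 * L) ^+ size js <= (16 * L) ^+ size js.
  by apply: lerXn2r; rewrite ?nnegrE.
have h2 : sqn c * nrm2 (ap z v) <= (16 * L) ^+ size js * e.
  by apply: ler_pM; rewrite ?sqn_ge0 ?nrm2_ge0//; exact: le_trans hp.
have h3 : 4 * L * nrm2 E <= 4 * L * ((16 * L) ^+ size js * e) by exact: ler_wpM2l.
have h4 : 0 <= (16 * L) ^+ size js * e by rewrite mulr_ge0// exprn_ge0.
rewrite exprS -mulrA; set W := _ * e in h2 h3 h4 *.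
have h5 : 2 * W <= 8 * L * W by exact: ler_wpM2r.
by rewrite -mulrA; exact: fin1 (le_trans h1 h3) h2 h5.
Qed.

(** For the index [i] with the largest coefficient, apply the product of the [D - z j] with
    [j != i]. It almost kills the other vectors and multiplies [t i] by the product of the
    [z i - z j], whose squared modulus is at least [s ^+ h]. The smallness of [e] keeps the errors
    below a fraction of this term. *)
Lemma eigen_riesz h (z : 'I_h -> C) (t : 'I_h -> 'rV[C]_m) (s e : R) :
  0 < s -> 0 <= e -> s <= 1 -> (forall i, sqn (z i) <= L) ->
  (forall i j, i != j -> s <= sqn (z i - z j)) ->
  (forall i, nrm2 (t i) = 1) -> (forall i, nrm2 (ap (z i) (t i)) <= e) ->
  16 * (16 * L) ^+ h * e <= s ^+ h ->
  forall (c : 'I_h -> C) i, sqn (c i) * (s ^+ h / (4 * (4 * L) ^+ h)) <=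
    nrm2 (\sum_j c j *: t j).
Proof.
move=> s0 e0 s1 zL sp t1 te cond c i0.
have [i _ hi] := @arg_maxP _ R _ i0 xpredT (fun i => sqn (c i)) isT.
set a := sqn (c i).
have a0 : 0 <= a := sqn_ge0 _.
set V := \sum_j _; set nv := nrm2 V.
have p4 : 0 < (4 * L) ^+ h by rewrite exprn_gt0.
apply: (@le_trans _ _ (a * (s ^+ h / (4 * (4 * L) ^+ h)))).
  by apply: ler_wpM2r; [rewrite divr_ge0 ?mulr_ge0 ?exprn_ge0 ?ltW|exact: hi].
rewrite mulrA ler_pdivrMr ?mulr_gt0//.
set js := [seq z j | j <- [seq j <- enum 'I_h | j != i]].
have sjs : (size js <= h)%N.
  by rewrite size_map size_filter; apply: leq_trans (count_size _ _) _; rewrite size_enum_ord.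
have aL : all (fun z => sqn z <= L) js by apply/allP => _ /mapP[j _ ->].
set q := \prod_(j <- js) (z i - j).
have hq : s ^+ h <= sqn q.
  apply: (@le_trans _ _ (s ^+ size js)); first by apply: ler_wiXn2l => //; exact: ltW.
  rewrite /q /js big_map size_map.
  have : all (fun j => j != i) [seq j <- enum 'I_h | j != i] by exact: filter_all.
  elim: [seq j <- enum 'I_h | j != i] => [|j r IH] /=; first by rewrite big_nil sqn1.
  move=> /andP[ji /IH {}IH]; rewrite big_cons sqnM exprS.
  by apply: ler_pM => //; [exact: ltW|by rewrite exprn_ge0// ltW|by apply: sp; rewrite eq_sym].
set E := aps js (t i) - q *: t i.
have hE : nrm2 E <= (16 * L) ^+ h * e.
  apply: (le_trans (nrm2_aps_eigen aL (zL i) e0 (te i))).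
  by apply: ler_wpM2r => //; apply: ler_weXn2l => //.
pose r := [seq j <- enum 'I_h | j != i].
set W := \sum_(j <- r) c j *: aps js (t j).
have hW : nrm2 W <= 4 ^+ h * ((4 * L) ^+ h * e * a).
  apply: (le_trans (nrm2_sum_le _ _)).
  have sr : (size r <= h)%N by move: sjs; rewrite size_map.
  have -> : (4 : R) ^+ h = 2 ^+ h * 2 ^+ h by rewrite -exprMn; congr (_ ^+ _); ring.
  rewrite -mulrA; apply: ler_pM => //.
  - by rewrite sumr_ge0// => j _; exact: nrm2_ge0.
  - by apply: ler_weXn2l => //; rewrite ler1n.
  apply: (@le_trans _ _ (\sum_(j <- r) ((4 * L) ^+ h * e * a))).
    rewrite big_seq [leRHS]big_seq; apply: ler_sum => j jr.
    rewrite nrm2Z mulrC; apply: ler_pM; rewrite ?nrm2_ge0 ?sqn_ge0//; last exact: hi.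
    apply: (@le_trans _ _ ((4 * L) ^+ size js * e)).
      by apply: nrm2_aps_kill (te j) => //; exact: map_f.
    by apply: ler_wpM2r => //; apply: ler_weXn2l => //.
  rewrite big_const_seq count_predT iter_addr_0 -[leLHS]mulr_natl; apply: ler_wpM2r.
    by rewrite !mulr_ge0// ltW.
  rewrite -natrX ler_nat; apply: leq_trans sr _; exact: ltnW (ltn_expl _ _).
have key : (c i * q) *: t i = aps js V - (W + c i *: E).
  rewrite /V (bigD1 i)//= apsD apsZ aps_sum.
  have -> : \sum_(j | j != i) aps js (c j *: t j) = W.
    rewrite /W /r big_filter big_enum_cond /=; apply: eq_bigr => j _.
    exact: apsZ.
  rewrite /E scalerBr scalerA.
  set A := c i *: _; set B := _ *: t i; by rewrite opprD addrA addrK opprB addrC subrK.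
have := congr1 (@nrm2 R m) key; rewrite nrm2Z sqnM t1 mulr1 -/a => hk.
have h1 : a * s ^+ h <= 2 * nrm2 (aps js V) + 2 * (2 * nrm2 W + 2 * (a * nrm2 E)).
  apply: (@le_trans _ _ (a * sqn q)); first exact: ler_wpM2l.
  rewrite hk -scaleN1r; apply: (le_trans (nrm2D_le _ _)); rewrite nrm2Z sqnN sqn1 mul1r lerD2l.
  by rewrite ler_pM2l//; have := nrm2D_le W (c i *: E); rewrite nrm2Z.
have h2 : nrm2 (aps js V) <= (4 * L) ^+ h * nv.
  apply: (le_trans (nrm2_aps _ aL)); apply: ler_wpM2r; first exact: nrm2_ge0.
  by apply: ler_weXn2l => //.
have h3 : a * nrm2 E <= (16 * L) ^+ h * e * a by rewrite mulrC; apply: ler_wpM2r.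
have h4 : 4 ^+ h * ((4 * L) ^+ h * e * a) = (16 * L) ^+ h * e * a.
  have -> : (16 * L) ^+ h = 4 ^+ h * (4 * L) ^+ h by rewrite -exprMn; congr (_ ^+ _); ring.
  by ring.
rewrite h4 in hW.
have h5 := ler_wpM2r a0 cond.
have h6 : 16 * ((16 * L) ^+ h * e * a) <= a * s ^+ h by rewrite [a * _]mulrC !mulrA.
have -> : nv * (4 * (4 * L) ^+ h) = 4 * ((4 * L) ^+ h * nv) by rewrite mulrCA [nv * _]mulrC.
exact: fin2 h1 h2 h3 hW h6.
Qed.

End shifts.

(** A lower Riesz bound: linear independence made quantitative. *)
Definition riesz n (tau : R) (ts : seq 'rV[C]_n) := forall (c : seq C) i, (i < size ts)%N ->
  sqn (nth 0 c i) * tau <= nrm2 (\sum_(j < size ts) nth 0 c j *: nth 0 ts j).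

Lemma riesz_cons n tau (v : 'rV[C]_n) s : riesz tau (v :: s) -> riesz tau s /\ tau <= qf (PJ s) v.
Proof.
move=> h; split.
  move=> c i hi; have := h (0 :: c) i.+1 hi; rewrite /= big_ord_recl /= scale0r add0r.
  by [].
have [c ->] := qfPJ_attained s v.
have := h (1 :: [seq - x | x <- mkseq (nth 0 c) (size s)]) 0 isT; rewrite /= sqn1 mul1r.
rewrite big_ord_recl /= scale1r.
have -> : v + \sum_(i < size s) nth 0 [seq - x | x <- mkseq (nth 0 c) (size s)] i *: nth 0 s i =
  v - \sum_(i < size s) nth 0 c i *: nth 0 s i; last by [].
congr (_ + _); rewrite -sumrN; apply: eq_bigr => i _.
by rewrite (nth_map 0) ?size_mkseq// nth_mkseq// scaleNr.
Qed.

Lemma riesz_gram n tau (s : seq 'rV[C]_n) : 0 < tau -> riesz tau s -> gram s != 0.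
Proof.
move=> t0; elim: s => [|v s IH] h /=; first exact: oner_neq0.
have [h1 h2] := riesz_cons h.
by rewrite mulf_neq0 ?IH// gt_eqF//; exact: lt_le_trans h2.
Qed.

(** Let [u] be the projection of [v] on the span. Then [|u|^2] is the sum of the conjugate
    coefficients of [u] times the products of [v] with the vectors of [s], and the Riesz bound makes
    each squared coefficient at most [|u|^2 / tau]; one factor [|u|^2] cancels. *)
Lemma riesz_proj n tau (s : seq 'rV[C]_n) (v : 'rV[C]_n) e : 0 < tau -> 0 <= e -> riesz tau s ->
  (forall u, u \in s -> sqn (dot v u) <= e) -> qf (1%:M - PJ s) v <= 4 ^+ size s * e / tau.
Proof.
move=> t0 e0 hr he; have pQ := isprojC (PJ_proj s).
have [c hc] := span_PJ s v.
rewrite (qf_proj _ pQ); set u := v *m _.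
have uE : u = \sum_(i < size s) nth 0 c i *: nth 0 s i by rewrite -hc /u mulmxBr mulmx1.
set N := nrm2 u; have N0 : 0 <= N := nrm2_ge0 _.
have hN : N%:C = \sum_(i < size s) (nth 0 c i)^*%R * dot v (nth 0 s i).
  rewrite /N -dot_nrm2; have -> : dot u u = dot v u.
    by rewrite {1}/u dot_adj; case: pQ => -> hi; rewrite /u -mulmxA hi.
  rewrite uE /dot adj_sum mulmx_sumr summxE; apply: eq_bigr => i _.
  by rewrite -![(_ *m adj _) 0 0]/(dot _ _) dotZr.
have hci i : (i < size s)%N -> sqn (nth 0 c i) <= N / tau.
  by move=> hi; rewrite ler_pdivlMr//; have := hr c i hi; rewrite -uE.
have : N ^+ 2 <= 4 ^+ size s * (N / tau * e).
  rewrite -sqn_real hN; apply: (le_trans (sqn_sum_le _ _)).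
  have -> : (4 : R) ^+ size s = 2 ^+ size s * 2 ^+ size s by rewrite -exprMn; congr (_ ^+ _); ring.
  have -> : size (index_enum ('I_(size s))) = size s by rewrite -[RHS]card_ord cardT enumT.
  rewrite -mulrA ler_pM2l ?exprn_gt0//.
  apply: (@le_trans _ _ (\sum_(i < size s) (N / tau * e))).
    apply: ler_sum => i _; rewrite sqnM sqn_conj.
    by apply: ler_pM; rewrite ?sqn_ge0 ?hci//; apply: he; exact: mem_nth.
  rewrite sumr_const card_ord -[leLHS]mulr_natl; apply: ler_wpM2r.
    by rewrite mulr_ge0// divr_ge0// ltW.
  by rewrite -natrX ler_nat; exact: ltnW (ltn_expl _ _).
have [->|Nn] := eqVneq N 0; first by rewrite divr_ge0 ?mulr_ge0 ?exprn_ge0// ltW.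
have Np : 0 < N by rewrite lt0r Nn.
move=> h; rewrite -(ler_pM2r Np) -expr2; apply: (le_trans h).
by rewrite le_eqVlt; apply/orP; left; apply/eqP; ring.
Qed.

End approximate_eigenvectors.

(** * Several points that fail at the same row *)

Section drops.
Variable R : realType.
Local Notation C := R[i].
Variable n : nat.
Implicit Types (u v x : 'rV[C]_n).

Definition unitrow (i : nat) : 'rV[C]_n := rw 1%:M i.

Lemma unitrow_ord (i : 'I_n) : unitrow i = ev R i.
Proof. by rewrite /unitrow rw_ord row1. Qed.

(** The [k] rows and the last [n - k - 1] unit vectors are fewer than [n], so some direction is
    orthogonal to all of them. The support condition is what makes the conjugate of [u] an
    approximate eigenvector of a matrix built from [k + 1] rows. *)
Lemma unit_normal (r : nat -> 'rV[C]_n) k : (k < n)%N -> exists u, [/\ nrm2 u = 1,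
  forall i, (i < k)%N -> dot (r i) u = 0 & forall j : 'I_n, (k < j)%N -> u 0 j = 0].
Proof.
move=> kn; pose s := rlist r k ++ [seq unitrow j | j <- iota k.+1 (n - k.+1)].
have sz : (size s < n)%N.
  by rewrite size_cat size_rlist size_map size_iota; move: kn; clear; lia.
have [a ha] : exists a, 0 < qf (PJ s) (ev R a).
  apply: contrapT => /forallNP h.
  have : trR (PJ s) <= 0.
    by rewrite trRE sumr_le0// => a _; rewrite leNgt; exact/negP/h.
  apply/negP; rewrite -ltNge; apply: lt_le_trans (trR_PJ_ge s).
  by rewrite subr_gt0 ltr_nat.
set v := ev R a *m PJ s; set b := qf (PJ s) (ev R a).
have nv : nrm2 v = b by rewrite /b (qf_proj _ (PJ_proj s)).
exists (((Num.sqrt b)^-1)%:C *: v); split.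
- rewrite nrm2Z nv sqn_real exprVn sqr_sqrtr; last exact: ltW.
  by rewrite mulVf// gt_eqF.
- move=> i ik; rewrite dotZr /v PJ_perp ?mulr0// mem_cat; apply/orP; left.
  by apply/mem_rlist; exists i.
move=> j kj; rewrite mxE.
have /(congr1 Num.conj) : dot (unitrow j) v = 0.
  rewrite /v PJ_perp// mem_cat; apply/orP; right; apply: map_f.
  by rewrite mem_iota; have := ltn_ord j; move: kj kn; clear; lia.
rewrite unitrow_ord dotE (bigD1 j)//= big1 ?addr0; last first.
  by move=> l lj; rewrite [ev R j 0 l]mxE (negbTE lj) andbF mul0r.
by rewrite [ev R j 0 j]mxE !eqxx mul1r conjCK conjC0 => ->; rewrite mulr0.
Qed.

Definition shiftrow (z : C) (i : nat) (x : 'rV[C]_n) := x - z *: unitrow i.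
Definition shiftlist (r : nat -> 'rV[C]_n) z k := rlist (fun i => shiftrow z i (r i)) k.

(** The columns of [D] are the rows [r] and [x0] without shift, followed by zeros. The conjugate of
    the unit normal for [z i] solves the eigenvector equation of [D] at [z i] exactly, except in
    coordinate [k], where the squared error is at most [dl]. As [D] is the same for all [i],
    separation of the points makes the normals robustly independent. *)
Lemma drop_core (r : nat -> 'rV[C]_n) k h (z : 'I_h -> C) (x0 : 'rV[C]_n) (L s dl : R) :
  (k < n)%N -> 1 <= L -> 0 < s -> s <= 1 -> 0 <= dl ->
  (forall i, sqn (z i) <= L) -> (forall i j, i != j -> s <= sqn (z i - z j)) ->
  \sum_(i < k) nrm2 (r i) + nrm2 x0 <= L ->
  (forall i, qf (PJ (shiftlist r (z i) k)) (shiftrow (z i) k x0) <= dl) ->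
  16 * (16 * L) ^+ h * dl <= s ^+ h ->
  exists us : seq 'rV[C]_n, [/\ size us = h, riesz (s ^+ h / (4 * (4 * L) ^+ h)) us &
    forall u, u \in us -> exists i : 'I_h, forall x,
      sqn (dot (shiftrow (z i) k x) u) <= qf (PJ (shiftlist r (z i) k)) (shiftrow (z i) k x)].
Proof.
move=> kn L1 s0 s1 d0 zL sep rL hx cond.
have /choice[u hu] i := unit_normal (fun l => shiftrow (z i) l (r l)) kn.
have fu i x : sqn (dot x (u i)) <= qf (PJ (shiftlist r (z i) k)) x.
  have [u1 uk _] := hu i; rewrite -[leRHS]mulr1 -u1; apply: qfPJ_functional => y.
  by move=> /mem_rlist[l lk ->]; exact: uk.
pose t i : 'rV[C]_n := map_mx Num.conj (u i).
pose a (i : 'I_n) : 'rV[C]_n := if (i < k)%N then r i else if (i == k :> nat) then x0 else 0.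
pose D : 'M[C]_n := \matrix_(j, i) a i 0 j.
have tD i v : (v *m D) 0 i = dot (a i) (map_mx Num.conj v).
  rewrite mxE dotE; apply: eq_bigr => j _; rewrite !mxE conjCK mulrC //.
have sa : \sum_i nrm2 (a i) <= L.
  apply: le_trans rL.
  have -> : \sum_(i < k) nrm2 (r i) = \sum_(i < n | (i < k)%N) nrm2 (r i).
    by rewrite (big_ord_widen _ (fun i => nrm2 (r i)) (ltnW kn)).
  rewrite (bigID (fun i : 'I_n => (i < k)%N)) /=; apply: lerD.
    by rewrite le_eqVlt; apply/orP; left; apply/eqP; apply: eq_bigr => i ik; rewrite /a ik.
  rewrite (bigD1 (Ordinal kn)) /= ?ltnn// big1 ?addr0; first by rewrite /a /= ltnn eqxx.
  move=> i /andP[ik ne]; rewrite /a (negbTE ik).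
  case: eqP => [e|_]; last exact: nrm2_0.
  by move: ne; rewrite -val_eqE /= e eqxx.
have DL v : nrm2 (v *m D) <= L * nrm2 v.
  rewrite [leLHS]nrm2E; apply: (@le_trans _ _ (\sum_i nrm2 (a i) * nrm2 v)).
    apply: ler_sum => i _; rewrite tD; apply: (le_trans (dot_cs _ _)).
    by rewrite le_eqVlt; apply/orP; left; apply/eqP; congr (_ * _);
      rewrite !nrm2E; apply: eq_bigr => j _; rewrite mxE sqn_conj.
  by rewrite -mulr_suml; apply: ler_wpM2r => //; exact: nrm2_ge0.
have t1 i : nrm2 (t i) = 1.
  have [<- _ _] := hu i; rewrite !nrm2E; apply: eq_bigr => j _; by rewrite mxE sqn_conj.
have ct i : map_mx Num.conj (t i) = u i by apply/rowP => j; rewrite !mxE conjCK.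
have te i : nrm2 (ap D (z i) (t i)) <= dl.
  apply: le_trans (hx i); apply: le_trans (fu i _).
  have [_ uk uz] := hu i.
  have E j : ap D (z i) (t i) 0 j = if j == Ordinal kn then dot (shiftrow (z i) k x0) (u i) else 0.
    have de : dot (unitrow j) (u i) = t i 0 j.
      rewrite unitrow_ord dotE (bigD1 j)//= big1 ?addr0; last first.
        by move=> l lj; rewrite [ev R j 0 l]mxE (negbTE lj) andbF mul0r.
      by rewrite [ev R j 0 j]mxE !eqxx mul1r mxE.
    rewrite /ap; have -> : (t i *m D - z i *: t i) 0 j = (t i *m D) 0 j - z i * t i 0 j by rewrite !mxE.
    rewrite tD ct -de -dotZl -dotNl -dotDl /a.
    case: ltngtP => [jk|jk|jk].
    - have -> : (j == Ordinal kn) = false by rewrite -val_eqE /= ltn_eqF.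
      exact: (uk j jk).
    - have -> : (j == Ordinal kn) = false by rewrite -val_eqE /= gtn_eqF.
      by rewrite dotDl dot0l dotNl dotZl de mxE uz// conjC0 mulr0 subrr.
    have -> : (j == Ordinal kn) = true by rewrite -val_eqE /= jk eqxx.
    by rewrite /shiftrow jk.
  rewrite nrm2E (bigD1 (Ordinal kn))//= big1 ?addr0; first by rewrite E eqxx.
  by move=> j jk; rewrite E (negbTE jk) sqn0.
have RZ := @eigen_riesz R n D L L1 DL h z t s dl s0 d0 s1 zL sep t1 te cond.
exists [seq u i | i <- enum 'I_h]; split; first by rewrite size_map size_enum_ord.
  move=> c i; rewrite size_map size_enum_ord => ih.
  have := RZ (fun j => (c`_j)^*%R) (Ordinal ih); rewrite sqn_conj => hz; apply: (le_trans hz).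
  rewrite le_eqVlt; apply/orP; left; apply/eqP.
  rewrite !nrm2E; apply: eq_bigr => j _; rewrite !summxE -[RHS]sqn_conj.
  rewrite rmorph_sum; congr sqn; apply: eq_bigr => l _.
  by rewrite (nth_map l) ?size_enum_ord// nth_ord_enum !mxE rmorphM.
by move=> _ /mapP[i _ ->]; exists i => x; exact: fu.
Qed.

End drops.

Section drop_probability.
Context d (T : measurableType d) (R : realType) (P : probability T R).
Local Notation C := R[i].
Context (X : nat * nat -> {RV P >-> R[i]}).
Hypothesis Xind : mutually_independent X.
Variable q : R.
Hypothesis q0 : 0 <= q.
Hypothesis Xac : forall i (a : C), (P [set w | (sqn (X i w - a) <= 1 / 4)%R] <= q%:E)%E.
Variables (n : nat) (M : 'M[C]_n).

Definition Ra (i : nat) (w : T) : 'rV[C]_n := Rw X (rw M) i w.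

(** A reference outcome [v0] in the event supplies the vectors of [drop_core], which are thereby
    deterministic. For any other outcome of the event the shifts cancel in the difference of the two
    rows, so this difference is almost orthogonal to [h] robustly independent vectors; the small
    ball estimate on their span gives [q ^+ h]. *)
Lemma drop_probability k (r : nat -> 'rV[C]_n) h (z : 'I_h -> C) (L s dl : R) (A : set T) :
  (k < n)%N -> 1 <= L -> 0 < s -> s <= 1 -> 0 <= dl ->
  (forall i, sqn (z i) <= L) -> (forall i j, i != j -> s <= sqn (z i - z j)) ->
  64 * n%:R * (16 * L) ^+ h * dl <= s ^+ h -> measurable A ->
  (forall v, A v -> \sum_(i < k) nrm2 (r i) + nrm2 (Ra k v) <= L) ->
  (forall v, A v -> forall i, qf (PJ (shiftlist r (z i) k)) (shiftrow (z i) k (Ra k v)) <= dl) ->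
  (P A <= (q ^+ h)%:E)%E.
Proof.
move=> kn L1 s0 s1 d0 zL sep cond mA hA1 hA2.
have [[v0 Av0]|] := pselect (exists v, A v); last first.
  move=> /forallNP h0; rewrite (_ : A = set0) ?measure0 ?lee_fin ?exprn_ge0//.
  by apply/seteqP; split => // v /h0.
have n1 : 1 <= n%:R :> R by rewrite ler1n (leq_trans _ kn).
have U0 : 0 <= (16 * L) ^+ h * dl by rewrite mulr_ge0// exprn_ge0//; lra.
have cond1 : 16 * (16 * L) ^+ h * dl <= s ^+ h.
  by apply: le_trans cond; rewrite -!mulrA; move: U0; set U := _ * dl; nra.
have [us [szu ru fu]] := drop_core kn L1 s0 s1 d0 zL sep (hA1 _ Av0) (hA2 _ Av0) cond1.
set tau := _ / _ in ru.
have L4 : 0 < 4 * L by lra.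
have t0 : 0 < tau by rewrite divr_gt0 ?mulr_gt0 ?exprn_gt0.
have pQ := isprojC (PJ_proj us).
have tQ : h%:R <= trR (1%:M - PJ us).
  rewrite trRD trRN trR1 trR_PJ_eq; last exact: riesz_gram ru.
  by rewrite szu opprB addrC subrK.
have := trace_lemma Xind q0 Xac (@rowix_inj n k) (- xrow X (@rowix n k) v0) (proj_psd pQ)
  (fun v => qf_proj_le v pQ) tQ.
apply: le_trans; apply: le_measure; rewrite ?inE//.
  by apply: meas_set_le; apply: meas_qf; [exact: mxmeas_cst|exact: mxmeas_xrowD].
move=> v Av /=; apply: (@le_trans _ _ (4 ^+ size us * (4 * dl) / tau)).
  apply: riesz_proj => //; first by rewrite mulr_ge0.
  move=> u uu; have [i hi] := fu u uu.
  have -> : xrow X (@rowix n k) v - xrow X (@rowix n k) v0 =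
     shiftrow (z i) k (Ra k v) - shiftrow (z i) k (Ra k v0).
    rewrite /shiftrow opprB addrA subrK /Ra /Rw opprD addrACA.
    by rewrite [rw M k - _]subrr addr0.
  rewrite dotDl dotNl; apply: (le_trans (sqnD2 _ _)); rewrite sqnN.
  have h1 := le_trans (hi (Ra k v)) (hA2 _ Av i).
  have h2 := le_trans (hi (Ra k v0)) (hA2 _ Av0 i).
  by move: h1 h2; set a := sqn _; set b := sqn _; lra.
rewrite szu /tau invf_div.
have s0' : 0 < s ^+ h by rewrite exprn_gt0.
have -> : 4 ^+ h * (4 * dl) * (4 * (4 * L) ^+ h / s ^+ h) = 16 * ((16 * L) ^+ h * dl) / s ^+ h.
  have -> : (16 * L) ^+ h = 4 ^+ h * (4 * L) ^+ h by rewrite -exprMn; congr (_ ^+ _); ring.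
  by field; rewrite gt_eqF.
rewrite ler_pdivrMr// [leRHS]mulrC ler_pdivlMr; last by rewrite mulr_gt0//; lra.
apply: le_trans cond; rewrite le_eqVlt; apply/orP; left; apply/eqP; ring.
Qed.

End drop_probability.

(** Pigeonhole on [m] disjoint blocks of length [h]. *)
Lemma sparse_chunk (A : eqType) (a : pred A) h m (s : seq A) : (m * h <= size s)%N ->
  (count a s < m)%N -> exists2 c, (c < m)%N & all (predC a) (take h (drop (c * h) s)).
Proof.
elim: m s => // m IH s hs hc.
have [h1|h1] := boolP (has a (take h s)); last first.
  by exists 0%N => //; rewrite mul0n drop0 all_predC.
have [c cm hcc] : exists2 c, (c < m)%N & all (predC a) (take h (drop (c * h) (drop h s))).
  apply: IH; first by rewrite size_drop; move: hs; clear; rewrite mulSn; lia.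
  move: hc; rewrite -{1}(cat_take_drop h s) count_cat; move: h1; rewrite has_count.
  by clear; lia.
by exists c.+1 => //; rewrite mulSn addnC -drop_drop.
Qed.

Lemma measurable_all d (D : measurableType d) (A : Type) (a : D -> A -> bool) (t : seq A) :
  (forall i, measurable [set x | a x i]) -> measurable [set x | all (predC (a x)) t].
Proof.
move=> ma; elim: t => [|i t IH] /=.
  by rewrite (_ : [set _ | _] = setT)//; apply/seteqP; split.
rewrite (_ : [set _ | _] = ~` [set v | a v i] `&` [set v | all (predC (a v)) t]).
  by apply: measurableI => //; exact: measurableC.
by apply/seteqP; split => v /= => [/andP[/negP ? ?]|[/negP ? ?]]; [split|apply/andP; split].
Qed.

(** * One of many points survives the last rows *)

Section survival.
Context d (T : measurableType d) (R : realType) (P : probability T R).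
Local Notation C := R[i].
Context (X : nat * nat -> {RV P >-> R[i]}).
Hypothesis Xind : mutually_independent X.
Variable q : R.
Hypothesis q0 : 0 <= q.
Hypothesis Xac : forall i (a : C), (P [set w | (sqn (X i w - a) <= 1 / 4)%R] <= q%:E)%E.
Variables (n : nat) (M : 'M[C]_n) (k0 : nat).
Hypothesis k0n : (k0 <= n)%N.
Variables (G h : nat) (z : 'I_G -> C) (g : 'I_G -> R) (L s dl : R).
Hypothesis L1 : 1 <= L.
Hypothesis s0 : 0 < s.
Hypothesis s1 : s <= 1.
Hypothesis d0 : 0 < dl.
Hypothesis g0 : forall i, 0 < g i.
Hypothesis zL : forall i, sqn (z i) <= L.
Hypothesis sep : forall i j, i != j -> s <= sqn (z i - z j).
Hypothesis cond : 64 * n%:R * (16 * L) ^+ h * dl <= s ^+ h.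

Let Ra := Ra X M.

Definition zgram k i w := gram (shiftlist (Ra ^~ w) (z i) k).
(** From row [k0] on, a point may lose the factor [dl] at each row. *)
Let thr k i := g i * dl ^+ (k - k0).
Definition survivors k w := [seq i <- enum 'I_G | thr k i <= zgram k i w].
Let cnt k w := size (survivors k w).
Let hs k w := \sum_(i < k) nrm2 (Ra i w).

Let zg1 k i (z' : T * T) :=
  qf (PJ (shiftlist (Ra ^~ z'.1) (z i) k)) (shiftrow (z i) k (Ra k z'.2)) * zgram k i z'.1.
Let cnt1 k z' := size [seq i <- enum 'I_G | thr k.+1 i <= zg1 k i z'].
Let hs1 k (z' : T * T) := hs k z'.1 + nrm2 (Ra k z'.2).

Let mRa k i : (i < k)%N -> mxmeas (Ra i : sigma_of X (upto k) -> _).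
Proof. by move=> ik; apply: mxmeas_Rw. Qed.

Let mshift k i j : (j < k)%N -> mxmeas (fun w : sigma_of X (upto k) => shiftrow (z i) j (Ra j w)).
Proof. by move=> jk; apply: mxmeasB; [exact: mRa|exact: mxmeas_cst]. Qed.

Let mzgram k i : measurable_fun setT (zgram k i : sigma_of X (upto k) -> R).
Proof.
apply: (@meas_gram_rlist _ _ _ _ (fun j (w : sigma_of X (upto k)) => shiftrow (z i) j (Ra j w))).
by move=> j jk; exact: mshift.
Qed.

Let mnrm2 d1 (D : measurableType d1) (f : D -> 'rV[C]_n) : mxmeas f ->
  measurable_fun setT (fun x => nrm2 (f x)).
Proof.
move=> mf; apply: (eq_meas (f := fun x => qf 1%:M (f x))) => [x|]; first by rewrite qf1.
by apply: meas_qf => //; exact: mxmeas_cst.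
Qed.

Let mhs k : measurable_fun setT (hs k : sigma_of X (upto k) -> R).
Proof. by apply: meas_sum => i; apply: mnrm2; exact: mRa. Qed.

Let mzg1 k i : measurable_fun setT (zg1 k i : sigma_of X (upto k) * sigma_of X (atrow k) -> R).
Proof.
apply: measurable_funM; last exact: (measurableT_comp (@mzgram k i) measurable_fst).
apply: meas_qf.
  apply: (@mxmeas_PJ_rlist _ _ _ _ (fun j (w : sigma_of X (upto k) * sigma_of X (atrow k)) =>
    shiftrow (z i) j (Ra j w.1))) => j jk.
  by apply: mxmeasB; [exact: mxmeas_Rw1|exact: mxmeas_cst].
by apply: mxmeasB; [exact: mxmeas_Rw2|exact: mxmeas_cst].
Qed.

Let mhs1 k : measurable_fun setT (hs1 k : sigma_of X (upto k) * sigma_of X (atrow k) -> R).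
Proof.
apply: measurable_funD; first exact: (measurableT_comp (@mhs k) measurable_fst).
by apply: mnrm2; exact: mxmeas_Rw2.
Qed.

Let mcount d1 (D : measurableType d1) (f : 'I_G -> D -> R) (t : 'I_G -> R) m :
  (forall i, measurable_fun setT (f i)) ->
  measurable [set x | (m <= size [seq i <- enum 'I_G | (t i <= f i x)%R])%N].
Proof.
move=> mf; pose F x : R := \sum_(i <- enum 'I_G) \1_[set y | t i <= f i y] x.
have FE x : F x = (size [seq i <- enum 'I_G | t i <= f i x])%:R.
  rewrite size_filter -sum1_count natr_sum [RHS]big_mkcond /=; apply: eq_bigr => i _.
  rewrite indicE; case: ifP => hi; first by rewrite mem_set.
  by rewrite memNset//= hi.
have mF : measurable_fun setT F.
  apply: meas_sum => i; apply: measurable_indic.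
  have := mf i measurableT _ (@measurable_itv R `[t i, +oo[); rewrite setTI.
  by congr measurable; apply/seteqP; split=> w /=; rewrite in_itv /= andbT.
have := mF measurableT _ (@measurable_itv R `[m%:R, +oo[); rewrite setTI.
by congr measurable; apply/seteqP; split=> w /=; rewrite in_itv /= andbT FE ler_nat.
Qed.

Let mlt d1 (D : measurableType d1) (f : D -> R) : measurable_fun setT f ->
  measurable [set x | f x <= L].
Proof.
move=> mf; have := mf measurableT _ (@measurable_itv R `]-oo, L]); rewrite setTI.
by congr measurable; apply/seteqP; split=> w /=; rewrite in_itv.
Qed.

(** With [m * h] survivors before a row and fewer than [m] after it, some block of [h] survivors
    fails as a whole. There are [m] blocks, all determined by the past, and each fails with
    conditional probability at most [q ^+ h]. *)
Let step k : (k0 <= k)%N -> (k < n)%N ->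
  (P [set w | (h ^ (n - k) <= cnt k w)%N /\ ((cnt k.+1 w < h ^ (n - k.+1))%N /\ (hs k.+1 w <= L)%R)] <=
   ((h ^ (n - k.+1))%:R * q ^+ h)%:E)%E.
Proof.
move=> kk0 kn; set m := (h ^ (n - k.+1))%N.
have hm : (h ^ (n - k) = m * h)%N by rewrite /m -expnSr -subSn.
pose B := [set w | (h ^ (n - k) <= cnt k w)%N].
pose A := [set z' | (cnt1 k z' < m)%N /\ hs1 k z' <= L].
have mB : measurable (B : set (sigma_of X (upto k))).
  exact: (mcount (D := sigma_of X (upto k)) _ _ (fun i => @mzgram k i)).
have mA : measurable (A : set (sigma_of X (upto k) * sigma_of X (atrow k))).
  have -> : A = ~` [set z' | (m <= cnt1 k z')%N] `&` [set z' | hs1 k z' <= L].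
    by apply/seteqP; split => z'; rewrite /A /= ltnNge => -[/negP].
  apply: measurableI; last exact: mlt (@mhs1 k).
  by apply: measurableC; exact: (mcount _ _ (fun i => @mzg1 k i)).
have Q0 : 0 <= m%:R * q ^+ h by rewrite mulr_ge0 ?exprn_ge0.
have hA w : B w -> (P [set v | A (w, v)] <= (m%:R * q ^+ h)%:E)%E.
  move=> Bw; pose al := survivors k w.
  pose a v i := thr k.+1 i <= zg1 k i (w, v).
  pose Ac c := [set v | all (predC (a v)) (take h (drop (c * h) al)) /\ hs1 k (w, v) <= L].
  have mAc c : measurable (Ac c).
    apply: measurableI; last first.
      exact: (measurable_section (X := X) (J := upto k) (K := atrow k)
        (A := [set z' | hs1 k z' <= L]) w (mlt (@mhs1 k))).
    apply: measurable_all => i.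
    apply: (measurable_section (X := X) (J := upto k) (K := atrow k)
      (A := [set z' | thr k.+1 i <= zg1 k i z']) w).
    have := @mzg1 k i measurableT _ (@measurable_itv R `[thr k.+1 i, +oo[); rewrite setTI.
    by congr measurable; apply/seteqP; split=> z' /=; rewrite in_itv /= andbT.
  have sub : [set v | A (w, v)] `<=` \big[setU/set0]_(c < m) Ac c.
    move=> v [/= h1 h2]; rewrite -bigcup_mkord.
    have [c cm hc] : exists2 c, (c < m)%N & all (predC (a v)) (take h (drop (c * h) al)).
      apply: sparse_chunk; first by rewrite -hm.
      apply: leq_ltn_trans h1; rewrite /cnt1 -size_filter /al /survivors.
      rewrite -filter_predI !size_filter; apply: sub_count => i /= /andP[].
      by [].
    by exists c.
  apply: (@le_trans _ _ (P (\big[setU/set0]_(c < m) Ac c))).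
    apply: le_measure; rewrite ?inE//; last exact: bigsetU_measurable.
    exact: (measurable_section w mA).
  apply: (le_trans (Boole_inequality P (fun c _ => mAc c))).
  rewrite EFinM -[m%:R%:E]/(m%:R%:E); have -> : (m%:R%:E * (q ^+ h)%:E = \sum_(c < m) (q ^+ h)%:E)%E.
    by rewrite sumEFin sumr_const card_ord -EFinM mulr_natl.
  apply: lee_sum => c _.
  set t := take h (drop (c * h) al).
  have st : size t = h.
    rewrite /t size_take_min size_drop; apply/minn_idPl.
    have : (m * h <= size al)%N by rewrite -hm.
    by have := ltn_ord c; move: (nat_of_ord c) => c'; clear => cm; nia.
  have ut : uniq t by apply: take_uniq; apply: drop_uniq; apply: filter_uniq; exact: enum_uniq.
  have alt i : i \in t -> thr k i <= zgram k i w.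
    by move=> /mem_take /mem_drop; rewrite mem_filter => /andP[].
  have [h00|h00] := posnP h.
    rewrite h00 expr0; exact: probability_le1.
  have [i0 _] : exists i0 : 'I_G, i0 \in t 
    by move: h00; rewrite -st; case: (t) => // i0 t' _; exists i0; rewrite inE eqxx.
  pose zt (j : 'I_h) := z (nth i0 t j).
  have tj (j : 'I_h) : nth i0 t j \in t by rewrite mem_nth// st.
  apply: (drop_probability Xind q0 Xac (M := M) (r := fun l => Ra l w) (z := zt) (L := L) (s := s) kn L1 s0 s1 (ltW d0) _ _ cond (mAc c)).
  - by move=> j; exact: zL.
  - by move=> i j ij; apply: sep; rewrite nth_uniq// st.
  - by move=> v [_].
  move=> v [/= /allP hv _] j.
  have := hv _ (tj j); rewrite /a /= -ltNge /zg1 /= => hlt.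
  have hal := alt _ (tj j).
  have tp : 0 < thr k (nth i0 t j) by rewrite mulr_gt0 ?exprn_gt0.
  have gp : 0 < zgram k (nth i0 t j) w by apply: lt_le_trans hal.
  (* A survivor that drops below the next threshold has lost more than the factor [dl], and this
     factor is the squared distance of the new row to the span of the previous ones. *)
  rewrite -(ler_pM2r gp); apply/ltW; apply: (lt_le_trans hlt).
  rewrite /thr subSn// exprS mulrCA; apply: ler_wpM2l hal; exact: ltW.
have E w : hs k.+1 w = hs1 k (w, w) by rewrite /hs big_ord_recr.
under eq_set do rewrite E.
apply: (le_trans (decouple_prod Xind (upto_atrow k) mB mA Q0 hA)).
rewrite -[leRHS]mule1; apply: lee_pmul => //; rewrite ?lee_fin//.
by apply: probability_le1; exact: (@sigma_of_measurable _ _ _ _ _ _ _ X (upto k) _ mB).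
Qed.

Let mT k (A : set T) : measurable (A : set (sigma_of X (upto k))) -> measurable A.
Proof. exact: (@sigma_of_measurable _ _ _ _ _ _ _ X (upto k)). Qed.

Let mcntT k m : measurable [set w : T | (m <= cnt k w)%N].
Proof.
apply: (@mT k); exact: (mcount (D := sigma_of X (upto k)) _ _ (fun i => @mzgram k i)).
Qed.

(** By Markov's inequality for the number of dead points, half of the [2 * h ^ (n - k0)] points are
    alive at row [k0] outside an event of probability [2 * pe]. Each later row may then divide their
    number by [h], which leaves one at the end. The term [pL] pays for rows of large norm. *)
Lemma survival (pe pL : R) : 0 <= pe -> (0 < h)%N -> G = (2 * h ^ (n - k0))%N ->
  (forall i, P [set w | (zgram k0 i w < g i)%R] <= pe%:E)%E ->
  (P [set w | (L < \sum_(i < n) nrm2 (Ra i w))%R] <= pL%:E)%E ->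
  (P [set w | ~ exists i, (g i * dl ^+ (n - k0) <= zgram n i w)%R] <=
   (2 * pe + pL + (n - k0)%:R * ((h ^ (n - k0))%:R * q ^+ h))%:E)%E.
Proof.
move=> pe0 hp GE hpe hpL; set H := (h ^ (n - k0))%N.
have Hp : 0 < H%:R :> R by rewrite ltr0n expn_gt0 hp.
pose dead i := [set w | zgram k0 i w < g i].
have mdead i : measurable (dead i) by apply: (@mT k0); apply: meas_set_lt.
pose nd w : R := \sum_(i <- enum 'I_G) \1_(dead i) w.
have ndE w : nd w = (G - cnt k0 w)%:R.
  have -> : (G - cnt k0 w)%N = size [seq i <- enum 'I_G | zgram k0 i w < g i].
    have e := count_predC (fun i => thr k0 i <= zgram k0 i w) (enum 'I_G).
    rewrite size_enum_ord -!size_filter in e.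
    rewrite -[X in (X - _)%N]e /cnt /survivors addKn.
    congr size; apply: eq_filter => i; rewrite /= /thr subnn mulr1.
    by rewrite -ltNge.
  rewrite size_filter -sum1_count natr_sum [RHS]big_mkcond /=; apply: eq_bigr => i _.
  rewrite indicE; case: ifP => hi; first by rewrite mem_set.
  by rewrite memNset//= /dead /= hi.
have mnd : measurable_fun setT nd by apply: meas_sum => i; exact: measurable_indic.
pose D := [set w | H%:R <= nd w].
have mD : measurable D.
  have := mnd measurableT _ (@measurable_itv R `[H%:R, +oo[); rewrite setTI.
  by congr measurable; apply/seteqP; split=> w /=; rewrite in_itv /= andbT.
have PD : (P D <= (2 * pe)%:E)%E.
  have h1 : (H%:R%:E * P D <= \int[P]_w (nd w)%:E)%E.
    have -> : (H%:R%:E * P D = \int[P]_w (H%:R * \1_D w)%:E)%E.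
      under eq_integral do rewrite EFinM.
      rewrite ge0_integralZl//; first by rewrite integral_indic// setIT.
      by apply/measurable_EFinP; exact: measurable_indic.
    apply: ge0_le_integral => //.
    - by apply/measurable_EFinP; apply: measurable_funM => //; exact: measurable_indic.
    - exact/measurable_EFinP.
    move=> w _; rewrite lee_fin indicE; have [hD|hD] := pselect (D w).
      by rewrite mem_set// mulr1.
    by rewrite memNset// mulr0 ndE.
  have h2 : (\int[P]_w (nd w)%:E <= (H%:R * (2 * pe))%:E)%E.
    under eq_integral do rewrite /nd -sumEFin.
    rewrite ge0_integral_sum//; last first.
      by move=> i; apply/measurable_EFinP; exact: measurable_indic.
    apply: (@le_trans _ _ (\sum_(i <- enum 'I_G) pe%:E)%E).
      by apply: lee_sum => i _; rewrite integral_indic// setIT; exact: hpe.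
    by rewrite sumEFin big_const_seq count_predT size_enum_ord iter_addr_0 lee_fin GE -/H
      -[_ *+ _]mulr_natl natrM mulrA [H%:R * 2]mulrC.
  have := le_trans h1 h2; have -> : P D = (fine (P D))%:E by rewrite fineK// fin_num_measure.
  by rewrite -EFinM !lee_fin ler_pM2l.
pose E j := [set w | (h ^ (n - (k0 + j)) <= cnt (k0 + j) w)%N /\
   ((cnt (k0 + j).+1 w < h ^ (n - (k0 + j).+1))%N /\ hs (k0 + j).+1 w <= L)].
have mhsT k : measurable_fun setT (hs k : T -> R).
  move=> _ Y mY; rewrite setTI; apply: (@mT k).
  by have := @mhs k measurableT Y mY; rewrite setTI.
have mlow k m : measurable [set w | (cnt k w < m)%N].
  rewrite (_ : [set _ | _] = ~` [set w | (m <= cnt k w)%N]); first exact: measurableC.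
  by apply/seteqP; split => w /=; rewrite ltnNge => /negP.
have mE j : measurable (E j).
  apply: measurableI; first exact: mcntT.
  apply: measurableI; first exact: mlow.
  exact: mlt.
pose B := [set w | L < hs n w].
have mB : measurable B.
  rewrite (_ : B = ~` [set w | hs n w <= L]); first by apply: measurableC; exact: mlt.
  by apply/seteqP; split => w; rewrite /B /= ltNge => /negP.
set F := [set w | ~ _].
have FE : F = [set w | (cnt n w < 1)%N].
  apply/seteqP; split => w; rewrite /F /= /cnt ltnS leqn0 size_eq0 /survivors.
    move=> h1; rewrite -[_ == _]negbK -has_filter; apply/hasPn => i _; apply/negP => h2.
    by apply: h1; exists i.
  rewrite -[_ == _]negbK -has_filter => /hasPn h1 [i hi].
  by have := h1 i; rewrite mem_enum inE => /(_ isT); rewrite /= /thr hi.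
have sub : F `<=` (D `|` B) `|` \big[setU/set0]_(j < n - k0) E j.
  move=> w Fw; have [Dw|nD] := pselect (D w); first by left; left.
  have [Bw|nB] := pselect (B w); first by left; right.
  right; rewrite -bigcup_mkord.
  have good0 : (h ^ (n - (k0 + 0)) <= cnt (k0 + 0) w)%N.
    rewrite addn0 leqNgt; apply/negP => lt; apply: nD; rewrite /D /= ndE ler_nat GE -/H.
    by move: lt; rewrite -/H; move: (cnt _ _) => c; clear; lia.
  have badn : ~~ (h ^ (n - (k0 + (n - k0))) <= cnt (k0 + (n - k0)) w)%N.
    by rewrite subnKC// subnn -ltnNge; move: Fw; rewrite FE.
  have [j jn /andP[g1 g2]] : exists2 j, (j < n - k0)%N &
     (h ^ (n - (k0 + j)) <= cnt (k0 + j) w)%N && ~~ (h ^ (n - (k0 + j.+1)) <= cnt (k0 + j.+1) w)%N.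
    elim: (n - k0)%N badn => [|l IH] bad; first by move: bad; rewrite good0.
    have [gl|bl] := boolP (h ^ (n - (k0 + l)) <= cnt (k0 + l) w)%N.
      by exists l => //; rewrite gl bad.
    by have [j jl hj] := IH bl; exists j => //; exact: ltnW.
  exists j => //; split => //; move: g2; rewrite addnS -ltnNge => g2; split => //.
  have : hs n w <= L by move/negP: nB; rewrite /B /= -leNgt.
  apply: le_trans; rewrite /hs.
  rewrite (big_ord_widen n (fun i => nrm2 (Ra i w))); last by move: jn; clear; lia.
  rewrite [leRHS](bigID (fun i : 'I_n => (i < (k0 + j).+1)%N)) /= lerDl.
  by apply: sumr_ge0 => i _; exact: nrm2_ge0.
have mEs : measurable (\big[setU/set0]_(j < n - k0) E j) by exact: bigsetU_measurable.
have mDB : measurable (D `|` B) by exact: measurableU.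
apply: (@le_trans _ _ (P D + P B + P (\big[setU/set0]_(j < n - k0) E j))%E).
  apply: (@le_trans _ _ (P (D `|` B) + P (\big[setU/set0]_(j < n - k0) E j))%E).
    apply: le_trans (measureU2 _ mDB mEs); apply: le_measure; rewrite ?inE//.
      by rewrite FE; exact: mlow.
    exact: measurableU.
  by apply: leeD => //; exact: measureU2.
rewrite 2!EFinD; apply: leeD; first exact: leeD.
apply: (le_trans (Boole_inequality P (fun j _ => mE j))).
apply: (@le_trans _ _ (\sum_(j < n - k0) (H%:R * q ^+ h)%:E)%E); last first.
  by rewrite sumEFin sumr_const card_ord -[_ *+ (n - k0)]mulr_natl.
apply: lee_sum => j _; apply: (le_trans (step _ _)); first exact: leq_addr.
  by have := ltn_ord j; move: (nat_of_ord j) => j'; move: k0n; clear; lia.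
rewrite lee_fin; apply: ler_wpM2r; first exact: exprn_ge0.
rewrite ler_nat /H leq_pexp2l//; move: (nat_of_ord j) => j'; clear; lia.
Qed.

End survival.

(** * Borel-Cantelli with a quadratic rate *)

Section borel_cantelli.
Context d (T : measurableType d) (R : realType) (P : probability T R).

Lemma borel_cantelli (E : nat -> set T) (K : R) n0 :
  (forall n, (n0 <= n)%N -> measurable (E n)) ->
  (forall n, (n0 <= n)%N -> P (E n) <= (K / (n.+1)%:R ^+ 2)%:E)%E ->
  {ae P, forall w, exists N, forall n, (N <= n)%N -> ~ E n w}.
Proof.
move=> mE hE; pose F n := if (n0 <= n)%N then E n else set0.
have mF n : measurable (F n) by rewrite /F; case: ifP => // h; exact: mE.
pose K' := Num.max K 0.
(* The bound [1 / (n+1)^2 <= 2 (1 / (n+1) - 1 / (n+2))] makes the series telescope. *)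
have hF n : (P (F n) <= (2 * K' * ((n.+1)%:R^-1 - (n.+2)%:R^-1))%:E)%E.
  have n1 : 0 < (n.+1)%:R :> R by rewrite ltr0n.
  have n2 : 0 < (n.+2)%:R :> R by rewrite ltr0n.
  have e : (n.+1)%:R^-1 - (n.+2)%:R^-1 = (n.+1)%:R^-1 * (n.+2)%:R^-1 :> R.
    have -> : (n.+2)%:R = (n.+1)%:R + 1 :> R by rewrite -natr1.
    by field; rewrite gt_eqF//= gt_eqF// natr1.
  have K0 : 0 <= K' by rewrite le_max lexx orbT.
  rewrite /F; case: ifP => h; last first.
    by rewrite measure0 lee_fin e !mulr_ge0// invr_ge0 ltW.
  apply: (le_trans (hE n h)); rewrite lee_fin e.
  apply: (@le_trans _ _ (K' / (n.+1)%:R ^+ 2)).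
    by apply: ler_wpM2r; [rewrite invr_ge0 exprn_ge0|rewrite /K' le_max lexx].
  rewrite -mulrA -mulrCA; apply: ler_wpM2l => //.
  rewrite expr2 invfM mulrCA; apply: ler_wpM2l; first by rewrite invr_ge0 ltW.
  have e2 : (n.+2)%:R = (n.+1)%:R + 1 :> R by rewrite natr1.
  rewrite ler_pdivlMr// mulrC ler_pdivrMr// e2.
  have h1 : 1 <= (n.+1)%:R :> R by rewrite ler1n.
  by move: h1; lra.
have tele N : \sum_(0 <= i < N) ((i.+1)%:R^-1 - (i.+2)%:R^-1) = 1 - (N.+1)%:R^-1 :> R.
  elim: N => [|N IH]; first by rewrite big_geq// invr1 subrr.
  by rewrite big_nat_recr//= IH addrA subrK.
have hs : (\sum_(0 <= n <oo) P (F n) < +oo)%E.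
  apply: (@le_lt_trans _ _ (2 * K')%:E); last exact: ltry.
  apply: lime_le; first by apply: is_cvg_nneseries => n _ _.
  near=> N.
  apply: (@le_trans _ _ (\sum_(0 <= n < N) (2 * K' * ((n.+1)%:R^-1 - (n.+2)%:R^-1))%:E)%E).
    by apply: lee_sum => n _; exact: hF.
  rewrite sumEFin lee_fin -mulr_sumr ler_piMr//.
    by rewrite mulr_ge0// le_max lexx orbT.
  by rewrite tele gerBl invr_ge0.
have h0 := lim_sup_set_cvg0 mF hs.
exists (lim_sup_set F); split => //.
  apply: bigcapT_measurable => k; apply: bigcup_measurable => j _; exact: mF.
move=> w /= hw k _; apply: contrapT => nk; apply: hw.
exists (maxn k n0) => n; rewrite geq_max => /andP[kn n0n] En; apply: nk.
by exists n => //; rewrite /F n0n.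
Unshelve. all: by end_near. Qed.

End borel_cantelli.

(** * Elementary bounds for exponentials and factorials *)

Section estimates.
Variable R : realType.
Implicit Types (x y t : R).

Lemma natX_le_expR (p k : nat) : ((p.+1) ^ k)%:R <= expR (k%:R * p%:R) :> R.
Proof.
rewrite natrX expRM_natl; apply: lerXn2r; rewrite ?nnegrE ?expR_ge0//.
by rewrite -natr1 addrC expR_ge1Dx.
Qed.

(** A crude form of Stirling's formula. With [a = j + 1] the inductive step is
    [(1 - 1 / (a + 1)) ^ (a + 1) <= 1 / e]. *)
Lemma expR_le_powfact (j : nat) : expR j%:R <= (j.+1)%:R ^+ j.+1 / j`!%:R :> R.
Proof.
elim: j => [|j IH]; first by rewrite expR0 expr1 fact0 divr1.
set a := (j.+1)%:R : R in IH *.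
have a0 : 0 < a by rewrite ltr0n.
have e2 : (j.+2)%:R = a + 1 :> R by rewrite natr1.
have a1 : 0 < a + 1 by rewrite addr_gt0.
have step : expR 1 * a ^+ j.+2 <= (a + 1) ^+ j.+2.
  have h : a / (a + 1) <= expR (- (a + 1)^-1).
    apply: le_trans (expR_ge1Dx _); rewrite le_eqVlt; apply/orP; left; apply/eqP.
    by field; lra.
  have h2 : (a / (a + 1)) ^+ j.+2 <= expR (- 1).
    apply: (@le_trans _ _ (expR (- (a + 1)^-1) ^+ j.+2)).
      by apply: lerXn2r; rewrite ?nnegrE ?expR_ge0// divr_ge0; lra.
    by rewrite -expRM_natl ler_expR e2 mulrN mulfV// gt_eqF.
  move: h2; rewrite expr_div_n ler_pdivrMr ?exprn_gt0//.
  by rewrite expRN mulrC ler_pdivlMr ?expR_gt0// mulrC.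
have f0 : 0 < j`!%:R :> R by rewrite ltr0n fact_gt0.
have aE : a = 1 + j%:R by rewrite /a -natr1 addrC.
rewrite {1}aE expRD; apply: (@le_trans _ _ (expR 1 * (a ^+ j.+1 / j`!%:R))).
  by rewrite ler_pM2l ?expR_gt0.
rewrite e2 factS natrM -/a.
have -> : expR 1 * (a ^+ j.+1 / j`!%:R) = expR 1 * a ^+ j.+2 / (a * j`!%:R).
  by rewrite [a ^+ j.+2]exprS; field; rewrite !gt_eqF.
by rewrite ler_wpM2r// invr_ge0 mulr_ge0 ?ltW.
Qed.

Lemma powfact_lower (j : nat) : expR (j%:R - 1) <= (j.+1)%:R * (j%:R ^+ j / j`!%:R) :> R.
Proof.
case: j => [|j].
  by rewrite sub0r expr0 fact0 divr1 mulr1 -[leRHS]expR0 ler_expR; lra.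
have -> : (j.+1)%:R - 1 = j%:R :> R by rewrite -natr1 addrK.
apply: (le_trans (expR_le_powfact j)); rewrite factS natrM.
have f0 : 0 < j`!%:R :> R by rewrite ltr0n fact_gt0.
have a0 : 0 < (j.+1)%:R :> R by rewrite ltr0n.
have p0 : 0 <= (j.+1)%:R ^+ j.+1 / j`!%:R :> R by rewrite divr_ge0 ?exprn_ge0 ?ltW.
have -> : (j.+2)%:R * ((j.+1)%:R ^+ j.+1 / ((j.+1)%:R * j`!%:R)) =
  (j.+2)%:R / (j.+1)%:R * ((j.+1)%:R ^+ j.+1 / j`!%:R) :> R.
  by field; rewrite !gt_eqF.
by apply: ler_peMl => //; rewrite ler_pdivlMr// mul1r ler_nat.
Qed.

Lemma fact_lower (n : nat) : n%:R ^+ n <= expR n%:R * n`!%:R :> R.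
Proof.
have f0 : 0 < n`!%:R :> R by rewrite ltr0n fact_gt0.
rewrite -ler_pdivrMr//; apply: le_trans (exp_partial n.+1 (ler0n R n)).
rewrite big_ord_recr /= lerDr; apply: sumr_ge0 => i _.
by rewrite divr_ge0 ?exprn_ge0.
Qed.

Lemma expR_le_1B t : 0 <= t -> t <= 1 / 2 -> expR (- (2 * t)) <= 1 - t.
Proof.
move=> t0 t1; have h := expR_ge1Dx (2 * t).
rewrite expRN -[leLHS]div1r ler_pdivrMr ?expR_gt0//.
apply: (@le_trans _ _ ((1 - t) * (1 + 2 * t))); first nra.
by apply: ler_wpM2l => //; lra.
Qed.

End estimates.

(** * Moments of the entries *)

Section moments.
Context d (T : measurableType d) (R : realType) (P : probability T R).
Local Notation C := R[i].
Variable x : nat -> nat -> {RV P >-> R[i]}.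
Hypothesis x_ident : identically_distributed (fun ij : nat * nat => x ij.1 ij.2).
Hypothesis x_mean : forall i j, Cexpectation P (x i j) = 0.
Hypothesis x_var : forall i j, ('E_P[fun w => (normc (x i j w) ^+ 2)%R] = 1)%E.

Definition entry (ij : nat * nat) := x ij.1 ij.2.

Lemma entry_Re ij : Ex P (fun w => Re (entry ij w)) = 0.
Proof. by have := congr1 (@complex.Re R) (x_mean ij.1 ij.2). Qed.

Lemma entry_Im ij : Ex P (fun w => Im (entry ij w)) = 0.
Proof. by have := congr1 (@complex.Im R) (x_mean ij.1 ij.2). Qed.

Lemma entry_sqn ij : (\int[P]_w (sqn (entry ij w))%:E)%E = 1%E.
Proof.
rewrite -(x_var ij.1 ij.2) unlock; apply: eq_integral => w _.
by rewrite normcE2.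
Qed.

Lemma int_entry ij (f : C -> \bar R) : measurable_fun setT f -> (forall z, 0 <= f z)%E ->
  (\int[P]_w f (entry ij w) = \int[P]_w f (entry (0, 0)%N w))%E.
Proof.
move=> mf f0; rewrite -(ge0_integral_distribution (entry ij) mf f0).
rewrite -(ge0_integral_distribution (entry (0, 0)%N) mf f0).
by apply: eq_measure_integral => A mA _; exact: x_ident.
Qed.

Lemma meas_trunc_id (K : R) : measurable_fun [set: C] (fun z => Num.min (sqn z) K).
Proof.
by apply: measurable_minr; [apply: meas_sqn; exact: cmeas_id|exact: measurable_cst].
Qed.

(** Monotone convergence for one entry; identical distribution lets the same [K] serve for all. *)
Lemma truncated_variance (eta : R) : 0 < eta -> exists2 K : R, 1 <= K &
  forall ij, 1 - eta <= Ex P (trunc (entry ij) K).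
Proof.
move=> e0; set xi := entry (0, 0)%N.
have mxi : cmeas xi by apply: cmeas_rv; exact: measurable_funPT.
pose g (n : nat) w := (trunc xi n%:R w)%:E.
have mg n : measurable_fun setT (g n).
  by apply/measurable_EFinP; apply: measurable_minr; [exact: meas_sqn|exact: measurable_cst].
have g0 n w : setT w -> (0 <= g n w)%E.
  by move=> _; rewrite lee_fin le_min sqn_ge0 ler0n.
have gnd w : setT w -> {homo g^~ w : n m / (n <= m)%N >-> (n <= m)%E}.
  by move=> _ n m nm; rewrite lee_fin /trunc; apply: le_min2; rewrite ?ler_nat.
have := cvg_monotone_convergence (mu := P) measurableT mg g0 gnd.
have -> : (\int[P]_w limn (g^~ w))%E = 1%E.
  rewrite -(entry_sqn (0, 0)%N); apply: eq_integral => w _.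
  apply/cvg_lim => //; apply: cvg_near_cst.
  near=> n; rewrite /g /trunc; congr EFin; apply/min_idPl.
  apply: ltW; near: n; exact: nbhs_infty_gtr.
move=> /fine_cvgP[_ cv].
have [n [n1 hn]] : exists n : nat, (0 < n)%N /\ 1 - eta < Ex P (trunc xi n%:R).
  have : \forall n \near \oo, 1 - eta < fine (\int[P]_w g n w)%E.
    by apply: (cvgr_gt _ cv); rewrite gtrBl.
  move=> [N _ hN]; exists N.+1; split => //.
  exact: (hN N.+1 (leqnSn N)).
exists n%:R; first by rewrite ler1n.
move=> ij; apply: ltW; apply: (lt_le_trans hn); rewrite le_eqVlt; apply/orP; left; apply/eqP.
rewrite /Ex /Rintegral; congr fine; symmetry.
have := @int_entry ij (fun z => (Num.min (sqn z) n%:R)%:E); apply.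
  by apply/measurable_EFinP; exact: meas_trunc_id.
by move=> z; rewrite lee_fin le_min sqn_ge0 ler0n.
Unshelve. all: by end_near. Qed.

End moments.

(** * Lower bound for the determinant *)

Section lower_estimates.
Variable R : realType.
Local Notation C := R[i].

Lemma ffact_ge (a n j : nat) (th : R) : (j <= a)%N -> (a <= n)%N -> 0 <= th -> th <= 1 ->
  (n - a)%:R <= th * (n - j)%:R -> (1 - th) ^+ j * (n ^_ j)%:R <= (a ^_ j)%:R :> R.
Proof.
move=> ja an th0 th1 h.
have E m : (j <= m)%N -> (m ^_ j)%:R = \prod_(i < j) ((m - i)%:R : R).
  by move=> jm; rewrite ffact_prod natr_prod.
rewrite !E ?(leq_trans ja)// -[j in _ ^+ j]card_ord -prodr_const -big_split /=.
apply: ler_prod => i _; rewrite mulr_ge0 ?subr_ge0//=.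
have ij := ltn_ord i; rewrite !natrB; try lia.
move: h; rewrite !natrB//; last exact: leq_trans an.
move=> h; have h2 : th * (n%:R - j%:R) <= th * (n%:R - i%:R).
  by rewrite ler_wpM2l// lerB// ler_nat ltnW.
by move: h h2; lra.
Qed.

(** The factor [sqn w ^+ j / j!] is about [exp j] when [j] is the integer part of [sqn w]. The bound
    on [q + \rank M] asks for [n - j] comparable to [n], which means a point inside the open
    disc. *)
Lemma Y_lower_exp (n q j : nat) (M : 'M[C]_n) (w : C) (th : R) :
  (0 < n)%N -> (q <= n)%N -> (j <= n)%N -> 0 <= th -> th <= 1 / 2 -> j%:R <= sqn w ->
  (q + \rank M)%:R <= th * (n - j)%:R ->
  expR (j%:R - 1) / (j.+1)%:R * expR (- (2 * th * n%:R)) * (n`!%:R / n%:R ^+ q) <=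
  Yf [seq rw (M - w%:M) i | i <- iota 0 (n - q)] [::].
Proof.
move=> n0 qn jn th0 th1 jw hq; set r := \rank M in hq *.
have qr : (q + r <= n - j)%N.
  rewrite -(ler_nat R); apply: (le_trans hq); apply: ler_piMl => //.
  by move: th1; lra.
have jk : (j <= n - q)%N by move: qr jn; clear; lia.
have := Y_lower M w (leq_subr q n) jk; rewrite -/r; set Y := Yf _ _ => hY.
have j0 : 0 < j`!%:R :> R by rewrite ltr0n fact_gt0.
set A := ((_ ^_ j)%:R : R) in hY; set B := ((_ ^_ (n - q - j))%:R : R) in hY.
have A0 : 0 <= A by []. have B0 : 0 <= B by [].
have hA : (1 - th) ^+ j * (n ^_ j)%:R <= A.
  apply: ffact_ge => //.
  - by move: qr jn; clear; lia.
  - by clear; lia.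
  - by apply: (le_trans th1); clear; lra.
  by have -> : (n - (n - q - r) = q + r)%N by move: qr; clear; lia.
have hB : n`!%:R / n%:R ^+ q <= (n ^_ j)%:R * B.
  have nq0 : 0 < n%:R ^+ q :> R by rewrite exprn_gt0// ltr0n.
  rewrite ler_pdivrMr// -natrX /B -!natrM ler_nat -(ffact_fact jn).
  have e : ((n - j) - (n - q - j) = q)%N by move: jk qn; clear; lia.
  have h : (n - q - j <= n - j)%N by clear; lia.
  rewrite -(ffact_fact h) e mulnA leq_mul2l; apply/orP; right.
  elim: (q) qn => // l IH ln; rewrite factS expnS; apply: leq_mul => //; apply: IH; exact: ltnW.
have h1 : expR (j%:R - 1) / (j.+1)%:R <= sqn w ^+ j / j`!%:R.
  rewrite ler_pdivrMr ?ltr0n// mulrC; apply: (le_trans (powfact_lower R j)).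
  apply: ler_wpM2l => //; apply: ler_wpM2r; first by rewrite invr_ge0 ltW.
  by apply: lerXn2r; rewrite ?nnegrE ?sqn_ge0.
have h2 : expR (- (2 * th * n%:R)) <= (1 - th) ^+ j.
  have t1 : 0 <= 1 - th by move: th1; lra.
  apply: (@le_trans _ _ ((1 - th) ^+ n)); last by apply: ler_wiXn2l => //; move: th0; lra.
  rewrite mulrC -mulrN expRM_natl; apply: lerXn2r; rewrite ?nnegrE ?expR_ge0//.
  exact: expR_le_1B.
have e0 : 0 <= expR (j%:R - 1) / (j.+1)%:R :> R by rewrite divr_ge0 ?expR_ge0.
have x0 : 0 <= sqn w ^+ j / j`!%:R by rewrite divr_ge0 ?exprn_ge0 ?sqn_ge0.
apply: (@le_trans _ _ ((sqn w ^+ j / j`!%:R) * (1 - th) ^+ j * ((n ^_ j)%:R * B))).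
  apply: ler_pM => //.
  by apply: ler_pM => //; exact: expR_ge0.
apply: (@le_trans _ _ ((sqn w ^+ j / j`!%:R) * (A * B))).
  by rewrite -mulrA; apply: ler_wpM2l => //; rewrite mulrA; exact: ler_wpM2r.
by rewrite mulrAC ler_pdivrMr// [Y * _]mulrC mulrA.
Qed.

Lemma le_expR (x : R) : x <= expR x.
Proof. by apply: le_trans (expR_ge1Dx x); lra. Qed.

Lemma two_le_expR1 : 2 <= expR 1 :> R.
Proof. by have := expR_ge1Dx (1 : R). Qed.

Lemma two_pow_le h : 2 ^+ h <= expR h%:R :> R.
Proof.
rewrite -[h%:R]mulr1 expRM_natl; apply: lerXn2r; rewrite ?nnegrE ?expR_ge0//.
exact: two_le_expR1.
Qed.

Lemma two_pow_ge h : expR (h%:R / 2) <= 2 ^+ h :> R.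
Proof.
rewrite expRM_natl; apply: lerXn2r; rewrite ?nnegrE ?expR_ge0//.
have := expR_ge1Dx (- 2^-1 : R); rewrite expRN => h1.
have e0 : 0 < expR 2^-1 :> R := expR_gt0 _.
rewrite -[leLHS]invrK -[leRHS]invrK lef_pV2 ?posrE ?invr_gt0//.
by apply: le_trans h1; lra.
Qed.

(** Supplies the parameter [p]. The exponent 16 is chosen because the last rows cost
    [exp (O (p ^ 14))], which is then [exp (O (n / p))]. *)
Lemma root16 n : exists p, (p ^ 16 <= n < p.+1 ^ 16)%N.
Proof.
elim: n => [|n [p /andP[h1 h2]]]; first by exists 0%N.
have [h|h] := ltnP n.+1 (p.+1 ^ 16); first by exists p; rewrite h (leq_trans h1).
exists p.+1; rewrite h /=; apply: (@leq_ltn_trans (p.+1 ^ 16)) => //.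
by rewrite ltn_exp2r.
Qed.

Section constants.
Variables (p n : nat).
Local Notation PR := (p%:R : R).
Hypothesis pn : (p ^ 16 <= n)%N.
Hypothesis np : (n < p.+1 ^ 16)%N.
Hypothesis p4 : (4 <= p)%N.

Lemma np_le : (n.+1)%:R <= expR (16 * PR).
Proof. by apply: le_trans (natX_le_expR R p 16); rewrite ler_nat. Qed.

Lemma n_le : n%:R <= expR (16 * PR).
Proof. by apply: le_trans np_le; rewrite ler_nat. Qed.

Let P1 : 1 <= PR. Proof. by rewrite ler1n; apply: leq_trans p4. Qed.
Let P0 : 0 < PR := lt_le_trans ltr01 P1.

Lemma pow_le_n k : (k <= 15)%N -> PR ^+ k <= n%:R / PR.
Proof.
move=> hk; rewrite ler_pdivlMr// -exprSr.
apply: (@le_trans _ _ (PR ^+ 16)); first exact: ler_weXn2l.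
by rewrite -natrX ler_nat.
Qed.

Lemma powp k l : (k <= l)%N -> PR ^+ k <= PR ^+ l.
Proof. exact: ler_weXn2l. Qed.

(** Since [G <= exp (7 p^3)], the separation to the power [h] costs [O (p^9)] in the exponent, and
    [(16 * 2 ^+ h) ^+ h] costs about [h^2 = p^12]. Over [p^2] rows this becomes [O (p^14)]. *)
Lemma dl_lower (r0 : R) : 0 < r0 ->
  forall (h : nat) (G dl : R), h = (p ^ 6)%N -> G = (2 * h ^ (p ^ 2))%:R ->
  dl = (r0 ^+ 2 / G ^+ 2) ^+ h / (64 * n%:R * (16 * 2 ^+ h) ^+ h) ->
  expR (- ((41 + 2 / r0) * (n%:R / PR))) <= dl ^+ (p ^ 2).
Proof.
move=> r0p h G dl hN GN dlN.
have hE : h%:R = PR ^+ 6 by rewrite hN natrX.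
have h0 : 0 < h%:R :> R by rewrite hE exprn_gt0.
have n0 : 0 < n%:R :> R.
  by rewrite ltr0n; apply: leq_trans pn; rewrite expn_gt0; apply/orP; left; apply: leq_trans p4.
have GE : G = 2 * h%:R ^+ (p ^ 2) by rewrite GN natrM natrX.
have G0 : 0 < G by rewrite GE mulr_gt0// exprn_gt0.
have Gle : G <= expR (7 * PR ^+ 3).
  apply: (@le_trans _ _ (expR 1 * expR (6 * PR ^+ 3))).
    rewrite GE; apply: ler_pM => //; [exact: two_le_expR1|].
    have -> : 6 * PR ^+ 3 = (p ^ 2)%:R * (6 * PR) by rewrite natrX; ring.
    rewrite expRM_natl; apply: lerXn2r; rewrite ?nnegrE ?expR_ge0//.
    rewrite hE expRM_natl; apply: lerXn2r; rewrite ?nnegrE ?expR_ge0//.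
    exact: le_expR.
  rewrite -expRD ler_expR; have := powp (leq0n 3); rewrite expr0; lra.
have r0e : expR (- (1 / r0)) <= r0.
  rewrite expRN -[leRHS]invrK lef_pV2 ?posrE ?expR_gt0 ?invr_gt0//.
  by apply: le_trans (le_expR _); rewrite div1r.
have sle : expR (- (14 * PR ^+ 3 + 2 / r0)) <= r0 ^+ 2 / G ^+ 2.
  rewrite -expr_div_n; have -> : - (14 * PR ^+ 3 + 2 / r0) = 2%:R * (- (1 / r0) - 7 * PR ^+ 3).
    by field; rewrite gt_eqF.
  rewrite expRM_natl; apply: lerXn2r; rewrite ?nnegrE ?expR_ge0//; first by rewrite divr_ge0 ?ltW.
  rewrite expRD; apply: ler_pM; rewrite ?expR_ge0// expRN.
  by rewrite lef_pV2 ?posrE ?expR_gt0.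
have Lle : 16 * 2 ^+ h <= expR (4 + h%:R) :> R.
  rewrite expRD; apply: ler_pM => //; last exact: two_pow_le.
  by have := two_pow_le 4; apply: le_trans; lra.
have nle : 64 * n%:R <= expR (6 + 16 * PR).
  rewrite expRD; apply: ler_pM => //; last exact: n_le.
  by have := two_pow_le 6; apply: le_trans; lra.
have dlge : expR (- (h%:R * (14 * PR ^+ 3 + 2 / r0) + (6 + 16 * PR) + h%:R * (4 + h%:R))) <= dl.
  rewrite -addrA opprD expRD dlN; apply: ler_pM; rewrite ?expR_ge0//.
    rewrite -mulrN expRM_natl; apply: lerXn2r; rewrite ?nnegrE ?expR_ge0//.
    by rewrite divr_ge0 ?exprn_ge0 ?ltW.
  rewrite expRN lef_pV2 ?posrE ?expR_gt0//; last by rewrite !mulr_gt0// exprn_gt0// mulr_gt0// exprn_gt0.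
  have a2 : 0 <= 16 * 2 ^+ h :> R by rewrite mulr_ge0// exprn_ge0.
  rewrite expRD; apply: ler_pM => //; rewrite ?mulr_ge0 ?exprn_ge0//.
  by rewrite expRM_natl; apply: lerXn2r; rewrite ?nnegrE ?expR_ge0.
apply: (@le_trans _ _ (expR (- (h%:R * (14 * PR ^+ 3 + 2 / r0) + (6 + 16 * PR) + h%:R * (4 + h%:R))) ^+ (p ^ 2))); last first.
  by apply: lerXn2r; rewrite ?nnegrE ?expR_ge0//; apply: le_trans dlge; exact: expR_ge0.
rewrite -expRM_natl ler_expR mulrN lerN2 natrX hE.
have i0 : 0 <= 2 / r0 by rewrite divr_ge0// ltW.
apply: (@le_trans _ _ ((41 + 2 / r0) * PR ^+ 14)); last first.
  by apply: ler_wpM2l; [lra|exact: pow_le_n].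
have -> : PR ^+ 2 * (PR ^+ 6 * (14 * PR ^+ 3 + 2 / r0) + (6 + 16 * PR) + PR ^+ 6 * (4 + PR ^+ 6)) =
  14 * PR ^+ 11 + (2 / r0) * PR ^+ 8 + 6 * PR ^+ 2 + 16 * PR ^+ 3 + 4 * PR ^+ 8 + PR ^+ 14 by ring.
have := @powp 11 14 isT; have := ler_wpM2l i0 (@powp 8 14 isT); have := @powp 2 14 isT.
have := @powp 3 14 isT; have := @powp 8 14 isT.
by rewrite [(41 + _) * _]mulrDl; lra.
Qed.

Lemma pow_quarter k : 4 * PR ^+ k <= PR ^+ k.+1.
Proof. by rewrite exprS ler_wpM2r ?exprn_ge0// ler_nat. Qed.

Let nR0 : 0 <= n%:R :> R := ler0n _ _.
Let E0 (x : R) : 0 <= expR x := expR_ge0 x.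

Lemma four_n_le : 4 * n%:R <= 2 ^+ (p ^ 6) :> R.
Proof.
apply: le_trans (two_pow_ge _).
apply: (@le_trans _ _ (expR (2 + 16 * PR))).
  rewrite expRD; apply: ler_pM => //; last exact: n_le.
  by have := two_pow_le 2; apply: le_trans; rewrite -natrX.
rewrite ler_expR natrX.
have h1 := pow_quarter 1; have h2 := pow_quarter 2; have h3 := pow_quarter 3.
have h4 := @powp 4 6 isT; have h5 : 4 <= PR by rewrite ler_nat.
by rewrite expr1 in h1; move: h1 h2 h3 h4 h5; lra.
Qed.

(** The rate of Markov's inequality for the sum of the squared norms of the rows at level
    [2 ^+ (p ^ 6)]. *)
Lemma square_over_two_pow : n%:R ^+ 2 / 2 ^+ (p ^ 6) <= expR (- PR).
Proof.
rewrite ler_pdivrMr ?exprn_gt0//; apply: (@le_trans _ _ (expR (- PR) * expR ((p ^ 6)%:R / 2))); last first.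
  by apply: ler_wpM2l; [exact: E0|exact: two_pow_ge].
apply: (@le_trans _ _ (expR (2%:R * (16 * PR)))).
  by rewrite expRM_natl; apply: lerXn2r; rewrite ?nnegrE//; exact: n_le.
rewrite -expRD ler_expR natrX.
have h1 := pow_quarter 1; have h2 := pow_quarter 2; have h3 := pow_quarter 3.
have h4 := pow_quarter 4; have h5 := pow_quarter 5; have h0 := ltW P0.
by rewrite expr1 in h1; move: h0 h1 h2 h3 h4 h5; lra.
Qed.

(** The term [x^32 / 32!] of the exponential series at [x = p + 1] beats [(n + 1)^2], as
    [n + 1 <= (p + 1)^16]. *)
Lemma exp_rate : expR (- PR) <= 32`!%:R * expR 1 / (n.+1)%:R ^+ 2.
Proof.
have N0 : 0 < (n.+1)%:R ^+ 2 :> R by rewrite exprn_gt0// ltr0n.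
rewrite ler_pdivlMr// expRN mulrC ler_pdivrMr ?expR_gt0// -mulrA -expRD.
apply: (@le_trans _ _ ((p.+1)%:R ^+ 32)).
  rewrite -[32%N]/(16 * 2)%N exprM; apply: lerXn2r; rewrite ?nnegrE ?exprn_ge0//.
  by rewrite -natrX ler_nat.
have := @expR_ge1Dxn R (p.+1)%:R 31 (ler0n _ _).
have F0 : 0 < 32`!%:R :> R by rewrite ltr0n fact_gt0.
move=> hx; rewrite mulrC -ler_pdivrMr//; apply: le_trans (le_trans _ hx) _; first by rewrite lerDr.
by rewrite ler_expR -natr1 addrC.
Qed.

Section rates.
Variables (c rho : R).
Hypothesis rho0 : 0 <= rho.
Hypothesis rhoe : rho <= expR (- c).
Hypothesis c0 : 0 < c.
Hypothesis cP : 17 <= c * PR.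

Let cPk k : 17 * PR ^+ k <= c * PR ^+ k.+1.
Proof. by rewrite exprS mulrA; apply: ler_wpM2r => //; rewrite exprn_ge0// ltW. Qed.

Let rhok k : rho ^+ k <= expR (- (c * k%:R)).
Proof. by rewrite mulrC -mulrN expRM_natl; apply: lerXn2r; rewrite ?nnegrE. Qed.

Lemma row_failures k0 : (k0 <= n)%N -> rho <= 1 -> k0%:R * rho ^+ (p ^ 2).+1 <= expR (- PR).
Proof.
move=> kn rho1; apply: (@le_trans _ _ (expR (16 * PR) * expR (- (c * (p ^ 2)%:R)))).
  apply: ler_pM => //; first by rewrite exprn_ge0.
    by apply: (le_trans _ n_le); rewrite ler_nat.
  by apply: (le_trans _ (rhok (p ^ 2))); exact: ler_wiXn2l.
rewrite -expRD ler_expR natrX; have := cPk 1; rewrite expr1; lra.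
Qed.

Lemma chunk_failures : (p ^ 2)%:R * (((p ^ 6) ^ (p ^ 2))%:R * rho ^+ (p ^ 6)) <= expR (- PR).
Proof.
have P0' : 0 <= PR := ltW P0.
apply: (@le_trans _ _ (expR (2%:R * PR) * (expR ((p ^ 2)%:R * (6%:R * PR)) * expR (- (c * (p ^ 6)%:R))))).
  apply: ler_pM => //; first by rewrite mulr_ge0// exprn_ge0.
    by rewrite natrX expRM_natl; apply: lerXn2r; rewrite ?nnegrE//; exact: le_expR.
  apply: ler_pM => //; first by rewrite exprn_ge0.
  rewrite natrX expRM_natl; apply: lerXn2r; rewrite ?nnegrE//.
  by rewrite natrX expRM_natl; apply: lerXn2r; rewrite ?nnegrE//; exact: le_expR.
rewrite -!expRD ler_expR !natrX.
have h1 := cPk 5; have h2 := @powp 3 5 isT; have h3 := @powp 1 3 isT; rewrite expr1 in h3.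
have -> : PR ^+ 2 * (6 * PR) = 6 * PR ^+ 3 by ring.
have h4 : 0 <= PR ^+ 3 by rewrite exprn_ge0.
by move: h1 h2 h3 h4; lra.
Qed.

End rates.

(** The number [a] of rows allowed to lose a polynomial factor. It must be large enough for [2 ^- a]
    to beat the growth [exp (2 K1 n / p^2)] in [engine], and small enough for the [a] factors to
    cost [exp (O (n / p))]. *)
Lemma weak_budget (K1 : R) : 0 <= K1 -> exists a : nat,
  4 * K1 * (n%:R / PR ^+ 2) + 2 * PR <= a%:R /\ a%:R * PR <= (4 * K1 + 3) * (n%:R / PR).
Proof.
move=> K10; exists ((Num.truncn (4 * K1 * (n%:R / PR ^+ 2))).+1 + 2 * p)%N.
have x0 : 0 <= 4 * K1 * (n%:R / PR ^+ 2).
  by rewrite mulr_ge0// ?mulr_ge0// divr_ge0// exprn_ge0// ltW.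
have h1 := truncnS_gt (4 * K1 * (n%:R / PR ^+ 2)).
have h2 : (Num.truncn (4 * K1 * (n%:R / PR ^+ 2)))%:R <= 4 * K1 * (n%:R / PR ^+ 2) by rewrite truncn_le.
rewrite natrD natrM; split; first by rewrite lerD2r ltW.
apply: (@le_trans _ _ ((4 * K1 * (n%:R / PR ^+ 2) + 1 + 2 * PR) * PR)).
  by rewrite ler_pM2r// lerD2r -natr1 lerD2r.
have -> : (4 * K1 * (n%:R / PR ^+ 2) + 1 + 2 * PR) * PR = 4 * K1 * (n%:R / PR) + PR + 2 * PR ^+ 2.
  by field; rewrite gt_eqF.
have h3 := @pow_le_n 1 isT; have h4 := @pow_le_n 2 isT; rewrite expr1 in h3.
by rewrite mulrDl; move: h3 h4; lra.
Qed.

Lemma strong_failures (K1 p1 : R) a k0 : (k0 <= n)%N -> 0 <= p1 -> p1 <= K1 / PR ^+ 2 ->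
  4 * K1 * (n%:R / PR ^+ 2) + 2 * PR <= a%:R -> (1 + 2 * p1) ^+ k0 * 2 ^- a <= expR (- PR).
Proof.
move=> kn p10 p1K ha.
have KP : 0 <= K1 / PR ^+ 2 by exact: le_trans p1K.
apply: (@le_trans _ _ (expR (n%:R * (2 * (K1 / PR ^+ 2))) * expR (- (a%:R / 2)))).
  apply: ler_pM; rewrite ?exprn_ge0 ?invr_ge0 ?exprn_ge0 ?addr_ge0 ?mulr_ge0//.
    apply: (@le_trans _ _ (expR (k0%:R * (2 * (K1 / PR ^+ 2))))).
      rewrite expRM_natl; apply: lerXn2r; rewrite ?nnegrE// ?addr_ge0 ?mulr_ge0//.
      by apply: le_trans (expR_ge1Dx _); rewrite lerD2l ler_pM2l.
    by rewrite ler_expR; apply: ler_wpM2r; [rewrite mulr_ge0|rewrite ler_nat].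
  by rewrite expRN lef_pV2 ?posrE ?expR_gt0 ?exprn_gt0// two_pow_ge.
rewrite -expRD ler_expR.
have -> : n%:R * (2 * (K1 / PR ^+ 2)) = 4 * K1 * (n%:R / PR ^+ 2) / 2 by field; rewrite gt_eqF.
by move: ha; lra.
Qed.

Lemma weak_factor (K1 K2 : R) a : 0 <= K2 -> a%:R * PR <= (4 * K1 + 3) * (n%:R / PR) ->
  expR (- ((52 + K2) * (4 * K1 + 3) * (n%:R / PR))) <=
  (4 * n%:R * ((p ^ 2).+1%:R + K2 * n%:R ^+ 2)) ^- a.
Proof.
move=> K20 ha.
have n1 : 1 <= n%:R :> R by rewrite ler1n; apply: leq_trans pn; rewrite expn_gt0 (leq_trans _ p4).
have B0 : 0 <= K2 * n%:R ^+ 2 by rewrite mulr_ge0// exprn_ge0.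
have tau0 : 0 < 4 * n%:R * ((p ^ 2).+1%:R + K2 * n%:R ^+ 2).
  apply: mulr_gt0; first by rewrite mulr_gt0//; exact: lt_le_trans n1.
  by rewrite ltr_pwDl// ltr0n.
have n12 : n%:R <= n%:R ^+ 2 :> R by rewrite -[leLHS]expr1; exact: ler_weXn2l.
have taule : 4 * n%:R * ((p ^ 2).+1%:R + K2 * n%:R ^+ 2) <= expR ((52 + K2) * PR).
  have hm : (p ^ 2).+1%:R <= 2 * n%:R ^+ 2 :> R.
    have : (p ^ 2)%:R <= n%:R :> R.
      by rewrite ler_nat; apply: leq_trans pn; rewrite leq_exp2l// (leq_trans _ p4).
    by rewrite -natr1; move: n12 n1; lra.
  apply: (@le_trans _ _ (4 * (2 + K2) * n%:R ^+ 3)).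
    have -> : 4 * (2 + K2) * n%:R ^+ 3 = 4 * n%:R * (2 * n%:R ^+ 2 + K2 * n%:R ^+ 2) by ring.
    by apply: ler_wpM2l; [rewrite mulr_ge0|rewrite lerD2r].
  apply: (@le_trans _ _ (expR 2 * expR (2 + K2) * expR (48 * PR))); last first.
    rewrite -!expRD ler_expR; have : K2 <= K2 * PR by rewrite ler_peMr.
    by move: P1; rewrite mulrDl; lra.
  have K22 : 0 <= 2 + K2 by rewrite addr_ge0.
  apply: ler_pM; rewrite ?exprn_ge0 ?mulr_ge0//.
    apply: ler_pM => //; last exact: le_expR.
    by have := two_pow_le 2; apply: le_trans; rewrite -natrX.
  have -> : 48 * PR = 3%:R * (16 * PR) by ring.
  by rewrite expRM_natl; apply: lerXn2r; rewrite ?nnegrE//; exact: n_le.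
rewrite expRN lef_pV2 ?posrE ?expR_gt0 ?exprn_gt0//.
apply: (@le_trans _ _ (expR ((52 + K2) * PR) ^+ a)).
  by apply: lerXn2r; rewrite ?nnegrE// ltW.
rewrite -expRM_natl ler_expR.
have -> : a%:R * ((52 + K2) * PR) = (52 + K2) * (a%:R * PR) by ring.
by rewrite -mulrA; apply: ler_wpM2l => //; rewrite addr_ge0.
Qed.

Lemma Y_lower_p (M : 'M[C]_n) (w : C) (t th : R) :
  0 <= th -> th <= 1 / 2 -> 0 <= t -> t <= 1 -> n%:R * t <= sqn w ->
  (p ^ 2 + \rank M)%:R <= th * (n%:R - n%:R * t) ->
  expR (n%:R * t - n%:R - 2 * th * n%:R - (2 + 16 * PR + 16 * PR ^+ 3)) * n%:R ^+ n <=
  Yf [seq rw (M - w%:M) i | i <- iota 0 (n - p ^ 2)] [::].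
Proof.
move=> th0 th1 t0 t1 tw hq; set j := Num.truncn (n%:R * t).
have n0 : (0 < n)%N by apply: leq_trans pn; rewrite expn_gt0 (leq_trans _ p4).
have n0R : 0 < n%:R :> R by rewrite ltr0n.
have nt0 : 0 <= n%:R * t by rewrite mulr_ge0.
have jle : j%:R <= n%:R * t by rewrite truncn_le.
have jgt : n%:R * t < j%:R + 1 by rewrite natr1 truncnS_gt.
have jn : (j <= n)%N by rewrite -(ler_nat R); apply: (le_trans jle); rewrite ler_piMr.
have qn : (p ^ 2 <= n)%N by apply: leq_trans pn; rewrite leq_exp2l// (leq_trans _ p4).
have qr : (p ^ 2 + \rank M)%:R <= th * (n - j)%:R.
  by apply: (le_trans hq); rewrite natrB//; apply: ler_wpM2l => //; rewrite lerB.
apply: le_trans (Y_lower_exp n0 qn jn th0 th1 (le_trans jle tw) qr).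
have f1 : expR (n%:R * t - 2 - 16 * PR) <= expR (j%:R - 1) / (j.+1)%:R.
  rewrite ler_pdivlMr ?ltr0n//; apply: (@le_trans _ _ (expR (n%:R * t - 2 - 16 * PR) * expR (16 * PR))).
    by apply: ler_wpM2l => //; apply: le_trans np_le; rewrite ler_nat.
  by rewrite -expRD ler_expR; move: jgt; lra.
have f2 : expR (- n%:R - 16 * PR ^+ 3) * n%:R ^+ n <= n`!%:R / n%:R ^+ (p ^ 2).
  rewrite ler_pdivlMr ?exprn_gt0//.
  have f3 : n%:R ^+ (p ^ 2) <= expR (16 * PR ^+ 3).
    have -> : 16 * PR ^+ 3 = (p ^ 2)%:R * (16 * PR) by rewrite natrX; ring.
    by rewrite expRM_natl; apply: lerXn2r; rewrite ?nnegrE//; exact: n_le.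
  apply: (@le_trans _ _ (expR (- n%:R - 16 * PR ^+ 3) * n%:R ^+ n * expR (16 * PR ^+ 3))).
    by apply: ler_wpM2l => //; rewrite mulr_ge0// exprn_ge0.
  rewrite mulrAC -expRD subrK expRN mulrC ler_pdivrMr ?expR_gt0//.
  by rewrite mulrC; exact: fact_lower.
set a1 := n%:R * t - 2 - 16 * PR in f1; set a3 := - n%:R - 16 * PR ^+ 3 in f2.
have -> : n%:R * t - n%:R - 2 * th * n%:R - (2 + 16 * PR + 16 * PR ^+ 3) =
  a1 + (- (2 * th * n%:R)) + a3 by rewrite /a1 /a3; ring.
rewrite (expRD (a1 + _)) (expRD a1) -mulrA; apply: ler_pM => //; rewrite ?mulr_ge0 ?exprn_ge0//.
by apply: ler_wpM2r.
Qed.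

End constants.
(** Equally spaced points on a horizontal segment that starts at [w0] and leads away from the
    imaginary axis. Moduli do not decrease along it, so the lower bound at [w0] serves for all of
    them. *)
Lemma segment_points (w0 : C) (r0 : R) G : 0 < r0 -> r0 <= 1 -> (0 < G)%N -> sqn w0 <= 1 ->
  exists z : 'I_G -> C, [/\ forall i, sqn (z i - w0) <= r0 ^+ 2, forall i, sqn w0 <= sqn (z i),
    forall i, sqn (z i) <= 4 & forall i j, i != j -> r0 ^+ 2 / G%:R ^+ 2 <= sqn (z i - z j)].
Proof.
move=> r0p r01 G0 w01.
have GR0 : 0 < G%:R :> R by rewrite ltr0n.
pose sg : R := if 0 <= Re w0 then 1 else -1.
have sg2 : sg ^+ 2 = 1 by rewrite /sg; case: ifP; rewrite ?expr1n ?sqrrN ?expr1n.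
pose u (i : 'I_G) : R := sg * (r0 * ((i : nat)%:R / G%:R)).
have fr0 (i : 'I_G) : 0 <= r0 * ((i : nat)%:R / G%:R) by apply: mulr_ge0; [exact: ltW|rewrite divr_ge0].
have u2 i : u i ^+ 2 <= r0 ^+ 2.
  rewrite /u exprMn sg2 mul1r; apply: lerXn2r; rewrite ?nnegrE ?fr0//; first exact: ltW.
  by apply: ler_piMr; [exact: ltW|rewrite ler_pdivrMr// mul1r ler_nat ltnW].
have uw i : 0 <= Re w0 * u i.
  rewrite /u /sg; have := fr0 i.
  by case: ifP => [a b|/negbT]; [rewrite mul1r mulr_ge0|rewrite -ltNge => a b; rewrite mulN1r mulrN -mulNr mulr_ge0// oppr_ge0 ltW].
exists (fun i => w0 + (u i)%:C); split.
- by move=> i; rewrite addrC addKr sqn_real u2.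
- move=> i; rewrite /sqn ReD ImD /= addr0; move: (uw i) (sqr_ge0 (u i)).
  set a := Re w0; set b := u i; clear; nra.
- move=> i; have h1 := sqnD2 w0 (u i)%:C; rewrite sqn_real in h1; have h2 := u2 i.
  have h3 : r0 ^+ 2 <= 1 by rewrite expr_le1// ltW.
  by move: h1 h2 h3 w01; lra.
move=> i j ij.
have -> : w0 + (u i)%:C - (w0 + (u j)%:C) = (u i - u j)%:C by rewrite opprD addrACA subrr add0r -rmorphB.
rewrite sqn_real /u -!mulrBr -mulrBl !exprMn sg2 mul1r exprVn mulrA.
have D1 : 1 <= ((i : nat)%:R - (j : nat)%:R) ^+ 2 :> R.
  have key (a b : nat) : (a < b)%N -> 1 <= (b%:R - a%:R) ^+ 2 :> R.
    by move=> ab; rewrite -natrB 1?ltnW// exprn_ege1// ler1n subn_gt0.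
  have [lt|lt|e] := ltngtP i j; last by move: ij; rewrite (val_inj e) eqxx.
    by rewrite -sqrrN opprB; exact: key.
  exact: key.
apply: ler_wpM2r; first by rewrite invr_ge0 exprn_ge0// ltW.
by apply: ler_peMr => //; rewrite exprn_ge0// ltW.
Qed.

End lower_estimates.

Section arithmetic.
Variable R : realType.
Implicit Types x y : R.

Lemma arith_exponent (N y t eta a y0 y1 y2 y3 : R) : 1 <= y -> y0 <= y -> y3 <= y ->
  N * (t - 1 - 4 * eta) - (34 * y + y1 + y2) <=
  - (2 * eta * N) - y1 + (N * t - N - 2 * eta * N - (2 + 16 * y0 + 16 * y3)) - y2.
Proof. lra. Qed.

Lemma arith_failures (a1 a2 a3 a4 e C : R) : a1 <= e -> a2 <= e -> a3 <= (1 + C) * e -> a4 <= e ->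
  2 * (a1 + a2) + a3 + a4 <= (6 + C) * e.
Proof. lra. Qed.

Lemma arith_parameters (p x1 x2 x3 : R) : 4 + x1 + x2 + x3 <= p -> 0 <= x1 -> 0 <= x2 -> 0 <= x3 ->
  [/\ 4 <= p, x1 <= p, x2 <= p & x3 <= p].
Proof. by move=> *; split; lra. Qed.

Lemma arith_rate (N t eps eta y : R) : y <= eps / 2 * N -> eta * N <= eps / 16 * N -> 0 <= eps * N ->
  N * (t - 1 - eps) <= N * (t - 1 - 4 * eta) - y.
Proof. lra. Qed.

End arithmetic.

Section markov_inequality.
Context d (T : measurableType d) (R : realType) (P : probability T R).

Lemma markov_real (f : T -> R) (B L : R) : 0 < L -> measurable_fun setT f -> (forall w, 0 <= f w) ->
  (\int[P]_w (f w)%:E <= B%:E)%E -> (P [set w | (L < f w)%R] <= (B / L)%:E)%E.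
Proof.
move=> L0 mf f0 h2; set A := [set w | _].
have mA : measurable A by apply: (meas_set_lt (f := fun=> L)) => //; exact: measurable_cst.
have h1 : (L%:E * P A <= \int[P]_w (f w)%:E)%E.
  have -> : (L%:E * P A = \int[P]_w (L * \1_A w)%:E)%E.
    under eq_integral do rewrite EFinM.
    rewrite ge0_integralZl//; first by rewrite integral_indic// setIT.
      by apply/measurable_EFinP; exact: measurable_indic.
    by rewrite lee_fin ltW.
  apply: ge0_le_integral => //.
  - by move=> w _; rewrite lee_fin mulr_ge0// ltW.
  - by apply/measurable_EFinP; apply: measurable_funM => //; exact: measurable_indic.
  - exact/measurable_EFinP.
  move=> w _; rewrite lee_fin indicE; have [hD|hD] := pselect (A w).
    by rewrite mem_set// mulr1 ltW.
  by rewrite memNset// mulr0.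
have := le_trans h1 h2; have -> : P A = (fine (P A))%:E by rewrite fineK// fin_num_measure.
by rewrite -EFinM !lee_fin => h; rewrite ler_pdivlMr// mulrC.
Qed.

End markov_inequality.

Section determinant_lower_bound.
Context d (T : measurableType d) (R : realType) (P : probability T R).
Local Notation C := R[i].
Context (X : nat * nat -> {RV P >-> R[i]}).
Hypothesis Xind : mutually_independent X.
Hypothesis XRe : forall i, Ex P (fun w => Re (X i w)) = 0.
Hypothesis XIm : forall i, Ex P (fun w => Im (X i w)) = 0.
Hypothesis Xsqn : forall i, (\int[P]_w (sqn (X i w))%:E)%E = 1%E.
Hypothesis Xtr : forall eta : R, 0 < eta -> exists2 K : R, 1 <= K &
  forall ij, 1 - eta <= Ex P (trunc (X ij) K).
Variable M : forall n, 'M[C]_n.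
Hypothesis Mrank : forall dl : R, 0 < dl -> exists n0, forall n, (n0 <= n)%N ->
  (\rank (M n))%:R <= dl * n%:R.
Variable Cm : R.
Hypothesis Cm0 : 0 <= Cm.
Hypothesis Mhs : forall n, \sum_(i < n) nrm2 (row i (M n)) <= Cm * n%:R ^+ 2.

Definition An n (w : T) : 'M[C]_n := M n + \matrix_(i, j) X (i : nat, j : nat) w.

Lemma row_An n (i : 'I_n) w : row i (An n w) = Ra X (M n) i w.
Proof. by rewrite /An /Ra /Rw rw_ord addrC linearD; congr (_ + _); apply/rowP => j; rewrite !mxE. Qed.

Lemma shiftlist_Rw n z k w : shiftlist (fun i => Ra X (M n) i w) z k =
  rlist (fun i => Rw X (rw (M n - z%:M)) i w) k.
Proof.
rewrite /shiftlist; elim: k => //= k ->; congr (_ :: _).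
by rewrite /shiftrow /Ra /Rw rw_shift addrA.
Qed.

Lemma sqn_det_An n z w : sqn (\det (An n w - z%:M)) = gram (shiftlist (fun i => Ra X (M n) i w) z n).
Proof.
apply: sqn_det_rlist => i.
rewrite linearB /= row_An /shiftrow /unitrow rw_ord; congr (_ - _).
by apply/rowP => j; rewrite !mxE mulr_natr.
Qed.

Lemma int_nrm2_row n i (N : 'rV[C]_n) :
  (\int[P]_w (nrm2 (xrow X (@rowix n i) w + N))%:E)%E = (n%:R + nrm2 N)%:E.
Proof.
have := int_qf_row Xind XRe XIm Xsqn (@rowix_inj n i) N (psd1 R n).
by rewrite trR1 qf1; under eq_integral do rewrite qf1.
Qed.

Lemma meas_nrm2 d1 (D : measurableType d1) n (f : D -> 'rV[C]_n) : mxmeas f ->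
  measurable_fun setT (fun x => nrm2 (f x)).
Proof.
move=> mf; apply: (eq_meas (f := fun x => qf 1%:M (f x))) => [x|]; first by rewrite qf1.
by apply: meas_qf => //; exact: mxmeas_cst.
Qed.

Lemma hs_markov n (L : R) : 0 < L ->
  (P [set w | (L < \sum_(i < n) nrm2 (Ra X (M n) i w))%R] <= ((1 + Cm) * n%:R ^+ 2 / L)%:E)%E.
Proof.
move=> L0; set f := fun w => \sum_(i < n) nrm2 (Ra X (M n) i w).
have mr i : measurable_fun setT (fun w => nrm2 (Ra X (M n) i w)).
  by apply: meas_nrm2; exact: mxmeas_xrowD.
have mf : measurable_fun setT f by exact: meas_sum.
have f0 w : 0 <= f w by apply: sumr_ge0 => i _; exact: nrm2_ge0.
apply: (markov_real L0 mf f0).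
under eq_integral do rewrite /f -sumEFin.
rewrite ge0_integral_sum//; last 2 first.
- by move=> i; apply/measurable_EFinP.
- by move=> i w _; rewrite lee_fin nrm2_ge0.
rewrite (eq_bigr (fun i : 'I_n => (n%:R + nrm2 (row i (M n)))%:E)); last first.
  by move=> i _; rewrite -[row i (M n)]rw_ord -(int_nrm2_row i).
rewrite sumEFin lee_fin big_split /= sumr_const card_ord mulrDl mul1r.
by apply: lerD; [rewrite -[leLHS]mulr_natr expr2|exact: Mhs].
Qed.

Lemma meas_det_An n z : measurable_fun setT (fun w => sqn (\det (An n w - z%:M))).
Proof.
apply: meas_sqn; apply: cmeas_det; apply: mxmeasB; last exact: mxmeas_cst.
apply: mxmeasD; first exact: mxmeas_cst.
move=> i j; apply: (eq_cmeas (f := X (i : nat, j : nat))) => [w|]; first by rewrite mxE.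
exact: cmeas_X.
Qed.

Lemma meas_none (A : finType) (c : A -> R) (F : A -> T -> R) :
  (forall i, measurable_fun setT (F i)) -> measurable [set w | ~ exists i, (c i <= F i w)%R].
Proof.
move=> mF; rewrite (_ : [set _ | _] = [set w | all (predC (fun i => c i <= F i w)) (enum A)]).
  apply: measurable_all => i; have := mF i measurableT _ (@measurable_itv R `[c i, +oo[).
  by rewrite setTI; congr measurable; apply/seteqP; split=> w /=; rewrite in_itv /= andbT.
apply/seteqP; split => w /=.
  by move=> h; apply/allP => i _ /=; apply/negP => hi; apply: h; exists i.
by move=> /allP h [i hi]; have := h i; rewrite mem_enum /= hi => /(_ isT).
Qed.

(** One [K] has to serve for Chebyshev with loss [eta] and for anticoncentration, which asks for a
    truncated mean of at least [15/16]. *)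
Lemma small_ball_constants (eta : R) : 0 < eta -> exists K c : R,
  [/\ 0 <= K, 0 < c, 0 <= 1 - c, forall ij, 1 - eta <= Ex P (trunc (X ij) K) &
  forall ij (a : C), (P [set w | (sqn (X ij w - a) <= 1 / 4)%R] <= (1 - c)%:E)%E].
Proof.
move=> eta0; have m0 : 0 < Num.min eta (1 / 16) by rewrite lt_min eta0 divr_gt0.
have [K K1 hK] := Xtr m0; have K0 := le_trans ler01 K1; exists K, (4 * K)^-1.
have K4 : 1 <= 4 * K by apply: (le_trans K1); rewrite ler_peMl// ler1n.
split => //.
- by rewrite invr_gt0 (lt_le_trans ltr01).
- by rewrite subr_ge0 invf_le1// (lt_le_trans ltr01).
- by move=> ij; apply: le_trans (hK ij); rewrite lerD2l lerN2 ge_min lexx.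
move=> ij a; apply: anticoncentration => //; first exact: cmeas_X.
apply: le_trans (hK ij); have mle : Num.min eta (1 / 16) <= 1 / 16 by rewrite ge_min lexx orbT.
by apply: (@le_trans _ _ (1 - 1 / 16)); [rewrite le_eqVlt; apply/orP; left; apply/eqP; field|rewrite lerD2l lerN2].
Qed.

Section one_size.
Variables (w0 : C) (r0 eta K c : R) (p n : nat).
Local Notation PR := (p%:R : R).
Hypothesis w01 : sqn w0 < 1.
Hypothesis r0p : 0 < r0.
Hypothesis r01 : r0 <= 1.
Hypothesis eta0 : 0 < eta.
Hypothesis eta1 : eta <= 1 / 2.
Hypothesis K0 : 0 <= K.
Hypothesis c0 : 0 < c.
Hypothesis c1 : 0 <= 1 - c.
Hypothesis XK : forall ij, 1 - eta / 2 <= Ex P (trunc (X ij) K).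
Hypothesis Xac : forall ij (a : C), (P [set w | (sqn (X ij w - a) <= 1 / 4)%R] <= (1 - c)%:E)%E.
Hypothesis pn : (p ^ 16 <= n)%N.
Hypothesis np : (n < p.+1 ^ 16)%N.
Hypothesis p4 : (4 <= p)%N.
Hypothesis cP : 17 <= c * PR.
Hypothesis rkM : (p ^ 2 + \rank (M n))%:R <= eta * (n%:R - n%:R * sqn w0).

(** [K1 / p^2] bounds the Chebyshev failure of one row, [K2 * n^2] the squared norm of a shifted row
    of [M n], and [Kt] collects the losses of order [n / p]. *)
Let K1 := 4 * (8 + 2 * K) / eta ^+ 2.
Let K2 := 2 * Cm + 8.
Let Kt := 34 + (52 + K2) * (4 * K1 + 3) + (41 + 2 / r0).
Let t := sqn w0.
Let q := (p ^ 2)%N.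
Let h := (p ^ 6)%N.
Let G := (2 * h ^ q)%N.

Let exponent_bound : expR (n%:R * (t - 1 - 4 * eta) - Kt * (n%:R / PR)) <=
  expR (- (2 * eta * n%:R)) * expR (- ((52 + K2) * (4 * K1 + 3) * (n%:R / PR))) *
  expR (n%:R * t - n%:R - 2 * eta * n%:R - (2 + 16 * PR + 16 * PR ^+ 3)) *
  expR (- ((41 + 2 / r0) * (n%:R / PR))).
Proof.
rewrite -!expRD ler_expR /Kt.
have h0 := pow_le_n R pn p4 (leq0n 15); have h1 := @pow_le_n R p n pn p4 1 isT.
have h3 := @pow_le_n R p n pn p4 3 isT; rewrite expr0 in h0; rewrite expr1 in h1.
rewrite [(34 + _ + _) * _]mulrDl [(34 + _) * _]mulrDl; exact: arith_exponent.
Qed.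

(** The first [n - q] rows are treated by [engine_rows], for each point separately, and the last [q]
    by [survival], for all points together. Four probabilities of order [exp (- p)] add up: small
    balls, Chebyshev failures, large norms, and failing blocks. *)
Lemma det_lower_size : exists z : 'I_G -> C, (forall i, sqn (z i - w0) <= r0 ^+ 2) /\
  (P [set w | ~ exists i, (expR (n%:R * (t - 1 - 4 * eta) - Kt * (n%:R / PR)) * n%:R ^+ n <=
     sqn (\det (An n w - ((Num.sqrt n%:R)%:C * z i)%:M)))%R] <=
   ((6 + Cm) * (32`!%:R * expR 1) / (n.+1)%:R ^+ 2)%:E)%E.
Proof.
have p0 : (0 < p)%N by apply: leq_trans p4.
have P0 : 0 < PR by rewrite ltr0n.
have n1 : (1 <= n)%N by apply: leq_trans pn; rewrite expn_gt0 p0.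
have nR1 : 1 <= n%:R :> R by rewrite ler1n.
have nR0 : 0 < n%:R :> R by rewrite ltr0n.
have qn : (q < n)%N by apply: leq_trans pn; rewrite ltn_exp2l// (leq_trans _ p4).
have h1 : (0 < h)%N by rewrite expn_gt0 p0.
have G0 : (0 < G)%N by rewrite muln_gt0 expn_gt0 h1.
have GR1 : 1 <= G%:R :> R by rewrite ler1n.
have GR0 : 0 < G%:R :> R by rewrite ltr0n.
have t0 : 0 <= t := sqn_ge0 _.
have [z [zr zlow zup zsep]] := segment_points r0p r01 G0 (ltW w01).
exists z; split => //.
pose zz i : C := (Num.sqrt n%:R)%:C * z i.
have zzE i : sqn (zz i) = n%:R * sqn (z i) by rewrite sqnM sqn_real sqr_sqrtr.
(* [L] must exceed the squared moduli of the shifts and, up to a tiny probability, the sum of the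
   squared norms of the rows; [dl] in the next line is the largest value that [cond] allows. *)
pose L : R := 2 ^+ h; pose s : R := r0 ^+ 2 / G%:R ^+ 2.
pose dl : R := s ^+ h / (64 * n%:R * (16 * L) ^+ h).
have L1 : 1 <= L by rewrite exprn_ege1// ler1n.
have L0 : 0 < L := lt_le_trans ltr01 L1.
have s0 : 0 < s by rewrite divr_gt0 ?exprn_gt0.
have s1 : s <= 1.
  rewrite ler_pdivrMr ?exprn_gt0// mul1r; apply: lerXn2r; rewrite ?nnegrE//; first exact: ltW.
  exact: le_trans r01 GR1.
have LL0 : 0 < 64 * n%:R * (16 * L) ^+ h by rewrite !mulr_gt0// exprn_gt0// mulr_gt0.
have d0 : 0 < dl by rewrite divr_gt0 ?exprn_gt0.
have cond : 64 * n%:R * (16 * L) ^+ h * dl <= s ^+ h by rewrite /dl mulrC divfK// gt_eqF.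
have zL i : sqn (zz i) <= L.
  rewrite zzE; apply: le_trans (four_n_le R np p4); rewrite mulrC; apply: ler_wpM2r; [exact: ltW|exact: zup].
have sep i j : i != j -> s <= sqn (zz i - zz j).
  move=> ij; rewrite /zz -mulrBr sqnM sqn_real sqr_sqrtr; last exact: ltW.
  apply: (le_trans (zsep i j ij)); apply: ler_peMl => //; exact: sqn_ge0.
pose k0 := (n - q)%N.
have k0n : (k0 <= n)%N by exact: leq_subr.
have k0p : (0 < k0)%N by rewrite subn_gt0.
have nk0 : (n - k0 = q)%N by rewrite subKn// ltnW.
have K10 : 0 <= K1 by rewrite divr_ge0 ?exprn_ge0 ?mulr_ge0 ?addr_ge0 ?mulr_ge0// ltW.
have K20 : 0 <= K2 by rewrite addr_ge0 ?mulr_ge0.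
pose B := K2 * n%:R ^+ 2.
have B0 : 0 <= B by rewrite mulr_ge0 ?exprn_ge0.
have [a [alow aup]] := weak_budget pn p4 K10.
pose Yz i := Yf [seq rw (M n - (zz i)%:M) l | l <- iota 0 k0] [::].
pose g i := (1 - eta) ^+ k0 * (4 * n%:R * (q.+1%:R + B)) ^- a * Yz i.
have Ylow i : expR (n%:R * t - n%:R - 2 * eta * n%:R - (2 + 16 * PR + 16 * PR ^+ 3)) * n%:R ^+ n <= Yz i.
  apply: Y_lower_p => //; [exact: ltW|exact: ltW|].
  by rewrite zzE; apply: ler_wpM2l; [exact: ltW|exact: zlow].
have e1' : 0 < 1 - eta by rewrite subr_gt0 (le_lt_trans eta1)// ltr_pdivrMr// mul1r ltr1n.
have Y0 i : 0 < Yz i by apply: lt_le_trans (Ylow i); rewrite mulr_gt0 ?expR_gt0 ?exprn_gt0.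
have tau0 : 0 < 4 * n%:R * (q.+1%:R + B) by rewrite mulr_gt0 ?mulr_gt0// ltr_pwDl// ltr0n.
have g0 i : 0 < g i by rewrite !mulr_gt0 ?invr_gt0 ?exprn_gt0.
have taua := weak_factor pn np p4 K20 aup.
have dlq : expR (- ((41 + 2 / r0) * (n%:R / PR))) <= dl ^+ q.
  exact: (@dl_lower R p n pn np p4 r0 r0p h G%:R dl).
have final i : expR (n%:R * (t - 1 - 4 * eta) - Kt * (n%:R / PR)) * n%:R ^+ n <= g i * dl ^+ q.
  have f1 : expR (- (2 * eta * n%:R)) <= (1 - eta) ^+ k0.
    apply: (@le_trans _ _ ((1 - eta) ^+ n)); last first.
      by apply: ler_wiXn2l => //; [exact: ltW|rewrite gerBl ltW].
    rewrite mulrC -mulrN expRM_natl; apply: lerXn2r; rewrite ?nnegrE ?expR_ge0//; first exact: ltW.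
    by apply: expR_le_1B => //; exact: ltW.
  apply: le_trans (ler_wpM2r (exprn_ge0 n (ltW nR0)) exponent_bound) _.
  have e' (a1 a2 a3 a4 y : R) : a1 * a2 * a3 * a4 * y = a1 * a2 * (a3 * y) * a4 by ring.
  rewrite e' /g.
  have u1 : 0 <= expR (n%:R * t - n%:R - 2 * eta * n%:R - (2 + 16 * PR + 16 * PR ^+ 3)) * n%:R ^+ n.
    by apply: mulr_ge0; [exact: expR_ge0|exact/exprn_ge0/ltW].
  have u2 := expR_ge0 (- (2 * eta * n%:R)).
  have u3 := expR_ge0 (- ((52 + K2) * (4 * K1 + 3) * (n%:R / PR))).
  have u4 := expR_ge0 (- ((41 + 2 / r0) * (n%:R / PR))).
  apply: (ler_pM _ u4 _ dlq); first exact: (mulr_ge0 (mulr_ge0 u2 u3) u1).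
  exact: (ler_pM (mulr_ge0 u2 u3) u1 (ler_pM u2 u3 f1 taua) (Ylow i)).
pose p1 := 4 * (8 + 2 * K) / (eta ^+ 2 * q.+1%:R).
pose pe := k0%:R * (1 - c) ^+ q.+1 + (1 + 2 * p1) ^+ k0 * 2 ^- a.
have p1n : p1 <= K1 / PR ^+ 2.
  rewrite /p1 invfM mulrA -/K1; apply: ler_wpM2l => //; rewrite lef_pV2 ?posrE ?exprn_gt0 ?ltr0n//.
  by rewrite -natrX ler_nat.
have p10 : 0 <= p1.
  by rewrite divr_ge0 ?mulr_ge0 ?exprn_ge0 ?addr_ge0 ?mulr_ge0// ltW.
have pe0 : 0 <= pe.
  apply: addr_ge0; first by apply: mulr_ge0; rewrite ?exprn_ge0.
  by apply: mulr_ge0; [apply: exprn_ge0; rewrite addr_ge0// mulr_ge0|rewrite invr_ge0 exprn_ge0].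
have hpe i : (P [set w | (zgram X (M n) zz k0 i w < g i)%R] <= pe%:E)%E.
  rewrite /zgram; under eq_set do rewrite shiftlist_Rw.
  have eta11 : eta <= 1 by move: e1'; rewrite subr_gt0 => /ltW.
  have := @engine_rows _ _ _ _ X Xind XRe XIm Xsqn n (rw (M n - (zz i)%:M)) k0 k0n eta K (1 - c) B a
    k0p eta0 eta11 K0 c1 XK Xac B0.
  rewrite nk0; apply => k kk; have kn : (k < n)%N by apply: leq_trans kk k0n.
  rewrite rw_shift -scaleNr; apply: (le_trans (nrm2D_le _ _)); rewrite nrm2Z sqnN zzE.
  have hr1 := nrm2_rw1 R n k.
  have hr2 : nrm2 (rw (M n) k) <= Cm * n%:R ^+ 2.
    apply: le_trans (Mhs n); rewrite (bigD1 (Ordinal kn))//= -[row _ _]rw_ord lerDl.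
    by apply: sumr_ge0 => l _; exact: nrm2_ge0.
  have hr3 : n%:R * sqn (z i) * nrm2 (rw (1%:M : 'M[C]_n) k) <= n%:R * 4.
    rewrite -mulrA; apply: ler_wpM2l; first exact: ltW.
    by rewrite -[4]mulr1; apply: ler_pM; rewrite ?sqn_ge0 ?nrm2_ge0 ?zup.
  have nn : n%:R <= n%:R ^+ 2 :> R by rewrite -[leLHS]expr1; exact: ler_weXn2l.
  rewrite /B /K2 [(2 * Cm + 8) * _]mulrDl -!mulrA; apply: lerD; first exact: ler_wpM2l.
  rewrite -[8]/((2 * 4)%N%:R) natrM -mulrA; apply: ler_wpM2l => //; rewrite mulrA.
  by apply: (le_trans hr3); rewrite mulrC; exact: ler_wpM2l.
have hLm := hs_markov n L0.
have S := survival (X := X) (M := M n) (k0 := k0) (z := zz) (g := g) (L := L) (s := s) (dl := dl)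
  Xind c1 Xac k0n L1 s0 s1 d0 g0 zL sep cond pe0 h1 _ hpe hLm.
rewrite nk0 in S.
apply: (@le_trans _ _ ((2 * pe + (1 + Cm) * n%:R ^+ 2 / L + q%:R * ((h ^ q)%:R * (1 - c) ^+ h))%:E)).
  apply: le_trans (S erefl).
  have zE w i : zgram X (M n) zz n i w = sqn (\det (An n w - (zz i)%:M)) by rewrite sqn_det_An.
  apply: le_measure; rewrite ?inE.
  - by apply: (meas_none (fun=> _)) => i; exact: meas_det_An.
  - apply: (meas_none (fun i => g i * dl ^+ q)) => i.
    by apply: (eq_meas _ (meas_det_An n (zz i))) => w; rewrite zE.
  move=> w /= nw [i hi]; apply: nw; exists i.
  by apply: (le_trans (final i)); rewrite -/(zz i) -zE.
rewrite lee_fin.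
have ce : 1 - c <= expR (- c) by exact: expR_ge1Dx.
have c1' : 1 - c <= 1 by rewrite gerBl ltW.
have fa := row_failures np c1 ce cP k0n c1'.
have fb := strong_failures p4 k0n p10 p1n alow.
have fc := square_over_two_pow R np p4.
have fd := chunk_failures p4 c1 ce cP.
apply: (@le_trans _ _ ((6 + Cm) * expR (- PR))); last first.
  rewrite -!mulrA; apply: ler_wpM2l; first by rewrite addr_ge0.
  by rewrite mulrA; exact: (exp_rate R np).
have C1 : 0 <= 1 + Cm by rewrite addr_ge0.
have fc' := ler_wpM2l C1 fc.
by rewrite -mulrA; exact: (arith_failures fa fb fc' fd).
Qed.

End one_size.

(** With the constants fixed, every threshold is a lower bound on [p]. Taking [eta] at most
    [eps / 16] leaves [eps / 4] for the losses proportional to [n] and [eps / 2] for the error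
    [Kt * n / p]. *)
Lemma det_lower (w0 : C) (r0 eps : R) : sqn w0 < 1 -> 0 < r0 -> r0 <= 1 -> 0 < eps ->
  exists Kf n0, forall n, (n0 <= n)%N -> exists G, exists z : 'I_G -> C,
  (forall i, sqn (z i - w0) <= r0 ^+ 2) /\
  (P [set w | ~ exists i, (expR (n%:R * (sqn w0 - 1 - eps)) * n%:R ^+ n <=
     sqn (\det (An n w - ((Num.sqrt n%:R)%:C * z i)%:M)))%R] <= (Kf / (n.+1)%:R ^+ 2)%:E)%E.
Proof.
move=> w01 r0p r01 e0; set t := sqn w0.
have t0 : 0 <= t := sqn_ge0 _.
pose eta := Num.min (1 / 2) (eps / 16).
have eta0 : 0 < eta by rewrite lt_min !divr_gt0.
have eta1 : eta <= 1 / 2 by rewrite ge_min lexx.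
have etae : eta <= eps / 16 by rewrite ge_min lexx orbT.
have eta20 : 0 < eta / 2 by rewrite divr_gt0.
have [K [c [K0 c0 c1 XK Xac]]] := small_ball_constants eta20.
pose dl := eta * (1 - t) / 2.
have dl0 : 0 < dl by rewrite divr_gt0// mulr_gt0// subr_gt0.
have [n0r hr] := Mrank dl0.
pose Kt := 34 + (52 + (2 * Cm + 8)) * (4 * (4 * (8 + 2 * K) / eta ^+ 2) + 3) + (41 + 2 / r0).
have r0i : 0 <= 2 / r0 by rewrite divr_ge0// ltW.
have Kt0 : 0 <= Kt.
  apply: addr_ge0; last by apply: addr_ge0.
  apply: addr_ge0 => //; apply: mulr_ge0; first by rewrite !addr_ge0// mulr_ge0.
  by rewrite addr_ge0// mulr_ge0// divr_ge0 ?exprn_ge0 ?mulr_ge0 ?addr_ge0 ?mulr_ge0// ltW.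
pose bd := 4 + 17 / c + 2 * Kt / eps + dl^-1.
have b1 : 0 <= 17 / c by rewrite divr_ge0// ltW.
have b2 : 0 <= 2 * Kt / eps by apply: divr_ge0; [exact: mulr_ge0|exact: ltW].
have b3 : 0 <= dl^-1 by rewrite invr_ge0 ltW.
pose p0 := Num.bound bd.
have p0bd : bd < p0%:R by apply: archi_boundP; rewrite /bd !addr_ge0.
exists ((6 + Cm) * (32`!%:R * expR 1)), (maxn (p0 ^ 16) n0r) => n.
rewrite geq_max => /andP[hn1 hn2].
have [p /andP[pn np]] := root16 n.
have pp : (p0 <= p)%N.
  by rewrite -ltnS -(@ltn_exp2r _ _ 16)//; exact: leq_ltn_trans np.
have Pbd : bd <= p%:R by apply: (le_trans (ltW p0bd)); rewrite ler_nat.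
have [P4 P17 PK Pd] : [/\ 4 <= p%:R :> R, 17 / c <= p%:R, 2 * Kt / eps <= p%:R & dl^-1 <= p%:R].
  exact: arith_parameters Pbd b1 b2 b3.
have p4 : (4 <= p)%N by rewrite -(ler_nat R).
have P0 : 0 < p%:R :> R by rewrite ltr0n (leq_trans _ p4).
have cP : 17 <= c * p%:R by move: P17; rewrite ler_pdivrMr// mulrC.
have nR0 : 0 <= n%:R :> R by [].
have rkM : (p ^ 2 + \rank (M n))%:R <= eta * (n%:R - n%:R * t).
  have -> : eta * (n%:R - n%:R * t) = dl * n%:R + dl * n%:R by rewrite /dl; field.
  rewrite natrD; apply: lerD; last exact: hr.
  rewrite natrX; apply: (le_trans (@pow_le_n R p n pn p4 2 isT)).
  rewrite mulrC; apply: ler_wpM2r => //.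
  by rewrite -[dl]invrK lef_pV2 ?posrE ?invr_gt0.
have [z [hz hP]] := det_lower_size w01 r0p r01 eta0 eta1 K0 c0 c1 XK Xac pn np p4 cP rkM.
exists _, z; split => //; apply: le_trans hP; apply: le_measure; rewrite ?inE.
- by apply: (meas_none (fun=> _)) => i; exact: meas_det_An.
- by apply: (meas_none (fun=> _)) => i; exact: meas_det_An.
move=> w /= nw [i hi]; apply: nw; exists i; apply: le_trans hi.
apply: ler_wpM2r; first by rewrite exprn_ge0.
rewrite ler_expR -/Kt -/t.
have k1 : Kt * (n%:R / p%:R) <= eps / 2 * n%:R.
  rewrite mulrA ler_pdivrMr// mulrAC; apply: ler_wpM2r => //.
  by move: PK; rewrite ler_pdivrMr// mulrC -ler_pdivlMr// => /le_trans; apply; rewrite [eps / 2 * _]mulrAC [eps * _]mulrC.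
have k2 : eta * n%:R <= eps / 16 * n%:R by exact: ler_wpM2r.
have k3 : 0 <= eps * n%:R by rewrite mulr_ge0// ltW.
exact: arith_rate.
Qed.

End determinant_lower_bound.

(** * Upper bound for the determinant *)

Section expected_determinant.
Context d (T : measurableType d) (R : realType) (P : probability T R).
Local Notation C := R[i].
Context (X : nat * nat -> {RV P >-> R[i]}).
Hypothesis Xind : mutually_independent X.
Hypothesis XRe : forall i, Ex P (fun w => Re (X i w)) = 0.
Hypothesis XIm : forall i, Ex P (fun w => Im (X i w)) = 0.
Hypothesis Xsqn : forall i, (\int[P]_w (sqn (X i w))%:E)%E = 1%E.

(** [Ye] is a martingale: averaging the form [Qe] over the next row gives its trace plus its value
    at the mean, which is the previous [Ye]. *)
Lemma int_Ye n (N : nat -> 'rV[C]_n) k : (k <= n)%N ->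
  (\int[P]_w (Ye X N n k w)%:E)%E = (Yf (tailN N n 0) [::])%:E.
Proof.
elim: k => [_|k IH kn].
  have -> : (\int[P]_w (Ye X N n 0 w)%:E = \int[P]_w (cst (Yf (tailN N n 0) [::])%:E w))%E by [].
  by rewrite integral_cst// [X in (_ * X)%E](probability_setT P) mule1.
rewrite -(IH (ltnW kn)); pose H (z : T * T) := (qf (Qe X N n k z.1) (Rw X N k z.2))%:E.
have H0 z : (0 <= H z)%E.
  by rewrite lee_fin; have [_ h] := Qf_psd (tailN N n k.+1) (rlist ((Rw X N) ^~ z.1) k); exact: h.
have mH : measurable_fun setT (H : sigma_of X (upto k) * sigma_of X (atrow k) -> \bar R).
  apply/measurable_EFinP; apply: meas_qf; last by apply: mxmeas_Rw2.
  apply: (@mxmeas_Qf_rlist _ _ _ _ _ (fun i (z : sigma_of X (upto k) * sigma_of X (atrow k)) => Rw X N i z.1)).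
  by move=> i ik; apply: mxmeas_Rw1.
have hd := @decouple _ _ _ _ _ _ _ X Xind (upto k) (atrow k) H (upto_atrow k) H0 mH.
transitivity (\int[P]_w H (w, w))%E; first by apply: eq_integral => w _; rewrite YeS.
rewrite hd; apply: eq_integral => w _; rewrite /H /= (int_qf_row Xind XRe XIm Xsqn (@rowix_inj n k)) ?YeE//.
exact: Qf_psd.
Qed.

Variable M : forall n, 'M[C]_n.

Lemma int_sqn_det n z : (\int[P]_w (sqn (\det (An X M n w - z%:M)))%:E)%E =
  (Yf [seq rw (M n - z%:M) i | i <- iota 0 n] [::])%:E.
Proof.
have := int_Ye (rw (M n - z%:M)) (leqnn n); rewrite /tailN subn0 => <-.
by apply: eq_integral => w _; rewrite sqn_det_An shiftlist_Rw /Ye /tailN subnn.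
Qed.

End expected_determinant.

(** * Expected squared determinant up to subexponential factors *)

Section upper_bound.
Variable R : realType.
Local Notation C := R[i].

(** Exponential tilting: for [a <= r] and [s <= 1] the factor [s ^ (a - r)] is at least 1, and the
    tilted series is an exponential. *)
Lemma sum_pow_fact_le (x s : R) (r m : nat) : 0 <= x -> 0 < s -> s <= 1 ->
  \sum_(a < m | (a <= r)%N) x ^+ a / (a`!)%:R <= s ^- r * expR (x * s).
Proof.
move=> x0 s0 s1; rewrite mulrC ler_pdivlMr ?exprn_gt0// mulr_suml.
have xs0 : 0 <= x * s by rewrite mulr_ge0// ltW.
apply: le_trans (exp_partial m xs0); rewrite [leRHS](bigID (fun a : 'I_m => (a <= r)%N)) /=.
apply: ler_wpDr; first by apply: sumr_ge0 => a _; rewrite divr_ge0// exprn_ge0.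
apply: ler_sum => a ar; rewrite mulrAC exprMn; apply: ler_wpM2r; first by rewrite invr_ge0.
by apply: ler_wpM2l; [exact: exprn_ge0|apply: ler_wiXn2l => //; exact: ltW].
Qed.

Lemma fact_sub_le (n r a : nat) : (2 * r <= n)%N -> (a <= r)%N -> (0 < n)%N ->
  ((n - a)`!)%:R <= n`!%:R * (2 / n%:R) ^+ a :> R.
Proof.
move=> rn ar n0; have nR0 : 0 < n%:R :> R by rewrite ltr0n.
elim: a ar => [|a IH] ar; first by rewrite subn0 expr0 mulr1.
have := IH (ltnW ar); have e : (n - a = (n - a.+1).+1)%N by lia.
have -> : (n - a)`! = ((n - a) * (n - a.+1)`!)%N by rewrite e factS.
rewrite natrM exprS => h; have na : n%:R / 2 <= (n - a)%:R :> R.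
  by rewrite ler_pdivrMr// -natrM ler_nat; lia.
have F0 : 0 <= ((n - a.+1)`!)%:R :> R by [].
have hh : n%:R / 2 * ((n - a.+1)`!)%:R <= n`!%:R * (2 / n%:R) ^+ a :> R by apply: le_trans h; exact: ler_wpM2r.
by rewrite mulrCA -[X in X * _]invf_div ler_pdivlMl ?divr_gt0.
Qed.

Lemma fact_upper (n : nat) : n`!%:R <= (n.+1)%:R * n%:R ^+ n * expR (1 - n%:R) :> R.
Proof.
have f0 : 0 < n`!%:R :> R by rewrite ltr0n fact_gt0.
have := powfact_lower R n; rewrite mulrA ler_pdivlMr// => h.
rewrite -[1 - _]opprB expRN ler_pdivlMr ?expR_gt0// mulrC; exact: h.
Qed.

Lemma subexponential (dl : R) : 0 < dl -> exists n0, forall n, (n0 <= n)%N ->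
  (n.+1)%:R * expR 1 <= expR (dl * n%:R) :> R.
Proof.
move=> d0; have e0 : 0 < expR 1 :> R := expR_gt0 _.
have c0 : 0 <= 8 * expR 1 / dl ^+ 2 by rewrite divr_ge0 ?exprn_ge0 ?mulr_ge0// ltW.
exists (maxn 1 (Num.bound (8 * expR 1 / dl ^+ 2))) => n; rewrite geq_max => /andP[n1 hn].
have n1R : 1 <= n%:R :> R by rewrite ler1n.
have h1 : 8 * expR 1 / dl ^+ 2 <= n%:R.
  by apply: le_trans (ltW (archi_boundP c0)) _; rewrite ler_nat.
rewrite ler_pdivrMr ?exprn_gt0// in h1.
have h2 : dl * n%:R / 2 <= expR (dl * n%:R / 2).
  by apply: le_trans (expR_ge1Dx _); rewrite lerDr.
have -> : dl * n%:R = 2%:R * (dl * n%:R / 2) by field.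
rewrite expRM_natl; apply: (@le_trans _ _ ((dl * n%:R / 2) ^+ 2)); last first.
  by apply: lerXn2r; rewrite ?nnegrE ?expR_ge0// divr_ge0 ?mulr_ge0// ltW.
rewrite -natr1; have -> : (dl * n%:R / 2) ^+ 2 = n%:R * (n%:R * dl ^+ 2) / 4 by field.
have h3 : n%:R * (8 * expR 1) <= n%:R * (n%:R * dl ^+ 2) by apply: ler_wpM2l h1; lra.
have h4 : (n%:R + 1) * expR 1 <= (2 * n%:R) * expR 1 :> R by apply: ler_wpM2r; [exact: ltW|lra].
apply: (le_trans h4); lra.
Qed.

Variable M : forall n, 'M[C]_n.
Hypothesis Mrank : forall dl : R, 0 < dl -> exists n0, forall n, (n0 <= n)%N ->
  (\rank (M n))%:R <= dl * n%:R.
Variable Cm : R.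
Hypothesis Cm0 : 0 <= Cm.
Hypothesis Mhs : forall n, \sum_(i < n) nrm2 (row i (M n)) <= Cm * n%:R ^+ 2.

(** The tilted sum with [s = exp (- u)] costs [exp (u * \rank M)], harmless since the rank is
    [o(n)], and [exp (Bc * n * s)], harmless for [u] large. Two of the four shares [t = eps / 4]
    cover this sum, one the weight [(1 + t) ^+ n], one the error in Stirling's formula. *)
Lemma Yf_upper (eps : R) : 0 < eps -> exists n0, forall n, (n0 <= n)%N -> forall z : C,
  Yf [seq rw (M n - z%:M) i | i <- iota 0 n] [::] <= n%:R ^+ n * expR (sqn z - n%:R + eps * n%:R).
Proof.
move=> e0; pose t := eps / 4; have t0 : 0 < t by rewrite divr_gt0.
pose Bc := 2 * Cm / t; have B0 : 0 <= Bc by rewrite divr_ge0 ?mulr_ge0// ltW.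
pose u := 4 * Bc / eps + 1; have u1 : 1 <= u by rewrite lerDr; apply: divr_ge0; [exact: mulr_ge0|exact: ltW].
have u0 : 0 < u := lt_le_trans ltr01 u1.
pose dl := Num.min (eps / 4 / u) (1 / 2).
have dl0 : 0 < dl by rewrite lt_min !divr_gt0.
have [n1 hr] := Mrank dl0; have [n2 hs] := subexponential t0.
exists (maxn 1 (maxn n1 n2)) => n; rewrite !geq_max => /and3P[n0 hn1 hn2] z.
have nR0 : 0 < n%:R :> R by rewrite ltr0n.
have nR : 0 <= n%:R :> R by [].
have rk := hr n hn1; set r := \rank (M n) in rk *.
have rn : (2 * r <= n)%N.
  rewrite -(ler_nat R) natrM mulrC -ler_pdivlMr//; apply: (le_trans rk).
  have d1 : dl <= 1 / 2 by rewrite ge_min lexx orbT.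
  by rewrite mulrC; apply: ler_wpM2l => //; rewrite -[leRHS]mul1r.
apply: (le_trans (Y_upper (M n) z t0)).
set S := \sum_(i < n) nrm2 _; have S0 : 0 <= S by apply: sumr_ge0 => i _; exact: nrm2_ge0.
pose s := expR (- u); have s0 : 0 < s := expR_gt0 _.
have s1 : s <= 1 by rewrite -[leRHS](@expR0 R) ler_expR oppr_le0 ltW.
have hsum : \sum_(a < n.+1 | (a <= r)%N) (t^-1 * S) ^+ a / (a`!)%:R * ((n - a)`!)%:R <=
    n`!%:R * expR (2 * t * n%:R).
  apply: (@le_trans _ _ (n`!%:R * \sum_(a < n.+1 | (a <= r)%N) (Bc * n%:R) ^+ a / (a`!)%:R)).
    rewrite [leRHS]mulr_sumr; apply: ler_sum => a ar.
    have tS : 0 <= t^-1 * S by rewrite mulr_ge0// invr_ge0 ltW.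
    apply: (@le_trans _ _ ((t^-1 * S) ^+ a / (a`!)%:R * (n`!%:R * (2 / n%:R) ^+ a))).
      by apply: ler_wpM2l; [rewrite divr_ge0// exprn_ge0|exact: (@fact_sub_le n r)].
    rewrite mulrCA; apply: ler_wpM2l => //; rewrite mulrAC -exprMn; apply: ler_wpM2r; first by rewrite invr_ge0.
    apply: lerXn2r; rewrite ?nnegrE; [by apply: mulr_ge0 => //; rewrite divr_ge0|by rewrite mulr_ge0|].
    rewrite mulrA ler_pdivrMr// /Bc.
    have -> : 2 * Cm / t * n%:R * n%:R = t^-1 * (Cm * n%:R ^+ 2) * 2 by field; rewrite gt_eqF.
    apply: ler_wpM2r => //; apply: ler_wpM2l; [by rewrite invr_ge0 ltW|exact: Mhs].
  apply: ler_wpM2l => //; have Bn : 0 <= Bc * n%:R by rewrite mulr_ge0.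
  apply: (le_trans (sum_pow_fact_le _ _ Bn s0 s1)).
  have -> : 2 * t * n%:R = t * n%:R + t * n%:R by ring.
  rewrite expRD; apply: ler_pM; rewrite ?expR_ge0 ?invr_ge0 ?exprn_ge0 ?expR_ge0//.
    rewrite /s -expRM_natl -expRN ler_expR mulrN opprK.
    apply: (@le_trans _ _ (dl * n%:R * u)); first by apply: ler_wpM2r => //; exact: ltW.
    rewrite mulrAC; apply: ler_wpM2r => //.
    apply: (@le_trans _ _ (eps / 4 / u * u)); last by rewrite divfK// gt_eqF.
    by apply: ler_wpM2r; [exact: ltW|rewrite ge_min lexx].
  rewrite ler_expR mulrAC; apply: ler_wpM2r => //.
  rewrite /s expRN ler_pdivrMr ?expR_gt0//.
  apply: (@le_trans _ _ (t * (1 + u))); last by apply: ler_wpM2l; [exact: ltW|exact: expR_ge1Dx].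
  rewrite /t /u; have -> : eps / 4 * (1 + (4 * Bc / eps + 1)) = Bc + eps / 2 by field; rewrite gt_eqF.
  by rewrite lerDl divr_ge0// ltW.
have ht : (1 + t) ^+ n <= expR (t * n%:R).
  rewrite mulrC expRM_natl; apply: lerXn2r; rewrite ?nnegrE ?expR_ge0//; last exact: expR_ge1Dx.
  by rewrite addr_ge0// ltW.
have hf := fact_upper n; have hss := hs n hn2.
have -> : sqn z - n%:R + eps * n%:R = t * n%:R + sqn z + (t * n%:R - n%:R) + 2 * t * n%:R.
  by rewrite /t; field.
have E4 (a b c c' : R) : expR (a + b + c + c') = expR a * expR b * expR c * expR c' by rewrite !expRD.
rewrite E4 [expR (t * _ - _)]expRD.
apply: (@le_trans _ _ (expR (t * n%:R) * expR (sqn z) *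
    (n%:R ^+ n * (expR (t * n%:R) * expR (- n%:R)) * expR (2 * t * n%:R)))); last first.
  by move: (expR (sqn z)) => y; rewrite le_eqVlt; apply/orP; left; apply/eqP; ring.
apply: ler_pM.
- by rewrite mulr_ge0 ?expR_ge0// exprn_ge0// addr_ge0// ltW.
- by apply: sumr_ge0 => a _; rewrite mulr_ge0// divr_ge0// exprn_ge0// mulr_ge0// invr_ge0 ltW.
- by apply: (ler_wpM2r (expR_ge0 _) ht).
apply: (le_trans hsum); apply: ler_wpM2r; first exact: expR_ge0.
apply: (le_trans hf).
have -> : (n.+1)%:R * n%:R ^+ n * expR (1 - n%:R : R) =
  n%:R ^+ n * ((n.+1)%:R * expR 1 * expR (- n%:R)) by rewrite expRD; ring.
by apply: ler_wpM2l; [rewrite exprn_ge0|apply: ler_wpM2r; [exact: expR_ge0|]].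
Qed.

End upper_bound.

(** * Discrete averages over a circle *)

Section averages.
Variable R : realType.
Local Notation C := R[i].

Lemma primitive_root_exists m : (0 < m)%N -> exists z : C, m.-primitive_root z.
Proof.
move=> m0; pose p : {poly C} := 'X^m - 1.
have [r Dp] := closed_field_poly_normal p.
move: Dp; rewrite (monicP _) ?monicXnsubC // scale1r => Dp.
have rn1 : all m.-unity_root r by apply/allP => z; rewrite -root_prod_XsubC -Dp.
have sz_r : (m < (size r).+1)%N by rewrite -(size_prod_XsubC r id) -Dp size_XnsubC.
have [|z] := hasP (cyclic.has_prim_root m0 rn1 _ sz_r); last by exists z.
by rewrite -separable.separable_prod_XsubC -Dp cyclotomic.separable_Xn_sub_1 // pnatr_eq0 -lt0n.
Qed.

Lemma sqn_mean_le m (a : 'I_m -> C) : sqn (\sum_j a j) <= m%:R * \sum_j sqn (a j).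
Proof.
have := dot_cs (\row_j a j) (const_mx 1); rewrite dotE !nrm2E.
rewrite (eq_bigr a) => [|j _]; last by rewrite !mxE conjC1 mulr1.
rewrite (eq_bigr (fun j => sqn (a j))) => [|j _]; last by rewrite mxE.
rewrite [X in _ * X](eq_bigr (fun=> 1)) => [|j _]; last by rewrite mxE sqn1.
by rewrite sumr_const card_ord mulrC.
Qed.

Lemma sum_prim_root m (zeta : C) i : m.-primitive_root zeta -> (0 < i < m)%N ->
  \sum_(j < m) (zeta ^+ j) ^+ i = 0.
Proof.
move=> pz /andP[i0 im]; have z1 : zeta ^+ i != 1.
  by rewrite -(prim_order_dvd pz) gtnNdvd.
under eq_bigr do rewrite -exprM mulnC exprM.
apply: (mulfI (x := zeta ^+ i - 1)); first by rewrite subr_eq0.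
by rewrite -subrX1 -exprM mulnC exprM (prim_expr_order pz) expr1n subrr mulr0.
Qed.

(** The sum of the [i]-th powers of the [m]-th roots of unity vanishes for [0 < i < m], so a finite
    average does what the integral over the circle would do. *)
Lemma mean_prim_root m (zeta : C) (p : {poly C}) (r : C) : m.-primitive_root zeta -> (size p <= m)%N ->
  \sum_(j < m) p.[r * zeta ^+ j] = m%:R * p.[0].
Proof.
move=> pz sp; have m0 := prim_order_gt0 pz.
under eq_bigr do rewrite (horner_coef_wide _ sp).
rewrite exchange_big /= (bigD1 (Ordinal m0)) //= [X in _ + X]big1 => [|i i0].
  by under eq_bigr do rewrite !expr0 mulr1; rewrite addr0 sumr_const card_ord horner_coef0 mulr_natl.
under eq_bigr do rewrite exprMn mulrA; rewrite -mulr_sumr sum_prim_root ?mulr0//.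
by rewrite ltn_ord andbT lt0n; apply: contraNneq i0 => e; apply/eqP/val_inj.
Qed.

Lemma sqn_prim_root m (zeta : C) j : m.-primitive_root zeta -> sqn (zeta ^+ j) = 1.
Proof.
move=> pz; have m0 := prim_order_gt0 pz; rewrite sqnX.
suff -> : sqn zeta = 1 by rewrite expr1n.
apply/eqP; rewrite -(pexpr_eq1 m0) ?sqn_ge0//; by rewrite -sqnX (prim_expr_order pz) sqn1.
Qed.

(* Roots inside the circle are reflected across it, which does not change moduli on the circle. *)
Lemma jensen_roots m (zeta : C) (s : seq C) (w0 c : C) (r : R) (K : nat) :
  m.-primitive_root zeta -> 0 < r -> (size s + size s * K < m)%N ->
  \prod_(l <- s) Num.max (r ^+ 2) (sqn (w0 - l)) <=
  m%:R^-1 * \sum_(j < m) (\prod_(l <- s) sqn (w0 + r%:C * zeta ^+ j - l)) *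
     sqn (1 - c * (r%:C * zeta ^+ j) / K%:R) ^+ (size s * K).
Proof.
move=> pz r0 sm; have m0 := prim_order_gt0 pz.
have mR0 : 0 < m%:R :> R by rewrite ltr0n.
have rC0 : r%:C != 0 :> C by apply/eqP => /(congr1 (@complex.Re R)) /= h; move: r0; rewrite h ltxx.
(* For a root inside the circle [q l] is the reflected factor: same modulus on the circle, modulus
   [r] at the centre. *)
pose q l : {poly C} := if r ^+ 2 <= sqn (w0 - l) then 'X - (l - w0)%:P
  else r%:C%:P - ((l - w0)^*%R / r%:C) *: 'X.
(* The damping factor is 1 at the centre, and its power in [T] imitates an exponential while
   remaining a polynomial. *)
pose e : {poly C} := 1 - (c / K%:R) *: 'X.
pose T := (\prod_(l <- s) q l) * e ^+ (size s * K).
have szl (a b : C) : (size ((a%:P - b *: 'X)%R : {poly C}) <= 2)%N.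
  apply: (leq_trans (size_polyD _ _)); rewrite geq_max size_polyN size_polyC.
  rewrite (leq_trans (leq_b1 _))//=; apply: leq_trans (size_scale_leq _ _) _.
  by rewrite size_polyX.
have szq l : (size (q l) <= 2)%N by rewrite /q; case: ifP => _; rewrite ?size_XsubC.
have size_prodle (t : seq C) : (size (\prod_(l <- t) q l)%R <= (size t).+1)%N.
  elim: t => [|l t IH]; first by rewrite big_nil size_poly1.
  rewrite big_cons; apply: (leq_trans (size_polyMleq _ _)) => /=.
  by have := leq_add (szq l) IH; case: (size (q l) + _)%N.
have size_exple k : (size (e ^+ k)%R <= k.+1)%N.
  apply: leq_trans (size_poly_exp_leq _ _) _; rewrite ltnS.
  have : (size e <= 2)%N by rewrite /e -[1]/(1%:P); exact: szl.
  by case: (size e) => [|[|[|]]]// _; rewrite ?mul0n ?mul1n.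
have sT : (size T <= m)%N.
  apply: (leq_trans (size_polyMleq _ _)).
  have := leq_add (size_prodle s) (size_exple (size s * K)%N).
  move: sm; set a := size (\prod_(l <- s) q l); set b := size (e ^+ _); lia.
have hm := mean_prim_root r%:C pz sT.
have hq l j : sqn (q l).[r%:C * zeta ^+ j] = sqn (w0 + r%:C * zeta ^+ j - l).
  rewrite /q; case: ifP => _.
    by rewrite hornerXsubC; congr sqn; ring.
  set x := r%:C * _; have sx : sqn x = r ^+ 2 by rewrite sqnM (sqn_prim_root _ pz) mulr1 sqn_real.
  have x0 : x != 0 by rewrite -sqn_eq0 sx expf_neq0// gt_eqF.
  rewrite hornerD hornerN hornerZ hornerX hornerC.
  have xE : x * x^*%R = r%:C * r%:C by rewrite mulconj sx -rmorphM expr2.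
  have -> : r%:C - (l - w0)^*%R / r%:C * x = x / r%:C * (x - (l - w0))^*%R.
    rewrite [X in _ = _ * X](rmorphB Num.conj) mulrBr [x / _ * x^*%R]mulrAC xE mulfK//.
    by rewrite mulrC mulrA mulrAC.
  rewrite sqnM sqnM sqnV sqn_real sx sqn_conj divff ?mul1r ?expf_neq0 ?gt_eqF//.
  by congr sqn; ring.
have hT j : sqn T.[r%:C * zeta ^+ j] = (\prod_(l <- s) sqn (w0 + r%:C * zeta ^+ j - l)) *
     sqn (1 - c * (r%:C * zeta ^+ j) / K%:R) ^+ (size s * K).
  rewrite /T hornerM horner_prod sqnM sqn_prod; congr (_ * _); first by apply: eq_bigr => l _; rewrite hq.
  rewrite horner_exp sqnX; congr (sqn _ ^+ _); rewrite /e !hornerE /=; ring.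
have hT0 : sqn T.[0] = \prod_(l <- s) Num.max (r ^+ 2) (sqn (w0 - l)).
  rewrite /T hornerM horner_prod sqnM sqn_prod horner_exp /e !hornerE subr0 expr1n sqn1 mulr1.
  apply: eq_bigr => l _; rewrite /q; case: ifP => h.
    by rewrite hornerXsubC max_r// sub0r opprB.
  by rewrite !hornerE subr0 sqn_real max_l// ltW// ltNge h.
rewrite -hT0 ler_pdivlMl// -(ler_pM2l mR0) mulrA -expr2.
under [in leRHS]eq_bigr do rewrite -hT.
apply: le_trans (sqn_mean_le _); rewrite hm sqnM; apply: ler_wpM2r; first exact: sqn_ge0.
by rewrite -[m%:R in leRHS](rmorph_nat (real_complex R)) sqn_real.
Qed.

(** This is [1 + x <= exp x] for [x = |1 - u / K|^2 - 1]. With [u = conj w0 * s] it cancels the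
    factor [exp (2 n Re u)] by which the bound for the expected squared determinant varies on the
    circle. *)
Lemma sqn_damping (u : C) (K n : nat) : (0 < K)%N ->
  sqn (1 - u / K%:R) ^+ (n * K) <= expR (n%:R * (- 2 * Re u + sqn u / K%:R)).
Proof.
move=> K0; have KR : 0 < K%:R :> R by rewrite ltr0n.
have -> : n%:R * (- 2 * Re u + sqn u / K%:R) = (n * K)%:R * (- 2 * Re u / K%:R + sqn u / K%:R ^+ 2).
  by rewrite natrM; field; rewrite gt_eqF.
rewrite expRM_natl; apply: lerXn2r; rewrite ?nnegrE ?sqn_ge0 ?expR_ge0//.
apply: le_trans (expR_ge1Dx _).
rewrite sqnD sqn1 mul1r sqnN rmorphN /= ReN ReconjE sqnM sqnV.
have -> : (K%:R : C) = (K%:R : R)%:C by rewrite rmorph_nat.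
rewrite sqn_real -rmorphV ?unitfE ?gt_eqF// [u * _]mulrC ReZ -addrA.
by rewrite le_eqVlt; apply/orP; left; apply/eqP; ring.
Qed.

End averages.

(** * Products over the eigenvalues *)

Section eigenvalue_products.
Variable R : realType.
Local Notation C := R[i].

Lemma sqn_det_eigenvalues n (A : 'M[C]_n) (z : C) :
  sqn (\det (A - ((Num.sqrt n%:R)%:C * z)%:M)) =
  n%:R ^+ n * \prod_(l <- eigenvalues ((Num.sqrt n%:R)^-1%:C *: A)) sqn (z - l).
Proof.
set s := (Num.sqrt n%:R)%:C : C; set B := (Num.sqrt n%:R)^-1%:C *: A.
have sn : sqn s = n%:R by rewrite sqn_real sqr_sqrtr.
have -> : A - (s * z)%:M = (- s) *: (z%:M - B).
  have [n0|n0] := posnP n.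
    by apply/matrixP => i; have := ltn_ord i; rewrite [X in (_ < X)%N]n0.
  have s0 : s * (Num.sqrt n%:R)^-1%:C = 1.
    by rewrite -rmorphM mulfV// sqrtr_eq0 -ltNge ltr0n.
  rewrite scaleNr scalerBr scale_scalar_mx opprB /B scalerA s0 scale1r.
  by congr (_ - _).
rewrite detZ sqnM sqnX sqnN sn; congr (_ * _); rewrite -sqn_prod; congr sqn.
have -> : \det (z%:M - B) = (char_poly B).[z].
  rewrite /char_poly -horner_evalE -det_map_mx; congr (\det _).
  apply/matrixP => i j; rewrite !mxE /= horner_evalE hornerD hornerN hornerC.
  by rewrite hornerMn hornerX.
by rewrite char_poly_eigenvalues horner_prod; apply: eq_bigr => l _; rewrite hornerXsubC.
Qed.

End eigenvalue_products.

Lemma Re_mulconj (R : realType) (z w : R[i]) : Re (z * w^*%R) = Re (z^*%R * w).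
Proof. by rewrite !conjE; case: z; case: w => a b c d /=; ring. Qed.

Section almost_sure.
Context d (T : measurableType d) (R : realType) (P : probability T R).
Local Notation C := R[i].

Lemma ae_countable (I : countType) (Q : I -> T -> Prop) :
  (forall i, {ae P, forall w, Q i w}) -> {ae P, forall w, forall i, Q i w}.
Proof.
move=> h; have : {ae P, forall w, forall n, if (unpickle n : option I) is Some i then Q i w else True}.
  apply: ae_foralln => n; case: (unpickle n) => [i|]; first exact: h.
  exact: aeW.
by apply: filterS => w H i; have := H (pickle i); rewrite pickleK.
Qed.

Lemma ae_eventually (Q : nat -> T -> Prop) (K : R) n0 :
  (forall n, (n0 <= n)%N -> exists2 E, measurable E /\ (P E <= (K / (n.+1)%:R ^+ 2)%:E)%E &
     forall w, ~ E w -> Q n w) ->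
  {ae P, forall w, exists N, forall n, (N <= n)%N -> Q n w}.
Proof.
move=> h; have h' n : exists E, (n0 <= n)%N ->
    [/\ measurable E, (P E <= (K / (n.+1)%:R ^+ 2)%:E)%E & forall w, ~ E w -> Q n w].
  have [hn|hn] := leqP n0 n; last by exists set0.
  by have [E [h1 h2] h3] := h n hn; exists E.
have [E hE] := choice h'.
have := @borel_cantelli _ _ _ P E K n0 (fun n hn => let: And3 a _ _ := hE n hn in a)
  (fun n hn => let: And3 _ a _ := hE n hn in a).
apply: filterS => w [N hN]; exists (maxn N n0) => n; rewrite geq_max => /andP[Nn n0n].
by have [_ _ h3] := hE n n0n; apply: h3; exact: hN.
Qed.

Lemma int_sum_le m (F : 'I_m -> T -> R) (c b : 'I_m -> R) : (forall j, 0 <= c j) ->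
  (forall j w, 0 <= F j w) -> (forall j, measurable_fun setT (F j)) ->
  (forall j, (\int[P]_w (F j w)%:E <= (b j)%:E)%E) ->
  (\int[P]_w (\sum_j c j * F j w)%:E <= (\sum_j c j * b j)%:E)%E.
Proof.
move=> c0 F0 mF hb; under eq_integral do rewrite -sumEFin.
rewrite ge0_integral_sum//; last 2 first.
- by move=> j; apply/measurable_EFinP; apply: measurable_funM => //; exact: measurable_cst.
- by move=> j w _; rewrite lee_fin mulr_ge0.
rewrite -sumEFin; apply: lee_sum => j _.
under eq_integral do rewrite EFinM.
rewrite ge0_integralZl//; first by rewrite EFinM; apply: lee_wpmul2l; rewrite ?lee_fin.
- exact/measurable_EFinP.
- by move=> w _; rewrite lee_fin.
by rewrite lee_fin.
Qed.

Context (X : nat * nat -> {RV P >-> R[i]}).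
Hypothesis Xind : mutually_independent X.
Hypothesis XRe : forall i, Ex P (fun w => Re (X i w)) = 0.
Hypothesis XIm : forall i, Ex P (fun w => Im (X i w)) = 0.
Hypothesis Xsqn : forall i, (\int[P]_w (sqn (X i w))%:E)%E = 1%E.
Hypothesis Xtr : forall eta : R, 0 < eta -> exists2 K : R, 1 <= K &
  forall ij, 1 - eta <= Ex P (trunc (X ij) K).
Variable M : forall n, 'M[C]_n.
Hypothesis Mrank : forall dl : R, 0 < dl -> exists n0, forall n, (n0 <= n)%N ->
  (\rank (M n))%:R <= dl * n%:R.
Variable Cm : R.
Hypothesis Cm0 : 0 <= Cm.
Hypothesis Mhs : forall n, \sum_(i < n) nrm2 (row i (M n)) <= Cm * n%:R ^+ 2.

Definition lam n w : seq C := eigenvalues ((Num.sqrt n%:R)^-1%:C *: An X M n w).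

Lemma size_lam n w : size (lam n w) = n.
Proof. exact: size_eigenvalues. Qed.

Lemma ae_prod_lower (w0 : C) (r0 eps : R) : sqn w0 < 1 -> 0 < r0 -> r0 <= 1 -> 0 < eps ->
  {ae P, forall w, exists N, forall n, (N <= n)%N -> exists2 z : C, sqn (z - w0) <= r0 ^+ 2 &
    expR (n%:R * (sqn w0 - 1 - eps)) <= \prod_(l <- lam n w) sqn (z - l)}.
Proof.
move=> w01 r0p r01 e0.
have [Kf [n0 h]] := det_lower Xind XRe XIm Xsqn Xtr Mrank Cm0 Mhs w01 r0p r01 e0.
apply: (@ae_eventually _ Kf (maxn n0 1)) => n; rewrite geq_max => /andP[hn n1].
have [G [z [zr hz]]] := h n hn; eexists; first split; [|exact: hz|].
  by apply: (meas_none (fun=> _)) => i; exact: meas_det_An.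
move=> w hw; apply: contrapT => h'; apply: hw => -[k].
rewrite sqn_det_eigenvalues mulrC ler_pM2l ?exprn_gt0 ?ltr0n// => hi.
by apply: h'; exists (z k).
Qed.

(** By [jensen_roots] the product is at most a weighted average of squared determinants, to which
    Markov's inequality is applied. Half of [eps] covers the second order error of the damping and
    the error of [Yf_upper]; the other half pays for the rate [(n + 1) ^ -2]. *)
Lemma ae_prod_upper (w0 : C) (r eps : R) : 0 < r -> 0 < eps ->
  {ae P, forall w, exists N, forall n, (N <= n)%N ->
    \prod_(l <- lam n w) Num.max (r ^+ 2) (sqn (w0 - l)) <= expR (n%:R * (sqn w0 + r ^+ 2 - 1 + eps))}.
Proof.
move=> r0 e0; pose K := (Num.bound (4 * (sqn w0 * r ^+ 2) / eps)).+1.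
have wr0 : 0 <= sqn w0 * r ^+ 2 by rewrite mulr_ge0 ?sqn_ge0 ?exprn_ge0// ltW.
have KR : 0 < K%:R :> R by rewrite ltr0n.
have hK : sqn w0 * r ^+ 2 / K%:R <= eps / 4.
  rewrite ler_pdivrMr// mulrAC ler_pdivlMr// mulrC -ler_pdivrMl//.
  apply: (@le_trans _ _ (4 * (sqn w0 * r ^+ 2) / eps)); first by rewrite [leLHS]mulrC lexx.
  apply: (le_trans (ltW (archi_boundP _))); last by rewrite ler_nat.
  by apply: divr_ge0; [rewrite mulr_ge0|exact: ltW].
have e4 : 0 < eps / 4 by rewrite divr_gt0.
have [n1 hY] := Yf_upper Mrank Cm0 Mhs e4; have [n2 hs] := subexponential e4.
apply: (@ae_eventually _ 1 (maxn n1 (maxn n2 1))) => n; rewrite !geq_max => /and3P[hn1 hn2 n0].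
have nR0 : 0 < n%:R :> R by rewrite ltr0n.
(* One more than the degree bound of the polynomial in [jensen_roots]. *)
pose m := (n + n * K).+1; have [zeta pz] := @primitive_root_exists R m isT.
have mR0 : 0 < m%:R :> R by rewrite ltr0n.
pose zz (j : 'I_m) : C := w0 + r%:C * zeta ^+ j.
pose F (j : 'I_m) w : R := sqn (\det (An X M n w - ((Num.sqrt n%:R)%:C * zz j)%:M)).
pose c (j : 'I_m) : R := m%:R^-1 * n%:R ^- n * sqn (1 - w0^*%R * (r%:C * zeta ^+ j) / K%:R) ^+ (n * K).
pose b (j : 'I_m) : R := n%:R ^+ n * expR (n%:R * sqn (zz j) - n%:R + eps / 4 * n%:R).
have c0 j : 0 <= c j.
  by rewrite mulr_ge0 ?exprn_ge0 ?sqn_ge0// mulr_ge0// invr_ge0 exprn_ge0.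
have F0 j w : 0 <= F j w by exact: sqn_ge0.
have mF j : measurable_fun setT (F j) by exact: meas_det_An.
have hb j : (\int[P]_w (F j w)%:E <= (b j)%:E)%E.
  rewrite (int_sqn_det Xind XRe XIm Xsqn) lee_fin; apply: (le_trans (hY n hn1 _)).
  by rewrite sqnM sqn_real sqr_sqrtr.
have hI := int_sum_le c0 F0 mF hb.
pose L := expR (n%:R * (sqn w0 + r ^+ 2 - 1 + eps)).
have L0 : 0 < L := expR_gt0 _.
have mU : measurable_fun setT (fun w => \sum_j c j * F j w).
  by apply: meas_sum => j; apply: measurable_funM => //; exact: measurable_cst.
have U0 w : 0 <= \sum_j c j * F j w by apply: sumr_ge0 => j _; rewrite mulr_ge0.
exists [set w | (L < \sum_j c j * F j w)%R].
  split; first by apply: (meas_set_lt (f := fun=> L)) => //; exact: measurable_cst.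
  apply: (le_trans (markov_real L0 mU U0 hI)); rewrite lee_fin ler_pdivrMr//.
  have hcb j : c j * b j <= m%:R^-1 * expR (n%:R * (sqn w0 + r ^+ 2 - 1 + eps / 2)).
    have -> : c j * b j = m%:R^-1 * (sqn (1 - w0^*%R * (r%:C * zeta ^+ j) / K%:R) ^+ (n * K) *
        expR (n%:R * sqn (zz j) - n%:R + eps / 4 * n%:R)).
      rewrite /c /b; move: (sqn (1 - _) ^+ _) (expR _) => x y.
      by field; rewrite !gt_eqF// exprn_gt0.
    apply: ler_wpM2l; first by rewrite invr_ge0.
    set u := w0^*%R * (r%:C * zeta ^+ j).
    have su : sqn u = sqn w0 * r ^+ 2 by rewrite !sqnM sqn_conj (sqn_prim_root _ pz) mulr1 sqn_real.
    have sz : sqn (zz j) = sqn w0 + 2 * Re u + r ^+ 2.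
      rewrite /zz sqnD sqnM (sqn_prim_root _ pz) mulr1 sqn_real.
      by rewrite Re_mulconj.
    have hd := @sqn_damping R u K n isT.
    apply: (@le_trans _ _ (expR (n%:R * (- 2 * Re u + sqn u / K%:R)) *
        expR (n%:R * sqn (zz j) - n%:R + eps / 4 * n%:R))).
      by apply: ler_wpM2r => //; exact: expR_ge0.
    rewrite -expRD ler_expR sz su.
    have : n%:R * (sqn w0 * r ^+ 2 / K%:R) <= n%:R * (eps / 4) by apply: ler_wpM2l => //; exact: ltW.
    rewrite mulrDr; set y := n%:R * (sqn w0 * _ / _); lra.
  apply: (@le_trans _ _ (expR (n%:R * (sqn w0 + r ^+ 2 - 1 + eps / 2)))).
    apply: (@le_trans _ _ (\sum_(j < m) m%:R^-1 * expR (n%:R * (sqn w0 + r ^+ 2 - 1 + eps / 2)))).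
      by apply: ler_sum => j _; exact: hcb.
    by rewrite sumr_const card_ord -mulrnAl -[_ *+ m]mulr_natl mulfV ?mul1r// gt_eqF.
  rewrite div1r /L -ler_pdivrMl ?invr_gt0 ?exprn_gt0 ?ltr0n// invrK.
  have -> : n%:R * (sqn w0 + r ^+ 2 - 1 + eps) =
      2%:R * (eps / 4 * n%:R) + n%:R * (sqn w0 + r ^+ 2 - 1 + eps / 2) by field.
  rewrite (expRD (2%:R * _)) (expRM_natl 2); apply: (ler_wpM2r (expR_ge0 _)).
  apply: lerXn2r; rewrite ?nnegrE ?expR_ge0//; apply: le_trans (hs n hn2).
  by rewrite ler_peMr// -[leLHS](@expR0 R) ler_expR.
move=> w /negP; rewrite -leNgt; apply: le_trans.
have sm : (size (lam n w) + size (lam n w) * K < m)%N by rewrite size_lam.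
apply: (le_trans (jensen_roots w0 (w0^*%R) pz r0 sm)); rewrite size_lam mulr_sumr.
apply: ler_sum => j _; rewrite /c /F sqn_det_eigenvalues -/(lam n w) -/(zz j).
rewrite le_eqVlt; apply/orP; left; apply/eqP; set p := \prod_(l <- _) _; set q := sqn _ ^+ _.
by field; rewrite !gt_eqF// exprn_gt0.
Qed.

Definition qc (q : rat * rat) : C := (ratr q.1 +i* ratr q.2)%C.

(** Rational parameters make the exceptional set a countable union, so one null set serves for all
    of them. *)
Lemma ae_potential : {ae P, forall w,
  (forall (q : rat * rat) (r eps : rat), 0 < r -> 0 < eps -> exists N, forall n, (N <= n)%N ->
    \prod_(l <- lam n w) Num.max (ratr r ^+ 2) (sqn (qc q - l)) <=
      expR (n%:R * (sqn (qc q) + ratr r ^+ 2 - 1 + ratr eps))) /\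
  (forall (q : rat * rat) (r0 eps : rat), sqn (qc q) < 1 -> 0 < r0 -> r0 <= 1 -> 0 < eps ->
    exists N, forall n, (N <= n)%N -> exists2 z : C, sqn (z - qc q) <= ratr r0 ^+ 2 &
    expR (n%:R * (sqn (qc q) - 1 - ratr eps)) <= \prod_(l <- lam n w) sqn (z - l))}.
Proof.
have h1 : {ae P, forall w, forall i : rat * rat * rat * rat, 0 < i.1.2 -> 0 < i.2 ->
    exists N, forall n, (N <= n)%N ->
    \prod_(l <- lam n w) Num.max (ratr i.1.2 ^+ 2) (sqn (qc i.1.1 - l)) <=
      expR (n%:R * (sqn (qc i.1.1) + ratr i.1.2 ^+ 2 - 1 + ratr i.2))}.
  apply: ae_countable => -[[q r] eps] /=.
  have [r0|r0] := boolP (0 < r); last by apply: aeW.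
  have [e0|e0] := boolP (0 < eps); last by apply: aeW.
  have r0' : 0 < ratr r :> R by rewrite ltr0q.
  have e0' : 0 < ratr eps :> R by rewrite ltr0q.
  by have := ae_prod_upper (qc q) r0' e0'; apply: filterS => w H _ _.
have h2 : {ae P, forall w, forall i : rat * rat * rat * rat, sqn (qc i.1.1) < 1 -> 0 < i.1.2 ->
    i.1.2 <= 1 -> 0 < i.2 ->
    exists N, forall n, (N <= n)%N -> exists2 z : C, sqn (z - qc i.1.1) <= ratr i.1.2 ^+ 2 &
    expR (n%:R * (sqn (qc i.1.1) - 1 - ratr i.2)) <= \prod_(l <- lam n w) sqn (z - l)}.
  apply: ae_countable => -[[q r] eps] /=.
  have [q1|q1] := boolP (sqn (qc q) < 1); last by apply: aeW.
  have [r0|r0] := boolP (0 < r); last by apply: aeW.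
  have [r1|r1] := boolP (r <= 1); last by apply: aeW.
  have [e0|e0] := boolP (0 < eps); last by apply: aeW.
  have r0' : 0 < ratr r :> R by rewrite ltr0q.
  have r1' : ratr r <= 1 :> R by rewrite -[leRHS](rmorph1 (@ratr R)) ler_rat.
  have e0' : 0 < ratr eps :> R by rewrite ltr0q.
  by have := ae_prod_lower q1 r0' r1' e0'; apply: filterS => w H _ _.
apply: filterS2 h1 h2 => w H1 H2; split.
  by move=> q r eps; exact: (H1 (q, r, eps)).
by move=> q r eps; exact: (H2 (q, r, eps)).
Qed.

End almost_sure.

(** * Potential theory *)

Section potential_theory.
Variable R : realType.
Local Notation C := R[i].

Lemma normcD_le (z w : C) : normc (z + w) <= normc z + normc w.
Proof. by rewrite -lecR rmorphD /=; exact: (@ler_normD _ R[i]). Qed.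

Lemma normc_opp (z : C) : normc (- z) = normc z.
Proof. by rewrite !normc_sqrt sqnN. Qed.

Lemma normc_dist (z w : C) : normc (z - w) = normc (w - z).
Proof. by rewrite -opprB normc_opp. Qed.

Lemma normc_le_sqn (z : C) (r : R) : 0 <= r -> sqn z <= r ^+ 2 -> normc z <= r.
Proof. by move=> r0 h; rewrite -(ler_pXn2r (n := 2)) ?nnegrE ?normc_ge0' ?normcE2. Qed.

Lemma eventually_fin (I : finType) (Q : I -> nat -> Prop) :
  (forall i, exists N, forall n, (N <= n)%N -> Q i n) ->
  exists N, forall n, (N <= n)%N -> forall i, Q i n.
Proof.
move=> /choice[N hN]; exists (\max_i N i) => n hn i; apply: hN.
by apply: leq_trans hn; exact: leq_bigmax.
Qed.

(** Layers of [ln^+ (r / x)], with the weights [1 / (j + 2) <= ln ((j + 2) / (j + 1))], which leave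
    room for the shift [rho]. In this form its average over the plane involves areas of discs
    only. *)
Definition step (r : R) m (x : R) : R := \sum_(j < m) (x <= r * j%:R / (m.+1)%:R)%R%:R / (j.+2)%:R.

(* [step] is a lower bound for the truncated logarithmic potential [ln^+ (r / (x + rho))]. *)
Lemma step_log (r rho x : R) m : 0 < r -> 0 <= rho -> 0 <= x -> rho <= r / (m.+1)%:R ->
  (x + rho) * expR (step r m x) <= Num.max (x + rho) r.
Proof.
move=> r0 rho0 x0 hrho; set N := (m.+1)%:R : R in hrho *.
have N0 : 0 < N by rewrite ltr0n.
have v0 : 0 <= x + rho by rewrite addr_ge0.
suff H k : (x + rho) * expR (\sum_(j < k) (x <= r * j%:R / N)%R%:R / (j.+2)%:R) <=
    Num.max (x + rho) (r * (k.+1)%:R / N).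
  by have := H m; rewrite mulfK// gt_eqF.
elim: k => [|k IH]; first by rewrite big_ord0 expR0 mulr1 le_max lexx.
rewrite big_ord_recr /= expRD mulrA; case: (lerP x (r * k%:R / N)) => hx; last first.
  rewrite mul0r expR0 mulr1; apply: (le_trans IH); rewrite ge_max !le_max lexx /=.
  apply/orP; right; rewrite -!mulrA; apply: ler_wpM2l; first exact: ltW.
  by apply: ler_wpM2r; [rewrite invr_ge0 ltW|rewrite ler_nat].
have hv : x + rho <= r * (k.+1)%:R / N.
  by apply: (le_trans (lerD hx hrho)); rewrite -mulrDl -natr1 mulrDr mulr1.
rewrite (max_r hv) in IH; rewrite le_max; apply/orP; right.
have e : expR (1 / (k.+2)%:R) <= (k.+2)%:R / (k.+1)%:R :> R.
  have h := expR_ge1Dx (- (1 / (k.+2)%:R) : R); rewrite expRN in h.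
  have -> : (k.+2)%:R / (k.+1)%:R = (1 - 1 / (k.+2)%:R)^-1 :> R.
    rewrite -[(k.+2)%:R]natr1; have : 0 < (k.+1)%:R :> R by rewrite ltr0n.
    by set y := (k.+1)%:R => yp; field; rewrite addrK !gt_eqF// addr_gt0.
  rewrite -[leLHS]invrK lef_pV2 ?posrE ?invr_gt0 ?expR_gt0//.
  by rewrite subr_gt0 ltr_pdivrMr ?ltr0n// mul1r ltr1n.
apply: (le_trans (ler_pM _ (expR_ge0 _) IH e)); first by rewrite mulr_ge0// expR_ge0.
by rewrite le_eqVlt; apply/orP; left; apply/eqP; field; rewrite ?gt_eqF ?ltr0n.
Qed.

Lemma step_ge0 r m x : 0 <= step r m x.
Proof. by apply: sumr_ge0 => j _; rewrite divr_ge0. Qed.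

Variable L : nat -> seq C.
Hypothesis sizeL : forall n, size (L n) = n.
Hypothesis HU : forall (q : rat * rat) (r eps : rat), 0 < r -> 0 < eps -> exists N, forall n, (N <= n)%N ->
  \prod_(l <- L n) Num.max (ratr r ^+ 2) (sqn (qc R q - l)) <=
    expR (n%:R * (sqn (qc R q) + ratr r ^+ 2 - 1 + ratr eps)).
Hypothesis HL : forall (q : rat * rat) (r0 eps : rat), sqn (qc R q) < 1 -> 0 < r0 -> r0 <= 1 -> 0 < eps ->
  exists N, forall n, (N <= n)%N -> exists2 z : C, sqn (z - qc R q) <= ratr r0 ^+ 2 &
    expR (n%:R * (sqn (qc R q) - 1 - ratr eps)) <= \prod_(l <- L n) sqn (z - l).

(** The upper bound at 0 with radius [1 - b] has exponent [n (- 2 b + 2 b^2)]. Each eigenvalue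
    contributes at least [2 ln (1 - b) >= - 2 b - 4 b^2], and each outlier [2 ln (1 + b) >= b] more,
    because [1 - b^2 = (1 - b) (1 + b)]. So the number of outliers times [b] is at most
    [6 b^2 n]. *)
Lemma few_outliers (b : rat) : 0 < b -> b <= 1 / 2 -> exists n0, forall n, (n0 <= n)%N ->
  (count (fun l => 1 - ratr b ^+ 2 <= normc l) (L n))%:R <= 6 * ratr b * n%:R :> R.
Proof.
move=> b0 b1; set a := ratr b : R.
have a0 : 0 < a by rewrite ltr0q.
have a1 : a <= 1 / 2.
  have -> : 1 / 2 = ratr (1 / 2) :> R by rewrite rmorphM fmorphV rmorph1 rmorph_nat.
  by rewrite ler_rat.
have s0 : 0 < 1 - b by rewrite subr_gt0 (le_lt_trans b1).
have e0 : 0 < b ^+ 2 by rewrite exprn_gt0.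
have [N hN] := HU (0, 0) s0 e0; exists N => n hn.
have q0 : qc R (0, 0) = 0 by rewrite /qc /= rmorph0.
have := hN n hn; rewrite q0 sqn0 add0r rmorphB rmorph1 rmorphXn /= -/a => h.
rewrite (eq_bigr (fun l => Num.max ((1 - a) ^+ 2) (sqn l))) in h; last by move=> l _; rewrite sub0r sqnN.
set c := count _ _; set s := 1 - a in h.
have s1 : 0 < s by rewrite /s; lra.
have hs : expR (- (a + 2 * a ^+ 2)) <= s.
  have h1 := expR_ge1Dx (a / s).
  have : 1 + a / s = s^-1 by rewrite /s; field; rewrite gt_eqF.
  move=> e; rewrite e in h1; rewrite expRN invf_ple ?posrE ?expR_gt0//.
  apply: (le_trans h1); rewrite ler_expR ler_pdivrMr//.
  by have := mulr_ge0 (ltW a0) (sqr_ge0 a); rewrite /s; nra.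
have ha : expR (a / 2) <= 1 + a.
  have h1 := expR_ge1Dx (- (a / 2)); rewrite expRN in h1.
  have h2 : 0 < 1 - a / 2 by lra.
  apply: (@le_trans _ _ (1 - a / 2)^-1).
    by rewrite -[leLHS]invrK lef_pV2 ?posrE ?invr_gt0 ?expR_gt0.
  by rewrite -[leLHS]div1r ler_pdivrMr//; nra.
have low : expR (n%:R * (- (2 * a) - 4 * a ^+ 2) + c%:R * a) <= \prod_(l <- L n) Num.max (s ^+ 2) (sqn l).
  set g := - (2 * a) - _; rewrite -{1}(sizeL n) /c; elim: (L n) => [|l t IH]; first by rewrite big_nil /= !mul0r addr0 expR0.
  rewrite big_cons /= natrD -[(size t).+1%:R]natr1 [X in X + _]mulrDl [X in _ + X]mulrDl mul1r.
  have -> (x y u v : R) : x + y + (u + v) = (y + u) + (x + v) by ring.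
  rewrite expRD; apply: ler_pM; rewrite ?expR_ge0//.
  have -> : g = - (a + 2 * a ^+ 2) + - (a + 2 * a ^+ 2) by rewrite /g; ring.
  case: (lerP (1 - a ^+ 2) (normc l)) => hl.
    rewrite mul1r le_max; apply/orP; right.
    have -> : a = a / 2 + a / 2 by field.
    have -> (x y : R) : x + x + (y + y) = 2%:R * (x + y) by ring.
    rewrite expRM_natl -normcE2; apply: lerXn2r; rewrite ?nnegrE ?expR_ge0 ?normc_ge0'//.
    apply: le_trans hl; rewrite expRD -splitr.
    have -> : 1 - a ^+ 2 = s * (1 + a) by rewrite /s; ring.
    by apply: ler_pM; rewrite ?expR_ge0.
  rewrite mul0r addr0 le_max; apply/orP; left.
  by rewrite expRD expr2; apply: ler_pM; rewrite ?expR_ge0.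
move: low; rewrite /= => low; have := le_trans low h; rewrite ler_expR /s => h3.
have h4 : c%:R * a <= (6 * a * n%:R) * a by move: h3; lra.
by rewrite ler_pM2r in h4.
Qed.

Lemma grid_point (Q : nat) (x : R) : (0 < Q)%N -> -1 <= x -> x <= 1 ->
  exists i : 'I_(2 * Q).+1, `|x - ratr ((i : nat)%:R / Q%:R - 1)| <= Q%:R^-1.
Proof.
move=> Q0 x0 x1; have QR : 0 < Q%:R :> R by rewrite ltr0n.
pose k := Num.truncn ((x + 1) * Q%:R).
have y0 : 0 <= (x + 1) * Q%:R by rewrite mulr_ge0//; lra.
have k1 : k%:R <= (x + 1) * Q%:R by rewrite truncn_le.
have k2 : (x + 1) * Q%:R < (k.+1)%:R by exact: truncnS_gt.
have kQ : (k < (2 * Q).+1)%N.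
  rewrite ltnS -(ler_nat R) natrM; apply: (le_trans k1); rewrite ler_pM2r//; lra.
exists (Ordinal kQ) => /=; rewrite rmorphB rmorph1 rmorphM fmorphV !rmorph_nat.
have -> : x - (k%:R / Q%:R - 1) = ((x + 1) * Q%:R - k%:R) / Q%:R by field; rewrite gt_eqF.
rewrite normrM normfV [X in _ / X]gtr0_norm// ler_piMl ?invr_ge0//.
by rewrite ger0_norm ?subr_ge0// lerBlDl natr1 ltW.
Qed.

Lemma step_term (r rho dl x x0 y : R) m : 0 < r -> 0 <= rho -> 0 <= dl -> 0 <= x -> rho <= r / (m.+1)%:R ->
  0 <= y -> y <= x + rho -> x <= x0 + dl ->
  y * expR (step r m x - (dl + rho) / r) <= Num.max r x0.
Proof.
move=> r0 rho0 dl0 x00 hrho y0 yx xx0.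
rewrite expRD mulrA expRN ler_pdivrMr ?expR_gt0//.
apply: (@le_trans _ _ (Num.max (x + rho) r)).
  by apply: le_trans (step_log r0 rho0 x00 hrho); apply: ler_wpM2r => //; exact: expR_ge0.
have M0 : 0 < Num.max r x0 by rewrite lt_max r0.
have k0 : 0 <= (dl + rho) / r by rewrite divr_ge0 ?addr_ge0// ltW.
apply: (@le_trans _ _ (Num.max r x0 * (1 + (dl + rho) / r))); last first.
  by apply: ler_wpM2l; [exact: ltW|exact: expR_ge1Dx].
have Mr : dl + rho <= Num.max r x0 * ((dl + rho) / r).
  rewrite mulrCA ler_peMr ?addr_ge0// ler_pdivlMr// mul1r le_max lexx//.
rewrite mulrDr mulr1 ge_max; apply/andP; split.
  have := @le_max _ _ x0 r x0; rewrite lexx orbT => h; move: Mr; lra.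
have : r <= Num.max r x0 by rewrite le_max lexx.
have := mulr_ge0 (ltW M0) k0; lra.
Qed.

(** At a grid point [w0] near [w] the truncated upper product is divided by the lower product at a
    point [z] near [w0]; the terms [n (|w0|^2 - 1)] cancel. Finitely many grid points give
    uniformity in [w], and [step_term] absorbs the displacements at a cost [kap] for each
    eigenvalue. The half in [r^2 / 2] comes from passing from squared moduli to moduli. *)
Lemma potential_bound (b : R) (r : rat) m (eps : R) : 0 < b -> 0 < r -> 0 < eps ->
  exists n0, forall n, (n0 <= n)%N -> forall w : C, normc w <= 1 - b ->
  \sum_(l <- L n) step (ratr r) m (normc (w - l)) <= n%:R * (ratr r ^+ 2 / 2 + eps).
Proof.
move=> b0 r0 e0; set rr := ratr r : R.
have rr0 : 0 < rr by rewrite ltr0q.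
(* In turn: [w0] stays in the open disc; the radius of the lower bound is at most 1; [step_log]
   applies with [rho = 2 tau]; and [kap = 3 tau / r] is at most [3 eps / 8]. *)
pose tau : R := Num.min (Num.min (b / 2) (1 / 2)) (Num.min (rr / (m.+1)%:R / 2) (eps * rr / 8)).
have m0 : 0 < (m.+1)%:R :> R by rewrite ltr0n.
have tau0 : 0 < tau.
  have a1 : 0 < b / 2 by rewrite divr_gt0.
  have a2 : 0 < rr / (m.+1)%:R / 2 by rewrite divr_gt0// divr_gt0.
  have a3 : 0 < eps * rr / 8 by rewrite divr_gt0// mulr_gt0.
  by rewrite !lt_min a1 a2 a3 divr_gt0.
have tauP : [/\ tau <= b / 2, tau <= 1 / 2, tau <= rr / (m.+1)%:R / 2 & tau <= eps * rr / 8].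
  by split; rewrite !ge_min lexx ?orbT.
case: tauP => t1 t2 t3 t4.
pose Q := (Num.bound (2 / tau)).+1; have QR : 0 < Q%:R :> R by rewrite ltr0n.
have hQ : Q%:R^-1 + Q%:R^-1 <= tau.
  have : 2 / tau <= Q%:R.
    apply: (le_trans (ltW (archi_boundP _))); last by rewrite ler_nat.
    by rewrite divr_ge0// ltW.
  have -> : Q%:R^-1 + Q%:R^-1 = 2 / Q%:R :> R by rewrite mulr2n mulrDl mul1r.
  by rewrite ler_pdivrMr// mulrC ler_pdivrMr.
have [t t0 tt] : exists2 t : rat, 0 < t & ratr t <= tau.
  have [q] := rat_in_itvoo tau0; rewrite in_itv /= => /andP[q1 q2].
  by exists q; [rewrite -(ltr0q R)|exact: ltW].
have tq1 : t <= 1.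
  rewrite -(ler_rat R) rmorph1; apply: (le_trans tt); apply: (le_trans t2).
  by rewrite ler_pdivrMr// mul1r ler1n.
have [e e0' ee] : exists2 e : rat, 0 < e & ratr e <= eps / 4.
  have [q] := rat_in_itvoo (divr_gt0 e0 (ltr0Sn R 3)); rewrite in_itv /= => /andP[q1 q2].
  by exists q; [rewrite -(ltr0q R)|exact: ltW].
pose gp (i : 'I_(2 * Q).+1) : rat := (i : nat)%:R / Q%:R - 1.
pose gq (i : 'I_(2 * Q).+1 * 'I_(2 * Q).+1) : rat * rat := (gp i.1, gp i.2).
have [n1 h1] : exists N, forall n, (N <= n)%N -> forall i,
    \prod_(l <- L n) Num.max (rr ^+ 2) (sqn (qc R (gq i) - l)) <=
    expR (n%:R * (sqn (qc R (gq i)) + rr ^+ 2 - 1 + ratr e)).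
  by apply: eventually_fin => i; exact: HU.
have [n2 h2] : exists N, forall n, (N <= n)%N -> forall i, sqn (qc R (gq i)) < 1 ->
    exists2 z : C, sqn (z - qc R (gq i)) <= ratr t ^+ 2 &
    expR (n%:R * (sqn (qc R (gq i)) - 1 - ratr e)) <= \prod_(l <- L n) sqn (z - l).
  apply: eventually_fin => i; have [q1|q1] := boolP (sqn (qc R (gq i)) < 1); last by exists 0%N.
  by have [N hN] := HL q1 t0 tq1 e0'; exists N => n hn _; exact: hN.
exists (maxn n1 n2) => n; rewrite geq_max => /andP[hn1 hn2] w wb.
have w1 : normc w <= 1 by apply: (le_trans wb); lra.
have wRe : -1 <= Re w <= 1 by rewrite -ler_norml; apply: le_trans w1; exact: Re_le_normc.
have wIm : -1 <= Im w <= 1.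
  rewrite -ler_norml; apply: le_trans w1; rewrite -(ler_pXn2r (n := 2)) ?nnegrE ?normc_ge0'//.
  by rewrite normcE2 real_normK ?num_real// /sqn lerDr sqr_ge0.
have [i1 hi1] := @grid_point Q (Re w) isT (proj1 (andP wRe)) (proj2 (andP wRe)).
have [i2 hi2] := @grid_point Q (Im w) isT (proj1 (andP wIm)) (proj2 (andP wIm)).
set w0 := qc R (gq (i1, i2)).
have ww0 : normc (w - w0) <= tau.
  apply: le_trans hQ; apply: (le_trans (normc_le_ReIm _)); apply: lerD.
    by rewrite ReD ReN.
  by rewrite ImD ImN.
have w0b : normc w0 <= 1 - b / 2.
  have -> : w0 = w - (w - w0) by ring.
  apply: (le_trans (normcD_le _ _)); rewrite normc_opp; lra.
have w01 : sqn w0 < 1.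
  have := normc_ge0' w0; rewrite -normcE2 => h; nra.
have [z zw0 hz] := h2 n hn2 (i1, i2) w01; have hu := h1 n hn1 (i1, i2).
rewrite -/w0 in zw0 hz hu.
have zn : normc (z - w0) <= tau.
  by apply: le_trans tt; apply: normc_le_sqn => //; rewrite ler0q ltW.
set kap := (tau + (tau + tau)) / rr.
have term (l : C) : sqn (z - l) * expR (2 * (step rr m (normc (w - l)) - kap)) <= Num.max (rr ^+ 2) (sqn (w0 - l)).
  have hyp1 : normc (z - l) <= normc (w - l) + (tau + tau).
    have -> : z - l = (z - w0) + ((w0 - w) + (w - l)) by ring.
    apply: (le_trans (normcD_le _ _)); have := normcD_le (w0 - w) (w - l).
    by move: ww0; rewrite normc_dist; lra.
  have hyp2 : normc (w - l) <= normc (w0 - l) + tau.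
    have -> : w - l = (w - w0) + (w0 - l) by ring.
    by apply: (le_trans (normcD_le _ _)); lra.
  have hyp3 : tau + tau <= rr / (m.+1)%:R by move: t3; set y := rr / _; lra.
  have tt0 : 0 <= tau + tau by rewrite addr_ge0// ltW.
  have := step_term rr0 tt0 (ltW tau0) (normc_ge0' _) hyp3 (normc_ge0' _) hyp1 hyp2.
  rewrite -/kap => ht.
  have -> : Num.max (rr ^+ 2) (sqn (w0 - l)) = Num.max rr (normc (w0 - l)) ^+ 2.
    rewrite -normcE2; have [hle|hlt] := lerP rr (normc (w0 - l)).
      by apply/max_idPr; apply: lerXn2r; rewrite ?nnegrE ?normc_ge0'// ltW.
    by apply/max_idPl; apply: lerXn2r; rewrite ?nnegrE ?normc_ge0'// ltW.
  rewrite (expRM_natl 2) -normcE2 -exprMn; apply: lerXn2r; rewrite ?nnegrE//.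
    by rewrite mulr_ge0 ?normc_ge0' ?expR_ge0.
  by rewrite le_max ltW.
have prodle (s : seq C) : (\prod_(l <- s) sqn (z - l)) *
    expR (2 * (\sum_(l <- s) step rr m (normc (w - l)) - (size s)%:R * kap)) <=
    \prod_(l <- s) Num.max (rr ^+ 2) (sqn (w0 - l)).
  elim: s => [|l s IH]; first by rewrite !big_nil mul0r subrr mulr0 expR0 mulr1.
  rewrite !big_cons /= -[(size s).+1%:R]natr1 [((size s)%:R + 1) * _]mulrDl mul1r.
  have -> (x y u v : R) : 2 * (x + y - (u + v)) = 2 * (x - v) + 2 * (y - u) by ring.
  rewrite expRD mulrACA; apply: ler_pM (term l) IH; first by rewrite mulr_ge0 ?sqn_ge0 ?expR_ge0.
  by rewrite mulr_ge0 ?expR_ge0//; apply: prodr_ge0 => *; exact: sqn_ge0.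
have := le_trans (prodle (L n)) hu; rewrite sizeL => hfin.
have hz2 : expR (n%:R * (sqn w0 - 1 - ratr e)) * expR (2 * (\sum_(l <- L n) step rr m (normc (w - l)) - n%:R * kap)) <=
    expR (n%:R * (sqn w0 + rr ^+ 2 - 1 + ratr e)).
  by apply: le_trans hfin; apply: (ler_wpM2r (expR_ge0 _)).
move: hz2; rewrite -expRD ler_expR; set S := \sum_(l <- _) _ => hS.
have hk : kap <= 3 / 8 * eps.
  rewrite /kap ler_pdivrMr//; lra.
have n0 : 0 <= n%:R :> R by [].
have hk2 := ler_wpM2l n0 hk; have he2 := ler_wpM2l n0 ee.
move: hS hk2 he2; set y1 := n%:R * kap; set y2 := n%:R * ratr e; set y3 := n%:R * (rr ^+ 2).
have -> : n%:R * (sqn w0 - 1 - ratr e) = n%:R * (sqn w0 - 1) - y2 by rewrite /y2; ring.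
have -> : n%:R * (sqn w0 + rr ^+ 2 - 1 + ratr e) = n%:R * (sqn w0 - 1) + y3 + y2 by rewrite /y2 /y3; ring.
have -> : n%:R * (rr ^+ 2 / 2 + eps) = y3 / 2 + n%:R * eps by rewrite /y3; field.
have : 0 <= n%:R * eps by rewrite mulr_ge0// ltW.
set y4 := n%:R * eps => y40.
have -> : n%:R * (3 / 8 * eps) = 3 / 8 * y4 by rewrite /y4; ring.
have -> : n%:R * (eps / 4) = y4 / 4 by rewrite /y4; ring.
set y5 := n%:R * _; lra.
Qed.

End potential_theory.

(** * Area of a disc *)

Section disc_area.
Variable R : realType.
Local Notation C := R[i].
Local Notation mu := (@lebesgue_measure R).

(** Substitution of [a + s sin th] for [x], after which [s^2 (th + sin th cos th)] is an
    antiderivative. *)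
Lemma integral_semicircle (a s : R) : 0 < s ->
  (\int[mu]_(x in `[(a - s)%R, (a + s)%R]) (2 * Num.sqrt (s ^+ 2 - (x - a) ^+ 2))%:E)%E = (pi * s ^+ 2)%:E.
Proof.
move=> s0; pose p : R := pi / 2; have p0 : 0 < p by rewrite divr_gt0// pi_gt0.
have pp : - p < p by rewrite gtrN.
pose F : R -> R := cst a + s \*: (@sin R).
have dF (x : R) : is_derive x 1 F (s * cos x).
  by have := is_deriveD (is_derive_cst a x 1) (is_deriveZ s (is_derive_sin x)); rewrite add0r.
have F'E : derive1 F = (fun x => s * cos x).
  by apply/funext => x; rewrite derive1E; exact: derive_val.
have cF : continuous F.
  by move=> x; apply/differentiable_continuous/derivable1_diffP; exact: (@ex_derive _ _ _ _ _ _ _ (dF x)).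
have cF' : continuous (fun x : R => s * cos x).
  by move=> x; apply: continuousM; [exact: cst_continuous|exact: continuous_cos].
have Fa : F (- p) = a - s by change (a + s * sin (- (pi / 2)) = a - s); rewrite sinN sin_pihalf mulrN1.
have Fb : F p = a + s by change (a + s * sin (pi / 2) = a + s); rewrite sin_pihalf mulr1.
pose G (x : R) : R := 2 * Num.sqrt (s ^+ 2 - (x - a) ^+ 2).
have cG : continuous G.
  move=> x; apply: (@continuousM _ _ (fun=> 2 : R) (fun x : R => Num.sqrt (s ^+ 2 - (x - a) ^+ 2))).
    exact: cst_continuous.
  apply: (@continuous_comp _ _ _ (fun x : R => s ^+ 2 - (x - a) ^+ 2) Num.sqrt); last exact: sqrt_continuous.
  apply: continuousB; first exact: cst_continuous.
  apply: (@continuous_comp _ _ _ (fun x : R => x - a) (fun y : R => y ^+ 2)); last exact: exprn_continuous.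
  by apply: continuousB; [exact: cvg_id|exact: cst_continuous].
rewrite -Fa -Fb (@integration_by_substitution_increasing _ F G (- p) p (ltW pp)); last 6 first.
- move=> x y; rewrite !in_itv /= => xp yp xy; rewrite /F !fctE ltrD2l.
  by change (s * sin x < s * sin y); rewrite ltr_pM2l// ltr_sin// in_itv.
- by rewrite F'E => x _; exact: cF'.
- by rewrite F'E; apply/cvg_ex; exists (s * cos (- p)); apply: cvg_at_right_filter; exact: cF'.
- by rewrite F'E; apply/cvg_ex; exists (s * cos p); apply: cvg_at_left_filter; exact: cF'.
- split; [|by apply: cvg_at_right_filter; exact: cF|by apply: cvg_at_left_filter; exact: cF].
  by move=> x _; exact: (@ex_derive _ _ _ _ _ _ _ (dF x)).
- exact: continuous_subspaceT.
pose H : R -> R := s ^+ 2 \*: (id + (@sin R) * (@cos R)).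
have dH (x : R) : is_derive x 1 H (2 * s ^+ 2 * cos x ^+ 2).
  have := is_deriveZ (s ^+ 2) (is_deriveD (is_derive_id x 1) (is_deriveM (is_derive_sin x) (is_derive_cos x))).
  rewrite /H; congr is_derive; rewrite /GRing.scale /=.
  have := cos2Dsin2 x; set c := cos x; set t := sin x => h.
  have e : t ^+ 2 = 1 - c ^+ 2 by rewrite -h addrAC subrr add0r.
  have -> : t * - t = - (t ^+ 2) by ring.
  by rewrite e; ring.
pose h (x : R) : R := 2 * s ^+ 2 * cos x ^+ 2.
have ch : continuous h.
  move=> x; apply: (@continuousM _ _ (fun=> 2 * s ^+ 2 : R) (fun x : R => cos x ^+ 2)).
    exact: cst_continuous.
  apply: (@continuous_comp _ _ _ (@cos R) (fun y : R => y ^+ 2)); last exact: exprn_continuous.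
  exact: continuous_cos.
have cH : continuous H.
  by move=> x; apply/differentiable_continuous/derivable1_diffP; exact: (@ex_derive _ _ _ _ _ _ _ (dH x)).
transitivity (\int[mu]_(x in `[(- p)%R, p]) (h x)%:E)%E.
  apply: eq_integral => x; rewrite inE /= in_itv /= => xp; congr EFin.
  rewrite F'E /G /F /h /= !fctE /= [a + _]addrC addrK /GRing.scale /=.
  have -> : s ^+ 2 - (s * sin x) ^+ 2 = (s * cos x) ^+ 2.
    by have := cos2Dsin2 x; set c := cos x; set t := sin x => e; nra.
  have c0 : 0 <= s * cos x by rewrite mulr_ge0 ?(ltW s0)// cos_ge0_pihalf.
  by rewrite sqrtr_sqr ger0_norm//; ring.
rewrite (@continuous_FTC2 _ h H (- p) p pp).
- rewrite -EFinB /H !fctE /GRing.scale /= cosN cos_pihalf !mulr0 !addr0.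
  by congr EFin; rewrite /p /GRing.scale /=; field.
- exact: continuous_subspaceT.
- split; [|by apply: cvg_at_right_filter; exact: cH|by apply: cvg_at_left_filter; exact: cH].
  by move=> x _; exact: (@ex_derive _ _ _ _ _ _ _ (dH x)).
by move=> x _; rewrite derive1E; exact: derive_val.
Qed.

Definition disc (l : C) (s : R) : set C := [set z | normc (z - l) <= s].

Lemma measurable_normc (l : C) : measurable_fun setT (fun z : C => normc (z - l)).
Proof.
apply: measurable_lip => z w; apply: (le_trans (_ : _ <= `|normc (z - l) - normc (w - l)|)) => //.
rewrite ler_norml; apply/andP; split.
  have := normcD_le (w - z) (z - l); rewrite subrKA [normc (w - z)]normc_dist; lra.
by have := normcD_le (z - w) (w - l); rewrite subrKA; lra.
Qed.

Lemma measurable_disc l s : measurable (disc l s).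
Proof.
have := measurable_normc l; move=> /(_ measurableT _ (@measurable_itv R `]-oo, s])).
by rewrite setTI; congr measurable; apply/seteqP; split=> w /=; rewrite in_itv.
Qed.

Lemma lebesgue_disc (l : C) (s : R) : 0 < s -> lebesgue_complex (disc l s) = (pi * s ^+ 2)%:E.
Proof.
move=> s0; rewrite -(integral_semicircle (Re l) s0).
rewrite /lebesgue_complex /pushforward /= /product_measure1 [RHS]integral_mkcond.
apply: eq_integral => x _ /=; rewrite patchE.
have secE (y : R) : (xsection (@complex_of_plane R @^-1` disc l s) x) y <->
    (y - Im l) ^+ 2 <= s ^+ 2 - (x - Re l) ^+ 2.
  rewrite /xsection /= inE /= /disc /= /complex_of_plane /=.
  rewrite -(ler_pXn2r (n := 2)) ?nnegrE ?normc_ge0' ?(ltW s0)// normcE2 /sqn ReD ImD ReN ImN /=.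
  by rewrite lerBrDl.
case: ifPn => hx.
  have d0 : 0 <= s ^+ 2 - (x - Re l) ^+ 2.
    move: hx; rewrite inE /= in_itv /= => /andP[h1 h2]; nra.
  set t := Num.sqrt _; have t0 : 0 <= t := sqrtr_ge0 _.
  rewrite (_ : xsection _ _ = `[Im l - t, Im l + t]%classic); last first.
    apply/seteqP; split => y /=; rewrite in_itv /=.
      move=> /secE h; rewrite -ler_distl -sqrtr_sqr; exact: ler_wsqrtr.
    move=> h; apply/secE; rewrite -ler_distl -sqrtr_sqr in h.
    by rewrite -(ler_sqrt _ d0).
  rewrite lebesgue_measure_itv /= lte_fin; case: ltP => ht; last first.
    by have -> : t = 0; [lra|rewrite mulr0].
  by rewrite -EFinB; congr EFin; ring.
rewrite (_ : xsection _ _ = set0) ?measure0//.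
apply/seteqP; split => y //= /secE h; move: hx; rewrite notin_setE /= in_itv /=; apply.
have : (x - Re l) ^+ 2 <= s ^+ 2 by have := sqr_ge0 (y - Im l); lra.
by rewrite -ler_distl -sqrtr_sqr -[X in _ -> _ <= X](ger0_norm (ltW s0)) -[`|s|]sqrtr_sqr; exact: ler_wsqrtr.
Qed.

End disc_area.

(** * The uniform law as an upper bound for the density *)

Section uniform_law.
Variable R : realType.
Local Notation C := R[i].
Local Notation nu := (uniform_disk R).

Lemma unit_diskE : @unit_disk R = disc (0 : C) 1.
Proof. by apply/seteqP; split => z; rewrite /unit_disk /disc /= subr0 -lecR. Qed.

Lemma uniform_discI (A : set C) : nu A = ((pi^-1)%:E * lebesgue_complex (A `&` disc (0%R : C) 1%R))%E.
Proof. by rewrite -unit_diskE. Qed.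

Lemma uniform_disc (l : C) (s : R) : 0 < s -> normc l + s <= 1 -> nu (disc l s) = (s ^+ 2)%:E.
Proof.
move=> s0 ls; rewrite uniform_discI (_ : _ `&` _ = disc l s) ?lebesgue_disc//.
  by rewrite -EFinM mulrA mulVf ?mul1r// gt_eqF// pi_gt0.
apply/setIidPl => z; rewrite /disc /= subr0 => h; apply: le_trans ls.
by rewrite -[z](subrK l) addrC; apply: (le_trans (normcD_le _ _)); rewrite lerD2l.
Qed.

Lemma uniform_setT : nu [set: C] = 1%E.
Proof.
rewrite uniform_discI setTI lebesgue_disc// -EFinM mulrA mulVf ?mul1r ?expr1n//.
by rewrite gt_eqF// pi_gt0.
Qed.

(** The average of [step r m (normc (w - l))] over [w], divided by [r^2], when the disc of radius
    [r] about [l] lies in the unit disc. Its limit [1/2] matches the constant of the potential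
    bound, which is why the density obtained is sharp. *)
Definition step_mass m : R := \sum_(j < m) (j%:R / (m.+1)%:R) ^+ 2 / (j.+2)%:R.

Lemma step_mass_lower m : 1 / 2 - 7 / (2 * (m.+1)%:R) <= step_mass m.
Proof.
set N := (m.+1)%:R : R; have N0 : 0 < N by rewrite ltr0n.
(* Summation of [j^2 / (j + 2) >= j - 2]. *)
have h k : (k%:R * k%:R - 5 * k%:R) / 2 / N ^+ 2 <= \sum_(j < k) (j%:R / N) ^+ 2 / (j.+2)%:R :> R.
  elim: k => [|k IH]; first by rewrite big_ord0 !(mul0r, mulr0, subr0).
  rewrite big_ord_recr /=.
  have t : (k%:R - 2) / N ^+ 2 <= (k%:R / N) ^+ 2 / (k.+2)%:R.
    rewrite exprMn exprVn mulrAC; apply: ler_wpM2r; first by rewrite invr_ge0 exprn_ge0// ltW.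
    rewrite ler_pdivlMr ?ltr0n// -(natr1 k.+1) -(natr1 k).
    by have := ler0n R k; nra.
  have -> : ((k.+1)%:R * (k.+1)%:R - 5 * (k.+1)%:R) / 2 / N ^+ 2 =
      (k%:R * k%:R - 5 * k%:R) / 2 / N ^+ 2 + (k%:R - 2) / N ^+ 2.
    by rewrite -[(k.+1)%:R]natr1; field; rewrite gt_eqF.
  exact: lerD.
apply: le_trans (h m); have -> : m%:R = N - 1 by rewrite /N -natr1 addrK.
have -> : ((N - 1) * (N - 1) - 5 * (N - 1)) / 2 / N ^+ 2 = 1 / 2 - 7 / (2 * N) + 3 / N ^+ 2.
  by field; rewrite gt_eqF.
by rewrite lerDl divr_ge0// exprn_ge0// ltW.
Qed.

Lemma indic_disc (l : C) (s : R) (w : C) : (normc (w - l) <= s)%R%:R = \1_(disc l s) w :> R.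
Proof. by rewrite indicE; congr (nat_of_bool _)%:R; apply/idP/idP; rewrite inE. Qed.

Lemma meas_step (r : R) m (l : C) : measurable_fun setT (fun w : C => step r m (normc (w - l))).
Proof.
apply: meas_sum => j; apply: measurable_funM; last exact: measurable_cst.
apply: (eq_meas (f := \1_(disc l (r * j%:R / (m.+1)%:R)) : C -> R)) => [z|]; first exact: indic_disc.
by apply: measurable_indic; exact: measurable_disc.
Qed.

Lemma int_step_lower (r : R) m (l : C) : 0 < r -> normc l + r <= 1 ->
  ((r ^+ 2 * step_mass m)%:E <= \int[nu]_w (step r m (normc (w - l)))%:E)%E.
Proof.
move=> r0 lr; under eq_integral do rewrite /step -sumEFin.
have N0 : 0 < (m.+1)%:R :> R by rewrite ltr0n.
have iE (j : 'I_m) (w : C) : ((normc (w - l) <= r * j%:R / (m.+1)%:R)%R%:R / (j.+2)%:R : R)%:E =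
    (((j.+2)%:R^-1)%:E * (\1_(disc l (r * j%:R / (m.+1)%:R)) w)%:E)%E.
  rewrite -EFinM mulrC; congr ((_ * _)%:E); exact: indic_disc.
have mi (j : 'I_m) : measurable_fun setT (fun w : C => (\1_(disc l (r * j%:R / (m.+1)%:R)) w)%:E : \bar R).
  by apply/measurable_EFinP; apply: measurable_indic; exact: measurable_disc.
under eq_integral do under eq_bigr do rewrite iE.
rewrite ge0_integral_sum//; last by move=> j; apply: measurable_funeM.
rewrite /step_mass mulr_sumr -sumEFin; apply: lee_sum => j _.
rewrite ge0_integralZl//.
rewrite integral_indic ?setIT//; last exact: measurable_disc.
case: (posnP j) => j0.
  by rewrite j0 mul0r expr0n mul0r mulr0; apply: mule_ge0; rewrite ?lee_fin.
have sp : 0 < r * j%:R / (m.+1)%:R by rewrite divr_gt0 ?mulr_gt0 ?ltr0n.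
rewrite uniform_disc//.
  by rewrite -EFinM lee_fin le_eqVlt; apply/orP; left; apply/eqP; field; rewrite gt_eqF//= pnatr_eq0.
apply: le_trans lr; rewrite lerD2l ler_pdivrMr//; apply: ler_wpM2l; first exact: ltW.
by rewrite ler_nat ltnW// ltnS ltnW.
Qed.

Definition unif_cont (f : C -> R) := forall eta : R, 0 < eta -> exists2 dl : R, 0 < dl &
  forall z w : C, normc (z - w) <= dl -> `|f z - f w| <= eta.

Variable L : nat -> seq C.
Hypothesis sizeL : forall n, size (L n) = n.
Hypothesis few : forall b : rat, 0 < b -> b <= 1 / 2 -> exists n0, forall n, (n0 <= n)%N ->
  (count (fun l => 1 - ratr b ^+ 2 <= normc l) (L n))%:R <= 6 * ratr b * n%:R :> R.
Hypothesis pot : forall (b : R) (r : rat) m (eps : R), 0 < b -> 0 < r -> 0 < eps ->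
  exists n0, forall n, (n0 <= n)%N -> forall w : C, normc w <= 1 - b ->
  \sum_(l <- L n) step (ratr r) m (normc (w - l)) <= n%:R * (ratr r ^+ 2 / 2 + eps).

(** Duality: the potential bound is integrated against [g] under the uniform law. Within distance
    [r] of [l] one has [g w >= g l - eta], so by Tonelli each eigenvalue receives at least
    [r^2 * step_mass m] times the positive part of [g l - eta]. As [step_mass m] is almost [1/2],
    the factor [r^2 / 2] cancels. *)
Lemma density_upper (g : C -> R) (b J eps : R) : 0 < b -> (forall z, 0 <= g z) ->
  (forall z, 1 - b < normc z -> g z = 0) -> unif_cont g -> measurable_fun setT g ->
  (\int[nu]_w (g w)%:E = J%:E)%E -> 0 < eps ->
  exists n0, forall n, (n0 <= n)%N -> \sum_(l <- L n) g l <= n%:R * (J + eps).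
Proof.
move=> b0 g0 gb ug mg gJ e0.
have J0 : 0 <= J by rewrite -lee_fin -gJ; apply: integral_ge0 => w _; rewrite lee_fin.
pose eta := eps / 2; have eta0 : 0 < eta by rewrite divr_gt0.
have [dl dl0 hdl] := ug _ eta0.
have [r r0 rr] : exists2 r : rat, 0 < r & ratr r <= Num.min dl b.
  have h : 0 < Num.min dl b by rewrite lt_min dl0.
  have [q] := rat_in_itvoo h; rewrite in_itv /= => /andP[q1 q2].
  by exists q; [rewrite -(ltr0q R)|exact: ltW].
have [rd rb] : ratr r <= dl /\ ratr r <= b.
  by split; apply: (le_trans rr); rewrite ge_min lexx ?orbT.
have rr0 : 0 < ratr r :> R by rewrite ltr0q.
pose kap := eps / (2 * (J + 1)) ; have J1 : 0 < J + 1 by rewrite ltr_wpDl.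
have kap0 : 0 < kap by rewrite divr_gt0// mulr_gt0.
(* [m] brings [step_mass] to [1/2] within the relative error [kap], itself chosen so that
   [kap * J <= eps / 2]. *)
have [m [e1 [e10 hm]]] : exists m (e1 : R), 0 < e1 /\ 1 / 2 + e1 <= (1 + kap) * step_mass m.
  pose de := Num.min kap 1 / 8; have de0 : 0 < de by rewrite divr_gt0// lt_min kap0 ltr01.
  exists (Num.bound (7 / (2 * de))), (kap / 4); split; first by rewrite divr_gt0.
  set m := Num.bound _; have N0 : 0 < (m.+1)%:R :> R by rewrite ltr0n.
  have hN : 7 / (2 * (m.+1)%:R) <= de.
    have d2 : 0 < 2 * de by rewrite mulr_gt0.
    have h : 7 / (2 * de) < m%:R by apply: archi_boundP; rewrite divr_ge0// ltW.
    rewrite ltr_pdivrMr// in h; rewrite ler_pdivrMr ?mulr_gt0//; apply: (le_trans (ltW h)).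
    have -> : de * (2 * (m.+1)%:R) = (m.+1)%:R * (2 * de) by ring.
    by apply: ler_wpM2r; [exact: ltW|rewrite ler_nat].
  have hs := step_mass_lower m; have d1 : de <= kap / 8 by rewrite ler_pM2r// ge_min lexx.
  have d2 : de <= 1 / 8 by rewrite ler_pM2r// ge_min lexx orbT.
  apply: (@le_trans _ _ ((1 + kap) * (1 / 2 - de))); last first.
    by apply: ler_wpM2l; [rewrite addr_ge0// ltW|apply: le_trans hs; rewrite lerD2l lerN2].
  have : kap * de <= kap * (1 / 8) by apply: ler_wpM2l => //; exact: ltW.
  by rewrite mulrDl mul1r mulrBr; lra.
have sm0 : 0 < step_mass m.
  have h : 0 < (1 + kap) * step_mass m by apply: lt_le_trans hm; rewrite addr_gt0 ?divr_gt0.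
  by rewrite pmulr_rgt0// ?addr_gt0 in h.
have er : 0 < e1 * ratr r ^+ 2 by rewrite mulr_gt0// exprn_gt0.
have [n0 hn0] := pot m b0 r0 er; exists n0 => n hn.
pose hh l := Num.max (g l - eta) 0.
have hh0 l : 0 <= hh l by rewrite le_max lexx orbT.
have pw (w : C) : \sum_(l <- L n) hh l * step (ratr r) m (normc (w - l)) <=
    n%:R * (ratr r ^+ 2 / 2 + e1 * ratr r ^+ 2) * g w.
  apply: (@le_trans _ _ (\sum_(l <- L n) g w * step (ratr r) m (normc (w - l)))).
    apply: ler_sum => l _; have [hwl|hwl] := lerP (normc (w - l)) (ratr r).
      apply: ler_wpM2r; first exact: step_ge0.
      rewrite ge_max g0 andbT; have := hdl l w; rewrite normc_dist => /(_ (le_trans hwl rd)).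
      by rewrite ler_norml => /andP[_]; lra.
    rewrite (_ : step _ _ _ = 0) ?mulr0//; apply: big1 => j _.
    rewrite leNgt (le_lt_trans _ hwl) ?mul0r//.
    rewrite ler_pdivrMr ?ltr0n//; apply: ler_wpM2l; first exact: ltW.
    by rewrite ler_nat ltnW// ltnS ltnW.
  rewrite -mulr_sumr; have [hw|hw] := lerP (normc w) (1 - b).
    by rewrite mulrC; apply: ler_wpM2r => //; exact: hn0.
  by rewrite gb// mul0r mulr0.
have I1 : (\sum_(l <- L n) (hh l * (ratr r ^+ 2 * step_mass m))%:E <=
    \int[nu]_w (\sum_(l <- L n) hh l * step (ratr r) m (normc (w - l)))%:E)%E.
  under eq_integral do rewrite -sumEFin.
  rewrite ge0_integral_sum//; last 2 first.
  - move=> l; apply/measurable_EFinP; apply: measurable_funM; first exact: measurable_cst.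
    exact: meas_step.
  - by move=> l w _; rewrite lee_fin mulr_ge0// step_ge0.
  apply: lee_sum => l _; under eq_integral do rewrite EFinM.
  rewrite ge0_integralZl//; last 3 first.
  - by apply/measurable_EFinP; exact: meas_step.
  - by move=> w _; rewrite lee_fin step_ge0.
  - by rewrite lee_fin.
  have [hl|hl] := eqVneq (hh l) 0; first by rewrite hl mul0r mul0e.
  rewrite EFinM; apply: lee_wpmul2l; first by rewrite lee_fin.
  apply: int_step_lower => //.
  have : normc l <= 1 - b.
    rewrite leNgt; apply/negP => hb; move/eqP: hl; apply; rewrite /hh gb// sub0r.
    by apply/max_idPr; rewrite oppr_le0 ltW.
  by move: rb; lra.
have I2 : (\int[nu]_w (\sum_(l <- L n) hh l * step (ratr r) m (normc (w - l)))%:E <=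
    (n%:R * (ratr r ^+ 2 / 2 + e1 * ratr r ^+ 2) * J)%:E)%E.
  have c0 : 0 <= n%:R * (ratr r ^+ 2 / 2 + e1 * ratr r ^+ 2) :> R.
    by rewrite mulr_ge0// addr_ge0 ?divr_ge0 ?exprn_ge0 ?(ltW er)// ltW.
  rewrite EFinM -gJ -ge0_integralZl//; last 2 first.
  - exact/measurable_EFinP.
  - by move=> w _; rewrite lee_fin.
  apply: ge0_le_integral => //.
  - by move=> w _; rewrite lee_fin; apply: sumr_ge0 => l _; rewrite mulr_ge0// step_ge0.
  - apply/measurable_EFinP; apply: meas_sum => l; apply: measurable_funM; first exact: measurable_cst.
    exact: meas_step.
  - by apply: measurable_funeM; exact/measurable_EFinP.
  by move=> w _; rewrite -EFinM lee_fin.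
have := le_trans I1 I2; rewrite sumEFin lee_fin -mulr_suml.
set S := \sum_(l <- _) hh l => hS.
have r2 : 0 < ratr r ^+ 2 :> R by rewrite exprn_gt0.
have hS2 : S <= n%:R * ((1 + kap) * J).
  have h : S * (ratr r ^+ 2 * step_mass m) <= n%:R * ((1 + kap) * J) * (ratr r ^+ 2 * step_mass m).
    apply: (le_trans hS).
    have -> : n%:R * (ratr r ^+ 2 / 2 + e1 * ratr r ^+ 2) * J = (1 / 2 + e1) * (n%:R * J * ratr r ^+ 2) by ring.
    have -> : n%:R * ((1 + kap) * J) * (ratr r ^+ 2 * step_mass m) =
       ((1 + kap) * step_mass m) * (n%:R * J * ratr r ^+ 2) by ring.
    by apply: ler_wpM2r => //; apply: mulr_ge0; [exact: mulr_ge0|exact: ltW].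
  by rewrite ler_pM2r// mulr_gt0 in h.
have hg : \sum_(l <- L n) g l <= S + n%:R * eta.
  have -> : n%:R * eta = \sum_(l <- L n) eta by rewrite big_const_seq count_predT sizeL iter_addr_0 mulr_natl.
  rewrite -big_split /=; apply: ler_sum => l _; rewrite -lerBlDr /hh le_max lexx//.
apply: (le_trans hg); rewrite -lerBrDr; apply: (le_trans hS2); rewrite -mulrBr; apply: ler_wpM2l => //.
have : kap * J <= eps / 2.
  rewrite /kap mulrAC ler_pdivrMr ?mulr_gt0//.
  have -> : eps / 2 * (2 * (J + 1)) = eps * (J + 1) by field.
  by apply: ler_wpM2l; [exact: ltW|rewrite lerDl].
by rewrite /eta; lra.
Qed.

End uniform_law.

(** * Convergence of linear statistics *)

Section convergence.
Variable R : realType.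
Local Notation C := R[i].
Local Notation nu := (uniform_disk R).

Lemma integrable_bounded (mu : {measure set C -> \bar R}) (f : C -> R) (B : R) : (mu setT < +oo)%E ->
  measurable_fun setT f -> (forall z, `|f z| <= B) -> mu.-integrable setT (EFin \o f).
Proof.
move=> m1 mf fB; apply: measurable_bounded_integrable => //.
exists B; split; first exact: num_real.
by move=> y By z _; apply: (le_trans (fB z)); exact: ltW.
Qed.

Lemma clamp_lip (b x y : R) : 0 <= b ->
  `|Num.max 0 (Num.min b x) - Num.max 0 (Num.min b y)| <= `|x - y|.
Proof.
move=> b0; rewrite ler_norml.
have h1 := ler_norm (x - y); have h2 := ler_norm (- (x - y)); rewrite normrN in h2.
move: h1 h2; set t := `|x - y| => h1 h2.
have t0 : 0 <= t by exact: normr_ge0.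
rewrite /Num.min; case: (ltP b x) => h3; case: (ltP b y) => h4; rewrite /Num.max;
  case: ltP => h5; case: ltP => h6; apply/andP; split; lra.
Qed.

(** A radial trapezoid: height [b] up to radius [1 - 2b], zero from radius [1 - b] on. *)
Definition cutoff (b : R) (z : C) : R := Num.max 0 (Num.min b (1 - b - normc z)).

Lemma cutoff_ge0 b z : 0 <= cutoff b z.
Proof. by rewrite le_max lexx. Qed.

Lemma cutoff_le b z : 0 <= b -> cutoff b z <= b.
Proof. by move=> b0; rewrite ge_max b0 ge_min lexx. Qed.

Lemma normc_lip (z w : C) : `|normc z - normc w| <= normc (z - w).
Proof.
rewrite ler_norml; apply/andP; split.
  have := normcD_le z (w - z); rewrite subrKC [normc (w - z)]normc_dist; lra.
by have := normcD_le w (z - w); rewrite subrKC; lra.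
Qed.

Lemma cutoff_lip b (z w : C) : 0 <= b -> `|cutoff b z - cutoff b w| <= normc (z - w).
Proof.
move=> b0; apply: (le_trans (clamp_lip _ _ b0)).
have -> : 1 - b - normc z - (1 - b - normc w) = normc w - normc z by ring.
by rewrite distrC; exact: normc_lip.
Qed.

Variable L : nat -> seq C.
Hypothesis sizeL : forall n, size (L n) = n.
Hypothesis few : forall b : rat, 0 < b -> b <= 1 / 2 -> exists n0, forall n, (n0 <= n)%N ->
  (count (fun l => 1 - ratr b ^+ 2 <= normc l) (L n))%:R <= 6 * ratr b * n%:R :> R.
Hypothesis pot : forall (b : R) (r : rat) m (eps : R), 0 < b -> 0 < r -> 0 < eps ->
  exists n0, forall n, (n0 <= n)%N -> forall w : C, normc w <= 1 - b ->
  \sum_(l <- L n) step (ratr r) m (normc (w - l)) <= n%:R * (ratr r ^+ 2 / 2 + eps).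

(** [density_upper] is applied to [(B + f) * chi], which is nonnegative and supported inside the
    open disc. Replacing [chi] by 1 costs at most [2 * B] for each eigenvalue with [chi < 1], and
    there are few of these. *)
Lemma mean_upper (f : C -> R) (B eps : R) : 0 < B -> (forall z, `|f z| <= B) -> unif_cont f ->
  measurable_fun setT f -> 0 < eps -> exists n0, forall n, (n0 <= n)%N ->
  \sum_(l <- L n) f l <= n%:R * (\int[nu]_z f z + eps).
Proof.
move=> B0 fB uf mf e0.
have [be be0 beb] : exists2 be : rat, 0 < be & ratr be <= Num.min (1 / 2) (eps / (24 * B)).
  have h : 0 < Num.min (1 / 2) (eps / (24 * B)) by rewrite lt_min !divr_gt0// mulr_gt0.
  have [q] := rat_in_itvoo h; rewrite in_itv /= => /andP[q1 q2].
  by exists q; [rewrite -(ltr0q R)|exact: ltW].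
have [b1 b2] : ratr be <= 1 / 2 :> R /\ ratr be <= eps / (24 * B).
  by split; apply: (le_trans beb); rewrite ge_min lexx ?orbT.
have be1 : be <= 1 / 2.
  by rewrite -(ler_rat R) rmorphM fmorphV rmorph1 rmorph_nat.
have be0R : 0 < ratr be :> R by rewrite ltr0q.
(* Thus [chi = 1] below the radius [1 - be^2 = 1 - 2b] used in counting outliers. *)
pose b : R := ratr be ^+ 2 / 2; have b0 : 0 < b by rewrite divr_gt0// exprn_gt0.
pose chi z := cutoff b z / b.
have chi0 z : 0 <= chi z by rewrite divr_ge0 ?cutoff_ge0// ltW.
have chi1 z : chi z <= 1 by rewrite ler_pdivrMr// mul1r cutoff_le// ltW.
have fB' z : 0 <= B + f z /\ B + f z <= 2 * B.
  by have := fB z; rewrite ler_norml => /andP[]; lra.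
pose g z := (B + f z) * chi z.
have g0 z : 0 <= g z by rewrite mulr_ge0//; case: (fB' z).
have gf z : g z <= B + f z by rewrite ler_piMr//; case: (fB' z).
have mchi : measurable_fun setT chi.
  apply: measurable_funM; last exact: measurable_cst.
  by apply: measurable_lip => z w; apply: cutoff_lip; exact: ltW.
have mg : measurable_fun setT g.
  by apply: measurable_funM => //; apply: measurable_funD => //; exact: measurable_cst.
have gb z : 1 - b < normc z -> g z = 0.
  move=> hz; rewrite /g /chi /cutoff (_ : Num.max _ _ = 0) ?mul0r ?mulr0//.
  by apply/max_idPl; rewrite ge_min; apply/orP; right; lra.
have ug : unif_cont g.
  move=> eta eta0; have e2 : 0 < eta / 2 by rewrite divr_gt0.
  have [dl dl0 hdl] := uf _ e2.
  have b4 : 0 < b * eta / (4 * B) by apply: divr_gt0; apply: mulr_gt0.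
  exists (Num.min dl (b * eta / (4 * B))); first by rewrite lt_min dl0.
  move=> z w; rewrite le_min => /andP[h1 h2].
  have -> : g z - g w = (f z - f w) * chi z + (B + f w) * (chi z - chi w) by rewrite /g; ring.
  apply: (le_trans (ler_normD _ _)); rewrite [leRHS]splitr; apply: lerD.
    rewrite normrM [`|chi z|]ger0_norm//; apply: (@le_trans _ _ (eta / 2 * 1)); last by rewrite mulr1.
    by apply: ler_pM => //; exact: hdl.
  have [h3 h4] := fB' w; rewrite normrM ger0_norm// -mulrBl normrM [`|b^-1|]ger0_norm ?invr_ge0 ?(ltW b0)//.
  have h5 : `|cutoff b z - cutoff b w| <= b * eta / (4 * B).
    by apply: le_trans h2; apply: cutoff_lip; exact: ltW.
  apply: (@le_trans _ _ (2 * B * (b * eta / (4 * B) / b))).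
    by apply: ler_pM => //; [rewrite mulr_ge0// invr_ge0 ltW|apply: ler_wpM2r; rewrite ?invr_ge0 ?(ltW b0)].
  by rewrite le_eqVlt; apply/orP; left; apply/eqP; field; rewrite !gt_eqF.
have nu1 : (nu setT < +oo)%E by rewrite uniform_setT ltry.
have ig : nu.-integrable setT (EFin \o g).
  apply: (integrable_bounded (B := 2 * B) nu1 mg) => z; rewrite ger0_norm//.
  by apply: (le_trans (gf z)); case: (fB' z).
have iff : nu.-integrable setT (EFin \o f) by exact: (integrable_bounded nu1 mf fB).
have ic : nu.-integrable setT (EFin \o (fun=> B)).
  by apply: (integrable_bounded (B := B) nu1 (measurable_cst _)) => z; rewrite ger0_norm// ltW.
pose J := \int[nu]_z g z.
have gJ : (\int[nu]_z (g z)%:E = J%:E)%E.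
  by rewrite /J /Rintegral fineK//; exact: (integrable_fin_num measurableT ig).
have JJ : J <= B + \int[nu]_z f z.
  have -> : B + \int[nu]_z f z = \int[nu]_z (B + f z).
    rewrite (RintegralD measurableT ic iff); congr (_ + _).
    by rewrite Rintegral_cst// [X in fine X]uniform_setT mulr1.
  apply: le_Rintegral => //.
  apply: (integrable_bounded (B := 2 * B) nu1) => [|z]; last by have [h1 h2] := fB' z; rewrite ger0_norm.
  by apply: measurable_funD => //; exact: measurable_cst.
have e2 : 0 < eps / 2 by rewrite divr_gt0.
have [n1 h1] := density_upper sizeL pot b0 g0 gb ug mg gJ e2.
have [n2 h2] := few be0 be1.
exists (maxn n1 n2) => n; rewrite geq_max => /andP[hn1 hn2].
have {h1} h1 := h1 n hn1; have {h2} h2 := h2 n hn2.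
set cn := (count _ _)%:R in h2.
have hchi : n%:R - cn <= \sum_(l <- L n) chi l.
  rewrite /cn -{1}(sizeL n); elim: (L n) => [|l s IH]; first by rewrite big_nil /= subrr.
  rewrite big_cons /= natrD -[(size s).+1%:R]natr1.
  have -> (x y u : R) : x + 1 - (u + y) = (1 - u) + (x - y) by ring.
  apply: lerD => //; have [hl|hl] := lerP (1 - ratr be ^+ 2) (normc l).
    by rewrite subrr.
  rewrite subr0 /chi /cutoff ler_pdivlMr// mul1r le_max; apply/orP; right.
  by rewrite le_min lexx /= /b; lra.
have hf : \sum_(l <- L n) f l <= \sum_(l <- L n) g l + n%:R * B - 2 * B * \sum_(l <- L n) chi l.
  have -> : n%:R = (size (L n))%:R :> R by rewrite sizeL.
  elim: (L n) => [|l s IH]; first by rewrite !big_nil /= mul0r mulr0 subr0 addr0.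
  rewrite !big_cons /= -[(size s).+1%:R]natr1.
  have -> (x y u v N : R) : x + y + (N + 1) * B - 2 * B * (u + v) =
     (x + B - 2 * B * u) + (y + N * B - 2 * B * v) by ring.
  apply: lerD => //; rewrite /g.
  have h : 0 <= (B - f l) * (1 - chi l).
    by apply: mulr_ge0; [have := fB l; rewrite ler_norml => /andP[_]; lra|rewrite subr_ge0].
  by lra.
have hB : 2 * B * (n%:R - cn) <= 2 * B * \sum_(l <- L n) chi l.
  by apply: ler_wpM2l => //; rewrite mulr_ge0// ltW.
have hcn : 2 * B * cn <= n%:R * (eps / 2).
  apply: (@le_trans _ _ (2 * B * (6 * ratr be * n%:R))); first by apply: ler_wpM2l => //; rewrite mulr_ge0// ltW.
  have -> : 2 * B * (6 * ratr be * n%:R) = n%:R * (12 * B * ratr be) by ring.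
  apply: ler_wpM2l => //; rewrite ler_pdivlMr ?mulr_gt0// in b2; lra.
have hJ : n%:R * (J + eps / 2) <= n%:R * (B + \int[nu]_z f z + eps / 2) by apply: ler_wpM2l => //; rewrite lerD2r.
move: hf hB hcn hJ h1; set I := \int[nu]_z f z; set S1 := \sum_(l <- _) f l; set S2 := \sum_(l <- _) g l.
set S3 := \sum_(l <- _) chi l; rewrite !mulrDr; lra.
Qed.

(** The one-sided bound is used for [f] and for [- f]: a density bounded by that of the uniform law,
    with no loss of mass, leaves no other limit. *)
Lemma mean_cvg (f : C -> R) (B : R) : (forall z, `|f z| <= B) -> unif_cont f -> measurable_fun setT f ->
  (n%:R^-1 * \sum_(l <- L n) f l) @[n --> \oo] --> \int[nu]_z f z.
Proof.
move=> fB uf mf; have B0 : 0 < B + 1 by rewrite ltr_wpDl//; apply: le_trans (fB 0).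
have fB1 z : `|f z| <= B + 1 by apply: (le_trans (fB z)); rewrite lerDl.
have nu1 : (nu setT < +oo)%E by rewrite uniform_setT ltry.
have iff : nu.-integrable setT (EFin \o f) by exact: (integrable_bounded nu1 mf fB).
apply/cvgrPdist_le => eps e0.
have [n1 h1] := mean_upper B0 fB1 uf mf e0.
have mNf : measurable_fun setT (fun z => - f z) by exact: measurable_funN.
have uNf : unif_cont (fun z => - f z).
  move=> eta eta0; have [dl dl0 h] := uf _ eta0; exists dl => // z w zw.
  by rewrite -opprD normrN; exact: h.
have NfB z : `|- f z| <= B + 1 by rewrite normrN.
have [n2 h2] := mean_upper B0 NfB uNf mNf e0.
exists (maxn 1 (maxn n1 n2)) => // n /=; rewrite !geq_max => /and3P[n0 hn1 hn2].
have nR : 0 < n%:R :> R by rewrite ltr0n.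
have {h1} h1 := h1 n hn1; have {h2} := h2 n hn2.
have -> : \int[nu]_z (- f z) = - \int[nu]_z f z.
  have -> : (fun z => - f z) = (fun z => -1 * f z) by apply/funext => z; rewrite mulN1r.
  by rewrite RintegralZl// mulN1r.
rewrite sumrN; set S := \sum_(l <- _) f l in h1 *; set I := \int[nu]_z f z in h1 * => h2.
have hx : n%:R^-1 * S <= I + eps by rewrite ler_pdivrMl.
have hy : I - eps <= n%:R^-1 * S.
  by rewrite ler_pdivlMl//; move: h2; rewrite !mulrDr !mulrN; lra.
by rewrite ler_norml; apply/andP; split; lra.
Qed.

End convergence.

Section empirical_integral.
Variable R : realType.
Local Notation C := R[i].

Lemma integral_esd n (A : 'M[C]_n) (f : C -> R) (B : R) : measurable_fun setT f ->
  (forall z, `|f z| <= B) -> (0 < n)%N ->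
  \int[esd A]_z f z = n%:R^-1 * \sum_(l <- eigenvalues A) f l.
Proof.
move=> mf fB n0; have nR : 0 < n%:R :> R by rewrite ltr0n.
have ge0E (g : C -> R) : measurable_fun setT g -> (forall z, 0 <= g z) ->
    \int[esd A]_z g z = n%:R^-1 * \sum_(l <- eigenvalues A) g l.
  move=> mg g0; rewrite /Rintegral /esd.
  have mg' : measurable_fun setT (EFin \o g) by exact/measurable_EFinP.
  rewrite ge0_integral_mscale//; last by move=> z _; rewrite lee_fin.
  rewrite ge0_integral_measure_sum//; last by move=> z _; rewrite lee_fin.
  under eq_bigr do rewrite integral_dirac// diracT mul1e.
  rewrite sumEFin -EFinM /=; congr (_ * _).
  by rewrite (big_nth 0) size_eigenvalues big_mkord.
have m1 : (esd A setT < +oo)%E by rewrite esd_setT// ltry.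
have iff : (esd A).-integrable setT (EFin \o f) by exact: (integrable_bounded m1 mf fB).
have B0 : 0 <= B by apply: le_trans (fB 0).
have ic : (esd A).-integrable setT (EFin \o (fun=> B)).
  by apply: (integrable_bounded (B := B) m1 (measurable_cst _)) => z; rewrite ger0_norm.
have := ge0E (fun z => f z + B) (measurable_funD mf (measurable_cst _)).
rewrite (RintegralD measurableT iff ic) Rintegral_cst// esd_setT// mulr1 big_split /=.
have -> : \sum_(l <- eigenvalues A) B = n%:R * B.
  by rewrite big_const_seq count_predT size_eigenvalues iter_addr_0 mulr_natl.
rewrite mulrDr mulKf ?gt_eqF//.
move=> h; apply: (addIr B); apply: h => z; have := fB z; rewrite ler_norml => /andP[]; lra.
Qed.

End empirical_integral.

(** * Measurability of spectral statistics *)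

Section test_functions.
Variable R : realType.
Local Notation C := R[i].

(** Balls in [R[i]] have complex radii; a positive radius is real, which allows the passage to real
    ones. *)
Lemma nbhs_normc (z : C) (A : set C) : nbhs z A <-> exists2 e : R, 0 < e & forall w, normc (z - w) < e -> A w.
Proof.
split.
  move=> /nbhs_ballP[e /= e0 eA].
  have eE : e = (Re e)%:C by case: e e0 {eA} => a b; rewrite ltcE /= => /andP[/eqP ->].
  exists (Re e); first by move: e0; rewrite ltcE => /andP[].
  move=> w zw; apply: eA; rewrite /ball /= eE.
  by rewrite [X in X < _](_ : _ = (normc (z - w))%:C)// ltcR.
move=> [e e0 h]; apply/nbhs_ballP; exists e%:C; first by rewrite /= ltcR.
move=> w; rewrite /ball /= => zw; apply: h.
by move: zw; rewrite [X in X < _](_ : _ = (normc (z - w))%:C)// ltcR.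
Qed.

Variable f : C -> R.
Hypothesis cf : continuous f.

Lemma continuous_normc (z : C) (eta : R) : 0 < eta ->
  exists2 e : R, 0 < e & forall w, normc (z - w) < e -> `|f z - f w| < eta.
Proof.
move=> eta0; have /cvgrPdist_lt/(_ _ eta0) := @cf z.
by move=> /nbhs_normc[e e0 h]; exists e.
Qed.

Lemma open_gt (x : R) : open [set z | x < f z].
Proof.
rewrite openE => z /= xz; apply/nbhs_normc.
have h0 : 0 < f z - x by rewrite subr_gt0.
have [e e0 h] := continuous_normc z h0; exists e => // w /h; rewrite ltr_norml /= => /andP[h1 h2]; lra.
Qed.

Lemma measurable_continuous : measurable_fun setT f.
Proof.
apply: (@measurability _ _ C R setT f (@RGenOInfty.G R)).
  exact: RGenOInfty.measurableE.
move=> _ [_ [x ->] <-]; rewrite setTI; apply: sub_sigma_algebra.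
have -> : f @^-1` `]x, +oo[%classic = [set z | x < f z].
  by apply/seteqP; split=> z /=; rewrite in_itv /= andbT.
exact: open_gt.
Qed.

Hypothesis sf : compactly_supported f.

Lemma outside_support z : ~ closure [set z | f z != 0] z -> f z = 0.
Proof. by move=> h; apply/eqP; apply: contrapT => hz; apply: h; apply: subset_closure; apply/negP. Qed.

Lemma bounded_continuous : exists B : R, forall z, `|f z| <= B.
Proof.
have /compact_near_coveringP h := sf.
have := h nat \oo (fun n z => `|f z| <= n%:R) _ _; case.
  move=> z _; have [e e0 he] := continuous_normc z ltr01.
  pose N := (Num.bound `|f z|).+1.
  exists ([set w | normc (z - w) < e], [set n | (N <= n)%N]).
    by split; [apply/nbhs_normc; exists e|exists N].
  move=> [w n] [/= hw hn]; have := he w hw.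
  have hN : `|f z| + 1 <= n%:R.
    apply: (@le_trans _ _ N%:R); last by rewrite ler_nat.
    by rewrite /N -natr1 lerD2r; exact/ltW/archi_boundP.
  rewrite distrC => h2; have := ler_distD 0 (f w) (f z); rewrite !subr0 sub0r normrN.
  have -> : f w = f z + (f w - f z) by ring.
  move=> _; apply: (le_trans (ler_normD _ _)); apply: le_trans hN; rewrite lerD2l; exact: ltW.
move=> N _ hN; exists N%:R => z; have [zs|zs] := pselect (closure [set z | f z != 0] z).
  exact: (hN N (leqnn N) z zs).
by rewrite outside_support// normr0.
Qed.

Lemma uniformly_continuous : unif_cont f.
Proof.
move=> eta eta0; have /compact_near_coveringP h := sf.
have e2 : 0 < eta / 2 by rewrite divr_gt0.
have := h nat \oo (fun n z => forall w, normc (z - w) <= (n.+1)%:R^-1 -> `|f z - f w| <= eta) _ _; case.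
  move=> z _; have [e e0 he] := continuous_normc z e2.
  pose N := Num.bound (2 / e).
  have ee2 : 0 < e / 2 by rewrite divr_gt0.
  exists ([set w | normc (z - w) < e / 2], [set n | (N <= n)%N]).
    by split; [apply/nbhs_normc; exists (e / 2)|exists N].
  move=> [w n] [/= hw hn] v hv.
  have hN : (n.+1)%:R^-1 <= e / 2.
    have h2 : 2 / e <= (n.+1)%:R.
      apply: (le_trans (ltW (archi_boundP _))); first by rewrite divr_ge0// ltW.
      by rewrite ler_nat (leq_trans hn).
    by rewrite -[e / 2]invf_div lef_pV2 ?posrE ?divr_gt0 ?ltr0n.
  have zv : normc (z - v) < e.
    rewrite -(subrKA w); apply: (le_lt_trans (normcD_le _ _)); rewrite [e]splitr.
    by apply: ltr_leD => //; exact: le_trans hv hN.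
  have we : normc (z - w) < e by apply: (lt_trans hw); rewrite ltr_pdivrMr// ltr_pMr// ltr1n.
  have h3 := he w we; have h4 := he v zv; rewrite distrC in h3.
  by apply: (le_trans (ler_distD (f z) _ _)); lra.
move=> N _ hN; exists (N.+1)%:R^-1; first by rewrite invr_gt0 ltr0n.
move=> z w zw; have [zs|zs] := pselect (closure [set z | f z != 0] z).
  exact: (hN N (leqnn N) z zs w zw).
have [ws|ws] := pselect (closure [set z | f z != 0] w).
  by rewrite distrC; apply: (hN N (leqnn N) w ws z); rewrite normc_dist.
by rewrite !outside_support// subrr normr0 ltW.
Qed.

End test_functions.

Section symmetric_functions.
Variable R : realType.
Local Notation C := R[i].

Lemma prod_XsubC_inj (s t : seq C) : \prod_(l <- s) ('X - l%:P) = \prod_(l <- t) ('X - l%:P) -> perm_eq s t.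
Proof.
elim: s t => [|l s IH] t e.
  have := congr1 (fun p : {poly C} => size p) e; rewrite !size_prod_XsubC => -[] /esym/eqP.
  by rewrite size_eq0 => /eqP ->.
have lt : l \in t by rewrite -root_prod_XsubC -e big_cons rootM root_XsubC eqxx.
rewrite perm_sym; apply: (perm_trans (perm_to_rem lt)); rewrite perm_cons perm_sym; apply: IH.
have := e; rewrite big_cons (perm_big _ (perm_to_rem lt)) /= big_cons.
by apply: mulfI; rewrite polyXsubC_eq0.
Qed.

(** Two monic polynomials of degree [n] differ by one of degree below [n], so agreement at
    [0, ..., n - 1] makes them equal. Hence [n] determinants determine the eigenvalues up to
    order. *)
Lemma prod_eq_perm n (s t : seq C) : size s = n -> size t = n ->
  (forall j, (j < n)%N -> \prod_(l <- s) (j%:R - l) = \prod_(l <- t) (j%:R - l)) -> perm_eq s t.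
Proof.
move=> sn tn h; apply: prod_XsubC_inj; apply/eqP; rewrite -subr_eq0; apply/eqP.
set p := \prod_(l <- s) _; set q := \prod_(l <- t) _.
apply: (@roots_geq_poly_eq0 _ _ [seq (j%:R : C) | j <- iota 0 n]).
- apply/allP => x /mapP[j]; rewrite mem_iota /= add0n => jn ->.
  rewrite /root hornerD hornerN !horner_prod subr_eq0; apply/eqP.
  by under eq_bigr do rewrite hornerXsubC; rewrite h//; apply: eq_bigr => l _; rewrite hornerXsubC.
- by rewrite map_inj_uniq ?iota_uniq//; move=> a b /eqP; rewrite eqr_nat => /eqP.
rewrite size_map size_iota leqNgt; apply/negP => hs.
have pm : p \is monic by exact: monic_prod_XsubC.
have qm : q \is monic by exact: monic_prod_XsubC.
have ps : size p = n.+1 by rewrite size_prod_XsubC sn.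
have qs : size q = n.+1 by rewrite size_prod_XsubC tn.
have sle : (size (p - q)%R <= n.+1)%N.
  by apply: (leq_trans (size_polyD _ _)); rewrite size_polyN ps qs maxnn.
have e : size (p - q) = n.+1 by apply/eqP; rewrite eqn_leq sle.
have : lead_coef (p - q) = 0.
  rewrite lead_coefE e /= coefB; have := monicP pm; have := monicP qm.
  by rewrite !lead_coefE ps qs /= => -> ->; rewrite subrr.
by move=> /eqP; rewrite lead_coef_eq0 => /eqP z0; rewrite z0 size_poly0 in e.
Qed.

Variable n : nat.
Local Notation V := 'rV[R]_(n + n).

(** Lists of [n] complex numbers are encoded as real vectors of length [2n], where compactness of
    boxes and density of rational vectors are at hand. *)
Definition cpt (v : V) (i : 'I_n) : C := (v 0 (lshift n i) +i* v 0 (rshift n i))%C.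
Definition cseq (v : V) : seq C := [seq cpt v i | i <- enum 'I_n].

Lemma size_cseq v : size (cseq v) = n.
Proof. by rewrite size_map size_enum_ord. Qed.

Lemma big_cseq (A : Type) (idx : A) (op : Monoid.law idx) (F : C -> A) v :
  \big[op/idx]_(l <- cseq v) F l = \big[op/idx]_(i < n) F (cpt v i).
Proof. by rewrite big_map enumT. Qed.

Lemma cseq_onto (s : seq C) : size s = n -> exists v, cseq v = s.
Proof.
move=> sn; exists (row_mx (\row_i Re s`_i) (\row_i Im s`_i)).
apply: (@eq_from_nth _ 0); rewrite size_cseq// => i hi.
rewrite (nth_map (Ordinal hi)) ?size_enum_ord//.
rewrite /cpt row_mxEl row_mxEr !mxE nth_enum_ord//; by case: (s`_i).
Qed.

Definition ccont (G : V -> C) := continuous (fun v => Re (G v)) /\ continuous (fun v => Im (G v)).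

Lemma ccont_cst a : ccont (fun=> a).
Proof. by split; exact: cst_continuous. Qed.

Lemma ccont_cpt i : ccont (cpt ^~ i).
Proof. by split => v; exact: (@coord_continuous R). Qed.

Lemma contD (g h : V -> R) : continuous g -> continuous h -> continuous (fun v => g v + h v).
Proof. by move=> cg ch v; exact: (cvgD (@cg v) (@ch v)). Qed.

Lemma contB (g h : V -> R) : continuous g -> continuous h -> continuous (fun v => g v - h v).
Proof. by move=> cg ch v; exact: (cvgB (@cg v) (@ch v)). Qed.

Lemma contM (g h : V -> R) : continuous g -> continuous h -> continuous (fun v => g v * h v).
Proof. by move=> cg ch v; exact: (cvgM (@cg v) (@ch v)). Qed.

Lemma ccontB G H : ccont G -> ccont H -> ccont (fun v => G v - H v).
Proof.
move=> [g1 g2] [h1 h2]; split.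
  have -> : (fun v => Re (G v - H v)) = (fun v => Re (G v) - Re (H v)).
    by apply/funext => v; rewrite ReD ReN.
  exact: contB.
have -> : (fun v => Im (G v - H v)) = (fun v => Im (G v) - Im (H v)).
  by apply/funext => v; rewrite ImD ImN.
exact: contB.
Qed.

Lemma ccontM G H : ccont G -> ccont H -> ccont (fun v => G v * H v).
Proof.
move=> [g1 g2] [h1 h2]; split.
  have -> : (fun v => Re (G v * H v)) = (fun v => Re (G v) * Re (H v) - Im (G v) * Im (H v)).
    by apply/funext => v; rewrite ReM.
  by apply: contB; exact: contM.
have -> : (fun v => Im (G v * H v)) = (fun v => Re (G v) * Im (H v) + Im (G v) * Re (H v)).
  by apply/funext => v; rewrite ImM.
by apply: contD; exact: contM.
Qed.

Lemma ccont_prod (I : Type) (s : seq I) (G : I -> V -> C) : (forall i, ccont (G i)) ->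
  ccont (fun v => \prod_(i <- s) G i v).
Proof.
move=> h; elim: s => [|i s IH].
  by have -> : (fun v => \prod_(i <- [::]) G i v) = (fun=> 1);
    [apply/funext => v; rewrite big_nil|exact: ccont_cst].
have -> : (fun v => \prod_(i <- i :: s) G i v) = (fun v => G i v * \prod_(j <- s) G j v).
  by apply/funext => v; rewrite big_cons.
exact: ccontM.
Qed.

Lemma continuous_sqn G : ccont G -> continuous (fun v => sqn (G v)).
Proof.
move=> [g1 g2]; have -> : (fun v => sqn (G v)) = (fun v => Re (G v) * Re (G v) + Im (G v) * Im (G v)).
  by apply/funext => v; rewrite /sqn !expr2.
by apply: contD; exact: contM.
Qed.

Variable f : C -> R.
Hypothesis cf : continuous f.

Lemma continuous_comp_cpt i : continuous (fun v => f (cpt v i)).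
Proof.
move=> v; apply/(@cvgrPdist_lt R R V (nbhs v) (nbhs_filter v)) => eta eta0.
have [e e0 he] := continuous_normc cf (cpt v i) eta0.
have e2 : 0 < e / 2 by rewrite divr_gt0.
have [c1 c2] := ccont_cpt i.
have /cvgrPdist_lt/(_ _ e2) h1 := @c1 v; have /cvgrPdist_lt/(_ _ e2) h2 := @c2 v.
apply: filterS2 h1 h2 => u h1 h2; apply: he; apply: (le_lt_trans (normc_le_ReIm _)).
by rewrite [e]splitr ReD ReN ImD ImN; apply: ltrD.
Qed.

Definition csum (v : V) : R := \sum_(l <- cseq v) f l.

Lemma continuous_csum : continuous csum.
Proof.
have -> : csum = (fun v => \sum_(i < n) f (cpt v i)).
  by apply/funext => v; rewrite /csum big_cseq.
elim: (index_enum _) => [|i r IH].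
  have -> : (fun v => \sum_(i <- [::]) f (cpt v i)) = cst 0 by apply/funext => v; rewrite big_nil.
  exact: cst_continuous.
have -> : (fun v => \sum_(j <- i :: r) f (cpt v j)) = (fun v => f (cpt v i) + \sum_(j <- r) f (cpt v j)).
  by apply/funext => v; rewrite big_cons.
by apply: contD => //; exact: continuous_comp_cpt.
Qed.

Definition cpol (j : nat) (v : V) : C := \prod_(l <- cseq v) (j%:R - l).

Lemma ccont_cpol j : ccont (cpol j).
Proof.
have -> : cpol j = (fun v => \prod_(i < n) (j%:R - cpt v i)).
  by apply/funext => v; rewrite /cpol big_cseq.
by apply: ccont_prod => i; apply: ccontB; [exact: ccont_cst|exact: ccont_cpt].
Qed.

Definition box (B : nat) : set V := [set v | forall i, `|v 0 i| <= B%:R].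

Lemma compact_box B : compact (box B).
Proof.
have h := @rV_compact R (n + n) (fun=> `[- B%:R, B%:R]%classic) (fun=> @segment_compact R _ _).
by congr compact: h; apply/seteqP; split => v hv i; have := hv i; rewrite /= in_itv /= ler_norml.
Qed.

(* This replaces a measurable choice of the eigenvalues: rational vectors whose
   characteristic polynomials converge to that of [v] accumulate at a reordering of [v]. *)
Lemma csum_limit (v : V) (c : R) B :
  (forall m : nat, exists2 u, box B u & c - (m.+1)%:R^-1 < csum u /\
    forall j, (j < n)%N -> sqn (cpol j v - cpol j u) < (m.+1)%:R^-1) -> c <= csum v.
Proof.
move=> H; rewrite leNgt; apply/negP => vc.
have /compact_near_coveringP K := @compact_box B.
have inv_small (e : R) : 0 < e -> exists N, forall m, (N <= m)%N -> (m.+1)%:R^-1 < e.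
  move=> e0; exists (Num.bound e^-1) => m hm; rewrite invf_plt ?posrE ?ltr0n//.
  apply: (lt_le_trans (archi_boundP _)); first by rewrite invr_ge0 ltW.
  by rewrite ler_nat (leq_trans hm).
have := K nat \oo (fun m u => ~ (c - (m.+1)%:R^-1 < csum u /\
    forall j, (j < n)%N -> sqn (cpol j v - cpol j u) < (m.+1)%:R^-1)) _ _; case.
  (* A point [u] of the box either has another characteristic polynomial, which rules out a
     neighbourhood for large [m], or is a reordering of [v], with the same [csum]. *)
  move=> u _; have [ne|eq] := pselect (exists2 j, (j < n)%N & cpol j v != cpol j u).
    have [j jn nj] := ne; pose e := sqn (cpol j v - cpol j u).
    have e0 : 0 < e by rewrite lt0r sqn_ge0 andbT sqn_eq0 subr_eq0.
    have e2 : 0 < e / 2 by rewrite divr_gt0.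
    have cG := continuous_sqn (ccontB (ccont_cst (cpol j v)) (ccont_cpol j)).
    have /cvgrPdist_lt/(_ _ e2) h1 := @cG u; have [N hN] := inv_small _ e2.
    exists ([set u' | `|sqn (cpol j v - cpol j u) - sqn (cpol j v - cpol j u')| < e / 2], [set m | (N <= m)%N]).
      by split; [exact: h1|exists N].
    move=> [u' m] [/= hu hm] [_ /(_ j jn)] h2.
    rewrite distrC in hu; have h3 := lt_trans (lt_trans (ltr_distlCBl hu) h2) (hN m hm); rewrite -/e in h3.
    by have h4 : e - e / 2 = e / 2 :> R; [field|rewrite h4 ltxx in h3].
  have su : csum u = csum v.
    apply: perm_big; rewrite perm_sym; apply: (@prod_eq_perm n); rewrite ?size_cseq// => j jn.
    by apply/eqP; apply: contrapT => nj; apply: eq; exists j => //; apply/negP.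
  have e2 : 0 < (c - csum v) / 2 by rewrite divr_gt0// subr_gt0.
  have /cvgrPdist_lt/(_ _ e2) h1 := @continuous_csum u; have [N hN] := inv_small _ e2.
  exists ([set u' | `|csum u - csum u'| < (c - csum v) / 2], [set m | (N <= m)%N]).
    by split; [exact: h1|exists N].
  move=> [u' m] [/= hu hm] [h2 _].
  have h3 := lt_trans h2 (ltr_distlCDr hu); rewrite su in h3.
  have h4 : c - (c - csum v) / 2 < c - (m.+1)%:R^-1 by rewrite ltrD2l ltrN2; exact: hN.
  have h5 := lt_trans h4 h3; have h6 : c - (c - csum v) / 2 = csum v + (c - csum v) / 2 :> R by field.
  by rewrite h6 ltxx in h5.
move=> N _ hN; have [u hu hu2] := H N; exact: (hN N (leqnn N) u hu).
Qed.

Definition ratv (q : 'rV[rat]_(n + n)) : V := map_mx ratr q.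

Lemma ratv_dense (v : V) (A : set V) : nbhs v A -> exists q, A (ratv q).
Proof.
move=> /nbhs_ballP[e /= e0 eA].
have /choice[q hq] : forall i, exists q : rat, `|v 0 i - ratr q| < e.
  move=> i; have h : v 0 i - e < v 0 i + e by rewrite ltrD2l gtrN.
  have [q] := rat_in_itvoo h; rewrite in_itv /= => /andP[q1 q2].
  by exists q; rewrite ltr_norml; apply/andP; split; lra.
exists (\row_i q i); apply: eA; rewrite /ball /=; split => // i j.
by rewrite !ord1 !mxE; exact: hq.
Qed.

Context d (D : measurableType d).

(** [eigenvalues] is obtained by choice and carries no measurability of its own. A superlevel set is
    therefore described by countably many conditions on the determinants of [j - A]: at each
    precision some rational vector of a fixed box has almost the same values of the characteristic
    polynomial and a sum above [c] up to that precision. [csum_limit] is the converse inclusion. *)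
Lemma measurable_eigenvalue_sum (A : D -> 'M[C]_n) : mxmeas A ->
  measurable_fun setT (fun w => \sum_(l <- eigenvalues (A w)) f l).
Proof.
move=> mA; set S := fun w => _.
have /choice[v hv] : forall w, exists v, cseq v = eigenvalues (A w).
  by move=> w; apply: cseq_onto; exact: size_eigenvalues.
have SE w : S w = csum (v w) by rewrite /S /csum hv.
have detE j w : \det (j%:R%:M - A w) = cpol j (v w).
  rewrite /cpol hv -[LHS]/(\det _); have -> : \det (j%:R%:M - A w) = (char_poly (A w)).[j%:R].
    rewrite /char_poly -horner_evalE -det_map_mx; congr (\det _).
    apply/matrixP => a b; rewrite !mxE /= horner_evalE hornerD hornerN hornerC.
    by rewrite hornerMn hornerX.
  by rewrite char_poly_eigenvalues horner_prod; apply: eq_bigr => l _; rewrite hornerXsubC.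
apply: (@measurability _ _ D R setT S (@RGenCInfty.G R)); first exact: RGenCInfty.measurableE.
move=> _ [_ [c ->] <-]; rewrite setTI.
pose E B m q := if (ratv q \in box B) && (c - (m.+1)%:R^-1 < csum (ratv q)) then
  \bigcap_(j in [set j | (j < n)%N]) [set w | sqn (\det (j%:R%:M - A w) - cpol j (ratv q)) < (m.+1)%:R^-1]
  else set0.
have -> : S @^-1` `[c, +oo[%classic = \bigcup_B \bigcap_m \bigcup_q E B m q.
  apply/seteqP; split => w.
    rewrite /= in_itv /= andbT SE => cS.
    pose B := (Num.bound (\sum_i `|v w 0 i|)).+1.
    exists B => // m _; have N0 : 0 < (m.+1)%:R^-1 :> R by rewrite invr_gt0.
    have /cvgrPdist_lt/(_ _ N0) h1 := @continuous_csum (v w).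
    have h2 : \forall u \near v w, box B u.
      apply/nbhs_ballP; exists 1 => //= u [_ hu] i.
      have hi : `|v w 0 i| <= \sum_i `|v w 0 i| by rewrite (bigD1 i)//= lerDl; apply: sumr_ge0.
      have s0 : 0 <= \sum_i `|v w 0 i| by apply: sumr_ge0.
      have := archi_boundP s0; have := hu 0 i; rewrite /ball /= distrC => h3 h4.
      have -> : u 0 i = v w 0 i + (u 0 i - v w 0 i) by ring.
      apply: (le_trans (ler_normD _ _)); rewrite /B -natr1; apply: lerD; last exact: ltW.
      by apply: (le_trans hi); exact: ltW.
    have h3 : \forall u \near v w, forall j : 'I_n, sqn (cpol j (v w) - cpol j u) < (m.+1)%:R^-1.
      apply: (@filter_forall V _ _ (nbhs (v w)) (nbhs_filter (v w))) => j.
      have cG := continuous_sqn (ccontB (ccont_cst (cpol j (v w))) (ccont_cpol j)).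
      have /cvgrPdist_lt/(_ _ N0) := @cG (v w); apply: filterS => u.
      by rewrite subrr sqn0 sub0r normrN ger0_norm ?sqn_ge0.
    have [q [[hq1 hq2] hq3]] := ratv_dense (filterI (filterI h1 h2) h3).
    exists q => //; rewrite /E; have -> : (ratv q \in box B) && (c - (m.+1)%:R^-1 < csum (ratv q)).
      apply/andP; split; first by rewrite inE.
      by rewrite distrC in hq1; apply: le_lt_trans (ltr_distlCBl hq1); rewrite lerD2r.
    by move=> j /= jn; rewrite detE; exact: (hq3 (Ordinal jn)).
  move=> [B _ hB]; rewrite /= in_itv /= andbT SE; apply: (@csum_limit _ _ B) => m.
  have [q _] := hB m I; rewrite /E; case: ifPn => // /andP[]; rewrite inE => q1 q2 h.
  by exists (ratv q) => //; split => // j jn; have := h j jn; rewrite /= detE.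
apply: bigcupT_measurable => B; apply: bigcapT_measurable => m.
apply: countable_bigcupT_measurable => // q; rewrite /E; case: ifP => // _.
(* For [n = 0] there is no determinant to test, and the intersection is the whole space. *)
have [n0|n0] := posnP n.
  rewrite (_ : [set j | (j < n)%N] = set0) ?bigcap_set0//.
  by apply/seteqP; split => // j /=; rewrite [X in (_ < X)%N]n0.
apply: bigcap_measurable => //; first by exists 0%N.
move=> j _; apply: meas_set_lt; last exact: measurable_cst.
apply: meas_sqn; apply: cmeasB; last exact: cmeas_cst.
by apply: cmeas_det; apply: mxmeasB => //; exact: mxmeas_cst.
Qed.

End symmetric_functions.

Section probability_convergence.
Context d (T : measurableType d) (R : realType) (P : probability T R).

(* Almost sure convergence only gives convergence in probability once the events are measurable. *)
Lemma cvg_probability (E : nat -> set T) : (forall n, measurable (E n)) ->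
  {ae P, forall w, exists N, forall n, (N <= n)%N -> ~ E n w} -> P (E n) @[n --> \oo] --> 0%E.
Proof.
move=> mE [Z [mZ Z0 hZ]]; pose F N := \bigcup_(n in [set n | (N <= n)%N]) E n.
have mF N : measurable (F N) by apply: bigcup_measurable => n _; exact: mE.
have FF : nonincreasing_seq F.
  by move=> N M NM; apply/subsetPset => w [n /= hn En]; exists n => //=; exact: leq_trans hn.
have mI : measurable (\bigcap_n F n) by apply: bigcapT_measurable.
have I0 : P (\bigcap_n F n) = 0%E.
  apply/eqP; rewrite eq_le measure_ge0 andbT -Z0; apply: le_measure; rewrite ?inE//.
  move=> w hw; apply: hZ => /= -[N hN]; have [n /= hn En] := hw N I; exact: hN hn En.
have P0 : (P (F 0%N) < +oo)%E by apply: le_lt_trans (ltry 1); exact: probability_le1.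
have h : P (F n) @[n --> \oo] --> 0%E by rewrite -I0; exact: (nonincreasing_cvg_mu P0 mF mI FF).
apply: (@squeeze_cvge _ _ _ _ (cst 0%E) _ (fun n => P (F n))).
- near=> n; rewrite measure_ge0 /=; apply: le_measure; rewrite ?inE//.
  by move=> w En; exists n => /=.
- exact: cvg_cst.
exact: h.
Unshelve. all: by end_near. Qed.

End probability_convergence.

Section hypotheses.
Variable R : realType.
Local Notation C := R[i].

Lemma hsnorm_rows n (A : 'M[C]_n) : hsnorm A ^+ 2 = \sum_(i < n) nrm2 (row i A).
Proof.
have e : Re (\tr (A *m map_mx Num.conj A^T)) = \sum_(i < n) nrm2 (row i A).
  rewrite /mxtrace Re_sum; apply: eq_bigr => i _; rewrite mxE Re_sum nrm2E.
  by apply: eq_bigr => j _; rewrite !mxE mulconj.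
by rewrite /hsnorm e sqr_sqrtr//; apply: sumr_ge0 => i _; exact: nrm2_ge0.
Qed.

Lemma rank_bound (M : forall n : nat, 'M[C]_n) :
  (fun n => (\rank (M n))%:R : R) =o_\oo (fun n => n%:R : R) ->
  forall dl : R, 0 < dl -> exists n0, forall n, (n0 <= n)%N -> (\rank (M n))%:R <= dl * n%:R.
Proof.
move=> /eqoP h dl d0; have [N _ hN] := h dl d0; exists N => n hn.
by have := hN n hn; rewrite /= !ger0_norm.
Qed.

Lemma hs_bound (M : forall n : nat, 'M[C]_n) :
  (ereal_sup (range (fun n : nat => (n%:R ^- 2 * hsnorm (M n) ^+ 2)%:E)) < +oo)%E ->
  exists2 Cm : R, 0 <= Cm & forall n, \sum_(i < n) nrm2 (row i (M n)) <= Cm * n%:R ^+ 2.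
Proof.
set s := ereal_sup _ => hs.
have ub n : ((n%:R ^- 2 * hsnorm (M n) ^+ 2)%:E <= s)%E by apply: ereal_sup_ubound; exists n.
have s0 : (0 <= s)%E by apply: le_trans (ub 0%N); rewrite lee_fin mulr_ge0 ?sqr_ge0// invr_ge0 exprn_ge0.
have sf : s \is a fin_num by rewrite ge0_fin_numE.
exists (fine s); first exact: fine_ge0.
move=> n; have := ub n; rewrite -[X in (_ <= X)%E](fineK sf) lee_fin hsnorm_rows => h.
have [n0|n0] := posnP n; first by rewrite big1 ?mulr_ge0 ?exprn_ge0 ?fine_ge0// => i; have := ltn_ord i; rewrite [X in (_ < X)%N]n0.
by rewrite mulrC -ler_pdivrMl ?exprn_gt0 ?ltr0n.
Qed.

End hypotheses.

Theorem corollary1p15 (R : realType) (d : measure_display)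
    (T : measurableType d) (P : probability T R)
    (x : nat -> nat -> {RV P >-> R[i]})
    (x_indep : mutually_independent (fun ij : nat * nat => x ij.1 ij.2))
    (x_ident : identically_distributed (fun ij : nat * nat => x ij.1 ij.2))
    (x_mean : forall i j, Cexpectation P (x i j) = 0)
    (x_var : forall i j, ('E_P[fun w => (normc (x i j w) ^+ 2)%R] = 1)%E)
    (M : forall n : nat, 'M[R[i]]_n)
    (M_rank : (fun n => (\rank (M n))%:R : R) =o_\oo (fun n => n%:R : R))
    (M_hs : (ereal_sup
      (range (fun n : nat => (n%:R ^- 2 * hsnorm (M n) ^+ 2)%:E)) < +oo)%E) :
  let X n (w : T) : 'M[R[i]]_n := \matrix_(i < n, j < n) x i j w in
  let A n w := M n + X n w in
  let mu n w := esd ((Num.sqrt n%:R)^-1%:C *: A n w) in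
  measures_cvg_in_probability P mu (uniform_disk R) /\
  measures_cvg_almost_surely P mu (uniform_disk R).
Proof.
move=> X A mu.
have [Cm Cm0 Mhs] := hs_bound M_hs.
have Xtr := truncated_variance x_ident x_var.
have ae := ae_potential (X := entry x) x_indep (entry_Re x_mean) (entry_Im x_mean)
  (entry_sqn x_var) Xtr (rank_bound M_rank) Cm0 Mhs.
have int_mu (f : R[i] -> R) B n w : measurable_fun setT f -> (forall z, `|f z| <= B) -> (0 < n)%N ->
    \int[mu n w]_z f z = n%:R^-1 * \sum_(l <- lam (entry x) M n w) f l.
  by move=> mf fB n0; rewrite (integral_esd _ mf fB n0).
have as_cvg : measures_cvg_almost_surely P mu (uniform_disk R).
  apply: filterS ae => w [HU HL] f cf sf.
  have szL n : size (lam (entry x) M n w) = n by exact: size_lam.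
  have few := few_outliers szL HU; have pot := potential_bound szL HU HL.
  have [B fB] := bounded_continuous cf sf; have mf := measurable_continuous cf.
  apply: cvg_trans (mean_cvg szL few pot fB (uniformly_continuous cf sf) mf).
  apply: near_eq_cvg; exists 1%N => // n /= n0.
  by rewrite (int_mu f B n w mf fB n0).
split => // f cf sf e e0.
have [B fB] := bounded_continuous cf sf; have mf := measurable_continuous cf.
(* For [n >= 1] this is the integral against the empirical measure, in a form whose measurability in
   [w] is known. *)
pose S n w := n%:R^-1 * \sum_(l <- lam (entry x) M n w) f l.
have mS n : measurable_fun setT (S n).
  apply: measurable_funM; first exact: measurable_cst.
  apply: measurable_eigenvalue_sum => //.
  apply: mxmeasZ; first exact: cmeas_cst.
  apply: mxmeasD; first exact: mxmeas_cst.
  move=> i j; apply: (eq_cmeas (f := entry x (i : nat, j : nat))) => [w|]; first by rewrite mxE.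
  exact: cmeas_X.
pose J := \int[uniform_disk R]_z f z.
pose E n := [set w | (e < `|S n w - J|)%R].
have mE n : measurable (E n).
  apply: (meas_set_lt (f := fun=> e)); first exact: measurable_cst.
  apply: measurableT_comp => //; apply: measurable_funB; [exact: mS|exact: measurable_cst].
have hE : P (E n) @[n --> \oo] --> 0%E.
  apply: cvg_probability => //; apply: filterS as_cvg => w /(_ f cf sf) /cvgrPdist_lt/(_ e e0)[N _ hN].
  exists (maxn N 1) => n; rewrite geq_max => /andP[hn n0]; apply/negP; rewrite -leNgt.
  by have := hN n hn; rewrite /= (int_mu f B n w mf fB n0) distrC => /ltW.
apply: cvg_trans hE; apply: near_eq_cvg; exists 1%N => // n /= n0; congr (P _).
by apply/seteqP; split => w /=; rewrite /E /= (int_mu f B n w mf fB n0).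
Qed.
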